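(* For every integer $g \ge 2$, there exists a finite branched cover $\widetilde{\Sigma} \to \Sigma_g$ such that $H_1^{\mathrm{scc}}(\widetilde{\Sigma};\mathbb{Q}) \neq H_1(\widetilde{\Sigma};\mathbb{Q})$.
   Context: $\Sigma_g$ denotes the closed (connected, oriented) surface of genus $g$. For a finite branched cover $\pi\colon \widetilde{\Sigma} \to \Sigma_g$ (with $\widetilde{\Sigma}$ a connected closed surface), $H_1^{\mathrm{scc}}(\widetilde{\Sigma};\mathbb{Q})$ is the $\mathbb{Q}$-span in $H_1(\widetilde{\Sigma};\mathbb{Q})$ of the set of classes $[\widetilde{\gamma}]$, where $\widetilde{\gamma}$ is a component of $\pi^{-1}(\gamma)$ for some simple closed curve $\gamma$ on $\Sigma_g$ that is disjoint from the branch points of $\pi$ in $\Sigma_g$. *)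

(* Defs.v *)
From HB Require Import structures.
From Stdlib Require Import Relation_Operators.
From mathcomp Require Import all_boot all_order all_algebra.
From mathcomp Require Import generic_quotient ring_quotient.
From mathcomp.real_closed Require Import complex.
From mathcomp.multinomials Require Import freeg.
From mathcomp Require Import all_classical all_reals all_analysis.

Set Implicit Arguments.
Unset Strict Implicit.
Unset Printing Implicit Defensive.

Import Order.TTheory GRing.Theory Num.Theory numFieldNormedType.Exports.

Local Open Scope classical_set_scope.
Local Open Scope quotient_scope.
Local Open Scope ring_scope.

Definition lin_span (F : fieldType) (V : lmodType F) (A : set V) : set V :=
  [set v | exists (n : nat) (a : 'I_n -> F) (e : 'I_n -> V),
      (forall i, A (e i)) /\ v = \sum_(i < n) a i *: e i].

(* The library quotient of a module by a submodule is only an additive group;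
   here it is given its module structure. *)
Section ModuleQuotient.
Variables (F : fieldType) (V : lmodType F) (S : {pred V}).
Hypothesis submodS : submod_closed S.

Definition submod_zmod : zmodClosed V :=
  HB.pack_for (zmodClosed V) S
    (GRing.isZmodClosed.Build V S (GRing.submod_closedB submodS)).

Definition submod_quot : Type := Quotient.quot submod_zmod.
Local Notation Q := submod_quot.

HB.instance Definition _ := GRing.Zmodule.on Q.
HB.instance Definition _ := Quotient.on Q.

Definition submod_pi (v : V) : Q := \pi_Q v.

Lemma submod_piD : {morph submod_pi : u v / u + v}.
Proof. by move=> u v; exact: raddfD (\pi_(Quotient.quot submod_zmod)) u v. Qed.

Lemma submod_pi_eq u v : (submod_pi u == submod_pi v) = (u - v \in S).
Proof. by rewrite [RHS](Quotient.idealrBE submod_zmod). Qed.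

Lemma submod_piP q : exists v, q = submod_pi v.
Proof. by exists (repr q); rewrite /submod_pi reprK. Qed.

Definition quot_scale (a : F) (q : Q) : Q := submod_pi (a *: repr q).

Lemma quot_scale_pi a v : quot_scale a (submod_pi v) = submod_pi (a *: v).
Proof.
apply/eqP; rewrite submod_pi_eq -scalerBr.
have : repr (submod_pi v) - v \in S by rewrite -submod_pi_eq /submod_pi reprK.
by case: submodS => S0 /(_ a _ 0) Slin vS; rewrite -[_ *: _]addr0 Slin.
Qed.

Fact quot_scaleA a b q : quot_scale a (quot_scale b q) = quot_scale (a * b) q.
Proof. by have [v ->] := submod_piP q; rewrite !quot_scale_pi scalerA. Qed.

Fact quot_scale1 : left_id 1 quot_scale.
Proof. by move=> q; have [v ->] := submod_piP q; rewrite quot_scale_pi scale1r. Qed.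

Fact quot_scaleDr : right_distributive quot_scale +%R.
Proof.
move=> a p q; have [u ->] := submod_piP p; have [v ->] := submod_piP q.
by rewrite -submod_piD !quot_scale_pi -submod_piD scalerDr.
Qed.

Fact quot_scaleDl q : {morph quot_scale^~ q : a b / a + b}.
Proof.
move=> a b /=; have [v ->] := submod_piP q.
by rewrite !quot_scale_pi -submod_piD scalerDl.
Qed.

HB.instance Definition _ := GRing.Zmodule_isLmodule.Build F Q
  quot_scaleA quot_scale1 quot_scaleDr quot_scaleDl.

End ModuleQuotient.

Section SingularHomology.
Variable R : realType.

Definition std_simplex (n : nat) : set 'rV[R]_n.+1 :=
  [set x | (forall i, 0 <= x ord0 i) /\ \sum_i x ord0 i = 1].
Arguments std_simplex : clear implicits.

Section Face.
Variables (n : nat) (i : 'I_n.+2).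

Definition face_row (x : 'rV[R]_n.+1) : 'rV[R]_n.+2 :=
  \row_j (if unlift i j is Some k then x ord0 k else 0).

Lemma face_row_std (x : std_simplex n) : face_row (set_val x) \in std_simplex n.+1.
Proof.
have /set_mem[x0 x1] := valP x; apply/mem_set; split.
  by move=> j; rewrite mxE; case: unliftP.
rewrite (bigD1_ord i) //= mxE unlift_none add0r -[RHS]x1.
by apply: eq_bigr => k _; rewrite mxE liftK.
Qed.

Definition face (x : std_simplex n) : std_simplex n.+1 :=
  SigSub (face_row_std x).

Lemma continuous_face_row : continuous face_row.
Proof.
move=> x A [P Px PA].
have : nbhs x [set y | forall a b, P a b (face_row y a b)].
  apply: (@filter_forall _ _ _ (nbhs x)) => a.
  apply: (@filter_forall _ _ _ (nbhs x)) => b.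
  have := Px a b; rewrite mxE => Pab.
  suff : nbhs x [set y : 'rV[R]_n.+1 |
      P a b (if unlift i b is Some k then y ord0 k else 0)].
    by apply: (@filterS _ (nbhs x) (nbhs_filter x)) => y /=; rewrite mxE.
  case: (unlift i b) Pab => [k|] Pab.
    exact: (@coord_continuous R _ _ ord0 k x).
  by apply: (@filterS _ (nbhs x) (nbhs_filter x) setT) filterT => y _ /=;
    exact: nbhs_singleton Pab.
by apply: (@filterS _ (nbhs x) (nbhs_filter x)) => y Py; exact: PA.
Qed.

Lemma continuous_face : continuous face.
Proof.
apply: continuous_comp_initial => x.
apply: (@continuous_comp _ _ _ set_val face_row); last exact: continuous_face_row.
exact: initial_continuous.
Qed.

End Face.

Section Chains.
Variable X : topologicalType.

Definition singular_simplex (n : nat) : Type := continuousType (std_simplex n) X.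
HB.instance Definition _ n := Choice.on (singular_simplex n).

Definition chain (n : nat) : Type := {freeg (singular_simplex n) / rat}.
HB.instance Definition _ n := GRing.Lmodule.on (chain n).

Definition simplex_face n (s : singular_simplex n.+1) (i : 'I_n.+2) :
  singular_simplex n := s \o mkcts (@continuous_face n i).

Definition boundary n : chain n.+1 -> chain n :=
  fglift (fun s => \sum_(i < n.+2) (-1) ^+ i *: << simplex_face s i >>).

Lemma boundary_is_linear n : linear (@boundary n).
Proof.
move=> a c d; rewrite /boundary.
set f := (X in fglift X); pose L := GRing.isZmodMorphism.Build _ _ _ (lift_is_additive f).
pose g : {additive chain n.+1 -> chain n} := HB.pack (fglift f) L.
rewrite -[fglift f]/(g : _ -> _) raddfD; congr (_ + _).
have -> : a *: c = \sum_(s <- dom c) << a * coeff s c *g s >> by [].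
rewrite raddf_sum -[in RHS](freeg_sumE c) raddf_sum scaler_sumr.
by apply: eq_bigr => s _; rewrite /g /= !liftU scalerA.
Qed.

HB.instance Definition _ n :=
  GRing.isLinear.Build rat (chain n.+1) (chain n) *:%R (@boundary n)
    (@boundary_is_linear n).

(* First singular homology with rational coefficients, as Z_1 / B_1. *)
Definition is_cycle1 : {pred chain 1} := fun c => boundary c == 0.

Fact is_cycle1_closed : submod_closed is_cycle1.
Proof.
split=> [|a c d]; rewrite !unfold_in ?linear0 // => /eqP c0 /eqP d0.
by rewrite linearP /= c0 d0 scaler0 addr0.
Qed.

HB.instance Definition _ :=
  GRing.isSubmodClosed.Build rat (chain 1) is_cycle1 is_cycle1_closed.

Definition cycle1 : Type := {c : chain 1 | is_cycle1 c}.
HB.instance Definition _ := [isSub of cycle1 for sval].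
HB.instance Definition _ := [Choice of cycle1 by <:].
HB.instance Definition _ := [SubChoice_isSubLmodule of cycle1 by <:].

Definition is_boundary1 : {pred cycle1} :=
  fun c => `[< exists b : chain 2, val c = boundary b >].

Fact is_boundary1_closed : submod_closed is_boundary1.
Proof.
split=> [|a c d]; rewrite !unfold_in.
  by apply/asboolP; exists 0; rewrite linear0 raddf0.
move=> /asboolP[b cb] /asboolP[b' db]; apply/asboolP; exists (a *: b + b').
by rewrite !linearP /= cb db.
Qed.

Definition H1 : lmodType rat := submod_quot is_boundary1_closed.

Definition homology_class (c : cycle1) : H1 := submod_pi is_boundary1_closed c.

End Chains.

(* A closed curve is a 1-periodic continuous map on the line, that is, a
   continuous map on the circle R/Z. *)
Section Curves.
Variable X : topologicalType.

Definition closed_curve (c : R -> X) : Prop :=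
  continuous c /\ (forall t, c (t + 1) = c t).

Definition simple_closed_curve (c : R -> X) : Prop :=
  closed_curve c /\ (forall s t, c s = c t -> s - t \is a Num.int).

Definition edge_coord (x : std_simplex 1) : R := set_val x ord0 ord_max.

Lemma continuous_edge_coord : continuous edge_coord.
Proof.
move=> x; apply: (@continuous_comp _ _ _ set_val (fun y : 'rV[R]_2 => y ord0 ord_max)).
  exact: initial_continuous.
exact: coord_continuous.
Qed.

Section Class.
Variable c : R -> X.
Hypothesis cc : closed_curve c.

Definition curve_simplex : singular_simplex X 1 :=
  mkcts cc.1 \o mkcts continuous_edge_coord.

Fact curve_is_cycle : is_cycle1 << curve_simplex >>.
Proof.
apply/eqP; rewrite /boundary liftU scale1r !big_ord_recl big_ord0 addr0.
rewrite expr0 expr1 scale1r scaleN1r; apply/eqP; rewrite subr_eq0; apply/eqP.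
congr (<< _ >>); apply/continuousEP => x.
have face_val i : simplex_face curve_simplex i x =
    c (face_row i (set_val x) ord0 ord_max) by [].
have /set_mem[_] := valP x; rewrite big_ord1 => x1.
have max1 : ord_max = fintype.lift ord0 ord0 :> 'I_2 by exact/val_inj.
have up1 : fintype.lift ord0 ord0 = ord_max :> 'I_2 by exact/val_inj.
rewrite !face_val !mxE up1 {1}max1 liftK unlift_none x1 -[1]add0r.
exact: cc.2.
Qed.

Definition curve_class : H1 X :=
  homology_class (Sub (<< curve_simplex >> : chain X 1) curve_is_cycle).

End Class.
End Curves.
End SingularHomology.

(* The complex plane, with the topology of its modulus. *)
HB.instance Definition _ (R : realType) := NormedModule.copy R[i] R[i]^o.

(* The closed oriented surface of genus g, as a quotient of the closed unit disc:
   the unit circle is cut into 4g equal arcs, labelled in cyclic order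
   a_0 b_0 a_0^-1 b_0^-1 a_1 b_1 a_1^-1 b_1^-1 ..., and arcs with the same letter
   are identified, with reversed direction for an inverse. *)
Section GenusSurface.
Variables (R : realType) (g : nat).

Definition closed_disc : set R[i] := [set z | `|z| <= 1].

Definition arc_point (s : R) : R[i] :=
  let a := 2 * pi * s / (4 * g)%:R in Complex (cos a) (sin a).

Definition edge_glued (z w : closed_disc) : Prop :=
  exists (k : nat) (t : R), [/\ (k < g)%N, 0 <= t <= 1 &
    (set_val z = arc_point ((4 * k)%:R + t) /\
     set_val w = arc_point ((4 * k + 3)%:R - t)) \/
    (set_val z = arc_point ((4 * k + 1)%:R + t) /\
     set_val w = arc_point ((4 * k + 4)%:R - t))].

Definition polygon_rel (z w : closed_disc) : bool :=
  `[< clos_refl_sym_trans closed_disc edge_glued z w >].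

Fact polygon_rel_equiv : equiv_class_of polygon_rel.
Proof.
split=> [z|z w|w z v].
- by apply/asboolP; exact: rst_refl.
- by apply/idP/idP => /asboolP zw; apply/asboolP; exact: rst_sym.
- by move=> /asboolP zw /asboolP wv; apply/asboolP; exact: rst_trans wv.
Qed.

Canonical polygon_equiv := EquivRelPack polygon_rel_equiv.
Canonical polygon_encModRel := defaultEncModRel polygon_rel.

Definition genus_surface : Type := quotient_topology {eq_quot polygon_rel}.
HB.instance Definition _ := Topological.on genus_surface.

End GenusSurface.

Section BranchedCovers.
Variable R : realType.

Definition open_embedding (X Y : topologicalType) (f : X -> Y) : Prop :=
  [/\ continuous f, injective f & forall U, open U -> open (f @` U)].

(* Second countability is automatic by compactness. Orientability is not
   required: it is automatic for a branched cover of an oriented surface. *)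
Definition closed_surface (X : topologicalType) : Prop :=
  [/\ compact [set: X], hausdorff_space X &
      forall x : X, exists phi : R[i] -> X, open_embedding phi /\ phi 0 = x].

Definition connected_space (X : topologicalType) : Prop :=
  [set: X] !=set0 /\ connected [set: X].

Variables (X Y : topologicalType) (p : X -> Y).

(* y has a neighbourhood psi(C) whose preimage is the disjoint union of n open
   discs phi_i(C), on which p reads z |-> z ^ (k i) in these coordinates. *)
Definition branched_model (y : Y) (n : nat) (k : 'I_n -> nat) : Prop :=
  exists (psi : R[i] -> Y) (phi : 'I_n -> R[i] -> X),
    [/\ open_embedding psi /\ psi 0 = y,
        forall i, open_embedding (phi i),
        trivIset [set: 'I_n] (fun i => range (phi i)),
        p @^-1` range psi = \bigcup_(i in [set: 'I_n]) range (phi i) &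
        forall i z, p (phi i z) = psi (z ^+ k i)].

Definition finite_branched_cover : Prop :=
  continuous p /\
  forall y, exists (n : nat) (k : 'I_n -> nat),
    [/\ (0 < n)%N, forall i, (0 < k i)%N & branched_model y k].

Definition branch_point (y : Y) : Prop :=
  exists (n : nat) (k : 'I_n -> nat),
    [/\ forall i, (0 < k i)%N, branched_model y k & exists i, (1 < k i)%N].

(* The orientation, and more generally the parametrisation, of the component is
   free: this only affects its class up to sign. *)
Definition component_of_scc_preimage (c : R -> X) : Prop :=
  simple_closed_curve c /\
  exists gamma : R -> Y,
    [/\ simple_closed_curve gamma,
        forall t, ~ branch_point (gamma t) &
        exists x : X, (p @^-1` range gamma) x /\
          range c = connected_component (p @^-1` range gamma) x].

Definition H1_scc : set (H1 R X) :=
  lin_span [set h | exists (c : R -> X) (cc : closed_curve c),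
    component_of_scc_preimage c /\ h = curve_class cc].

End BranchedCovers.
Arguments H1_scc R {X Y} p _.

(* Main.v *)
Require Import Defs.
From mathcomp Require Import all_boot all_order all_algebra.
From mathcomp Require Import all_classical all_reals all_analysis.
From Stdlib Require Import Relation_Operators.
From HB Require Import structures.
From mathcomp Require Import all_field generic_quotient ring_quotient.
From mathcomp.real_closed Require Import complex.
From mathcomp.multinomials Require Import freeg.
From mathcomp Require Import all_classical all_reals all_analysis.
From mathcomp Require Import ring lra zify.

(* The surface of genus g is a polygon with 4g sides glued in pairs, and a cover branched only at
   its vertex v is a finite set S of sheets with a permutation tau_j of S for each side j.  Sheets
   are pairs of a vector over F_2 and a row over a finite field F of characteristic 2: crossing a
   side shifts the vector and multiplies the row by a unitriangular matrix, the vectors of F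
   attached to the edges being independent over F_2.  Then S has a fixed-point free involution z
   commuting with all tau_j, and some power of the monodromy of a loop is z on a given sheet
   as soon as the loop is not closed modulo 2 or crosses some edge of the F_2-cover an odd number
   of times.  The vertex word is of this kind, so v is a branch point and a simple closed curve
   that avoids branch points avoids v.

   Counting dimensions yields a nonzero z-odd integral harmonic cochain N, which is closed at
   vertices and coclosed on sheets.  Winding numbers around the circle-valued primitive of the
   dual cocycle give a linear form on H_1 whose value on the cycle sum N(e) e is 2 pi sum N(e)^2 > 0.
   This form vanishes on every lift of a simple closed curve gamma: if z is a power of the
   monodromy, by oddness; otherwise gamma cuts the polygon into unlinked chords, and if no chord
   returns to the side that it leaves, a mod 2 count of the chord ends, labelled by the sheets of
   the F_2-cover, is contradictory; so an innermost returning chord can be pushed off, by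
   induction.  The chords are read off from gamma by continuing it across a collar of the
   boundary, up to a level kappa < 1 that is not a local minimum of its modulus, and they are
   unlinked by planar intersection arguments. *)

Set Implicit Arguments.
Unset Strict Implicit.
Unset Printing Implicit Defensive.

Import Order.TTheory GRing.Theory Num.Theory numFieldNormedType.Exports.

Local Open Scope classical_set_scope.
Local Open Scope complex_scope.
Local Open Scope ring_scope.

Local Notation Re := complex.Re.
Local Notation Im := complex.Im.

(** * Complex numbers and paths *)

Section Cplx.
Variable R : realType.
Notation C := R[i].

(** The rows have [2 ^ k + 1] entries for two reasons. With [m = 2 ^ k] the identity
    [(1 + A) ^ m = 1 + A ^ m] holds in characteristic 2, and over a field with [2 ^ m] elements the
    one surviving entry of [A ^ m] is the norm of the parameter of the word, which is 1 as soon as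
    that parameter is nonzero. So a single involution [z] serves all words, however their parameters
    differ. The hypothesis [2 <= g] makes the count of dimensions work: an odd cochain has [2 * g]
    free values for each pair of sheets exchanged by [z], against two equations, one from the sheets
    and at most one from the vertices. The main obstacle is that a simple closed curve is only
    continuous and may meet the sides of the polygon in a Cantor set, so that there is no
    transversality to start from. Hence the hysteresis in the collar: a sheet extended beyond its
    boundary is left only at modulus [1 / kappa], and the curve is then read in the next sheet at
    modulus [kappa]. A crossing takes a definite time, the word is finite, and crossings become
    strands between two circles. All planar topology is reduced to lifting an argument over a
    square. *)

Definition md (z : C) : R := Normc.normc z.

Arguments md : simpl never.

(** The norm of [R[i]] has complex values; [md] is the same modulus in [R], where it can be composed
    with real functions. *)
Lemma norm_md (z : C) : `|z| = (md z)%:C.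
Proof. by []. Qed.

Lemma md_ge0 z : 0 <= md z.
Proof. by rewrite -(ler0c (md z)) -norm_md. Qed.

Lemma mdM z w : md (z * w) = md z * md w.
Proof. exact: Normc.normcM. Qed.

Lemma mdV z : md z^-1 = (md z)^-1.
Proof. exact: Normc.normcV. Qed.

Lemma mdX z n : md (z ^+ n) = md z ^+ n.
Proof.
by elim: n => [|n IH]; [rewrite !expr0 /md Normc.normc1|rewrite !exprS mdM IH].
Qed.

Lemma md_eq0 z : (md z == 0) = (z == 0).
Proof.
apply/eqP/eqP => [/Normc.eq0_normc//|->]; exact: Normc.normc0.
Qed.

Lemma md_gt0 z : (0 < md z) = (z != 0).
Proof. by rewrite lt_def md_ge0 andbT md_eq0. Qed.

Lemma md0 : md 0 = 0. Proof. exact: Normc.normc0. Qed.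
Lemma md1 : md 1 = 1. Proof. exact: Normc.normc1. Qed.

Lemma mdN z : md (- z) = md z. Proof. exact: normcN. Qed.
Lemma mdB z w : md (z - w) = md (w - z). Proof. by rewrite -mdN opprB. Qed.

Lemma mdD z w : md (z + w) <= md z + md w.
Proof. exact: le_normcD. Qed.

Lemma mdRe (x : R) : md x%:C = `|x|.
Proof. by rewrite /md /= expr0n /= addr0 sqrtr_sqr. Qed.

Lemma md_sqr z : md z ^+ 2 = Re z ^+ 2 + Im z ^+ 2.
Proof. by case: z => a b; rewrite /md /= sqr_sqrtr // addr_ge0 ?sqr_ge0. Qed.

Lemma Re_le_md z : `|Re z| <= md z.
Proof.
rewrite -[`|_|]ger0_norm// -[md z]ger0_norm ?md_ge0// -ler_sqr ?nnegrE// ?normr_ge0//.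
by rewrite !real_normK ?num_real// md_sqr lerDl sqr_ge0.
Qed.

Lemma Im_le_md z : `|Im z| <= md z.
Proof.
rewrite -[`|_|]ger0_norm// -[md z]ger0_norm ?md_ge0// -ler_sqr ?nnegrE// ?normr_ge0//.
by rewrite !real_normK ?num_real// md_sqr lerDr sqr_ge0.
Qed.

Lemma md_le z : md z <= `|Re z| + `|Im z|.
Proof.
rewrite [leLHS](_ : _ = md ((Re z)%:C + 'i%C * (Im z)%:C)); last by rewrite -complexE.
rewrite (le_trans (mdD _ _))// mdM !mdRe.
have -> : md 'i%C = 1 by rewrite /md /= expr0n expr1n add0r sqrtr1.
by rewrite mul1r.
Qed.

Lemma gt0_cplx (e : C) : 0 < e -> e = (Re e)%:C /\ 0 < Re e.
Proof. by case: e => a b; rewrite ltcE /= => /andP[/eqP -> a0]. Qed.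

Lemma cvgc_md (T : Type) (F : set_system T) {FF : Filter F} (f : T -> C) (l : C) :
  (forall e : R, 0 < e -> \forall t \near F, md (l - f t) < e) <-> f @ F --> l.
Proof.
split=> [H|].
  apply/cvgrPdist_lt => e /gt0_cplx[-> e0].
  have := H _ e0; apply: filterS => t; by rewrite norm_md ltcR.
move=> /cvgrPdist_lt H e e0.
have := H e%:C; rewrite ltcR => /(_ e0); apply: filterS => t.
by rewrite norm_md ltcR.
Qed.

Lemma cvg_Re_Im (T : Type) (F : set_system T) {FF : Filter F} (f : T -> C) (l : C) :
  (fun t => Re (f t)) @ F --> Re l -> (fun t => Im (f t)) @ F --> Im l -> f @ F --> l.
Proof.
move=> /cvgrPdist_lt HR /cvgrPdist_lt HI; apply/cvgc_md => e e0.
have e2 : 0 < e / 2 by rewrite divr_gt0.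
have {}HR := HR _ e2; have {}HI := HI _ e2.
apply: filterS2 HR HI => t HR HI.
rewrite (le_lt_trans (md_le _))// [ltRHS]splitr ltrD//.
- by move: HR; case: (l) (f t) => ? ? [].
- by move: HI; case: (l) (f t) => ? ? [].
Qed.

Lemma near_md (z : C) (e : R) : 0 < e -> \forall w \near z, md (z - w) < e.
Proof.
by move=> e0; have /cvgc_md/(_ e e0) : (fun w : C => w) @ z --> z by exact: cvg_id.
Qed.

Lemma continuous_Re : continuous (@Re R : C -> R).
Proof.
move=> z; apply/(@cvgrPdist_lt _ _ _ _ (@fmap_filter _ _ _ _ (nbhs_filter z))) => e e0.
move: (near_md z e0); apply: (@filterS _ (nbhs z) (nbhs_filter z)) => w; apply: le_lt_trans.
by rewrite -[_ - _](_ : Re (z - w) = _) ?Re_le_md//; case: z w => ? ? [].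
Qed.

Lemma continuous_Im : continuous (@Im R : C -> R).
Proof.
move=> z; apply/(@cvgrPdist_lt _ _ _ _ (@fmap_filter _ _ _ _ (nbhs_filter z))) => e e0.
move: (near_md z e0); apply: (@filterS _ (nbhs z) (nbhs_filter z)) => w; apply: le_lt_trans.
by rewrite -[_ - _](_ : Im (z - w) = _) ?Im_le_md//; case: z w => ? ? [].
Qed.

Lemma md_dist z w : `|md z - md w| <= md (z - w).
Proof.
have H a b : md a - md b <= md (a - b).
  by rewrite lerBlDr -{1}[a](subrK b) mdD.
by rewrite ler_norml H andbT lerNl opprB (mdB z).
Qed.

Lemma continuous_md : continuous md.
Proof.
move=> z; apply/(@cvgrPdist_lt _ _ _ _ (@fmap_filter _ _ _ _ (nbhs_filter z))) => e e0.
move: (near_md z e0); apply: (@filterS _ (nbhs z) (nbhs_filter z)) => w; apply: le_lt_trans; exact: md_dist.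
Qed.

Lemma continuous_toC : continuous (fun x : R => x%:C).
Proof. by move=> x; apply: cvg_Re_Im => /=; [exact: cvg_id|exact: cvg_cst]. Qed.

Definition cis (a : R) : C := Complex (cos a) (sin a).

Lemma continuous_cis : continuous cis.
Proof. by move=> x; apply: cvg_Re_Im => /=; [exact: continuous_cos|exact: continuous_sin]. Qed.

Lemma cisD a b : cis (a + b) = cis a * cis b.
Proof. by rewrite /cis cosD sinD; congr Complex; rewrite addrC. Qed.

Lemma md_cis a : md (cis a) = 1.
Proof. by rewrite /md /= cos2Dsin2 sqrtr1. Qed.

Lemma cis0 : cis 0 = 1. Proof. by rewrite /cis cos0 sin0. Qed.

Lemma cisN a : cis (- a) = (cis a)^-1.
Proof.
have c0 : cis a != 0 by rewrite -md_gt0 md_cis.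
by apply: (mulIf c0); rewrite mulVf// -cisD addNr cis0.
Qed.

Lemma cis_neq0 a : cis a != 0. Proof. by rewrite -md_gt0 md_cis. Qed.


Section Combinators.
Variable T : topologicalType.

Lemma cts_cst (U : topologicalType) (u : U) : continuous (fun _ : T => u).
Proof. by move=> t; exact: cvg_cst. Qed.

Lemma cts_id : continuous (fun t : T => t).
Proof. by move=> t; exact: cvg_id. Qed.

Lemma cts_comp (U V : topologicalType) (f : T -> U) (g : U -> V) :
  continuous g -> continuous f -> continuous (fun t => g (f t)).
Proof. by move=> cg cf t; apply: continuous_comp; [exact: cf|exact: cg]. Qed.

Lemma cts_Re (f : T -> C) : continuous f -> continuous (fun t => Re (f t)).
Proof. exact/cts_comp/continuous_Re. Qed.
Lemma cts_Im (f : T -> C) : continuous f -> continuous (fun t => Im (f t)).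
Proof. exact/cts_comp/continuous_Im. Qed.
Lemma cts_md (f : T -> C) : continuous f -> continuous (fun t => md (f t)).
Proof. exact/cts_comp/continuous_md. Qed.
Lemma cts_toC (f : T -> R) : continuous f -> continuous (fun t => (f t)%:C).
Proof. exact/cts_comp/continuous_toC. Qed.
Lemma cts_cis (f : T -> R) : continuous f -> continuous (fun t => cis (f t)).
Proof. exact/cts_comp/continuous_cis. Qed.

Lemma ctsD (K : numFieldType) (f g : T -> K) :
  continuous f -> continuous g -> continuous (fun t => f t + g t).
Proof. by move=> cf cg t; apply: cvgD; [exact: cf|exact: cg]. Qed.
Lemma ctsM (K : numFieldType) (f g : T -> K) :
  continuous f -> continuous g -> continuous (fun t => f t * g t).
Proof. by move=> cf cg t; apply: cvgM; [exact: cf|exact: cg]. Qed.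
Lemma ctsN (K : numFieldType) (f : T -> K) :
  continuous f -> continuous (fun t => - f t).
Proof. by move=> cf t; apply: cvgN; exact: cf. Qed.
Lemma ctsB (K : numFieldType) (f g : T -> K) :
  continuous f -> continuous g -> continuous (fun t => f t - g t).
Proof. by move=> cf cg; apply: ctsD => //; exact: ctsN. Qed.
Lemma ctsV (K : numFieldType) (f : T -> K) :
  continuous f -> (forall t, f t != 0) -> continuous (fun t => (f t)^-1).
Proof. by move=> cf f0 t; apply: cvgV; [exact: f0|exact: cf]. Qed.
Lemma ctsX (K : numFieldType) (f : T -> K) n :
  continuous f -> continuous (fun t => f t ^+ n).
Proof.
move=> cf; elim: n => [|n IH]; first by under eq_fun do rewrite expr0; exact: cts_cst.
by under eq_fun do rewrite exprS; exact: ctsM.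
Qed.
Lemma cts_sum (K : numFieldType) (I : Type) (r : seq I) (P : pred I) (f : I -> T -> K) :
  (forall i, P i -> continuous (f i)) -> continuous (fun t => \sum_(i <- r | P i) f i t).
Proof.
move=> cf; elim: r => [|i r IH].
  by under eq_fun do rewrite big_nil; exact: cts_cst.
under eq_fun do rewrite big_cons; case: (boolP (P i)) => // Pi.
by apply: ctsD => //; exact: cf.
Qed.
Lemma cts_max (f g : T -> R) :
  continuous f -> continuous g -> continuous (fun t => Num.max (f t) (g t)).
Proof. by move=> cf cg t; apply: continuous_max; [exact: cf|exact: cg]. Qed.
Lemma cts_min (f g : T -> R) :
  continuous f -> continuous g -> continuous (fun t => Num.min (f t) (g t)).
Proof. by move=> cf cg t; apply: continuous_min; [exact: cf|exact: cg]. Qed.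
Lemma cts_pair (U V : topologicalType) (f : T -> U) (g : T -> V) :
  continuous f -> continuous g -> continuous (fun t => (f t, g t)).
Proof. by move=> cf cg t; apply: cvg_pair; [exact: cf|exact: cg]. Qed.

(** Off the zeros of [phi] a single branch is chosen on a whole neighbourhood; at a zero both
    branches are close to the same value. *)
Lemma cts_paste (U : topologicalType) (phi : T -> R) (f g : T -> U) :
  continuous phi -> continuous f -> continuous g ->
  (forall t, phi t = 0 -> f t = g t) ->
  continuous (fun t => if phi t <= 0 then f t else g t).
Proof.
move=> cphi cf cg fg t A.
have op (h : T -> U) : continuous h -> nbhs (h t) A -> nbhs t [set x | A (h x)].
  by move=> ch; exact: ch.
have lt0 : phi t < 0 -> nbhs t [set x | phi x < 0].
  move=> pt; have /(cphi t) : nbhs (phi t) [set y : R | y < 0].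
    by apply: open_nbhs_nbhs; split=> //; exact: open_lt.
  by [].
have gt0 : 0 < phi t -> nbhs t [set x | 0 < phi x].
  move=> pt; have /(cphi t) : nbhs (phi t) [set y : R | 0 < y].
    by apply: open_nbhs_nbhs; split=> //; exact: open_gt.
  by [].
rewrite /nbhs /=; case: (ltgtP (phi t) 0) => [pt|pt|pt] /= Ah.
- have H := @filterI _ (nbhs t) (nbhs_filter t) _ _ (lt0 pt) (op f cf Ah).
  by move: H; apply: (@filterS _ (nbhs t) (nbhs_filter t)) => x /= [/ltW ->].
- have H := @filterI _ (nbhs t) (nbhs_filter t) _ _ (gt0 pt) (op g cg Ah).
  by move: H; apply: (@filterS _ (nbhs t) (nbhs_filter t)) => x /= []; rewrite leNgt => ->.
- have Ag : nbhs (g t) A by rewrite -fg.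
  have H := @filterI _ (nbhs t) (nbhs_filter t) _ _ (op f cf Ah) (op g cg Ag).
  by move: H; apply: (@filterS _ (nbhs t) (nbhs_filter t)) => x /= []; case: ifP.
Qed.

End Combinators.

Lemma cts_fst (U V : topologicalType) : continuous (@fst U V).
Proof. by move=> x; exact: cvg_fst. Qed.
Lemma cts_snd (U V : topologicalType) : continuous (@snd U V).
Proof. by move=> x; exact: cvg_snd. Qed.

Lemma cts_atan : continuous (@atan R).
Proof. by move=> x; exact: continuous_atan. Qed.

(** An argument on the right half-plane only, which is enough for ratios close to 1. *)
Definition argr (w : C) : R := atan (Im w / Re w).

Lemma argrP w : 0 < Re w -> w = (md w)%:C * cis (argr w).
Proof.
case: w => a b /= a0; rewrite /argr /=.
set x := b / a; pose c := cos (atan x); pose s := sin (atan x).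
have c0 : 0 < c by rewrite /c cos_atan invr_gt0 sqrtr_gt0 ltr_wpDr ?sqr_ge0.
have sx : s = x * c by rewrite -{1}[x]atanK /tan mulfVK ?gt_eqF.
have cx : (1 + x ^+ 2) * c ^+ 2 = 1.
  rewrite mulrDl mul1r -exprMn -sx; exact: cos2Dsin2.
have m0 : md (Complex a b) = a / c.
  apply/eqP; rewrite -(@eqrXn2 _ 2) ?md_ge0 ?divr_ge0 ?ltW// md_sqr /=.
  have c20 : c ^+ 2 != 0 by rewrite expf_eq0 /= gt_eqF.
  rewrite expr_div_n; apply/eqP; apply: (mulIf c20); rewrite mulfVK//.
  by rewrite -[b](@mulfVK _ a) ?gt_eqF// -/x; move: cx; clear; move=> cx; nra.
rewrite m0 /cis -/c -/s sx /real_complex_def /=; apply/eqP.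
rewrite eq_complex /=; apply/andP; split; apply/eqP.
  by rewrite mul0r subr0 mulfVK// gt_eqF.
by rewrite mul0r addr0 mulrCA divfK ?gt_eqF// mulfVK ?gt_eqF.
Qed.

Lemma Re_gt0_near1 (w : C) : md (w - 1) < 1 -> 0 < Re w.
Proof.
move=> h; have := le_lt_trans (Re_le_md (w - 1)) h.
by case: w {h} => a b /=; rewrite ltr_norml => /andP[+ _]; rewrite ltrBrDr addNr.
Qed.

(** For [0 < h < 2 * pi] the number [sin (h / 2)] is positive, and
    [cos h = 1 - 2 * sin (h / 2) ^+ 2] is less than 1. *)
Lemma cis_inj0 (h : R) : cis h = 1 -> `|h| < 2 * pi -> h = 0.
Proof.
wlog h0 : h / 0 <= h.
  move=> H hh hp; case: (leP 0 h) => h0; first exact: H.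
  have := H (- h); rewrite oppr_ge0 ltW// normrN cisN hh invr1 => /(_ isT erefl hp).
  by move/eqP; rewrite oppr_eq0 => /eqP.
move=> [ch _]; rewrite ger0_norm// => hp; apply/eqP.
case: eqP => // /eqP hn; have {hn}h0' : 0 < h by rewrite lt_def hn.
have sh : 0 < sin (h / 2).
  by apply: sin_gt0_pi; rewrite divr_gt0//= ltr_pdivrMr// mulrC.
have := cosD (h / 2) (h / 2); rewrite -splitr ch -!expr2 => E.
have := cos2Dsin2 (h / 2); nra.
Qed.

Lemma cis_inj (a b : R) : cis a = cis b -> `|a - b| < 2 * pi -> a = b.
Proof.
move=> ab h; apply/eqP; rewrite -subr_eq0; apply/eqP/cis_inj0 => //.
by rewrite cisD cisN ab mulfV ?cis_neq0.
Qed.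

Lemma cis_surj (z : C) : md z = 1 -> exists a, z = cis a.
Proof.
move=> z1; have := md_sqr z; rewrite z1 expr1n => /esym E.
have hR : -1 <= Re z <= 1 by rewrite -ler_norml -z1 Re_le_md.
have sE : sin (acos (Re z)) = `|Im z|.
  by rewrite sin_acos// -sqrtr_sqr -E addrAC subrr add0r.
case: z z1 E hR sE => a b /= _ _ hR sE.
case: (leP 0 b) => b0.
  by exists (acos a); rewrite /cis acosK// sE ger0_norm.
exists (- acos a); rewrite /cis cosN sinN acosK// sE.
by rewrite ltr0_norm// opprK.
Qed.
End Cplx.

(** * Planar intersection arguments *)

Section Lifting.
Variable R : realType.
Notation C := R[i].

(** A ratio within distance 1 of 1 lies in the right half-plane, so between points of [K] and points
    [e]-close to them the argument of [F] varies by a value of [argr]. *)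
Lemma unif_ratio (K : set (R * R)%type) (F : R * R -> C) :
  compact K -> continuous F -> (forall p, F p != 0) ->
  exists2 e : R, 0 < e & forall p p', K p -> ball p e p' -> md (F p' / F p - 1) < 1.
Proof.
move=> /compact_near_coveringP cK0 cF F0.
pose P (e : R) p := forall p', ball p e p' -> md (F p' / F p - 1) < 1.
have : \forall e \near (0 : R)^'+, K `<=` P e.
  apply: cK0 => x Kx.
  pose H (u : (R * R) * (R * R)) := md (F u.2 / F u.1 - 1).
  have cH : continuous H.
    apply: cts_md; apply: ctsB; last exact: cts_cst.
    apply: ctsM; first exact: cts_comp cF (@cts_snd _ _).
    by apply: ctsV; [exact: cts_comp cF (@cts_fst _ _)|].
  have : nbhs (H (x, x)) [set y : R | y < 1].
    apply: open_nbhs_nbhs; split; first exact: open_lt.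
    by rewrite /= /H /= mulfV// subrr md0.
  move=> /(cH (x, x)) [[A B] /= [Ax Bx] AB].
  have /nbhs_ballP[d /= d0 dB] := Bx.
  have d20 : 0 < d / 2 by rewrite divr_gt0.
  exists (A `&` ball x (d / 2), [set e | e < d / 2]); first split => /=.
  - by apply: filterI => //; exact: nbhsx_ballx.
  - near=> e; near: e; exact: nbhs_right_lt.
  move=> [p e] /= [[Ap xp] ed] p' pp'.
  apply: (AB (p, p')); split => //=; apply: dB.
  rewrite [d]splitr; apply: ball_triangle xp _.
  by apply: le_ball pp'; exact: ltW.
move=> H.
have : \forall e \near (0 : R)^'+, 0 < e /\ K `<=` P e.
  by near=> e; split; near: e => //; exact: nbhs_right_gt.
move=> /filter_ex[e [e0 eP]]; exists e => // p p' Kp; exact: eP.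
Unshelve. all: by end_near.
Qed.

Definition clamp01 (x : R) : R := Num.max 0 (Num.min 1 x).

Lemma clamp01_itv x : 0 <= clamp01 x <= 1.
Proof. by rewrite /clamp01 le_max lexx /= ge_max ler01 ge_min lexx. Qed.

Lemma clamp01_id x : 0 <= x <= 1 -> clamp01 x = x.
Proof. by move=> /andP[x0 x1]; rewrite /clamp01 (min_idPr x1) (max_idPr x0). Qed.

Lemma continuous_clamp01 : continuous clamp01.
Proof. by apply: cts_max; [exact: cts_cst|apply: cts_min; [exact: cts_cst|exact: cts_id]]. Qed.

(** The segment from the origin to [p] is cut into [N] equal steps. The ratios of consecutive values
    of [F] have positive real part, and their product telescopes, so the sum of their arguments is a
    continuous angle for [F p]. Clamping extends all functions to the plane. *)
Lemma lift_square (F : R * R -> C) (th : R) :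
  continuous F -> (forall p, F p != 0) ->
  F (0, 0) = (md (F (0, 0)))%:C * cis th ->
  exists h : R * R -> R, [/\ continuous h, h (0, 0) = th &
    forall s t, 0 <= s <= 1 -> 0 <= t <= 1 ->
      F (s, t) = (md (F (s, t)))%:C * cis (h (s, t))].
Proof.
move=> cF F0 Fth.
pose I : set R := `[0, 1]%classic.
have [e e0 eP] := unif_ratio
  (compact_setX (segment_compact (a:=0) (b:=1)) (segment_compact (a:=0) (b:=1))) cF F0.
pose N := (Num.truncn e^-1).+1.
have N0 : 0 < N%:R :> R by rewrite ltr0n.
have Ne : N%:R^-1 < e.
  by rewrite invf_plt ?posrE// /N truncnS_gt.
pose pt k (p : R * R) : R * R := (k%:R / N%:R * clamp01 p.1, k%:R / N%:R * clamp01 p.2).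
have cpt k : continuous (pt k).
  apply: cts_pair; apply: ctsM; [exact: cts_cst| |exact: cts_cst|].
  - by apply: cts_comp (@cts_fst _ _); exact: continuous_clamp01.
  - by apply: cts_comp (@cts_snd _ _); exact: continuous_clamp01.
pose q k p := F (pt k.+1 p) / F (pt k p).
have qR k p : (k < N)%N -> 0 < Re (q k p).
  move=> kN; apply: Re_gt0_near1; apply: eP.
    have H x : 0 <= k%:R / N%:R * clamp01 x <= 1.
      have /andP[c0 c1] := clamp01_itv x.
      rewrite mulr_ge0 ?divr_ge0 ?ler0n//= mulr_ile1 ?divr_ge0 ?ler0n//.
      by rewrite ler_pdivrMr// mul1r ler_nat ltnW.
    by split; rewrite /= in_itv /= H.
  have H x : ball (k%:R / N%:R * clamp01 x) e (k.+1%:R / N%:R * clamp01 x).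
    rewrite /ball /= -mulrBl -mulrBl -[k.+1]addn1 natrD opprD addrA subrr add0r.
    rewrite mulN1r mulNr normrN normrM normfV (ger0_norm (ltW N0)).
    have /andP[c0 c1] := clamp01_itv x; rewrite (ger0_norm c0).
    by apply: le_lt_trans Ne; rewrite ger_pMr ?invr_gt0.
  by split; exact: H.
pose h p := th + \sum_(k < N) argr (q k p).
have ch : continuous h.
  apply: ctsD; first exact: cts_cst.
  apply: cts_sum => k _.
  apply: (@cts_comp _ _ _ (fun t => Im (q k t) / Re (q k t)) _ (@cts_atan R)).
  have cq : continuous (q k).
    apply: ctsM; first exact: cts_comp cF (cpt _).
    by apply: ctsV; [exact: cts_comp cF (cpt _)|].
  apply: ctsM; first exact: cts_Im.
  by apply: ctsV; [exact: cts_Re|move=> t; rewrite gt_eqF// qR].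
have hn n p : (n <= N)%N -> exists2 r : R, 0 <= r &
    F (pt n p) = r%:C * cis (th + \sum_(k < n) argr (q k p)).
  elim: n => [_|n IH nN].
    exists (md (F (0, 0))); first exact: md_ge0.
    by rewrite big_ord0 addr0 -Fth /pt !mul0r.
  have [r r0 E] := IH (ltnW nN); exists (md (q n p) * r).
    by rewrite mulr_ge0// md_ge0.
  rewrite big_ord_recr /= addrA [in RHS]cisD.
  have -> : F (pt n.+1 p) = q n p * F (pt n p) by rewrite /q mulfVK.
  rewrite E {1}(argrP (qR n p nN)) rmorphM /=; ring.
have h00 : h (0, 0) = th.
  rewrite /h big1 ?addr0// => k _; rewrite /argr /q.
  have -> : pt k.+1 (0, 0) = pt k (0, 0) :> R * R by rewrite /pt /= clamp01_id ?lexx ?ler01// !mulr0.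
  by rewrite mulfV//= mul0r atan0.
exists h; split => // s t s01 t01.
have [r r0] := hn N (s, t) (leqnn N).
have -> : pt N (s, t) = (s, t) by rewrite /pt /= !clamp01_id// mulfV ?gt_eqF// !mul1r.
by move=> E; rewrite {1}E; congr (_%:C * _); rewrite E mdM md_cis mulr1 mdRe ger0_norm.
Qed.

Lemma ivt_avoid (h : R -> R) (c : R) : continuous h ->
  (forall t, 0 <= t <= 1 -> h t != c) -> h 0 < c -> h 1 < c.
Proof.
move=> ch hc h0; rewrite ltNge; apply/negP => h1.
have [||t t01 /eqP] := @IVT R h 0 1 c ler01.
- by apply: continuous_subspaceT.
- by rewrite ge_min (ltW h0) /= le_max h1 orbT.
by move: t01; rewrite in_itv /= => /hc/negPf ->.
Qed.

Lemma ivt_avoid' (h : R -> R) (c : R) : continuous h ->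
  (forall t, 0 <= t <= 1 -> h t != c) -> c < h 0 -> c < h 1.
Proof.
move=> ch hc h0; rewrite -ltrN2; apply: (ivt_avoid (h := fun t => - h t)) => //.
- exact: ctsN.
- by move=> t /hc; apply: contra => /eqP/oppr_inj/eqP.
by rewrite ltrN2.
Qed.

Lemma ivt_stay (h : R -> R) (c d : R) : continuous h ->
  (forall t, 0 <= t <= 1 -> h t != c) -> (forall t, 0 <= t <= 1 -> h t != d) ->
  c < h 0 < d -> c < h 1 < d.
Proof.
by move=> ch hc hd /andP[? ?]; rewrite (ivt_avoid' (h := h))// (ivt_avoid (h := h)).
Qed.

Lemma cis_pihalf : cis (pi / 2) = 'i%C :> C.
Proof. by rewrite /cis cos_pihalf sin_pihalf. Qed.

Lemma cis_pi : cis pi = -1 :> C.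
Proof. by rewrite /cis cospi sinpi; apply/eqP; rewrite eq_complex /= oppr0 !eqxx. Qed.

Lemma cis_Npihalf : cis (- (pi / 2)) = - 'i%C :> C.
Proof. by rewrite /cis cosN sinN cos_pihalf sin_pihalf; apply/eqP; rewrite eq_complex /= oppr0 !eqxx. Qed.

Lemma cis_2pi : cis (2 * pi) = 1 :> C.
Proof. by rewrite mulr_natl mulr2n cisD cis_pi mulrNN mulr1. Qed.

Lemma lift_square' (f : R -> R -> C) (th : R) :
  continuous (fun p : R * R => f p.1 p.2) ->
  (forall s t, 0 <= s <= 1 -> 0 <= t <= 1 -> f s t != 0) ->
  f 0 0 = (md (f 0 0))%:C * cis th ->
  exists h : R -> R -> R, [/\ continuous (fun p : R * R => h p.1 p.2), h 0 0 = th &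
    forall s t, 0 <= s <= 1 -> 0 <= t <= 1 -> f s t = (md (f s t))%:C * cis (h s t)].
Proof.
move=> cf f0 fth.
pose F (p : R * R) := f (clamp01 p.1) (clamp01 p.2).
have c0 : clamp01 0 = 0 :> R by rewrite clamp01_id// lexx ler01.
have [|||h [ch h0 hP]] := @lift_square F th.
- have cc : continuous (fun p : R * R => (clamp01 p.1, clamp01 p.2)).
    apply: cts_pair; apply: cts_comp; try exact: continuous_clamp01; [exact: cts_fst|exact: cts_snd].
  exact: (cts_comp cf cc).
- by move=> p; apply: f0; exact: clamp01_itv.
- by rewrite /F /= c0.
exists (fun s t => h (s, t)); split => //.
  by under eq_fun do rewrite -surjective_pairing.
by move=> s t s01 t01; have := hP s t s01 t01; rewrite /F /= !clamp01_id.
Qed.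

Lemma cslice1 (h : R -> R -> R) s : continuous (fun p : R * R => h p.1 p.2) -> continuous (h s).
Proof.
move=> ch; have cc : continuous (fun t : R => (s, t)) by apply: cts_pair; [exact: cts_cst|exact: cts_id].
exact: (cts_comp ch cc).
Qed.

Lemma cslice2 (h : R -> R -> R) t : continuous (fun p : R * R => h p.1 p.2) -> continuous (h^~ t).
Proof.
move=> ch; have cc : continuous (fun s : R => (s, t)) by apply: cts_pair; [exact: cts_id|exact: cts_cst].
exact: (cts_comp ch cc).
Qed.

Lemma i00 : 0 <= (0 : R) <= 1. Proof. by rewrite lexx ler01. Qed.
Lemma i11 : 0 <= (1 : R) <= 1. Proof. by rewrite lexx ler01. Qed.

(** The angle of [f] starts at [- pi / 2]. Along the sides [s = 0] and [t = 1] it cannot pass 0, and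
    along [t = 0] and [s = 1] it cannot pass [- pi]. At the opposite vertex it is therefore between
    [- pi] and 0, against the sign of the imaginary part there. *)
Lemma no_twist (f : R -> R -> C) :
  continuous (fun p : R * R => f p.1 p.2) ->
  (forall s t, 0 <= s <= 1 -> 0 <= t <= 1 -> f s t != 0) ->
  Re (f 0 0) = 0 -> Im (f 0 0) < 0 -> 0 < Im (f 1 1) ->
  (forall t, 0 <= t <= 1 -> 0 <= Re (f 0 t) -> Im (f 0 t) != 0) ->
  (forall s, 0 <= s <= 1 -> 0 <= Re (f s 1) -> Im (f s 1) != 0) ->
  (forall s, 0 <= s <= 1 -> Re (f s 0) <= 0 -> Im (f s 0) != 0) ->
  (forall t, 0 <= t <= 1 -> Re (f 1 t) <= 0 -> Im (f 1 t) != 0) ->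
  False.
Proof.
move=> cf f0 R00 I00 I11 H1 H2 H3 H4.
have [|h [ch h00 hP]] := @lift_square' f (- (pi / 2)) cf f0.
  have m0 : md (f 0 0) = - Im (f 0 0).
    apply/eqP; rewrite -(@eqrXn2 _ 2) ?md_ge0 ?oppr_ge0 ?(ltW I00)//.
    by rewrite md_sqr R00 expr0n add0r sqrrN.
  rewrite m0 cis_Npihalf; move: R00 {m0 I00}; case: (f 0 0) => a b /= ->.
  by apply/eqP; rewrite eq_complex /= !(mul0r, mulr0, subr0, addr0, oppr0, mulrN1, opprK) !eqxx.
have pi0 : 0 < pi :> R := pi_gt0 R.
have hx s t a : 0 <= s <= 1 -> 0 <= t <= 1 -> h s t = a ->
    Re (f s t) = md (f s t) * cos a /\ Im (f s t) = md (f s t) * sin a.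
  move=> s01 t01 ha; rewrite {1 3}hP// ha /cis /=.
  by rewrite !mul0r subr0 addr0.
have E1 : h 0 1 < 0.
  apply: (ivt_avoid (h := h 0)); [exact: cslice1| |by rewrite h00 oppr_lt0 divr_gt0].
  move=> t t01; apply/eqP => /(hx _ _ _ i00 t01)[E F]; have := H1 t t01.
  by rewrite E F cos0 sin0 mulr1 mulr0 eqxx => /(_ (md_ge0 _)).
have E2 : h 1 1 < 0.
  apply: (ivt_avoid (h := h^~ 1)); [exact: cslice2| |exact: E1].
  move=> t t01; apply/eqP => /(hx _ _ _ t01 i11)[E F]; have := H2 t t01.
  by rewrite E F cos0 sin0 mulr1 mulr0 eqxx => /(_ (md_ge0 _)).
have E3 : - pi < h 1 0.
  apply: (ivt_avoid' (h := h^~ 0)); [exact: cslice2| |].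
    move=> t t01; apply/eqP => /(hx _ _ _ t01 i00)[E F]; have := H3 t t01.
    rewrite E F cosN sinN cospi sinpi oppr0 mulr0 eqxx mulrN1 oppr_le0.
    by move=> /(_ (md_ge0 _)).
  by rewrite h00 ltrN2 ltr_pdivrMr// mulr_natr mulr2n ltrDl.
have E4 : - pi < h 1 1.
  apply: (ivt_avoid' (h := h 1)); [exact: cslice1| |exact: E3].
  move=> t t01; apply/eqP => /(hx _ _ _ i11 t01)[E F]; have := H4 t t01.
  rewrite E F cosN sinN cospi sinpi oppr0 mulr0 eqxx mulrN1 oppr_le0.
  by move=> /(_ (md_ge0 _)).
have [_ F] := hx _ _ _ i11 i11 erefl.
move: I11; rewrite F pmulr_rgt0 ?md_gt0 ?f0 ?i11//.
rewrite -[h 1 1]opprK sinN oppr_gt0 ltNge => /negP; apply.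
by apply/ltW/sin_gt0_pi; rewrite oppr_gt0 E2 ltrNl.
Qed.

Section Reparam.
Variables (a b : R).
Hypothesis ab : a <= b.
Definition aff (s : R) := a + s * (b - a).
Lemma aff0 : aff 0 = a. Proof. by rewrite /aff mul0r addr0. Qed.
Lemma aff1 : aff 1 = b. Proof. by rewrite /aff mul1r addrC subrK. Qed.
Lemma aff_itv s : 0 <= s <= 1 -> a <= aff s <= b.
Proof.
move=> /andP[s0 s1]; rewrite /aff lerDl mulr_ge0 ?subr_ge0//= -lerBrDl.
by rewrite ler_piMl// subr_ge0.
Qed.
Lemma caff : continuous aff.
Proof. by apply: ctsD; [exact: cts_cst|apply: ctsM; [exact: cts_id|exact: cts_cst]]. Qed.
End Reparam.

Lemma cdiff (A B : R -> C) a0 a1 b0 b1 : continuous A -> continuous B ->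
  continuous (fun p : R * R => A (aff a0 a1 p.1) - B (aff b0 b1 p.2)).
Proof.
move=> cA cB; apply: (@ctsB).
  by apply: cts_comp cA _; apply: cts_comp (@caff _ _) (@cts_fst _ _).
by apply: cts_comp cB _; apply: cts_comp (@caff _ _) (@cts_snd _ _).
Qed.

(** If two strands cross a vertical band and exchange their order, then [A s - B t] has the boundary
    behaviour excluded by [no_twist] unless it vanishes somewhere. *)
Lemma strands_meet (A B : R -> C) (a0 a1 b0 b1 l r : R) :
  a0 <= a1 -> b0 <= b1 -> continuous A -> continuous B ->
  Re (A a0) = l -> Re (B b0) = l -> Re (A a1) = r -> Re (B b1) = r ->
  (forall s, a0 < s <= a1 -> l < Re (A s)) -> (forall s, a0 <= s < a1 -> Re (A s) < r) ->
  (forall t, b0 < t <= b1 -> l < Re (B t)) -> (forall t, b0 <= t < b1 -> Re (B t) < r) ->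
  Im (A a0) < Im (B b0) -> Im (B b1) < Im (A a1) ->
  exists s t, [/\ a0 <= s <= a1, b0 <= t <= b1 & A s = B t].
Proof.
move=> a01 b01 cA cB Al Bl Ar Br lA rA lB rB I0 I1.
apply: contrapT => nE.
pose f s t := A (aff a0 a1 s) - B (aff b0 b1 t).
have RB z w : Re (z - w) = Re z - Re w :> R by case: z w => ? ? [].
have IB z w : Im (z - w) = Im z - Im w :> R by case: z w => ? ? [].
apply: (@no_twist f).
- exact: cdiff.
- move=> s t s01 t01; rewrite subr_eq0; apply/eqP => E; apply: nE.
  by exists (aff a0 a1 s), (aff b0 b1 t); split => //; exact: aff_itv.
- by rewrite /f !aff0 RB Al Bl subrr.
- by rewrite /f !aff0 IB subr_lt0.
- by rewrite /f !aff1 IB subr_gt0.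
- move=> t t01; rewrite /f aff0 RB IB Al subr_ge0.
  have /andP[b0t tb1] := aff_itv b01 t01.
  case: (ltgtP b0 (aff b0 b1 t)) b0t => // [bt|<-] _.
    by rewrite leNgt lB// bt.
  by rewrite lt_eqF// subr_lt0.
- move=> s s01; rewrite /f aff1 RB IB Br subr_ge0.
  have /andP[a0s sa1] := aff_itv a01 s01.
  case: (ltgtP (aff a0 a1 s) a1) sa1 => // [sa|->] _.
    by rewrite leNgt rA// a0s.
  by rewrite gt_eqF// subr_gt0.
- move=> s s01; rewrite /f aff0 RB IB Bl subr_le0.
  have /andP[a0s sa1] := aff_itv a01 s01.
  case: (ltgtP a0 (aff a0 a1 s)) a0s => // [sa|<-] _.
    by rewrite leNgt lA// sa.
  by rewrite lt_eqF// subr_lt0.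
- move=> t t01; rewrite /f aff1 RB IB Ar subr_le0.
  have /andP[b0t tb1] := aff_itv b01 t01.
  case: (ltgtP (aff b0 b1 t) b1) tb1 => // [bt|->] _.
    by rewrite leNgt rB// b0t.
  by rewrite gt_eqF// subr_gt0.
Qed.

(** If the arcs were disjoint, [A s - B t] would have a continuous angle on the square. Starting
    from [pi], this angle is [pi] at the opposite vertex when followed along two sides, where the
    difference stays below and then above the real axis, and [- pi] when followed along the other
    two. *)
Lemma halfplane_meet (A B : R -> C) (a0 a1 b0 b1 : R) :
  a0 <= a1 -> b0 <= b1 -> continuous A -> continuous B ->
  (forall s, a0 <= s <= a1 -> 0 <= Im (A s)) -> (forall t, b0 <= t <= b1 -> 0 <= Im (B t)) ->
  Im (A a0) = 0 -> Im (A a1) = 0 -> Im (B b0) = 0 -> Im (B b1) = 0 ->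
  Re (A a0) < Re (B b0) -> Re (B b0) < Re (A a1) -> Re (A a1) < Re (B b1) ->
  exists s t, [/\ a0 <= s <= a1, b0 <= t <= b1 & A s = B t].
Proof.
move=> a01 b01 cA cB IA IB A0 A1 B0 B1 h1 h2 h3.
apply: contrapT => nE.
pose f s t := A (aff a0 a1 s) - B (aff b0 b1 t).
have RB z w : Re (z - w) = Re z - Re w :> R by case: z w => ? ? [].
have IBB z w : Im (z - w) = Im z - Im w :> R by case: z w => ? ? [].
have cf : continuous (fun p : R * R => f p.1 p.2) by exact: cdiff.
have f0 s t : 0 <= s <= 1 -> 0 <= t <= 1 -> f s t != 0.
  move=> s01 t01; rewrite subr_eq0; apply/eqP => E; apply: nE.
  by exists (aff a0 a1 s), (aff b0 b1 t); split => //; exact: aff_itv.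
have neg (z : C) : Re z < 0 -> Im z = 0 -> z = - (md z)%:C.
  case: z => x y /= x0 ->; rewrite /md /= expr0n addr0 sqrtr_sqr ltr0_norm//.
  by apply/eqP; rewrite eq_complex /= opprK oppr0 !eqxx.
have pos (z : C) : 0 < Re z -> Im z = 0 -> z = (md z)%:C.
  case: z => x y /= x0 ->; rewrite /md /= expr0n addr0 sqrtr_sqr gtr0_norm//.
have f00 : f 0 0 = - (md (f 0 0))%:C.
  by apply: neg; rewrite /f !aff0 ?RB ?IBB ?subr_lt0// A0 B0 subrr.
have f01 : f 0 1 = - (md (f 0 1))%:C.
  apply: neg; rewrite /f aff0 aff1 ?RB ?IBB ?A0 ?B1 ?subrr// subr_lt0.
  exact: lt_trans h1 (lt_trans h2 h3).
have f11 : f 1 1 = - (md (f 1 1))%:C.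
  by apply: neg; rewrite /f !aff1 ?RB ?IBB ?subr_lt0// A1 B1 subrr.
have f10 : f 1 0 = (md (f 1 0))%:C.
  by apply: pos; rewrite /f aff1 aff0 ?RB ?IBB ?subr_gt0// A1 B0 subrr.
have I1 t : 0 <= t <= 1 -> Im (f 0 t) <= 0.
  by move=> t01; rewrite /f IBB aff0 A0 sub0r oppr_le0 IB// aff_itv.
have I2 s : 0 <= s <= 1 -> 0 <= Im (f s 1).
  by move=> s01; rewrite /f IBB aff1 B1 subr0 IA// aff_itv.
have I3 s : 0 <= s <= 1 -> 0 <= Im (f s 0).
  by move=> s01; rewrite /f IBB aff0 B0 subr0 IA// aff_itv.
have I4 t : 0 <= t <= 1 -> Im (f 1 t) <= 0.
  by move=> t01; rewrite /f IBB aff1 A1 sub0r oppr_le0 IB// aff_itv.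
have [|h [ch h00 hP]] := @lift_square' f pi cf f0.
  by rewrite cis_pi mulrN1.
have pi0 : 0 < pi :> R := pi_gt0 R.
have hi s t a : 0 <= s <= 1 -> 0 <= t <= 1 -> Im (f s t) <= 0 -> cis a = 'i%C -> h s t != a.
  move=> s01 t01 If ai; apply/eqP => ha; move: If; rewrite hP// ha ai /=.
  by rewrite mulr1 mul0r addr0 leNgt md_gt0 f0.
have hni s t a : 0 <= s <= 1 -> 0 <= t <= 1 -> 0 <= Im (f s t) -> cis a = - 'i%C -> h s t != a.
  move=> s01 t01 If ai; apply/eqP => ha; move: If; rewrite hP// ha ai /=.
  by rewrite mulrN1 mul0r addr0 leNgt oppr_lt0 md_gt0 f0.
have hneg s t a : 0 <= s <= 1 -> 0 <= t <= 1 -> f s t = - (md (f s t))%:C ->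
    cis a = -1 -> `|h s t - a| < 2 * pi -> h s t = a.
  move=> s01 t01 E ca; apply: cis_inj; rewrite ca.
  have m0 : (md (f s t))%:C != 0 by rewrite -md_gt0 mdRe normr_gt0 md_eq0 f0.
  by apply: (mulfI m0); rewrite -hP// mulrN1.
have hpos s t a : 0 <= s <= 1 -> 0 <= t <= 1 -> f s t = (md (f s t))%:C ->
    cis a = 1 -> `|h s t - a| < 2 * pi -> h s t = a.
  move=> s01 t01 E ca; apply: cis_inj; rewrite ca.
  have m0 : (md (f s t))%:C != 0 by rewrite -md_gt0 mdRe normr_gt0 md_eq0 f0.
  by apply: (mulfI m0); rewrite -hP// mulr1.
have c1 : cis (pi / 2 + 2 * pi) = 'i%C :> C by rewrite cisD cis_2pi mulr1 cis_pihalf.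
have c2 : cis (- (pi / 2) + 2 * pi) = - 'i%C :> C by rewrite cisD cis_2pi mulr1 cis_Npihalf.
have c3 : cis (pi / 2 - 2 * pi) = 'i%C :> C by rewrite cisD cisN cis_2pi invr1 mulr1 cis_pihalf.
have h01 : h 0 1 = pi.
  apply: hneg; rewrite ?i00 ?i11 ?cis_pi//.
  have /andP[] : pi / 2 < h 0 1 < pi / 2 + 2 * pi.
    apply: (ivt_stay (h := h 0)); first exact: cslice1.
    - by move=> t t01; apply: hi; rewrite ?i00 ?I1 ?cis_pihalf.
    - by move=> t t01; apply: hi; rewrite ?i00 ?I1.
    - by rewrite h00; apply/andP; split; lra.
  by rewrite ltr_norml => ? ?; apply/andP; split; lra.
have h11 : h 1 1 = pi.
  apply: hneg; rewrite ?i00 ?i11 ?cis_pi//.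
  have /andP[] : - (pi / 2) < h 1 1 < - (pi / 2) + 2 * pi.
    apply: (ivt_stay (h := h^~ 1)); first exact: cslice2.
    - by move=> t t01; apply: hni; rewrite ?i11 ?I2 ?cis_Npihalf.
    - by move=> t t01; apply: hni; rewrite ?i11 ?I2.
    - by rewrite h01; apply/andP; split; lra.
  by rewrite ltr_norml => ? ?; apply/andP; split; lra.
have h10 : h 1 0 = 0.
  apply: hpos; rewrite ?i00 ?i11 ?cis0//.
  have /andP[] : - (pi / 2) < h 1 0 < - (pi / 2) + 2 * pi.
    apply: (ivt_stay (h := h^~ 0)); first exact: cslice2.
    - by move=> t t01; apply: hni; rewrite ?i00 ?I3 ?cis_Npihalf.
    - by move=> t t01; apply: hni; rewrite ?i00 ?I3.
    - by rewrite h00; apply/andP; split; lra.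
  by rewrite ltr_norml => ? ?; apply/andP; split; lra.
have : h 1 1 = - pi.
  apply: hneg; rewrite ?i00 ?i11 ?cisN ?cis_pi ?invrN1//.
  have /andP[] : pi / 2 - 2 * pi < h 1 1 < pi / 2.
    apply: (ivt_stay (h := h 1)); first exact: cslice1.
    - by move=> t t01; apply: hi; rewrite ?i11 ?I4.
    - by move=> t t01; apply: hi; rewrite ?i11 ?I4 ?cis_pihalf.
    - by rewrite h10; apply/andP; split; lra.
  by rewrite ltr_norml => ? ?; apply/andP; split; lra.
by rewrite h11; lra.
Qed.

End Lifting.

Section Topo.
Variable R : realType.
Notation C := R[i].

(* The Cayley transform of the disc of radius rho, sending rho to infinity. *)
Definition cayley (rho : R) (z : C) : C :=
  let D := (rho - Re z) ^+ 2 + Im z ^+ 2 in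
  Complex (- (2 * rho * Im z) / D) ((rho ^+ 2 - md z ^+ 2) / D).

Lemma cayley_den (rho : R) (z : C) : z != rho%:C -> 0 < (rho - Re z) ^+ 2 + Im z ^+ 2.
Proof.
move=> zr; rewrite lt_def addr_ge0 ?sqr_ge0// andbT paddr_eq0 ?sqr_ge0// !expf_eq0 /=.
apply: contra zr; case: z => x y /=; rewrite subr_eq0 => /andP[/eqP -> /eqP ->].
by [].
Qed.

(** Equal images give equal values of [(rho - x) / D] and [y / D]; the sum of their squares is
    [1 / D], so [D] and then the point are recovered. *)
Lemma cayley_inj (rho : R) (z w : C) : 0 < rho -> z != rho%:C -> w != rho%:C ->
  cayley rho z = cayley rho w -> z = w.
Proof.
move=> r0 /cayley_den + /cayley_den; rewrite /cayley.
case: z w => x y [u v]; rewrite !md_sqr /=.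
set D := (rho - x) ^+ 2 + y ^+ 2; set E := (rho - u) ^+ 2 + v ^+ 2.
move=> D0 E0 [h1 h2].
have D1 : D != 0 by rewrite gt_eqF.
have E1 : E != 0 by rewrite gt_eqF.
have e1 : y / D = v / E.
  have r2 : - (2 * rho) != 0 by rewrite oppr_eq0 mulf_eq0 pnatr_eq0 /= gt_eqF.
  apply: (mulfI r2); rewrite !mulNr; congr (- _).
  by move: h1; rewrite !mulNr => /oppr_inj; rewrite -!mulrA.
have e2 : (rho - x) / D = (rho - u) / E.
  have r2 : 2 * rho != 0 by rewrite mulf_eq0 pnatr_eq0 /= gt_eqF.
  apply: (mulfI r2); rewrite !mulrA.
  have -> : 2 * rho * (rho - x) = (rho ^+ 2 - (x ^+ 2 + y ^+ 2)) + D by rewrite /D; ring.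
  have -> : 2 * rho * (rho - u) = (rho ^+ 2 - (u ^+ 2 + v ^+ 2)) + E by rewrite /E; ring.
  by rewrite [LHS]mulrDl [RHS]mulrDl h2 !mulfV.
have DE : D^-1 = E^-1.
  have <- : ((rho - x) / D) ^+ 2 + (y / D) ^+ 2 = D^-1.
    by rewrite !expr_div_n -mulrDl -/D expr2 invfM mulrA mulfV// mul1r.
  rewrite e1 e2 !expr_div_n -mulrDl -/E expr2 invfM mulrA mulfV// mul1r//.
move: e1 e2; rewrite DE => e1 e2.
have Ei : E^-1 != 0 by rewrite invr_eq0.
by move/(mulIf Ei): e1 => ->; move/(mulIf Ei): e2 => /addrI/oppr_inj ->.
Qed.

(** The expression is [- cot (a / 2)], the boundary value of the Cayley transform at angle [a]. *)
Lemma cot_half (a b : R) : 0 < a -> a < b -> b < 2 * pi ->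
  - sin a / (1 - cos a) < - sin b / (1 - cos b).
Proof.
move=> a0 ab b2.
have half (x : R) : 0 < x < 2 * pi -> [/\ 0 < sin (x / 2), sin x = 2 * (sin (x / 2) * cos (x / 2))
    & 1 - cos x = 2 * sin (x / 2) ^+ 2].
  move=> /andP[x0 x2]; split.
  - by apply: sin_gt0_pi; rewrite divr_gt0//= ltr_pdivrMr// mulrC.
  - by rewrite {1}[x]splitr sinD; ring.
  - rewrite {1}[x]splitr cosD -!expr2.
    by have := cos2Dsin2 (x / 2); lra.
have [|sa ea fa] := half a; first by rewrite a0 (lt_trans ab).
have [|sb eb fb] := half b; first by rewrite (lt_trans a0).
rewrite !mulNr ltrN2 ltr_pdivrMr; last by rewrite fb mulr_gt0// exprn_gt0.
rewrite mulrAC ltr_pdivlMr; last by rewrite fa mulr_gt0// exprn_gt0.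
rewrite ea eb fa fb.
have : 0 < sin (b / 2 - a / 2).
  apply: sin_gt0_pi; rewrite subr_gt0 ltr_pM2r ?invr_gt0// ab /=.
  by rewrite -mulrBl ltr_pdivrMr//; lra.
rewrite sinB => h.
rewrite -subr_gt0.
set u := sin (a / 2) in sa h *; set v := sin (b / 2) in sb h *.
set c := cos (a / 2) in h *; set d := cos (b / 2) in h *.
have -> : 2 * (u * c) * (2 * v ^+ 2) - 2 * (v * d) * (2 * u ^+ 2)
   = 4 * (u * v) * (v * c - d * u) by ring.
by rewrite !mulr_gt0.
Qed.

Lemma cayley_bd (rho a : R) : 0 < rho -> 0 < a < 2 * pi ->
  cayley rho (rho%:C * cis a) = Complex (- sin a / (1 - cos a)) 0.
Proof.
move=> r0 /andP[a0 a2]; rewrite /cayley mdM md_cis mulr1 mdRe gtr0_norm// subrr mul0r.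
congr Complex; rewrite /= !mul0r subr0 addr0.
have -> : (rho - rho * cos a) ^+ 2 + (rho * sin a) ^+ 2 = 2 * rho ^+ 2 * (1 - cos a).
  by have := cos2Dsin2 a; move: (cos a) (sin a) => c s; nra.
case: (eqVneq (1 - cos a) 0) => [->|c0]; first by rewrite mulr0 invr0 !mulr0.
have r1 : rho != 0 by rewrite gt_eqF.
by field; rewrite c0 r1.
Qed.

Lemma continuous_cayley (T : topologicalType) (rho : R) (A : T -> C) :
  continuous A -> (forall t, A t != rho%:C) -> continuous (fun t => cayley rho (A t)).
Proof.
move=> cA A0.
have cDD : continuous (fun t => ((rho - Re (A t)) ^+ 2 + Im (A t) ^+ 2)^-1).
  apply: ctsV; last by move=> t; rewrite gt_eqF// cayley_den.
  by apply: ctsD; apply: ctsX; [apply: ctsB; [exact: cts_cst|exact: cts_Re]|exact: cts_Im].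
move=> t; apply: cvg_Re_Im => /=; apply: cvgM; try exact: cDD.
  by apply: (@ctsN _ _ (fun t => 2 * rho * Im (A t))); apply: ctsM; [exact: cts_cst|exact: cts_Im].
by apply: (@ctsB _ _ (fun t => rho ^+ 2) (fun t => md (A t) ^+ 2));
  [exact: cts_cst|apply: ctsX; exact: cts_md].
Qed.

Lemma disc_meet (rho : R) (A B : R -> C) (a0 a1 b0 b1 p p' q q' : R) :
  0 < rho -> a0 <= a1 -> b0 <= b1 -> continuous A -> continuous B ->
  (forall s, a0 <= s <= a1 -> md (A s) <= rho /\ A s != rho%:C) ->
  (forall t, b0 <= t <= b1 -> md (B t) <= rho /\ B t != rho%:C) ->
  A a0 = rho%:C * cis p -> A a1 = rho%:C * cis p' ->
  B b0 = rho%:C * cis q -> B b1 = rho%:C * cis q' ->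
  0 < p -> p < q -> q < p' -> p' < q' -> q' < 2 * pi ->
  exists s t, [/\ a0 <= s <= a1, b0 <= t <= b1 & A s = B t].
Proof.
move=> r0 a01 b01 cA cB hA hB A0 A1 B0 B1 p0 pq qp pq' q2.
(* Clamping the time keeps the curve off the pole [rho] at all times, as global continuity
   requires. *)
pose A' s := cayley rho (A (aff a0 a1 (clamp01 s))).
pose B' s := cayley rho (B (aff b0 b1 (clamp01 s))).
have ia s : a0 <= aff a0 a1 (clamp01 s) <= a1 by apply: aff_itv => //; exact: clamp01_itv.
have ib s : b0 <= aff b0 b1 (clamp01 s) <= b1 by apply: aff_itv => //; exact: clamp01_itv.
have cc c d : continuous (fun s => aff c d (clamp01 s) : R).
  by apply: cts_comp (@caff _ _ _) _; exact: continuous_clamp01.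
have cA' : continuous A'.
  apply: continuous_cayley; first by apply: cts_comp cA _; exact: cc.
  by move=> t; have [] := hA _ (ia t).
have cB' : continuous B'.
  apply: continuous_cayley; first by apply: cts_comp cB _; exact: cc.
  by move=> t; have [] := hB _ (ib t).
have Im0 z : md z <= rho -> z != rho%:C -> 0 <= Im (cayley rho z).
  move=> zr /cayley_den D0 /=; rewrite divr_ge0 ?(ltW D0)// subr_ge0.
  by rewrite lerXn2r// nnegrE ?md_ge0// ltW.
have E00 : A' 0 = Complex (- sin p / (1 - cos p)) 0.
  by rewrite /A' clamp01_id ?i00// aff0 A0 cayley_bd// p0; lra.
have E01 : A' 1 = Complex (- sin p' / (1 - cos p')) 0.
  by rewrite /A' clamp01_id ?i11// aff1 A1 cayley_bd//; apply/andP; split; lra.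
have E10 : B' 0 = Complex (- sin q / (1 - cos q)) 0.
  by rewrite /B' clamp01_id ?i00// aff0 B0 cayley_bd//; apply/andP; split; lra.
have E11 : B' 1 = Complex (- sin q' / (1 - cos q')) 0.
  by rewrite /B' clamp01_id ?i11// aff1 B1 cayley_bd//; apply/andP; split; lra.
have [|||||||||s [t [s01 t01 E]]] := @halfplane_meet _ A' B' 0 1 0 1 ler01 ler01 cA' cB' _ _
   _ _ _ _.
- by move=> s _; have [] := hA _ (ia s); exact: Im0.
- by move=> s _; have [] := hB _ (ib s); exact: Im0.
- by rewrite E00.
- by rewrite E01.
- by rewrite E10.
- by rewrite E11.
- by rewrite E00 E10 /=; apply: cot_half => //; lra.
- by rewrite E01 E10 /=; apply: cot_half => //; lra.
- by rewrite E01 E11 /=; apply: cot_half => //; lra.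
exists (aff a0 a1 (clamp01 s)), (aff b0 b1 (clamp01 t)); split => //.
by apply: cayley_inj E => //; [have [] := hA _ (ia s)|have [] := hB _ (ib t)].
Qed.

Lemma lift_line (f : R -> C) : continuous f -> (forall t, 0 <= t <= 1 -> md (f t) = 1) ->
  exists2 h : R -> R, continuous h & forall t, 0 <= t <= 1 -> f t = cis (h t).
Proof.
move=> cf f1.
have [th fth] := cis_surj (f1 0 (i00 _)).
have [|||h [ch _ hP]] := @lift_square' _ (fun s _ => f s) th.
- exact: cts_comp cf (@cts_fst _ _).
- by move=> s t s01 _; rewrite -md_gt0 f1.
- by rewrite f1 ?i00// mul1r.
exists (h^~ 0); first exact: cslice2.
by move=> t t01; rewrite [LHS](hP t 0 t01 (i00 _)) f1// mul1r.
Qed.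

(** The preimage of a closed set [F] by [E] is the preimage by [c] of the finite union of the
    compact sets [Phi i (K i /\ G i^-1 F)]. This is how continuity is obtained for maps defined by
    choosing representatives: the pieces need only be compact and compatible, not open. *)
Lemma compact_lift (T Y Z U : topologicalType) (I : finType) (K : I -> set U)
  (Phi : I -> U -> Y) (G : I -> U -> Z) (c : T -> Y) (E : T -> Z) :
  hausdorff_space Y -> (forall i, compact (K i)) ->
  (forall i, continuous (Phi i)) -> (forall i, {within K i, continuous (G i)}) ->
  (forall i k i' k', K i k -> K i' k' -> Phi i k = Phi i' k' -> G i k = G i' k') ->
  continuous c -> (forall t, exists i k, [/\ K i k, c t = Phi i k & E t = G i k]) ->
  continuous E.
Proof.
move=> hY cK0 cPhi cG compat cc hE; apply/continuous_closedP => F cF.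
pose B := \bigcup_(i in [set: I]) (Phi i @` (K i `&` G i @^-1` F)).
have -> : E @^-1` F = c @^-1` B.
  apply/seteqP; split=> t /=.
    by move=> Ft; have [i [k [Kk ck Ek]]] := hE t; exists i => //; exists k => //; split => //=;
      rewrite -Ek.
  move=> [i _ [k [Kk Gk] ck]]; have [i' [k' [Kk' ck' Ek']]] := hE t.
  by rewrite Ek' -(compat i k) // ck.
move/continuous_closedP: cc; apply.
apply: closed_bigcup => //; first exact: finite_finset.
move=> i _; apply: compact_closed => //.
apply: continuous_compact; first exact: continuous_subspaceT.
have [/(_ (cG i) F cF) /closed_subspaceP[V ctsV VE] _] := @continuous_closedP (subspace (K i)) Z (G i).
have -> : K i `&` G i @^-1` F = K i `&` V by rewrite setIC -VE setIC.
exact: compact_closedI.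
Qed.

Lemma compact_disc (r : R) : compact [set z : C | md z <= r].
Proof.
have cf : continuous (fun p : R * R => p.1%:C * cis p.2).
  by apply: ctsM; [apply: cts_toC; exact: cts_fst|apply: cts_cis; exact: cts_snd].
case: (leP 0 r) => r0; last first.
  rewrite (_ : [set _ | _] = set0); first exact: compact0.
  by apply/seteqP; split => // z /=; rewrite leNgt (lt_le_trans r0)// md_ge0.
have : exists b : R, forall z : C, exists2 a, 0 <= a <= b & z = (md z)%:C * cis a.
  exists (2 * pi) => z.
  have [->|z0] := eqVneq z 0.
    by exists 0; rewrite ?lexx ?mulr_ge0 ?pi_ge0// md0 mul0r.
  have m0 : (md z)%:C != 0 by rewrite -md_gt0 mdRe normr_gt0 md_eq0.
  have : md (z / (md z)%:C) = 1 by rewrite mdM mdV mdRe ger0_norm ?md_ge0// mulfV// md_eq0.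
  move=> z1.
  have := md_sqr (z / (md z)%:C); rewrite z1 expr1n => /esym E.
  have hR : -1 <= Re (z / (md z)%:C) <= 1 by rewrite -ler_norml -z1 Re_le_md.
  set w := z / _ in E hR z1.
  have zE : z = (md z)%:C * w by rewrite /w mulrCA mulfV// mulr1.
  have sE : sin (acos (Re w)) = `|Im w|.
    by rewrite sin_acos// -sqrtr_sqr -E addrAC subrr add0r.
  have a0 := acos_ge0 hR; have a1 := acos_lepi hR.
  have pi0 := pi_gt0 R.
  case: (leP 0 (Im w)) => b0.
    exists (acos (Re w)); first by rewrite a0 /=; lra.
    rewrite {1}zE; congr (_ * _); rewrite /cis acosK// sE ger0_norm//; by case: (w).
  exists (2 * pi - acos (Re w)); first by apply/andP; split; lra.
  rewrite {1}zE; congr (_ * _); rewrite cisD cis_2pi mul1r /cis cosN sinN acosK// sE ltr0_norm//.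
  by rewrite opprK; case: (w).
move=> [b hb].
have -> : [set z : C | md z <= r] =
   (fun p : R * R => p.1%:C * cis p.2) @` (`[0, r]%classic `*` `[0, b]%classic).
  apply/seteqP; split => z /=.
    move=> zr; have [a a0 E] := hb z; exists (md z, a) => //=.
    by rewrite !in_itv /= md_ge0.
  move=> [[x y] /= []]; rewrite !in_itv /= => /andP[x0 xr] _ <-.
  by rewrite mdM md_cis mulr1 mdRe ger0_norm.
apply: continuous_compact; first exact: continuous_subspaceT.
by apply: compact_setX; exact: segment_compact.
Qed.

(** It is enough to test discs about 0: near [f z], the image of [U] contains the open image of a
    large disc minus the compact image of the part of the closed disc outside [U]. *)
Lemma open_embeddingP (X : topologicalType) (f : C -> X) :
  hausdorff_space X -> continuous f -> injective f ->
  (forall r : R, 0 < r -> open (f @` [set z | md z < r])) -> open_embedding f.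
Proof.
move=> hX cf fi fo; split => // U oU.
rewrite openE => _ [z Uz <-]; rewrite /interior.
have r0 : 0 < md z + 1 by rewrite ltr_wpDl ?md_ge0.
pose W := f @` [set z' | md z' < md z + 1] `\` f @` ([set z' | md z' <= md z + 1] `\` U).
have oW : open W.
  rewrite /W setDE; apply: openI; first exact: fo.
  apply: closed_openC; apply: compact_closed => //.
  apply: continuous_compact; first exact: continuous_subspaceT.
  rewrite setDE; apply: compact_closedI; first exact: compact_disc.
  exact: open_closedC.
have : nbhs (f z) W.
  apply: open_nbhs_nbhs; split => //; split; first by exists z => //=; rewrite ltrDl.
  by move=> [z' [_ nU]] /fi E; apply: nU; rewrite E.
apply: filterS => y [[z' z'r <-] nE]; exists z' => //; apply: contrapT => nU.
by apply: nE; exists z' => //; split => //=; exact: ltW.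
Qed.

End Topo.

(** * Glued polygons *)

Module Gluing.

Section Arcs.
Variables (R : realType) (g : nat).
Hypothesis g0 : (0 < g)%N.
Notation C := R[i].
Notation n4 := ((4 * g)%:R : R).
Notation z4 := ((4 * g)%N%:Z).

Definition arc (x : R) : C := cis (2 * pi * x / n4).

Lemma n4_gt0 : 0 < n4. Proof. by rewrite ltr0n muln_gt0. Qed.

Lemma arcE x : arc_point g x = arc x. Proof. by []. Qed.

Lemma arcD x y : arc (x + y) = arc x * arc y.
Proof. by rewrite /arc mulrDr mulrDl cisD. Qed.

Lemma arcN x : arc (- x) = (arc x)^-1.
Proof. by rewrite /arc mulrN mulNr cisN. Qed.

Lemma arcB x y : arc (x - y) = arc x / arc y.
Proof. by rewrite arcD arcN. Qed.

Lemma arc0 : arc 0 = 1. Proof. by rewrite /arc mulr0 mul0r cis0. Qed.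

Lemma md_arc x : md (arc x) = 1. Proof. exact: md_cis. Qed.

Lemma arc_neq0 x : arc x != 0. Proof. exact: cis_neq0. Qed.

Lemma continuous_arc : continuous arc.
Proof. by apply: cts_cis; apply: ctsM; [apply: ctsM; [exact: cts_cst|exact: cts_id]|exact: cts_cst]. Qed.

Lemma cis2pin (n : nat) : cis (2 * pi * n%:R) = 1 :> C.
Proof.
elim: n => [|n IH]; first by rewrite mulr0 cis0.
by rewrite -[n.+1]addn1 natrD mulrDr cisD IH mul1r mulr1 cis_2pi.
Qed.

Lemma cis2piz (m : int) : cis (2 * pi * m%:~R) = 1 :> C.
Proof.
case: m => n; first exact: cis2pin.
by rewrite NegzE mulrNz mulrN cisN -pmulrn cis2pin invr1.
Qed.

Lemma arc_per x (m : int) : arc (x + (z4 * m)%:~R) = arc x.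
Proof.
rewrite arcD [X in _ * X](_ : _ = 1) ?mulr1// /arc.
rewrite [X in cis X](_ : _ = 2 * pi * m%:~R) ?cis2piz//.
rewrite intrM -pmulrn; have := lt0r_neq0 n4_gt0; set n := n4 => n0.
by rewrite [n * _]mulrC mulrA mulfK.
Qed.

Lemma cis_eq1 (a : R) : cis a = 1 -> exists m : int, a = 2 * pi * m%:~R.
Proof.
move=> ca; have pi0 : 0 < pi :> R := pi_gt0 R.
have p2 : 0 < 2 * pi :> R by rewrite mulr_gt0.
exists (Num.floor (a / (2 * pi))); set m := Num.floor _.
apply/eqP; rewrite -subr_eq0; apply/eqP/cis_inj0.
  by rewrite cisD cisN cis2piz invr1 ca mulr1.
have /andP[h1 h2] : m%:~R <= a / (2 * pi) < (m + 1)%:~R by rewrite floor_le floorD1_gt.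
rewrite ler_pdivlMr// in h1; rewrite ltr_pdivrMr// intrD mulrDl mul1r in h2.
rewrite ger0_norm; first by rewrite ltrBlDl mulrC.
by rewrite subr_ge0 mulrC.
Qed.

Lemma arc_eq1 x : arc x = 1 -> exists m : int, x = (z4 * m)%:~R.
Proof.
move=> /cis_eq1[m E]; exists m.
have n0 := n4_gt0; have pi0 := pi_gt0 R.
have E2 : 2 * pi * x = 2 * pi * m%:~R * n4 by rewrite -E mulfVK// gt_eqF.
have p2 : 2 * pi != 0 :> R by rewrite gt_eqF// mulr_gt0.
by apply: (mulfI p2); rewrite E2 intrM -pmulrn -mulrA [n4 * _]mulrC.
Qed.

Lemma arc_inj x y : arc x = arc y -> exists m : int, x = y + (z4 * m)%:~R.
Proof.
move=> E; have [|m mE] := @arc_eq1 (x - y).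
  by rewrite arcB E mulfV// arc_neq0.
by exists m; rewrite -mE addrC subrK.
Qed.

Lemma arc_surj z : md z = 1 -> exists x, z = arc x.
Proof.
move=> /cis_surj[a ->]; exists (a * n4 / (2 * pi)); congr cis.
have n0 := lt0r_neq0 n4_gt0.
have p2 : 2 * pi != 0 :> R by rewrite lt0r_neq0// mulr_gt0// pi_gt0.
by rewrite mulrCA mulfV// mulr1 mulfK.
Qed.

(** In the word [a b a^-1 b^-1] of a handle the sides with residues 0 and 2, and 1 and 3, are glued.
    Sides are numbered by all integers, with period [4 * g], so that the boundary is parametrised by
    the real line. *)
Definition iota4 (j : int) : int := if (j %% 4)%Z < 2 then j + 2 else j - 2.

Lemma iota4_per j m : iota4 (j + z4 * m) = iota4 j + z4 * m.
Proof. clear g0.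
have E : z4 * m = (g%:Z * m) * 4 by rewrite PoszM; lia.
by rewrite /iota4 {1}E [j + _]addrC modzMDl; case: ifP => _; ring.
Qed.

Lemma iota4K j : iota4 (iota4 j) = j.
Proof. clear g0.
rewrite /iota4; 
have hj := divz_eq j 4; have h0 : (0 <= (j %% 4)%Z) by exact: modz_ge0.
have h4 : ((j %% 4)%Z < 4) by exact: ltz_pmod.
set r := (j %% 4)%Z in hj h0 h4 *; set d := (j %/ 4)%Z in hj.
have sm k : 0 <= k < 4 -> modz (d * 4 + k) 4 = k by move=> hk; rewrite modzMDl modz_small.
have sj k : 0 <= r + k < 4 -> modz (j + k) 4 = r + k by move=> hk; rewrite hj -addrA sm.
case: (ltP r 2) => hr.
  by rewrite sj; [case: ltP; lia|lia].
by rewrite sj; [case: ltP; lia|lia].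
Qed.

Lemma iota4_neq j : iota4 j != j.
Proof. by clear g0; rewrite /iota4; case: ifP => _; lia. Qed.

Section Sheets.
Variables (S : choiceType) (tau : int -> S -> S).
Hypothesis tauK : forall j s, tau (iota4 j) (tau j s) = s.
Hypothesis tau_per : forall j m s, tau (j + z4 * m) s = tau j s.

Definition shift (m : int) (a : S * R) : S * R := (a.1, a.2 + (z4 * m)%:~R).

(** The point at distance [x - j] from the start of side [j] is glued to the point at the same
    distance from the end of side [iota4 j]. *)
Definition nxt (a : S * R) : S * R :=
  let j := Num.floor a.2 in (tau j a.1, (j + iota4 j + 1)%:~R - a.2).

(** This differs from [nxt] only at a corner, where the side that ends at the corner is crossed
    instead of the one that starts there: the two maps turn in opposite directions around the
    vertex. *)
Definition prv (a : S * R) : S * R :=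
  let j := Num.ceil a.2 - 1 in (tau j a.1, (j + iota4 j + 1)%:~R - a.2).

Lemma nxt_shift m a : nxt (shift m a) = shift m (nxt a).
Proof.
case: a => s x; rewrite /nxt /shift /=.
have -> : Num.floor (x + (z4 * m)%:~R) = Num.floor x + z4 * m.
  by rewrite floorDrz ?intr_int// intrKfloor.
by rewrite tau_per iota4_per !intrD; congr pair; ring.
Qed.

Lemma iter_nxt_shift i m a : iter i nxt (shift m a) = shift m (iter i nxt a).
Proof. by elim: i => //= i ->; rewrite nxt_shift. Qed.

Lemma shiftD m m' a : shift m (shift m' a) = shift (m + m') a.
Proof. by rewrite /shift /= mulrDr intrD addrAC addrA. Qed.

Lemma shift0 a : shift 0 a = a.
Proof. by case: a => s x; rewrite /shift /= mulr0 addr0. Qed.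

Lemma prvK a : nxt (prv a) = a.
Proof.
case: a => s x; rewrite /prv /nxt /=; set j := Num.ceil x - 1.
have -> : Num.floor ((j + iota4 j + 1)%:~R - x) = iota4 j.
  apply: floor_def; have := ceil_itv x; rewrite -/j.
  have -> : Num.ceil x = j + 1 by rewrite /j subrK.
  by rewrite !intrD => /andP[h1 h2]; apply/andP; split; lra.
rewrite tauK iota4K; congr pair; rewrite !intrD; ring.
Qed.

Lemma prvE a : prv a = nxt a \/ exists j, a.2 = j%:~R.
Proof.
case: a => s x; rewrite /prv /nxt /=.
case: (boolP (x \is a Num.int)) => [/intrP[j ->]|xn]; first by right; exists j.
by left; rewrite ceil_floor xn /= addrK.
Qed.

(** Identification of boundary points, as existence of a common forward iterate up to full turns of
    the polygon; symmetry and transitivity are then formal. *)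
Definition bdrel (a b : S * R) := exists i k m, iter i nxt a = iter k nxt (shift m b).

Lemma bdrel_sym a b : bdrel a b -> bdrel b a.
Proof.
move=> [i [k [m E]]]; exists k, i, (- m).
by rewrite iter_nxt_shift E -iter_nxt_shift shiftD addNr shift0.
Qed.

Lemma bdrel_trans b a c : bdrel a b -> bdrel b c -> bdrel a c.
Proof.
move=> [i [k [m E]]] [i' [k' [m' E']]]; exists (i' + i)%N, (k + k')%N, (m + m').
have -> : iter (i' + i) (nxt) a = iter i' nxt (iter i nxt a) by rewrite iterD.
by rewrite E -iterD addnC !iterD iter_nxt_shift E' -iter_nxt_shift shiftD.
Qed.

Lemma bdrel_shift m a : bdrel (shift m a) a.
Proof. by exists 0%N, 0%N, m. Qed.

Lemma bdrel_nxt a : bdrel (nxt a) a.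
Proof. by exists 0%N, 1%N, 0; rewrite /= shift0. Qed.

Lemma bdrel_inv (T : Type) (Phi : S * R -> T) :
  (forall a, Phi (nxt a) = Phi a) -> (forall m a, Phi (shift m a) = Phi a) ->
  forall a b, bdrel a b -> Phi a = Phi b.
Proof.
move=> Pn Ps a b [i [k [m E]]].
have Pi i' a' : Phi (iter i' nxt a') = Phi a' by elim: i' => //= i' IH; rewrite Pn.
by rewrite -(Pi i a) E Pi Ps.
Qed.

Lemma nxtK a : a.2 \isn't a Num.int -> nxt (nxt a) = a.
Proof.
by move=> an; case: (prvE a) => [<-|[j E]]; [exact: prvK|rewrite E intr_int in an].
Qed.

Lemma nxt_int a : (nxt a).2 \is a Num.int = (a.2 \is a Num.int).
Proof.
case: a => s x; rewrite /nxt /=; set n := (_ + _ + 1).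
apply/idP/idP => h; last by rewrite rpredB ?intr_int.
have -> : x = n%:~R - (n%:~R - x) by rewrite subKr.
by rewrite rpredB ?intr_int.
Qed.

Lemma bdrel_int a b : bdrel a b -> (a.2 \is a Num.int) = (b.2 \is a Num.int).
Proof.
apply: (bdrel_inv (Phi := fun a => a.2 \is a Num.int)); first exact: nxt_int.
by move=> m [s x]; rewrite /shift /= rpredDr// intr_int.
Qed.

Lemma bdrel_edge a b : a.2 \isn't a Num.int -> bdrel a b ->
  exists m, a = shift m b \/ a = shift m (nxt b).
Proof.
move=> an ab; have bn : b.2 \isn't a Num.int by rewrite -(bdrel_int ab).
have it i c : c.2 \isn't a Num.int -> iter i nxt c = c \/ iter i nxt c = nxt c.
  move=> cn; elim: i => [|i IH] /=; first by left.
  by case: IH => ->; [right|left; rewrite nxtK].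
case: ab => i [k [m]]; rewrite iter_nxt_shift => E.
case: (it k b bn) E => ->; case: (it i a an) => -> E; exists m.
- by left.
- by right; rewrite -nxt_shift -E nxtK.
- by right.
- by left; rewrite -[a]nxtK// E nxt_shift nxtK.
Qed.

End Sheets.

Definition cmax1 (z : C) : C := (Num.max 1 (md z))%:C.
(** Radial retraction onto the closed disc. Sheets are thus parametrised by the whole plane, and no
    subspace topology is involved. *)
Definition ret (z : C) : C := z / cmax1 z.

Lemma cmax1_neq0 z : cmax1 z != 0.
Proof. by rewrite -md_gt0 mdRe normr_gt0 gt_eqF// lt_max ltr01. Qed.

Lemma continuous_ret : continuous ret.
Proof.
apply: ctsM; first exact: cts_id.
by apply: ctsV; [apply: cts_toC; apply: cts_max; [exact: cts_cst|exact: continuous_md]|exact: cmax1_neq0].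
Qed.

Lemma ret_id z : md z <= 1 -> ret z = z.
Proof. by move=> z1; rewrite /ret /cmax1 (max_idPl z1) divr1. Qed.

Lemma md_ret z : md (ret z) <= 1.
Proof.
rewrite /ret mdM mdV mdRe ger0_norm ?le_max ?ler01// ler_pdivrMr ?lt_max ?ltr01//.
by rewrite mul1r le_max lexx orbT.
Qed.

(* A surface obtained from the discs s * D, for s in S, by gluing side j of the disc s to
   side iota4 j of the disc tau j s. *)
Record polysurf (S : choiceType) (tau : int -> S -> S) (Y : topologicalType) (q : S -> C -> Y) : Prop :=
  Polysurf {
    ps_cont : forall s, continuous (q s);
    ps_surj : forall y, exists s z, md z <= 1 /\ y = q s z;
    ps_open : forall A : set Y, (forall s, open (q s @^-1` A)) -> open A;
    ps_ret : forall s z, q s z = q s (ret z);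
    ps_eq : forall s z s' z', md z <= 1 -> md z' <= 1 -> q s z = q s' z' ->
      (s = s' /\ z = z') \/
      exists x x', [/\ z = arc x, z' = arc x' & bdrel tau (s, x) (s', x')];
    ps_glue : forall s x s' x', bdrel tau (s, x) (s', x') -> q s (arc x) = q s' (arc x')
  }.

Section Descend.
Variables (S : choiceType) (tau : int -> S -> S) (Y : topologicalType) (q : S -> C -> Y).
Hypothesis ps : polysurf tau q.

(** Agreement across [nxt] is enough, because [bdrel] is generated by [nxt] and full turns. *)
Lemma descend (T : topologicalType) (F : S -> C -> T) :
  (forall s, continuous (F s)) ->
  (forall s x, F (nxt tau (s, x)).1 (arc (nxt tau (s, x)).2) = F s (arc x)) ->
  exists2 f : Y -> T, continuous f & forall s z, md z <= 1 -> f (q s z) = F s z.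
Proof.
move=> cF hF.
have /choice[r rP] : forall y, exists a : S * C, md a.2 <= 1 /\ y = q a.1 a.2.
  by move=> y; have [s [z [? ?]]] := ps_surj ps y; exists (s, z).
have fE s z : md z <= 1 -> F (r (q s z)).1 (r (q s z)).2 = F s z.
  move=> z1; have [r1 E] := rP (q s z).
  have [[<- <-]//|[x [x' [-> -> bd]]]] := ps_eq ps z1 r1 E.
  apply: esym; apply: (bdrel_inv (Phi := fun a => F a.1 (arc a.2)) _ _ bd).
    by move=> [s1 x1]; exact: hF.
  by move=> m [s1 x1] /=; rewrite arc_per.
exists (fun y => F (r y).1 (r y).2); last exact: fE.
apply/continuousP => A oA; apply: (ps_open ps) => s.
have -> : q s @^-1` ((fun y => F (r y).1 (r y).2) @^-1` A) = (F s \o ret) @^-1` A.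
  by apply/seteqP; split => z /=; rewrite (ps_ret ps) fE// md_ret.
have /continuousP : continuous (F s \o ret) by apply: cts_comp (cF s) _; exact: continuous_ret.
exact.
Qed.

Lemma ps_compact : finite_set [set: S] -> compact [set: Y].
Proof.
move=> fS.
have -> : [set: Y] = \bigcup_(s in [set: S]) q s @` [set z | md z <= 1].
  apply/seteqP; split => // y _; have [s [z [z1 ->]]] := ps_surj ps y.
  by exists s => //; exists z.
have cq s : compact (q s @` [set z | md z <= 1]).
  apply: continuous_compact; last exact: compact_disc.
  by apply: continuous_subspaceT; exact: (ps_cont ps).
have /finite_seqP[A ->] := fS.
by rewrite bigcup_seq; apply: bigsetU_compact => s _; exact: cq.
Qed.

End Descend.
End Arcs.

End Gluing.
Import Gluing.

(** * Construction of glued surfaces, and the surface of genus g as a single glued sheet *)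

Section Surfaces.
Variables (R : realType) (g : nat).
Hypothesis g0 : (0 < g)%N.
Notation C := R[i].
Notation z4 := ((4 * g)%N%:Z).
Notation arc := (@arc R g).

Section Sheets.
Variables (S : choiceType) (tau : int -> S -> S).
Hypothesis tauK : forall j s, tau (iota4 j) (tau j s) = s.
Hypothesis tau_per : forall j m s, tau (j + z4 * m) s = tau j s.
Notation nxt := (@nxt R S tau).
Notation prv := (@prv R S tau).
Notation shift := (@shift R g S).
Notation bdrel := (@bdrel R g S tau).

Lemma prv_shift m a : prv (shift m a) = shift m (prv a).
Proof.
case: a => s x; rewrite /Gluing.prv /Gluing.shift /=.
have -> : Num.ceil (x + (z4 * m)%:~R) - 1 = Num.ceil x - 1 + z4 * m.
  by rewrite ceilDrz ?intr_int// intrKceil; ring.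
by rewrite tau_per iota4_per//; congr pair; rewrite !intrD; ring.
Qed.

Lemma nxtKp a : prv (nxt a) = a.
Proof.
case: a => s x; rewrite /Gluing.prv /Gluing.nxt /=; set j := Num.floor x.
have -> : Num.ceil ((j + iota4 j + 1)%:~R - x) = iota4 j + 1.
  apply: ceil_def; have := floor_itv x; rewrite -/j.
  by rewrite addrK !intrD => /andP[h1 h2]; apply/andP; split; lra.
rewrite addrK tauK iota4K; congr pair; rewrite !intrD; ring.
Qed.

(** At the end [x = j + 1] of the side, [floor x] is already the next side, and the gluing is read
    off [prv]. *)
Lemma bdrel_side s x j : j%:~R <= x <= j%:~R + 1 ->
  bdrel (tau j s, (j + iota4 j + 1)%:~R - x) (s, x).
Proof.
move=> /andP[h1]; rewrite le_eqVlt => /orP[/eqP ->|h2].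
  have E : prv (s, j%:~R + 1) = (tau j s, (j + iota4 j + 1)%:~R - (j%:~R + 1)).
    by rewrite /Gluing.prv /= -[j%:~R + 1]/(j%:~R + 1%:~R) -intrD intrKceil addrK.
  by rewrite -E; apply: bdrel_sym => //; rewrite -[X in bdrel X _](prvK tauK); exact: bdrel_nxt.
have -> : (tau j s, (j + iota4 j + 1)%:~R - x) = nxt (s, x).
  by rewrite /Gluing.nxt /=; have -> : Num.floor x = j by apply: floor_def; rewrite h1 intrD.
exact: bdrel_nxt.
Qed.

Definition psurf_rel (a b : S * C) : Prop :=
  (a.1 = b.1 /\ ret a.2 = ret b.2) \/
  exists x x', [/\ ret a.2 = arc x, ret b.2 = arc x' & bdrel (a.1, x) (b.1, x')].

Lemma psurf_relxx a : psurf_rel a a. Proof. by left. Qed.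

Lemma psurf_rel_sym a b : psurf_rel a b -> psurf_rel b a.
Proof.
move=> [[? ?]|[x [x' [h1 h2 h3]]]]; [by left|right; exists x', x; split => //].
exact: bdrel_sym.
Qed.

Lemma psurf_rel_trans b a c : psurf_rel a b -> psurf_rel b c -> psurf_rel a c.
Proof.
move=> [[h1 h2]|[x [x' [h1 h2 h3]]]] [[k1 k2]|[y [y' [k1 k2 k3]]]].
- by left; rewrite h1 h2.
- by right; exists y, y'; rewrite h1 h2.
- by right; exists x, x'; rewrite -k1 -k2.
- right; exists x, y'; split => //; apply: bdrel_trans h3 _ => //.
  have [m ->] : exists m : int, x' = y + (z4 * m)%:~R by apply: arc_inj => //; rewrite -h2.
  by apply: bdrel_trans k3 => //; exact: (bdrel_shift g tau m (b.1, y)).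
Qed.

(** The points are the classes themselves, as sets. The type of sheets need not be finite: the
    construction serves both for the cover with sheets [S] and for its infinite cyclic cover with
    sheets [S * int]. *)
Definition psurf : Type := {A : set (S * C) | `[< exists a, A = psurf_rel a >]}.
HB.instance Definition _ := gen_eqMixin psurf.
HB.instance Definition _ := gen_choiceMixin psurf.

Fact psurf_cls a : `[< exists b, psurf_rel a = psurf_rel b >].
Proof. by apply/asboolP; exists a. Qed.

Definition psurf_q (s : S) (z : C) : psurf :=
  exist (fun A => is_true `[< exists a, A = psurf_rel a >]) (psurf_rel (s, z)) (psurf_cls (s, z)).

Definition psurf_open (A : set psurf) := forall s, open (psurf_q s @^-1` A).

Fact psurf_openT : psurf_open setT.
Proof. by move=> s; rewrite preimage_setT; exact: openT. Qed.

Fact psurf_openI A B : psurf_open A -> psurf_open B -> psurf_open (A `&` B).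
Proof. by move=> oA oB s; rewrite preimage_setI; exact: openI. Qed.

Fact psurf_open_bigU (I : Type) (f : I -> set psurf) :
  (forall i, psurf_open (f i)) -> psurf_open (\bigcup_i f i).
Proof. by move=> of_ s; rewrite preimage_bigcup; apply: bigcup_open => i _; exact: of_. Qed.

HB.instance Definition _ := isOpenTopological.Build psurf psurf_openT psurf_openI psurf_open_bigU.

Lemma psurf_qE s z s' z' : psurf_q s z = psurf_q s' z' <-> psurf_rel (s, z) (s', z').
Proof.
split.
  move=> /(congr1 sval) /= /(congr1 (fun A => A (s', z'))) ->; exact: psurf_relxx.
move=> h; apply: eq_exist; apply/funext => b; apply/propext; split => h'.
  exact: psurf_rel_trans (psurf_rel_sym h) h'.
exact: psurf_rel_trans h h'.
Qed.

Lemma psurfP : polysurf g tau psurf_q.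
Proof.
split.
- by move=> s; apply/continuousP => A oA; exact: oA.
- move=> [A PA]; have /asboolP[[s z] E] := PA; exists s, (ret z); split; first exact: md_ret.
  have -> : psurf_q s (ret z) = psurf_q s z.
    by apply/psurf_qE; left; rewrite /= [ret (ret z)]ret_id// md_ret.
  exact: eq_exist.
- by move=> A.
- by move=> s z; apply/psurf_qE; left; rewrite /= [ret (ret z)]ret_id// md_ret.
- by move=> s z s' z' z1 z1' /psurf_qE; rewrite /psurf_rel /= !ret_id.
- move=> s x s' x' h; apply/psurf_qE; right; exists x, x'.
  by rewrite /= !ret_id ?md_arc.
Qed.

End Sheets.

Section SheetMap.
Variables (S S' : choiceType) (tau : int -> S -> S) (tau' : int -> S' -> S').
Variables (X Y : topologicalType) (q : S -> C -> X) (q' : S' -> C -> Y).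
Hypotheses (ps : polysurf g tau q) (ps' : polysurf g tau' q').
Variable f : S -> S'.
Hypothesis ftau : forall j s, f (tau j s) = tau' j (f s).

Lemma sheet_map : exists2 p : X -> Y, continuous p & forall s z, p (q s z) = q' (f s) z.
Proof.
have [|s x|p cp pE] := descend g0 ps (F := fun s z => q' (f s) z).
- by move=> s; exact: (ps_cont ps').
- apply: (ps_glue ps') => /=; rewrite ftau.
  exact: (bdrel_nxt g tau' (f s, x)).
by exists p => // s z; rewrite (ps_ret ps) pE ?md_ret// -(ps_ret ps').
Qed.

End SheetMap.

Section Fiber.
Variables (S : choiceType) (tau : int -> S -> S).
Hypothesis tauK : forall j s, tau (iota4 j) (tau j s) = s.
Hypothesis tau_per : forall j m s, tau (j + z4 * m) s = tau j s.
Let tau1 (j : int) (u : unit) := u.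
Variables (X Y : topologicalType) (q : S -> C -> X) (q1 : unit -> C -> Y).
Hypotheses (ps : polysurf g tau q) (ps1 : polysurf g tau1 q1).
Variable p : X -> Y.
Hypothesis pE : forall s z, p (q s z) = q1 tt z.

Lemma iter_nxt_proj i s x : (iter i (nxt tau) (s, x)).2 = (iter i (nxt tau1) (tt, x)).2 :> R.
Proof. by elim: i => //= i IH; rewrite /nxt /= IH. Qed.

(** An identification in the base is a walk of [i] steps forward and [k] steps back; the same walk
    is made in the cover with [nxt] and [prv], whose second coordinates do not see the sheets. *)
Lemma bdrel_lift s x x' : bdrel g tau1 (tt, x) (tt, x') -> exists s' : S, bdrel g tau (s, x) (s', x' : R).
Proof.
move=> [i [k [m]]]; set b := shift g m (tt, x') => E.
pose c := iter k (prv tau) (iter i (nxt tau) (s, x)).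
have cE : iter k (nxt tau) c = iter i (nxt tau) (s, x).
  rewrite /c; elim: k {E c} => //= k IH.
  by rewrite -iterS iterSr (prvK tauK).
have c2 : c.2 = b.2.
  have inj : injective (nxt tau1 : unit * R -> unit * R) by apply: can_inj (nxtKp (fun=> fun=> erefl)).
  have AB : iter k (nxt tau1) (tt, c.2) = iter i (nxt tau1) (tt, x) :> unit * R.
    have := congr1 snd cE; rewrite [c in iter k _ c]surjective_pairing !iter_nxt_proj.
    by case: (iter k (nxt tau1) _) => [[] u]; case: (iter i (nxt tau1) _) => [[] v] /= ->.
  have : iter k (nxt tau1) (tt, c.2) = iter k (nxt tau1) b by rewrite AB E.
  by elim: (k) => [/(congr1 snd)//|l IH] /= /inj.
exists c.1, i, k, m; rewrite -cE; congr (iter k _ _).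
by rewrite [LHS]surjective_pairing c2.
Qed.

Lemma fiberP x z : md z <= 1 -> p x = q1 tt z -> exists s, x = q s z.
Proof.
move=> z1; have [s [w [w1 ->]]] := ps_surj ps x; rewrite pE => E.
have [[_ <-]|[y [y' [-> -> bd]]]] := ps_eq ps1 w1 z1 E; first by exists s.
have [s' bd'] := bdrel_lift s bd.
by exists s'; exact: (ps_glue ps).
Qed.

End Fiber.

Section Genus.
Open Scope quotient_scope.

Lemma ret_in_disc (z : C) : ret z \in @closed_disc R.
Proof.
by apply/mem_set; rewrite /closed_disc /= norm_md -[1]/(1%:C) lecR md_ret.
Qed.

Definition toD (z : C) : @closed_disc R := SigSub (ret_in_disc z).

Lemma toD_val z : set_val (toD z) = ret z.
Proof. by []. Qed.

Lemma continuous_toD : continuous toD.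
Proof. by apply: continuous_comp_initial; exact: continuous_ret. Qed.

Lemma disc_val_md (d : @closed_disc R) : md (set_val d) <= 1.
Proof. by have /set_mem := valP d; rewrite /closed_disc /= norm_md -[1]/(1%:C) lecR. Qed.

Lemma toDK (d : @closed_disc R) : toD (set_val d) = d.
Proof. by apply: val_inj => /=; rewrite ret_id// disc_val_md. Qed.

Local Notation GQ := (quotient_topology {eq_quot (@polygon_rel R g)}).

Definition genus_q (u : unit) (z : C) : genus_surface R g := \pi_GQ (toD z).

Let tau1 (j : int) (u : unit) := u.

Lemma iota40 (k : nat) : iota4 (4 * k)%:Z = (4 * k)%:Z + 2.
Proof. by rewrite /iota4 PoszM -[X in modz X _]addr0 mulrC modzMDl. Qed.

Lemma iota41 (k : nat) : iota4 ((4 * k)%:Z + 1) = (4 * k)%:Z + 3.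
Proof. by rewrite /iota4 PoszM mulrC modzMDl /=; ring. Qed.

(** After reduction modulo [4 * g], sides with residues 0 and 1 modulo 4 are glued by [edge_glued]
    itself; residues 2 and 3 are the same gluings read backwards, with [1 - t] for [t]. *)
Lemma genus_bd (x y : R) : bdrel g tau1 (tt, x) (tt, y) -> genus_q tt (arc x) = genus_q tt (arc y).
Proof.
have per m z : arc (z + (z4 * m)%:~R) = arc z by exact: arc_per.
have glued (z w : @closed_disc R) : edge_glued g z w -> \pi_GQ z = \pi_GQ w.
  by move=> h; apply/eqmodP; apply/asboolP; exact: rst_step.
have step (k : nat) (t : R) : (k < g)%N -> 0 <= t <= 1 ->
    (genus_q tt (arc ((4 * k)%:R + t)) = genus_q tt (arc ((4 * k + 3)%:R - t))) /\
    (genus_q tt (arc ((4 * k + 1)%:R + t)) = genus_q tt (arc ((4 * k + 4)%:R - t))).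
  by move=> kg t01; split; apply: glued; exists k, t; split => //; [left|right];
    split; rewrite toD_val ret_id ?md_arc.
move: x y; suff H (a : unit * R) : genus_q (nxt tau1 a).1 (arc (nxt tau1 a).2) = genus_q a.1 (arc a.2).
  move=> x y bd.
  apply: (bdrel_inv (Phi := fun a => genus_q a.1 (arc a.2)) _ _ bd) => //.
  by move=> m [u z] /=; rewrite per.
case: a => [[] x]; rewrite /nxt /=; set j := Num.floor x.
have /andP[h1 h2] : j%:~R <= x < j%:~R + 1 by have := floor_itv x; rewrite -/j intrD.
pose m := divz j z4; pose r := `|modz j z4|%N.
have z40 : z4 != 0 by rewrite eqz_nat -lt0n muln_gt0.
have rE : r%:Z = modz j z4 by rewrite /r gez0_abs// modz_ge0.
have jE : j = r%:Z + z4 * m by rewrite rE {1}(divz_eq j z4) addrC mulrC.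
have rg : (r < 4 * g)%N by rewrite -ltz_nat rE ltz_pmod// ltz_nat muln_gt0.
have [t t01 xE] : exists2 t : R, 0 <= t <= 1 & x = r%:R + t + (z4 * m)%:~R.
  exists (x - j%:~R); first by apply/andP; split; lra.
  by rewrite jE intrD -pmulrn; ring.
pose k := (r %/ 4)%N.
have kg : (k < g)%N by rewrite ltn_divLR// mulnC.
have [st1 st2] := step k t kg t01.
have [st3 st4] : (genus_q tt (arc ((4 * k + 2)%:R + t)) = genus_q tt (arc ((4 * k + 1)%:R - t))) /\
    (genus_q tt (arc ((4 * k + 3)%:R + t)) = genus_q tt (arc ((4 * k + 2)%:R - t))).
  have t01' : 0 <= 1 - t <= 1 by lra.
  have [s1 s2] := step k (1 - t) kg t01'; split; apply: esym.
    have -> : (4 * k + 1)%:R - t = (4 * k)%:R + (1 - t) :> R by rewrite natrD; ring.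
    by rewrite s1; apply: (congr1 (fun y => genus_q tt (arc y))); rewrite !natrD; ring.
  have -> : (4 * k + 2)%:R - t = (4 * k + 1)%:R + (1 - t) :> R by rewrite !natrD; ring.
  by rewrite s2; apply: (congr1 (fun y => genus_q tt (arc y))); rewrite !natrD; ring.
have goalE c : genus_q tt (arc ((iota4 r%:Z + 1)%:~R - t)) = genus_q tt (arc (r%:R + t)) ->
   genus_q tt (arc ((j + iota4 j + 1)%:~R - x)) = genus_q tt (arc x).
  move=> E; rewrite {2}xE per -E -(per m (_ - t)) xE jE iota4_per.
  by apply: (congr1 (fun y => genus_q tt (arc y))); rewrite !intrD -pmulrn; ring.
apply: goalE => //; have rk : r = (4 * k + r %% 4)%N by rewrite {1}(divn_eq r 4) mulnC.
have : (r %% 4 < 4)%N by rewrite ltn_mod.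
case E : (r %% 4)%N rk => [|[|[|[|//]]]] -> _.
- rewrite addn0 iota40 st1; apply: (congr1 (fun y => genus_q tt (arc y))).
  by rewrite !intrD -!pmulrn natrD; ring.
- rewrite PoszD iota41 st2; apply: (congr1 (fun y => genus_q tt (arc y))).
  by rewrite !intrD -!pmulrn natrD; ring.
- rewrite PoszD -iota40 iota4K st3; apply: (congr1 (fun y => genus_q tt (arc y))).
  by rewrite !intrD -!pmulrn natrD; ring.
- rewrite PoszD -iota41 iota4K st4; apply: (congr1 (fun y => genus_q tt (arc y))).
  by rewrite !intrD -!pmulrn !natrD; ring.
Qed.

(** This bridges the quotient of the disc by the closure of [edge_glued] and the glued polygons used
    everywhere else. *)
Lemma genus_surfaceP : polysurf g tau1 genus_q.
Proof.
have tK : forall j s, tau1 (iota4 j) (tau1 j s) = s by [].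
have tP : forall (j m : int) s, tau1 (j + z4 * m) s = tau1 j s by [].
split.
- by move=> u; apply: cts_comp; [exact: pi_continuous|exact: continuous_toD].
- move=> y; exists tt, (set_val (repr y)); split; first exact: disc_val_md.
  by rewrite /genus_q toDK reprK.
- move=> A /(_ tt) oA; rewrite /open /= /quotient_open.
  exists (genus_q tt @^-1` A) => //.
  by apply/seteqP; split => d /=; rewrite /genus_q toDK.
- move=> u z; congr (\pi_GQ _); apply: val_inj; change (ret z = ret (ret z)).
  by rewrite [RHS]ret_id ?md_ret.
- move=> [] z [] z' z1 z1' /eqmodP /asboolP.
  pose T (a b : @closed_disc R) := (set_val a = set_val b) \/
     exists x x', [/\ set_val a = arc x, set_val b = arc x' & bdrel g tau1 (tt, x) (tt, x')].
  suff HT a b : clos_refl_sym_trans _ (edge_glued g) a b -> T a b.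
    by move=> /HT; rewrite /T !toD_val !ret_id// => -[->|]; [left|right].
  elim=> {a b} [a b|a|a b _ [E|[x [x' [h1 h2 h3]]]]|a b c _ h _ h'].
  + move=> [k [t [kg t01 [[aE bE]|[aE bE]]]]]; right.
    * exists ((4 * k)%:R + t), ((4 * k + 3)%:R - t); split => //.
      apply: bdrel_sym => //; have := @bdrel_side unit tau1 tK tP tt ((4 * k)%:R + t) (4 * k)%:Z.
      rewrite -pmulrn lerDl lerD2l => /(_ t01); rewrite iota40 /=; congr (bdrel _ _ (tt, _) _).
      by rewrite !intrD -!pmulrn natrD; ring.
    * exists ((4 * k + 1)%:R + t), ((4 * k + 4)%:R - t); split => //.
      apply: bdrel_sym => //; have := @bdrel_side unit tau1 tK tP tt ((4 * k + 1)%:R + t) ((4 * k)%:Z + 1).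
      rewrite intrD -pmulrn -natrD lerDl lerD2l => /(_ t01); rewrite iota41 /=.
      congr (bdrel _ _ (tt, _) _).
      by rewrite !intrD -!pmulrn !natrD; ring.
  + by left.
  + by left; rewrite E.
  + by right; exists x', x; split => //; exact: bdrel_sym.
  + case: h h' => [E|[x [x' [h1 h2 h3]]]] [E'|[y [y' [k1 k2 k3]]]].
    * by left; rewrite E.
    * by right; exists y, y'; rewrite E.
    * by right; exists x, x'; rewrite -E'.
    * right; exists x, y'; split => //; apply: bdrel_trans h3 _ => //.
      have [m ->] : exists m : int, x' = y + (z4 * m)%:~R by apply: arc_inj => //; rewrite -h2.
      by apply: bdrel_trans k3 => //; exact: (bdrel_shift g tau1 m (tt, y)).
- by move=> [] x [] x' bd; exact: genus_bd.
Qed.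

End Genus.
End Surfaces.

(** * Moebius coordinates on half-discs at boundary points *)

Section Mobius.
Variables (R : realType) (g : nat).
Hypothesis g0 : (0 < g)%N.
Notation C := R[i].
Notation n4 := ((4 * g)%:R : R).
Notation arc := (@arc R g).

(* The Moebius map from the upper half-plane to the unit disc sending 0 to a. *)
Definition mob (a w : C) : C := a * (1 + 'i%C * w) / (1 - 'i%C * w).

Lemma mob_den (w : C) : 0 <= Im w -> 1 - 'i%C * w != 0.
Proof.
case: w => x y /= y0; apply/eqP => /(congr1 (@Re R)) /=.
by rewrite mul0r mul1r sub0r; lra.
Qed.

Lemma mobB a w : 0 <= Im w -> mob a w - a = 'i%C * w * (mob a w + a).
Proof. by move=> /mob_den d0; rewrite /mob; field. Qed.

Lemma mobD_neq0 a w : a != 0 -> 0 <= Im w -> mob a w + a != 0.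
Proof.
move=> a0 /mob_den d0; have -> : mob a w + a = 2 * a / (1 - 'i%C * w) by rewrite /mob; field.
by rewrite !mulf_neq0 ?invr_eq0// pnatr_eq0.
Qed.

Lemma md_i : md ('i%C : C) = 1.
Proof. by rewrite /md /= expr0n expr1n add0r sqrtr1. Qed.

Lemma mob_ratio a w : 0 <= Im w -> md (mob a w - a) = md w * md (mob a w + a).
Proof. by move=> w0; rewrite mobB// !mdM md_i mul1r. Qed.

(** The point is that [|1 - i w|^2 - |1 + i w|^2 = 4 Im w]. *)
Lemma mob_md a w : md a = 1 -> 0 <= Im w ->
  md (mob a w) <= 1 /\ (md (mob a w) = 1 -> Im w = 0).
Proof.
move=> a1 w0; have d0 := mob_den w0; rewrite /mob !mdM mdV a1 mul1r.
have m0 : 0 < md (1 - 'i%C * w) by rewrite md_gt0.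
have E : md (1 - 'i%C * w) ^+ 2 - md (1 + 'i%C * w) ^+ 2 = 4 * Im w.
  by rewrite !md_sqr; case: (w) => x y /=; ring.
split.
  rewrite ler_pdivrMr// mul1r -ler_sqr ?nnegrE ?md_ge0// -subr_ge0 E.
  by rewrite mulr_ge0.
move=> /(congr1 (fun u => u * md (1 - 'i%C * w))); rewrite mulfVK ?gt_eqF// mul1r => e.
by move: E; rewrite e subrr; lra.
Qed.

Lemma mob_inj a w w' : a != 0 -> 0 <= Im w -> 0 <= Im w' -> mob a w = mob a w' -> w = w'.
Proof.
move=> a0 w0 w0' E; have := mobB a w0; rewrite E mobB// => /(mulIf (mobD_neq0 a0 w0')).
have i0 : 'i%C != 0 :> C by rewrite -md_gt0 md_i.
by move/(mulfI i0).
Qed.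

Lemma mob_surj a z : md a = 1 -> md z <= 1 -> z != - a -> exists2 w, 0 <= Im w & z = mob a w.
Proof.
move=> a1 z1 za; have a0 : a != 0 by rewrite -md_gt0 a1.
have i2 : 'i%C * 'i%C = -1 :> C by rewrite -expr2 sqr_i.
have d0 : z + a != 0 by rewrite addr_eq0.
pose w := - 'i%C * ((z - a) / (z + a)); exists w.
  have : Re ((z - a) / (z + a)) <= 0.
    move: (z) (a) z1 a1 d0 => [x y] [u v] z1 a1 d0.
    have : md (Complex x y) ^+ 2 <= md (Complex u v) ^+ 2 by rewrite a1 expr1n expr_le1// md_ge0.
    rewrite !md_sqr /= => h.
    have D0 : 0 <= ((x + u) ^+ 2 + (y + v) ^+ 2)^-1 by rewrite invr_ge0 addr_ge0// sqr_ge0.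
    set D := (_)^-1 in D0 *.
    rewrite [leLHS](_ : _ = - ((u ^+ 2 + v ^+ 2 - (x ^+ 2 + y ^+ 2)) * D)); last by ring.
    by rewrite oppr_le0 mulr_ge0// subr_ge0.
  by rewrite /w; case: ((z - a) / (z + a)) => x y /=; lra.
have iw : 'i%C * w = (z - a) / (z + a) by rewrite /w mulrA mulrN i2 opprK mul1r.
rewrite /mob iw.
have -> : 1 + (z - a) / (z + a) = 2 * z / (z + a) by field.
have -> : 1 - (z - a) / (z + a) = 2 * a / (z + a) by field.
by field; rewrite d0 a0.
Qed.

(** As [(1 + i t) / (1 - i t)] has angle [2 * atan t], this is the displacement along the boundary,
    in units of sides, of the image of the real number [t] under [mob]. *)
Definition beta (t : R) : R := n4 / pi * atan t.

Lemma betaN t : beta (- t) = - beta t. Proof. by rewrite /beta atanN mulrN. Qed.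
Lemma beta0 : beta 0 = 0. Proof. by rewrite /beta atan0 mulr0. Qed.
Lemma beta_gt0 t : 0 < t -> 0 < beta t.
Proof.
move=> t0; rewrite /beta mulr_gt0 ?divr_gt0 ?pi_gt0 ?n4_gt0// -[ltLHS]atan0.
exact: lt_atan.
Qed.

Lemma beta_small (d : R) : 0 < d -> exists2 e : R, 0 < e & forall t, 0 < t < e -> beta t < d.
Proof.
move=> d0; have cb : continuous beta by apply: ctsM; [exact: cts_cst|exact: cts_atan].
have : nbhs (beta 0) [set y | y < d].
  by apply: open_nbhs_nbhs; split; [exact: open_lt|rewrite /= beta0].
move=> /(cb 0) /nbhs_ballP[e /= e0 he]; exists e => // t /andP[t0 te].
by apply: he; rewrite /ball /= sub0r normrN gtr0_norm.
Qed.

Lemma mob_real x t : mob (arc x) t%:C = arc (x + beta t).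
Proof.
rewrite arcD /mob -mulrA; congr (_ * _); have c0 : 0 < cos (atan t).
  by rewrite cos_atan invr_gt0 sqrtr_gt0 ltr_wpDr ?sqr_ge0.
rewrite [RHS](_ : _ = cis (atan t + atan t)); last first.
  rewrite /Gluing.arc /beta; congr cis; have n0 := lt0r_neq0 (n4_gt0 R g0).
  have p0 := lt0r_neq0 (pi_gt0 R).
  apply: (mulIf n0); rewrite mulfVK// -mulr2n -mulr_natl.
  move: (n4) (atan t) => n u.
  have e : n / pi * pi = n by rewrite mulfVK.
  by rewrite -[in RHS]e; move: (n / pi) => k; ring.
have E : cis (atan t) = (cos (atan t))%:C * (1 + 'i%C * t%:C).
  have st : sin (atan t) = t * cos (atan t) by rewrite -{2}[t]atanK /tan mulfVK ?gt_eqF.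
  rewrite /cis st; apply/eqP; rewrite eq_complex /=; apply/andP; split; apply/eqP; ring.
have E' : cis (- atan t) = (cos (atan t))%:C * (1 - 'i%C * t%:C).
  have st : sin (atan t) = t * cos (atan t) by rewrite -{2}[t]atanK /tan mulfVK ?gt_eqF.
  rewrite /cis cosN sinN st; apply/eqP; rewrite eq_complex /=; apply/andP; split; apply/eqP; ring.
have cn : (cos (atan t))%:C != 0 :> C by rewrite -md_gt0 mdRe normr_gt0 gt_eqF.
have d0 : 1 - 'i%C * t%:C != 0 :> C by apply: mob_den.
rewrite cisD -[X in _ = _ * X]invrK -cisN E E'.
by field; rewrite cn d0.
Qed.

(** Polar coordinates with angles measured from the negative real axis, so that [psi = pi] on one
    half-disc is glued to [psi = 0] on the next one in the order of [nxt]. *)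
Definition hpol (rho psi : R) : C := Complex (- (rho * cos psi)) (rho * sin psi).

Lemma md_hpol rho psi : 0 <= rho -> md (hpol rho psi) = rho.
Proof.
move=> r0; rewrite /md /= sqrrN !exprMn -mulrDr cos2Dsin2 mulr1 sqrtr_sqr ger0_norm//.
Qed.

Lemma Im_hpol rho psi : 0 <= rho -> 0 <= psi <= pi -> 0 <= Im (hpol rho psi).
Proof. by move=> r0 p0; rewrite mulr_ge0// sin_ge0_pi. Qed.

Lemma hpolP w : 0 <= Im w -> exists2 psi, 0 <= psi <= pi & w = hpol (md w) psi.
Proof.
move=> w0; have [->|wn] := eqVneq w 0.
  exists 0; first by rewrite lexx pi_ge0.
  by rewrite md0 /hpol !mul0r oppr0.
have m0 : 0 < md w by rewrite md_gt0.
have hR : -1 <= - (Re w / md w) <= 1.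
  by rewrite -ler_norml normrN normrM normfV (gtr0_norm m0) ler_pdivrMr// mul1r Re_le_md.
exists (acos (- (Re w / md w))); first by rewrite acos_ge0// acos_lepi.
rewrite /hpol acosK// sin_acos// sqrrN expr_div_n.
have E : (md w * Num.sqrt (1 - Re w ^+ 2 / md w ^+ 2)) = Im w.
  apply/eqP; rewrite -(@eqrXn2 _ 2) ?mulr_ge0 ?sqrtr_ge0 ?md_ge0//.
  have s0 : 0 <= 1 - Re w ^+ 2 / md w ^+ 2.
    have := md_sqr w; have m2 : 0 < md w ^+ 2 by rewrite exprn_gt0.
    rewrite subr_ge0 ler_pdivrMr// mul1r => ->; by rewrite lerDl sqr_ge0.
  have m2 : md w ^+ 2 != 0 by rewrite expf_eq0 /= gt_eqF.
  rewrite exprMn sqr_sqrtr// mulrBr mulr1 mulrCA mulfV// mulr1.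
  by rewrite md_sqr addrAC subrr add0r.
rewrite E mulrN opprK mulrCA mulfV ?gt_eqF// mulr1; by case: (w).
Qed.

End Mobius.

(** * Charts at boundary points *)

Lemma fin_eps (R : realType) (n : nat) (P : nat -> R -> Prop) :
  (forall i, (i < n)%N -> exists2 e, 0 < e & P i e) ->
  (forall i e e', 0 < e' -> e' <= e -> P i e -> P i e') ->
  exists2 e, 0 < e & forall i, (i < n)%N -> P i e.
Proof.
move=> H mono; elim: n H => [|n IH] H; first by exists 1.
have [i ni|e e0 he] := IH; first by apply: H; exact: ltnW.
have [e' e'0 he'] := H n (ltnSn n).
exists (Num.min e e'); first by rewrite lt_min e0.
move=> i; rewrite ltnS leq_eqVlt => /orP[/eqP ->|ni].
  by apply: mono he'; rewrite ?lt_min ?e0// ge_min lexx orbT.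
by apply: mono (he i ni); rewrite ?lt_min ?e0// ge_min lexx.
Qed.

Section Polar.
Variable R : realType.
Notation C := R[i].

Lemma polar (z : C) : exists2 a, 0 <= a <= 2 * pi & z = (md z)%:C * cis a.
Proof.
have [->|z0] := eqVneq z 0.
  by exists 0; rewrite ?lexx ?mulr_ge0 ?pi_ge0// md0 mul0r.
have m0 : (md z)%:C != 0 by rewrite -md_gt0 mdRe normr_gt0 md_eq0.
have z1 : md (z / (md z)%:C) = 1 by rewrite mdM mdV mdRe ger0_norm ?md_ge0// mulfV// md_eq0.
have := md_sqr (z / (md z)%:C); rewrite z1 expr1n => /esym E.
have hR : -1 <= Re (z / (md z)%:C) <= 1 by rewrite -ler_norml -z1 Re_le_md.
set w := z / _ in E hR z1.
have zE : z = (md z)%:C * w by rewrite /w mulrCA mulfV// mulr1.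
have sE : sin (acos (Re w)) = `|Im w|.
  by rewrite sin_acos// -sqrtr_sqr -E addrAC subrr add0r.
have a0 := acos_ge0 hR; have a1 := acos_lepi hR; have pi0 := pi_gt0 R.
case: (leP 0 (Im w)) => b0.
  exists (acos (Re w)); first by rewrite a0 /=; lra.
  rewrite {1}zE; congr (_ * _); rewrite /cis acosK// sE ger0_norm//; by case: (w).
exists (2 * pi - acos (Re w)); first by apply/andP; split; lra.
rewrite {1}zE; congr (_ * _); rewrite cisD cis_2pi mul1r /cis cosN sinN acosK// sE ltr0_norm//.
by rewrite opprK; case: (w).
Qed.
End Polar.

Section Nbhd.
Variables (R : realType) (g : nat).
Hypothesis g0 : (0 < g)%N.
Notation C := R[i].
Notation z4 := ((4 * g)%N%:Z).
Notation arc := (@arc R g).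
Notation beta := (@beta R g).
Variables (S : choiceType) (tau : int -> S -> S).
Hypothesis tauK : forall j s, tau (iota4 j) (tau j s) = s.
Hypothesis tau_per : forall j m s, tau (j + z4 * m) s = tau j s.
Notation nxt := (@nxt R S tau).
Notation prv := (@prv R S tau).
Notation shift := (@shift R g S).
Notation bdrel := (@bdrel R g S tau).

(** Within the displacement [beta eps] of [x] there is no corner other than possibly [x] itself, and
    the points on either side lie on the sides that [nxt] and [prv] cross. *)
Definition small (eps x : R) := forall t, 0 < t < eps ->
  [/\ Num.floor (x + beta t) = Num.floor x, Num.floor (x - beta t) = Num.ceil x - 1,
      x + beta t \isn't a Num.int & x - beta t \isn't a Num.int].

Lemma small_le eps eps' x : eps' <= eps -> small eps x -> small eps' x.
Proof. by move=> le h t /andP[t0 te]; apply: h; rewrite t0 (lt_le_trans te). Qed.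

Lemma small_ex x : exists2 eps, 0 < eps & small eps x.
Proof.
have /andP[f1 f2] := floor_itv x; have /andP[c1 c2] := ceil_itv x.
rewrite !intrD in f2 c1.
have [|e e0 he] := @beta_small R g (Num.min ((Num.floor x)%:~R + 1 - x) (x - ((Num.ceil x)%:~R - 1))).
  by rewrite lt_min; apply/andP; split; lra.
exists e => // t t0e; have := he t t0e; rewrite lt_min => /andP[b1 b2].
have /andP[t0 _] := t0e; have b0 := beta_gt0 g0 t0.
have F1 : Num.floor (x + beta t) = Num.floor x.
  by apply: floor_def; rewrite intrD; apply/andP; split; lra.
have F2 : Num.floor (x - beta t) = Num.ceil x - 1.
  by apply: floor_def; rewrite subrK intrD; apply/andP; split; lra.
split => //; rewrite intrEfloor.
  by rewrite F1 lt_eqF//; lra.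
by rewrite F2 lt_eqF// intrD; lra.
Qed.

Lemma small_nxt eps a : small eps a.2 -> small eps (nxt a).2.
Proof.
case: a => s x /= h t t0e; have [h1 h2 h3 h4] := h t t0e.
set c := (_ + _ + 1).
have fl (y : R) : Num.floor (c%:~R - y) = c - Num.ceil y.
  have := ceil_itv y; rewrite !intrD => /andP[y1 y2].
  by apply: floor_def; rewrite !intrD !intrN; apply/andP; split; lra.
have ce (y : R) : Num.ceil (c%:~R - y) = c - Num.floor y.
  have := floor_itv y; rewrite !intrD => /andP[y1 y2].
  by apply: ceil_def; rewrite !intrD !intrN; apply/andP; split; lra.
have cn (y : R) : y \isn't a Num.int -> c%:~R - y \isn't a Num.int.
  by apply: contraNN => yi; rewrite -[y](subKr c%:~R) rpredB ?intr_int.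
have e1 : c%:~R - x + beta t = c%:~R - (x - beta t) by ring.
have e2 : c%:~R - x - beta t = c%:~R - (x + beta t) by ring.
rewrite e1 e2; split.
- by rewrite fl fl ceil_floor h4 h2 subrK.
- by rewrite fl ce ceil_floor h3 h1 /=; lia.
- exact: cn.
- exact: cn.
Qed.

Variables (X : topologicalType) (q : S -> C -> X).
Hypothesis ps : polysurf g tau q.
Variables (a : S * R) (n : nat) (m0 : int) (eps : R).
Hypothesis n0 : (0 < n)%N.
Let h i := iter i nxt a.
Hypothesis hn : h n = shift m0 a.
Hypothesis h2 : forall i k m, h i = shift m (h k) -> i = k %[mod n].
Hypothesis eps0 : 0 < eps.
Hypothesis epsS : small eps a.2.
Hypothesis epsD : forall i k, arc (h i).2 != arc (h k).2 -> 4 * eps <= md (arc (h i).2 - arc (h k).2).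

Lemma epsSh i : small eps (h i).2.
Proof. by elim: i => // i IH; exact: small_nxt. Qed.

Lemma hper i : h (i + n) = shift m0 (h i).
Proof. by rewrite /h iterD -/(h n) hn iter_nxt_shift. Qed.

Lemma hmod i : exists m, h i = shift m (h (i %% n)).
Proof.
rewrite {1}(divn_eq i n); elim: (i %/ n)%N => [|l [m IH]].
  by exists 0; rewrite mul0n add0n shift0.
by exists (m0 + m); rewrite mulSn -addnA addnC hper IH shiftD.
Qed.

Lemma bd_h i : bdrel (h i) a.
Proof. by exists 0%N, i, 0; rewrite shift0. Qed.

Definition th (i : nat) (psi : R) : R := 2 / n%:R * (psi + pi * i%:R).

Lemma nR0 : n%:R != 0 :> R. Proof. by rewrite pnatr_eq0 -lt0n. Qed.

Lemma cis_thper i l psi : cis (th (l * n + i) psi) = cis (th i psi) :> C.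
Proof.
have -> : th (l * n + i) psi = th i psi + 2 * pi * l%:R.
  rewrite /th natrD natrM; have e : n%:R / n%:R = 1 :> R by rewrite mulfV// nR0.
  rewrite [LHS](_ : _ = 2 / n%:R * (psi + pi * i%:R) + 2 * pi * l%:R * (n%:R / n%:R)); last by ring.
  by rewrite e mulr1.
by rewrite cisD cis2pin mulr1.
Qed.

Lemma cis_thmod i k psi : i = k %[mod n] -> cis (th i psi) = cis (th k psi) :> C.
Proof. by move=> E; rewrite (divn_eq i n) (divn_eq k n) !cis_thper E. Qed.

Lemma th_pi i : th i pi = th i.+1 0.
Proof. by rewrite /th add0r -[i.+1]addn1 natrD; ring. Qed.

(** Disc coordinate of a boundary point displaced by [beta t] from the centre, seen in sector [i]:
    the two sides at the centre become the two rays that bound the sector. *)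
Definition bc (i : nat) (t : R) : C :=
  if 0 <= t then t%:C * cis (th i pi) else (- t)%:C * cis (th i 0).

Definition Gb (b : S * R) (c : C) := exists i m t,
  [/\ `|t| < eps, b = shift m ((h i).1, (h i).2 + beta t) & c = bc i t].

Lemma nxt_right i t : 0 <= t < eps ->
  nxt ((h i).1, (h i).2 + beta t) = ((h i.+1).1, (h i.+1).2 - beta t).
Proof.
move=> /andP[t0 te]; have E : Num.floor ((h i).2 + beta t) = Num.floor (h i).2.
  move: t0; rewrite le_eqVlt => /orP[/eqP <-|t0]; first by rewrite beta0 addr0.
  by have [|->] := @epsSh i t; first by rewrite t0.
by rewrite /Gluing.nxt /= E; congr pair; rewrite /Gluing.nxt; ring.
Qed.

Lemma nxt_left i t : 0 < t < eps ->
  nxt ((h i).1, (h i).2 - beta t) = ((prv (h i)).1, (prv (h i)).2 + beta t).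
Proof.
move=> te; have [_ E _ _] := @epsSh i t te.
by rewrite /Gluing.nxt /= E; congr pair; rewrite /Gluing.prv; ring.
Qed.

Lemma prv_h i : exists k m, prv (h i) = shift m (h k) /\ k.+1 = i %[mod n].
Proof.
case: i => [|i]; last by exists i, 0; rewrite shift0 /h /= nxtKp.
case: (n) n0 hn => // n' _ E; exists n', (- m0); split; last by rewrite modnn mod0n.
have -> : h 0 = shift (- m0) (h n'.+1) by rewrite E shiftD addNr shift0.
by rewrite prv_shift //= /h /= nxtKp.
Qed.

Lemma Gb_shift m b c : Gb b c -> Gb (shift m b) c.
Proof. by move=> [i [m' [t [te -> ->]]]]; exists i, (m + m'), t; rewrite shiftD. Qed.

(** Crossing a side passes from the last ray of a sector to the first ray of the next one, or back;
    these rays coincide, so the disc coordinate is unchanged. *)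
Lemma Gb_nxt b c : Gb b c -> Gb (nxt b) c.
Proof.
move=> [i [m [t [te -> ->]]]]; rewrite nxt_shift//; apply: Gb_shift.
case: (ltgtP t 0) te => [t0|t0|->] te.
- have te' : 0 < - t < eps by rewrite oppr_gt0 t0 -(ltr0_norm t0).
  have -> : (h i).2 + beta t = (h i).2 - beta (- t) by rewrite betaN opprK.
  rewrite nxt_left//; have [k [m' [-> ki]]] := prv_h i.
  exists k, m', (- t); split; first by rewrite normrN.
    by rewrite /Gluing.shift /= addrAC.
  by rewrite /bc oppr_ge0 (ltW t0) leNgt t0 /= th_pi (cis_thmod 0 ki).
- have te' : 0 <= t < eps by rewrite ltW//= -(gtr0_norm t0).
  rewrite nxt_right//; exists i.+1, 0, (- t); split; first by rewrite normrN.
    by rewrite shift0 betaN.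
  by rewrite /bc (ltW t0) oppr_ge0 leNgt t0 /= opprK th_pi.
- rewrite beta0 addr0 -surjective_pairing; exists i.+1, 0, 0; split => //.
    by rewrite shift0 beta0 addr0 -surjective_pairing.
  by rewrite /bc lexx !mul0r.
Qed.

Lemma Gb_nxtV b c : Gb (nxt b) c -> Gb b c.
Proof.
move=> G; case: (boolP (b.2 \is a Num.int)) => bi; last by rewrite -[b](nxtK tauK bi); exact: Gb_nxt.
have nb : (nxt b).2 \is a Num.int by rewrite nxt_int.
case: G => i [m [t [te E ->]]].
have t0 : t = 0.
  apply/eqP; apply: contraT => tn; move: nb; rewrite E /Gluing.shift /=.
  rewrite rpredDr ?intr_int//; case: (ltgtP t 0) tn te => // t0 _ te.
    have [|_ _ _] := @epsSh i (- t); first by rewrite oppr_gt0 t0 -(ltr0_norm t0).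
    by rewrite betaN opprK => /negPf ->.
  by have [|_ _ /negPf ->] := @epsSh i t; first by rewrite t0 -(gtr0_norm t0).
rewrite t0 beta0 addr0 -surjective_pairing in E.
rewrite -[b](nxtKp tauK) E prv_shift//; apply: Gb_shift.
have [k [m' [-> _]]] := prv_h i; exists k, m', 0; split => //; first by rewrite normr0.
  by rewrite beta0 addr0 -surjective_pairing.
by rewrite t0 /bc lexx !mul0r.
Qed.

Lemma Gb_bdrel b b' c : bdrel b b' -> Gb b c -> Gb b' c.
Proof.
move=> bb'; have -> // : Gb b = Gb b'.
apply: (bdrel_inv (Phi := Gb) _ _ bb').
  by move=> d; apply/funext => e; apply/propext; split; [exact: Gb_nxtV|exact: Gb_nxt].
move=> m d; apply/funext => e; apply/propext; split; last exact: Gb_shift.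
by move=> /(Gb_shift (- m)); rewrite shiftD addNr shift0.
Qed.

(* Half-disc coordinates z around a boundary point are fitted into a disc with coordinate c: the
   n half-discs met around the point become sectors of angle 2 pi / n. *)
Definition Gamz (s : S) (z : C) (c : C) := exists i rho psi,
  [/\ 0 <= rho < eps, 0 <= psi <= pi, s = (h i).1, z = mob (arc (h i).2) (hpol rho psi)
    & c = rho%:C * cis (th i psi)].

Lemma hpol0 rho : hpol rho 0 = (- rho)%:C :> C.
Proof. by rewrite /hpol cos0 sin0 mulr1 mulr0. Qed.
Lemma hpolpi rho : hpol rho pi = rho%:C :> C.
Proof. by rewrite /hpol cospi sinpi mulrN1 opprK mulr0. Qed.

(** A boundary point has a real half-plane coordinate, hence lies on one of the two rays or at the
    centre. *)
Lemma Gamz_Gb s x c : Gamz s (arc x) c -> Gb (s, x) c.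
Proof.
move=> [i [rho [psi [/andP[r0 re] p0 -> E ->]]]].
have I0 : Im (hpol rho psi) = 0.
  by apply: (mob_md (md_arc g (h i).2) (Im_hpol r0 p0)).2; rewrite -E md_arc.
have key t : hpol rho psi = t%:C -> exists m, x = (h i).2 + beta t + (z4 * m)%:~R.
  by move=> e; move: E; rewrite e mob_real// => /(arc_inj g0).
move: r0; rewrite le_eqVlt => /orP[/eqP r0|r0].
  have [|m xE] := key 0; first by rewrite -r0 /hpol !mul0r oppr0.
  by exists i, m, 0; split; [rewrite normr0|rewrite xE|rewrite -r0 /bc lexx !mul0r].
have : psi = 0 \/ psi = pi.
  move: I0 => /= /eqP; rewrite mulf_eq0 gt_eqF//= => /eqP s0.
  case/andP: p0; rewrite !le_eqVlt => /orP[/eqP <-|p0] /orP[/eqP ->|p1]; [by left|by left|by right|].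
  by have := sin_gt0_pi (x := psi); rewrite p0 p1 s0 ltxx => /(_ isT).
case=> pE; rewrite pE in key *.
  have [|m xE] := key (- rho); first by rewrite hpol0.
  exists i, m, (- rho); split; [by rewrite normrN gtr0_norm|by rewrite xE|].
  by rewrite /bc oppr_ge0 leNgt r0 /= opprK.
have [|m xE] := key rho; first by rewrite hpolpi.
exists i, m, rho; split; [by rewrite gtr0_norm|by rewrite xE|].
by rewrite /bc (ltW r0).
Qed.

Lemma Gb_Gamz s x c : Gb (s, x) c -> Gamz s (arc x) c.
Proof.
move=> [i [m [t [te [-> ->] ->]]]]; rewrite arc_per//.
have pi0 := pi_ge0 R.
case: (leP 0 t) te => t0 te; rewrite /bc ?t0 ?leNgt ?t0 /=.
  exists i, t, pi; split => //; first by rewrite t0 -(ger0_norm t0).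
    by rewrite pi0 lexx.
  by rewrite hpolpi mob_real.
exists i, (- t), 0; split => //; first by rewrite oppr_ge0 ltW// -(ltr0_norm t0).
  by rewrite lexx pi0.
by rewrite hpol0 opprK mob_real.
Qed.

Lemma Gamz_md s z c : Gamz s z c -> md z <= 1.
Proof.
move=> [i [rho [psi [/andP[r0 _] p0 _ -> _]]]].
exact: (mob_md (md_arc g _) (Im_hpol r0 p0)).1.
Qed.

Lemma Gamz_sat s z s' z' c : md z' <= 1 -> q s z = q s' z' -> Gamz s z c -> Gamz s' z' c.
Proof.
move=> z1' E G; have z1 := Gamz_md G.
have [[<- <-]//|[x [x' [zx zx' bd]]]] := ps_eq ps z1 z1' E.
rewrite zx'; apply: Gb_Gamz; apply: Gb_bdrel bd _; apply: Gamz_Gb.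
by rewrite -zx.
Qed.

Lemma Gamz_near s z c : Gamz s z c -> exists i, s = (h i).1 /\
  md (z - arc (h i).2) <= 2 * md c /\ md (z - arc (h i).2) = md c * md (z + arc (h i).2).
Proof.
move=> G; have z1 := Gamz_md G.
case: G => i [rho [psi [/andP[r0 re] p0 -> zE ->]]]; exists i; split => //.
have -> : md (rho%:C * cis (th i psi)) = rho by rewrite mdM md_cis mulr1 mdRe ger0_norm.
have := mob_ratio (arc (h i).2) (Im_hpol r0 p0); rewrite -zE md_hpol// => E.
split => //; rewrite E mulrC ler_wpM2r//.
by rewrite (le_trans (mdD _ _))// md_arc -[2]/(1 + 1) lerD2r.
Qed.

(** A point with coordinate [c] is within [2 * md c] of the centre of its half-disc. Centres are at
    least [4 * eps] apart, so the centre, then the sector modulo [n], and then the polar coordinates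
    are determined. *)
Lemma Gamz_fun s z c c' : Gamz s z c -> Gamz s z c' -> c = c'.
Proof.
move=> [i [r [p [/andP[r0 re] p0 sE zE ->]]]] [k [r' [p' [/andP[r0' re'] p0' sE' zE' ->]]]].
have [aE|aE] := eqVneq (arc (h i).2) (arc (h k).2); last first.
  have := epsD aE; rewrite leNgt => /negP; case.
  have e1 := mob_ratio (arc (h i).2) (Im_hpol r0 p0).
  have e2 := mob_ratio (arc (h k).2) (Im_hpol r0' p0').
  have z1 : md z <= 1 by rewrite zE; exact: (mob_md (md_arc g _) (Im_hpol r0 p0)).1.
  rewrite -zE md_hpol// in e1; rewrite -zE' md_hpol// in e2.
  have m2 b : md (z + arc b) <= 2.
    by rewrite (le_trans (mdD _ _))// md_arc -[2]/(1 + 1) lerD2r.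
  have -> : arc (h i).2 - arc (h k).2 = (z - arc (h k).2) - (z - arc (h i).2) by ring.
  rewrite (le_lt_trans (mdD _ _))// mdN e1 e2.
  have b1 := m2 (h i).2; have b2 := m2 (h k).2; have b3 := md_ge0 (z + arc (h i).2).
  have b4 := md_ge0 (z + arc (h k).2).
  by nra.
have [m mE] := arc_inj g0 aE.
have ik : i = k %[mod n].
  by apply: (h2 (m := m)); rewrite [LHS]surjective_pairing mE -sE sE'.
have a0 := arc_neq0 g (h k).2 : arc (h k).2 != 0.
have : hpol r p = hpol r' p'.
  by apply: (mob_inj a0); rewrite ?Im_hpol// -zE' -aE -zE.
move=> hE; have rE : r = r' by rewrite -(md_hpol p r0) hE md_hpol.
rewrite -rE in hE *; move: r0; rewrite le_eqVlt => /orP[/eqP <-|r0]; first by rewrite !mul0r.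
have pE : p = p'.
  case: hE => /oppr_inj; have rn : r != 0 by rewrite gt_eqF.
  move=> /(mulfI rn) cE _.
  by rewrite -(cosK (x := p)) ?in_itv //= cE cosK// in_itv.
by rewrite pE (cis_thmod _ ik).
Qed.

Lemma Gamz_mod s z c : Gamz s z c -> exists i rho psi,
  [/\ (i < n)%N, 0 <= rho < eps, 0 <= psi <= pi, s = (h i).1 &
      z = mob (arc (h i).2) (hpol rho psi) /\ c = rho%:C * cis (th i psi)].
Proof.
move=> [i [rho [psi [re p0 -> -> ->]]]]; exists (i %% n)%N, rho, psi.
have [m ->] := hmod i; split => //; first by rewrite ltn_mod.
split; first by rewrite /= arc_per.
by rewrite (cis_thmod (k := (i %% n)%N)) ?modn_mod.
Qed.

(** Equal angles modulo a full turn mean the same sector, two neighbouring sectors along their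
    common ray, or the seam between the last sector and the first. *)
Lemma Gamz_inj s z s' z' c : Gamz s z c -> Gamz s' z' c -> q s z = q s' z'.
Proof.
move=> /Gamz_mod[i [r [p [il /andP[r0 re] /andP[p0 p1] -> [-> cE]]]]].
move=> /Gamz_mod[k [r' [p' [kl /andP[r0' re'] /andP[p0' p1'] -> [-> cE']]]]].
have rE : r = r'.
  have := congr1 (@md R) cE'; rewrite cE !mdM !md_cis !mulr1 !mdRe !ger0_norm//.
move: r0' re' cE'; rewrite -rE cE => {r' rE} _ _ cE'.
have pi0 := pi_gt0 R.
have glue b b' : bdrel b b' -> q b.1 (arc b.2) = q b'.1 (arc b'.2).
  by move=> bd; apply: (ps_glue ps); rewrite -!surjective_pairing.
have step j : q (h j).1 (mob (arc (h j).2) (hpol r pi)) = q (h j.+1).1 (mob (arc (h j.+1).2) (hpol r 0)).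
  rewrite hpolpi hpol0 !mob_real// betaN.
  have E := @nxt_right j r; rewrite r0 re in E.
  have := glue _ _ (bdrel_nxt g tau ((h j).1, (h j).2 + beta r)).
  by rewrite E//= => ->.
move: r0; rewrite le_eqVlt => /orP[/eqP r0|r0].
  have e0 ps' : hpol r ps' = 0%:C :> C by rewrite -r0 /hpol !mul0r oppr0.
  rewrite !e0 !mob_real// beta0 !addr0; apply: glue.
  by apply: bdrel_trans (bd_h i) _ => //; apply: bdrel_sym => //; exact: bd_h.
have rn : r%:C != 0 :> C by rewrite -md_gt0 mdRe normr_gt0 gt_eqF.
have {cE'} tE : cis (th i p) = cis (th k p') :> C by apply: (mulfI rn).
wlog le : i p k p' il kl p0 p1 p0' p1' tE {cE} / th i p <= th k p'.
  move=> H; case: (leP (th i p) (th k p')) => le; first exact: H.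
  by apply: esym; apply: H => //; exact: ltW.
have nn0 : 0 < n%:R :> R by rewrite ltr0n.
have th0 j p'' : 0 <= p'' -> 0 <= th j p''.
  by move=> ?; rewrite /th mulr_ge0 ?divr_ge0 ?ler0n// addr_ge0// mulr_ge0 ?ler0n// ltW.
have thS j p'' : p'' <= pi -> th j p'' <= 2 * pi * j.+1%:R / n%:R.
  move=> ?; rewrite /th [leRHS](_ : _ = 2 / n%:R * (pi + pi * j%:R)).
    by rewrite ler_wpM2l ?divr_ge0 ?ler0n// lerD2r.
  by rewrite -[j.+1]addn1 natrD; ring.
have th2 j p'' : (j < n)%N -> p'' <= pi -> th j p'' <= 2 * pi.
  move=> jn /(thS j)/le_trans; apply; rewrite ler_pdivrMr//.
  by rewrite ler_pM2l ?mulr_gt0// ler_nat.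
have inv j p'' j' p3 : th j p'' = th j' p3 -> p'' + pi * j%:R = p3 + pi * j'%:R.
  by apply: mulfI; rewrite mulf_neq0 ?invr_eq0 ?nR0// pnatr_eq0.
case: (ltP (th k p' - th i p) (2 * pi)) => lt.
  have E : th i p = th k p'.
    by apply: cis_inj => //; rewrite ler0_norm ?subr_le0// opprB.
  have {}E := inv _ _ _ _ E.
  case: (ltngtP i k) => ik.
  - have ik' : i%:R + 1 <= k%:R :> R by rewrite natr1 ler_nat.
    have pk : pi * (i%:R + 1) <= pi * k%:R :> R by rewrite ler_pM2l.
    have pE : p = pi by lra.
    have pE' : p' = 0 by lra.
    have kE : k = i.+1.
      apply/eqP; rewrite eq_sym eqn_leq ik /= -(ler_nat R) -natr1 -(ler_pM2l pi0); lra.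
    by rewrite pE pE' kE step.
  - have ik' : k%:R + 1 <= i%:R :> R by rewrite natr1 ler_nat.
    have pk : pi * (k%:R + 1) <= pi * i%:R :> R by rewrite ler_pM2l.
    have pE : p' = pi by lra.
    have pE' : p = 0 by lra.
    have kE : i = k.+1.
      apply/eqP; rewrite eq_sym eqn_leq ik /= -(ler_nat R) -natr1 -(ler_pM2l pi0); lra.
    by rewrite pE pE' kE step.
  - by rewrite ik in E *; have -> : p = p' by lra.
(* The angles differ by a full turn, so they are 0 and [2 * pi]: this is the seam, closed by the
   period [hn]. *)
have t1 := th0 i p p0; have t2 := th2 k p' kl p1'.
have i0 : th i p = th 0 0 by rewrite {2}/th mulr0 addr0 mulr0; lra.
have {}i0 := inv _ _ _ _ i0.
have kn : th k p' = th n 0.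
  rewrite {2}/th add0r mulrCA divfK ?nR0//; lra.
have {}kn := inv _ _ _ _ kn.
have i00 : i = 0%N.
  apply/eqP; rewrite -leqn0 -(ler_nat R) -(ler_pM2l pi0); lra.
rewrite i00 in i0 *; have p00 : p = 0 by lra.
have kn' : n = k.+1.
  apply/eqP; rewrite eqn_leq kl andbT -(ler_nat R) -natr1 -(ler_pM2l pi0); lra.
have pE : p' = pi.
  move: kn; rewrite kn' -natr1; lra.
rewrite p00 pE step -kn' hn /=; congr (q _ (mob _ _)).
by rewrite arc_per.
Qed.

Lemma Gamz_surj c : md c < eps -> exists s z, Gamz s z c.
Proof.
move=> ce; have [al /andP[a0 a2] cE] := polar c.
have pi0 := pi_gt0 R; have nn0 : 0 < n%:R :> R by rewrite ltr0n.
have : exists i psi, [/\ 0 <= psi <= pi & th i psi = al].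
  pose u := n%:R * al / 2; have u0 : 0 <= u by rewrite divr_ge0// mulr_ge0 ?ler0n.
  pose i := Num.truncn (u / pi).
  have /andP[h3 h4] : i%:R <= u / pi < i.+1%:R by apply: truncn_itv; rewrite divr_ge0// ltW.
  rewrite ler_pdivlMr// in h3; rewrite ltr_pdivrMr// -natr1 mulrDl mul1r in h4.
  exists i, (u - pi * i%:R); split; first by apply/andP; split; lra.
  rewrite /th subrK /u; have e : n%:R / n%:R = 1 :> R by rewrite mulfV// nR0.
  by rewrite [LHS](_ : _ = (n%:R / n%:R) * al) ?e ?mul1r//; field; rewrite nR0.
move=> [i [psi [p0 pE]]]; exists (h i).1, (mob (arc (h i).2) (hpol (md c) psi)).
by exists i, (md c), psi; split => //; [rewrite md_ge0|rewrite pE].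
Qed.

Definition Nb (r : R) : set X := [set y | exists s z c, [/\ Gamz s z c, md c < r & y = q s z]].

(** By [mob_ratio] the trace of [Nb r] near each centre [a] is given by the Apollonius inequality
    [|z - a| < r * |z + a|], which is open. *)
Lemma Nb_open r : 0 < r -> r <= eps -> open (Nb r).
Proof.
move=> r0 re; apply: (ps_open ps) => s.
have -> : q s @^-1` Nb r = \bigcup_(i in [set i | s = (h i).1])
   [set z | md (ret z - arc (h i).2) < r * md (ret z + arc (h i).2)].
  apply/seteqP; split => z.
    move=> [s' [z' [c [G cr E]]]].
    have G' : Gamz s (ret z) c by apply: Gamz_sat G; rewrite ?md_ret// -(ps_ret ps).
    have [i [sE [_ zE]]] := Gamz_near G'; exists i => //=; rewrite zE ltr_pM2r// md_gt0.
    apply/eqP => z0; move: zE; rewrite z0 md0 mulr0 => /eqP; rewrite md_eq0 subr_eq0 => /eqP z1.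
    move: z0; rewrite z1 -mulr2n -mulr_natl => /eqP; rewrite mulf_eq0 pnatr_eq0 /=.
    by rewrite (negPf (arc_neq0 _ _)).
  move=> [i /= sE zr]; exists s, (ret z).
  have [|w w0 zE] := @mob_surj R (arc (h i).2) (ret z) (md_arc _ _) (md_ret z).
    apply/eqP => zE; move: zr; rewrite {2}zE addNr md0 mulr0.
    by rewrite ltNge md_ge0.
  have [psi p0 wE] := hpolP w0.
  have wr : md w < r.
    move: zr; rewrite {1}zE mob_ratio// -zE.
    have d0 : 0 < md (ret z + arc (h i).2) by rewrite md_gt0 zE mobD_neq0// arc_neq0.
    by rewrite ltr_pM2r.
  exists ((md w)%:C * cis (th i psi)); split.
  - by exists i, (md w), psi; split => //; rewrite ?md_ge0 ?(lt_le_trans wr)// -wE.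
  - by rewrite mdM md_cis mulr1 mdRe ger0_norm// md_ge0.
  - exact: (ps_ret ps).
apply: bigcup_open => i _.
pose f z := r * md (ret z + arc (h i).2) - md (ret z - arc (h i).2).
have cf : continuous f.
  apply: ctsB.
    apply: ctsM; first exact: cts_cst.
    by apply: cts_md; apply: ctsD; [exact: continuous_ret|exact: cts_cst].
  by apply: cts_md; apply: ctsB; [exact: continuous_ret|exact: cts_cst].
have -> : [set z | md (ret z - arc (h i).2) < r * md (ret z + arc (h i).2)] = f @^-1` [set x | 0 < x].
  by apply/seteqP; split => z /=; rewrite /f subr_gt0.
by apply: open_comp; [move=> z _; exact: cf|exact: open_gt].
Qed.

Lemma Nb_center r : 0 < r -> Nb r (q a.1 (arc a.2)).
Proof.
move=> r0; exists a.1, (arc a.2), 0; split; [|by rewrite md0|by []].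
exists 0%N, 0, 0; split => //; rewrite ?lexx ?eps0 ?pi_ge0//; last by rewrite mul0r.
by rewrite hpol0 oppr0 mob_real// beta0 addr0.
Qed.

End Nbhd.

(** * Orbits of boundary points, and the Hausdorff property *)

Section OrbitData.
Variables (R : realType) (g : nat).
Hypothesis g0 : (0 < g)%N.
Notation C := R[i].
Notation z4 := ((4 * g)%N%:Z).
Notation arc := (@arc R g).
Let tau1 (j : int) (u : unit) := u.

(** Turning around the vertex visits the corners in the order 0, 3, 2, 1, 4, 7, 6, 5, 8, ...; this
    is the position of corner [j] in that order. It shows that all corners of the polygon form one
    orbit. *)
Definition corner_idx (j : int) : int :=
  if modz j 4 == 0 then j else j + 4 - 2 * modz j 4.

Lemma corner_idxD j k : corner_idx (j + 4 * k) = corner_idx j + 4 * k.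
Proof.
rewrite /corner_idx; have -> : modz (j + 4 * k) 4 = modz j 4.
  by rewrite addrC mulrC modzMDl.
by case: ifP => _; ring.
Qed.

Lemma corner_idx_next j : corner_idx (iota4 j + 1) = corner_idx j + 1.
Proof.
rewrite (divz_eq j 4); move: (modz_ge0 j (isT : 4 != 0 :> int)) (ltz_pmod j (isT : 0 < 4 :> int)).
set d := divz j 4; case: (modz j 4) => // r _ r4.
have -> : iota4 (d * 4 + r) + 1 = iota4 r + 1 + 4 * d.
  rewrite /iota4 modzMDl; case: ifP => _; ring.
have -> : d * 4 + r = r%:Z + 4 * d by ring.
rewrite !corner_idxD addrAC; congr (_ + _).
by case: r r4 => [|[|[|[|r]]]].
Qed.

Definition cstep (j : int) : int := iota4 j + 1.

Lemma iter_nxt_corner (S : choiceType) (tau : int -> S -> S) (s : S) (j : int) i :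
  iter i (nxt tau) (s, j%:~R) =
  ((iter i (nxt tau) (s, j%:~R : R)).1, (iter i cstep j)%:~R) :> S * R.
Proof.
elim: i => //= i IH; rewrite IH /nxt /= intrKfloor; congr pair.
by rewrite /cstep !intrD; ring.
Qed.

Lemma iter_cstep4 l j : iter (4 * l) cstep j = j + (4 * l)%N%:Z.
Proof.
have f4 k : cstep (cstep (cstep (cstep k))) = k + 4.
  rewrite (divz_eq k 4); move: (modz_ge0 k (isT : 4 != 0 :> int)) (ltz_pmod k (isT : 0 < 4 :> int)).
  set d := divz k 4; case: (modz k 4) => // r _ r4.
  have fd u : cstep (d * 4 + u) = d * 4 + cstep u.
    rewrite /cstep /iota4 modzMDl; case: ifP => _; ring.
  rewrite !fd -addrA; congr (_ + _).
  by case: r r4 => [|[|[|[|r]]]].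
elim: l => [|l IH]; first by rewrite muln0 addr0.
by rewrite mulnS iterD IH /= f4 PoszD; ring.
Qed.

(** The period is [4 * g] at a corner, where [corner_idx] counts the steps, and 2 inside a side,
    where [nxt] is an involution that never amounts to a full turn because [iota4 j - j] is 2 or
    -2. *)
Lemma base_period (x : R) : exists (n1 : nat) (m1 : int), [/\ (0 < n1)%N,
  iter n1 (nxt tau1) (tt, x) = shift g m1 (tt, x) &
  forall i k m, iter i (nxt tau1) (tt, x) = shift g m (iter k (nxt tau1) (tt, x)) ->
    i = k %[mod n1]].
Proof.
have tK : forall j s, tau1 (iota4 j) (tau1 j s) = s by [].
have z40 : z4 != 0 by rewrite eqz_nat -lt0n muln_gt0.
case: (boolP (x \is a Num.int)) => [/intrP[j ->]|xn].
  have fE i : iter i (nxt tau1) (tt, j%:~R) = (tt, (iter i cstep j)%:~R) :> unit * R.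
    by rewrite iter_nxt_corner; case: (iter _ _ _) => -[].
  have idx i : corner_idx (iter i cstep j) = corner_idx j + i%:Z.
    elim: i => [|i IH]; first by rewrite addr0.
    by rewrite /= /cstep corner_idx_next IH -[i.+1]addn1 PoszD; ring.
  exists (4 * g)%N, 1; split; first by rewrite muln_gt0.
    by rewrite fE iter_cstep4 /shift /= mulr1 intrD.
  move=> i k m; rewrite !fE /shift /= => -[] /eqP; rewrite -intrD eqr_int => /eqP E.
  have := congr1 corner_idx E; rewrite idx PoszM -mulrA corner_idxD idx => E2.
  have E3 : i%:Z = k%:Z + (4 * g)%N%:Z * m by rewrite PoszM; lia.
  by apply/eqP; rewrite -eqz_nat -!modz_nat E3 addrC mulrC modzMDl.
exists 2%N, 0; split => //; first by rewrite shift0 /= (nxtK tK).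
have it i : iter i (nxt tau1) (tt, x) = if odd i then nxt tau1 (tt, x) else (tt, x) :> unit * R.
  by elim: i => //= i ->; case: (odd i) => //=; rewrite (nxtK tK).
have ne m : nxt tau1 (tt, x) <> shift g m (tt, x).
  move=> [] E; have : Num.floor ((Num.floor x + iota4 (Num.floor x) + 1)%:~R - x) = iota4 (Num.floor x).
    have := floor_itv x; rewrite intrD => /andP[f1 f2].
    have fx : (Num.floor x)%:~R != x by rewrite -intrEfloor.
    apply: floor_def; rewrite !intrD; apply/andP; split; first by lra.
    by have : (Num.floor x)%:~R < x; [rewrite lt_def eq_sym fx|lra].
  rewrite E floorDrz ?intr_int// intrKfloor.
  have -> : z4 * m = 4 * (g%:Z * m) by rewrite PoszM mulrA.
  move: (g%:Z * m) (Num.floor x) => w j.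
  by rewrite /iota4; case: ifP => _ /(congr1 (fun y => y - j)); rewrite ![_ + _ - j]addrAC subrr !add0r; lia.
move=> i k m; rewrite !it !modn2.
case: (odd i) (odd k) => -[] //.
  by move=> /ne.
move=> /(congr1 (shift g (- m))); rewrite shiftD addNr shift0 => /esym.
by move=> /ne.
Qed.

(** The positions in an orbit do not depend on the sheets, so one [eps] serves the base and all its
    covers; the charts of a cover and of the base then have matching radii. *)
Lemma eps_ex (x : R) : exists eps, [/\ 0 < eps, small g eps x &
  forall (S : choiceType) (tau : int -> S -> S) (s : S) i k,
    arc (iter i (nxt tau) (s, x)).2 != arc (iter k (nxt tau) (s, x)).2 ->
    4 * eps <= md (arc (iter i (nxt tau) (s, x)).2 - arc (iter k (nxt tau) (s, x)).2)].
Proof.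
have tP : forall (j m : int) s, tau1 (j + z4 * m) s = tau1 j s by [].
have [n1 [m1 [n10 per _]]] := base_period x.
pose u i := arc (iter i (nxt tau1) (tt, x)).2.
have um i : u i = u (i %% n1)%N.
  rewrite /u {1}(divn_eq i n1); elim: (i %/ n1)%N => [|l IH]; first by rewrite mul0n add0n.
  by rewrite mulSn -addnA addnC iterD per (iter_nxt_shift tP) /= arc_per.
have [e1 e10 s1] := small_ex g0 x.
have [e2 e20 h2] : exists2 e, 0 < e & forall i, (i < n1)%N ->
    forall k, (k < n1)%N -> u i != u k -> 4 * e <= md (u i - u k).
  apply: (@fin_eps R n1 (fun i e => forall k, (k < n1)%N -> u i != u k -> 4 * e <= md (u i - u k))).
    move=> i _.
    apply: (@fin_eps R n1 (fun k e => u i != u k -> 4 * e <= md (u i - u k))).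
      move=> k _; have [->|ik] := eqVneq (u i) (u k); first by exists 1.
      exists (md (u i - u k) / 4); first by rewrite divr_gt0// md_gt0 subr_eq0.
      by move=> _; rewrite mulrCA mulfV ?mulr1// pnatr_eq0.
    by move=> k e e' e0 ee' h ne; apply: le_trans (h ne); rewrite ler_pM2l.
  by move=> i e e' e0 ee' h k kn ne; apply: le_trans (h k kn ne); rewrite ler_pM2l.
exists (Num.min e1 e2); split; first by rewrite lt_min e10.
  by apply: small_le s1; rewrite ge_min lexx.
move=> S tau s i k; rewrite !(iter_nxt_proj (S := S)) -/(u i) -/(u k) um (um k) => ne.
apply: le_trans (h2 _ _ _ _ ne); rewrite ?ltn_mod// ler_pM2l// ge_min lexx orbT//.
Qed.

Section Fin.
Variables (S : finType) (tau : int -> S -> S).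
Hypothesis tauK : forall j s, tau (iota4 j) (tau j s) = s.
Hypothesis tau_per : forall j m s, tau (j + z4 * m) s = tau j s.
Notation nxt := (@nxt R S tau).
Notation shift := (@shift R g S).

(** Going once around the point downstairs permutes the sheets; [k] is the length of the cycle of
    [s] under this permutation. *)
Lemma orbit_period (x : R) (n1 : nat) (m1 : int) (s : S) : (0 < n1)%N ->
  iter n1 (Gluing.nxt tau1) (tt, x) = Gluing.shift g m1 (tt, x) ->
  (forall i k m, iter i (Gluing.nxt tau1) (tt, x) = Gluing.shift g m (iter k (Gluing.nxt tau1) (tt, x)) ->
    i = k %[mod n1]) ->
  exists (k : nat), [/\ (0 < k)%N,
   iter (k * n1) nxt (s, x) = shift (k%:Z * m1) (s, x),
   (forall i l m, iter i nxt (s, x) = shift m (iter l nxt (s, x)) -> i = l %[mod k * n1]) &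
   forall j, (0 < j)%N -> (exists m, iter (j * n1) nxt (s, x) = shift m (s, x)) -> (k <= j)%N].
Proof.
move=> n10 per dist.
pose sg (s : S) := (iter n1 nxt (s, x)).1.
have sE s' : iter n1 nxt (s', x) = shift m1 (sg s', x).
  by rewrite [LHS]surjective_pairing (iter_nxt_proj tau) per.
have sEk k s' : iter (k * n1) nxt (s', x) = shift (k%:Z * m1) (iter k sg s', x).
  elim: k => [|k IH]; first by rewrite mul0n mul0r shift0.
  rewrite mulSn iterD IH iter_nxt_shift// sE shiftD /=.
  by rewrite -[k.+1]addn1 PoszD mulrDl mul1r addrC.
have nI : injective nxt by exact: can_inj (nxtKp tauK).
have itI i : injective (iter i nxt) by elim: i => [|i IH] a b //= /nI/IH.
have sI : injective sg.
  move=> s1 s2 E; have : iter n1 nxt (s1, x) = iter n1 nxt (s2, x) by rewrite !sE E.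
  by move=> /itI[].
have kdvd l : iter l sg s = s -> (fingraph.order sg s %| l)%N.
  move=> ls; rewrite /dvdn; apply/eqP; set k := fingraph.order sg s.
  have lk : iter (l %% k) sg s = s.
    rewrite -[RHS]ls [in RHS](divn_eq l k) addnC iterD; congr (iter _ _ _).
    elim: (l %/ k)%N => // u IH; rewrite mulSn addnC iterD (iter_order sI) -IH//.
  have := findex_iter (f := sg) (x := s) (i := (l %% k)%N).
  rewrite lk findex0 => <- //; rewrite ltn_mod; exact: order_gt0.
exists (fingraph.order sg s); split.
- exact: order_gt0.
- by rewrite sEk (iter_order sI).
- suff H i l m : (l <= i)%N -> iter i nxt (s, x) = shift m (iter l nxt (s, x)) ->
      i = l %[mod fingraph.order sg s * n1].
    move=> i l m E; case: (leqP l i) => li; first exact: H E.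
    apply: esym; apply: (H _ _ (- m)); first exact: ltnW.
    by rewrite E shiftD addNr shift0.
  move=> li E.
  have E1 : iter i (Gluing.nxt tau1) (tt, x) = Gluing.shift g m (iter l (Gluing.nxt tau1) (tt, x)).
    have := congr1 snd E; rewrite /Gluing.shift /= !(iter_nxt_proj tau).
    by case: (iter i _ (tt, x)) => -[] u; case: (iter l _ (tt, x)) => -[] v /= ->.
  have /eqP := dist _ _ _ E1; rewrite eqn_mod_dvd// => /dvdnP[d dE].
  have iE : i = (l + d * n1)%N by rewrite -dE subnKC.
  apply/eqP; rewrite eqn_mod_dvd// dE dvdn_pmul2r//; apply: kdvd.
  move: E; rewrite iE iterD -iter_nxt_shift// => /itI; rewrite sEk.
  by move=> [].
- move=> j j0 [m]; rewrite sEk => -[sj _]; exact: dvdn_leq (kdvd _ sj).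
Qed.

Variables (X : topologicalType) (q : S -> C -> X).
Hypothesis ps : polysurf g tau q.

Lemma bd_or_int (y : X) : (exists s z, md z < 1 /\ y = q s z) \/ (exists s x, y = q s (arc x)).
Proof.
have [s [z [z1 ->]]] := ps_surj ps y.
move: z1; rewrite le_eqVlt => /orP[/eqP/(arc_surj g0)[x ->]|z1]; first by right; exists s, x.
by left; exists s, z.
Qed.

Lemma int_eq s z s' z' : md z < 1 -> md z' <= 1 -> q s z = q s' z' -> s = s' /\ z = z'.
Proof.
move=> z1 z1' E; have [//|[x [x' [zE _ _]]]] := ps_eq ps (ltW z1) z1' E.
by move: z1; rewrite zE md_arc ltxx.
Qed.

(** The separating function is a bump at [z] inside the sheet [s], extended by 0; it vanishes on the
    boundary by the triangle inequality. *)
Lemma int_sep s z y : md z < 1 -> q s z != y ->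
  exists2 f : X -> R, continuous f & f (q s z) != f y.
Proof.
move=> z1 ne; pose F (s' : S) (z' : C) : R :=
  if s' == s then Num.max 0 (1 - md z - md (z' - z)) else 0.
have F0 s' x : F s' (arc x) = 0.
  rewrite /F; case: ifP => // _; apply/eqP; rewrite eq_le le_max lexx andbT ge_max lexx /=.
  by rewrite subr_le0 lerBlDr -(md_arc g x) (le_trans _ (mdD _ _))// subrK.
have [||f cf fE] := descend g0 ps (F := F).
- move=> s'; rewrite /F /=; case: (s' == s); last exact: cts_cst.
  apply: cts_max; first exact: cts_cst.
  apply: ctsB; first exact: cts_cst.
  by apply: cts_md; apply: ctsB; [exact: cts_id|exact: cts_cst].
- by move=> s' x; rewrite !F0.
exists f => //; rewrite fE ?(ltW z1)// /F eqxx subrr md0 subr0.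
have [s' [z' [z1' yE]]] := ps_surj ps y; rewrite yE fE//.
have e0 : 0 < 1 - md z by rewrite subr_gt0.
rewrite (max_idPr (ltW e0)) gt_eqF// /F; case: ifP => // /eqP s'E.
rewrite gt_max e0 ltrBlDr ltrDl md_gt0 subr_eq0; apply: contraNneq ne => zE.
by rewrite yE s'E zE.
Qed.

(** Interior points are separated by a bump function. For two boundary points, neighbourhoods [Nb]
    of a radius below a quarter of the distance between distinct positions of their orbits can meet
    only if the two points are identified. *)
Lemma ps_hausdorff : hausdorff_space X.
Proof.
rewrite open_hausdorff => y y' ne.
match goal with |- ?G => have fsep (f : X -> R) : continuous f -> f y != f y' -> G end.
  move=> cf fne; have := @Rhausdorff R; rewrite open_hausdorff => /(_ _ _ fne).
  move=> [[A B] /= [Ay By] [oA oB AB]]; exists (f @^-1` A, f @^-1` B) => /=.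
    by split; apply/mem_set => /=; apply: set_mem.
  split; [by apply: open_comp => // z _; exact: cf|by apply: open_comp => // z _; exact: cf|].
  by rewrite -preimage_setI (eqP AB) preimage_set0.
have [[s [z [z1 yE]]]|[s [x yE]]] := bd_or_int y.
  have /(int_sep z1)[f cf fne] : q s z != y' by rewrite -yE.
  by apply: (fsep f) => //; rewrite yE.
have [[s' [z' [z1 yE']]]|[s' [x' yE']]] := bd_or_int y'.
  have /(int_sep z1)[f cf fne] : q s' z' != y by rewrite -yE' eq_sym.
  by apply: (fsep f) => //; rewrite eq_sym yE'.
have [n1 [m1 [n10 per dist]]] := base_period x.
have [n1' [m1' [n10' per' dist']]] := base_period x'.
have [k [k0 kper kdist _]] := orbit_period s n10 per dist.
have [k' [k0' kper' kdist' _]] := orbit_period s' n10' per' dist'.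
have [e [e0 es ed]] := eps_ex x.
have [e' [e0' es' ed']] := eps_ex x'.
pose a i := iter i nxt (s, x); pose b i := iter i nxt (s', x').
have [r0 r00 r0P] : exists2 r : R, 0 < r & forall i, (i < k * n1)%N ->
    forall l, (l < k' * n1')%N -> arc (a i).2 != arc (b l).2 -> 4 * r <= md (arc (a i).2 - arc (b l).2).
  apply: (@fin_eps R _ (fun i r => forall l, (l < k' * n1')%N -> arc (a i).2 != arc (b l).2 ->
     4 * r <= md (arc (a i).2 - arc (b l).2))).
    move=> i _; apply: (@fin_eps R _ (fun l r => arc (a i).2 != arc (b l).2 ->
     4 * r <= md (arc (a i).2 - arc (b l).2))).
      move=> l _; have [->|il] := eqVneq (arc (a i).2) (arc (b l).2); first by exists 1.
      exists (md (arc (a i).2 - arc (b l).2) / 4); first by rewrite divr_gt0// md_gt0 subr_eq0.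
      by move=> _; rewrite mulrCA mulfV ?mulr1// pnatr_eq0.
    by move=> l u v v0 uv h nel; apply: le_trans (h nel); rewrite ler_pM2l.
  by move=> i u v v0 uv h l ln nel; apply: le_trans (h l ln nel); rewrite ler_pM2l.
pose r := Num.min r0 (Num.min e e').
have r_0 : 0 < r by rewrite !lt_min r00 e0.
have re : r <= e by rewrite !ge_min lexx orbT.
have re' : r <= e' by rewrite !ge_min lexx !orbT.
have rr : r <= r0 by rewrite !ge_min lexx.
have kn0 : (0 < k * n1)%N by rewrite muln_gt0 k0.
have kn0' : (0 < k' * n1')%N by rewrite muln_gt0 k0'.
exists (Nb g tau q (s, x) (k * n1) e r, Nb g tau q (s', x') (k' * n1') e' r) => /=.
  by split; apply/mem_set; rewrite ?yE ?yE'; exact: Nb_center.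
split.
- exact: (Nb_open g0 tauK tau_per ps kn0 kper e0 es).
- exact: (Nb_open g0 tauK tau_per ps kn0' kper' e0' es').
apply/eqP/seteqP; split => // w [[s1 [z1 [c1 [G1 c1r wE]]]] [s2 [z2 [c2 [G2 c2r wE']]]]].
have G2' := Gamz_sat g0 tauK tau_per ps kn0' kper' e0' es' (Gamz_md G1) (etrans (esym wE') wE) G2.
have [i [i1 [i2 _]]] := Gamz_near G1; have [l [l1 [l2 _]]] := Gamz_near G2'.
have [u uE] := hmod tau_per kper i; have [v vE] := hmod tau_per kper' l.
have E : arc (a i).2 = arc (b l).2.
  apply/eqP; apply: contraT => il; move: (il).
  rewrite /a /b uE vE /= !arc_per// => /r0P; rewrite !ltn_mod => /(_ kn0 kn0') h.
  have E1 : arc (iter i nxt (s, x)).2 = arc (a (i %% (k * n1))%N).2 by rewrite uE /= arc_per.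
  have E2 : arc (iter l nxt (s', x')).2 = arc (b (l %% (k' * n1'))%N).2 by rewrite vE /= arc_per.
  move: h; rewrite -/(a _) -/(b _) -E1 -E2.
  have -> : arc (iter i nxt (s, x)).2 - arc (iter l nxt (s', x')).2 =
    (z1 - arc (iter l nxt (s', x')).2) - (z1 - arc (iter i nxt (s, x)).2) by ring.
  move=> h; have := le_trans h (mdD _ _); rewrite mdN; lra.
have [m mE] := arc_inj g0 E.
move: ne; rewrite yE yE' => /negP; apply; apply/eqP; apply: (ps_glue ps).
have abl : a i = shift m (b l) by rewrite [LHS]surjective_pairing mE -i1 l1.
apply: (bdrel_trans tau_per (b := a i)).
  by apply: bdrel_sym => //; exact: (bd_h g tau (s, x) i).
rewrite abl; apply: (bdrel_trans tau_per (b := b l)); first exact: bdrel_shift.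
exact: (bd_h g tau (s', x') l).
Qed.

End Fin.
End OrbitData.

(** * Branched coverings of glued polygons *)

Arguments ps_cont {R g S tau Y q} p s : rename.

Section Om.
Variable R : realType.
Notation C := R[i].

(** This homeomorphism of the plane with the open unit disc keeps arguments and makes [md (om k z)]
    equal to [md (om 1 (z ^+ k))]: the power map reads [rho * u |-> rho * u ^+ k] on the discs,
    without change of radius. *)
Definition om (k : nat) (t : C) : C := t * (md t ^+ k.-1 / (1 + md t ^+ k))%:C.

Lemma om_den k (t : C) : 0 < 1 + md t ^+ k.
Proof. by rewrite ltr_pwDl// exprn_ge0// md_ge0. Qed.

Lemma om0 k : om k 0 = 0. Proof. by rewrite /om mul0r. Qed.

Lemma md_om k t : (0 < k)%N -> md (om k t) = md t ^+ k / (1 + md t ^+ k).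
Proof.
move=> k0; rewrite /om mdM mdRe ger0_norm; first by rewrite mulrA -exprS prednK.
by rewrite divr_ge0 ?exprn_ge0 ?md_ge0// ltW// om_den.
Qed.

Lemma ratio_lt (u v : R) : 0 <= u -> 0 <= v -> (u / (1 + u) < v / (1 + v)) = (u < v).
Proof.
move=> u0 v0; have u1 : 0 < 1 + u by rewrite ltr_pwDl.
have v1 : 0 < 1 + v by rewrite ltr_pwDl.
rewrite ltr_pdivrMr// mulrAC ltr_pdivlMr//; apply/idP/idP; nra.
Qed.

Lemma md_om_lt1 k t : (0 < k)%N -> md (om k t) < 1.
Proof. by move=> k0; rewrite md_om// ltr_pdivrMr ?om_den// mul1r ltrDr. Qed.

Lemma om_inj k : (0 < k)%N -> injective (om k).
Proof.
move=> k0 t t' E; have := congr1 (@md R) E; rewrite !md_om// => E2.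
have p0 (u : C) : 0 <= md u ^+ k by rewrite exprn_ge0 ?md_ge0.
have E3 : md t ^+ k = md t' ^+ k.
  by apply/eqP; rewrite eq_le !leNgt -(ratio_lt (p0 t) (p0 t')) -(ratio_lt (p0 t') (p0 t)) E2 ltxx.
have E4 : md t = md t' by apply: (pexpIrn k0); rewrite ?nnegrE ?md_ge0.
move: E; rewrite /om E4; have [t0|t0] := eqVneq t' 0.
  by move: E4; rewrite t0 md0 => /eqP; rewrite md_eq0 => /eqP ->.
apply: mulIf; rewrite -md_gt0 mdRe normr_gt0 mulf_neq0 ?invr_eq0 ?expf_neq0 ?md_eq0//.
by rewrite gt_eqF// om_den.
Qed.

Lemma om_surj k c : (0 < k)%N -> md c < 1 -> exists t, c = om k t.
Proof.
move=> k0 c1; have [->|c0] := eqVneq c 0; first by exists 0; rewrite om0.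
pose r := md c; have r0 : 0 < r by rewrite md_gt0.
pose x := r / (1 - r); have x0 : 0 < x by rewrite divr_gt0// subr_gt0.
pose rho := x `^ (k%:R^-1); have rho0 : 0 < rho by rewrite powR_gt0.
have rk : rho ^+ k = x.
  by rewrite /rho -powR_mulrn ?powR_ge0// -powRrM mulVf ?pnatr_eq0 -?lt0n// powRr1// ltW.
have mdt : md (c * (rho / r)%:C) = rho.
  by rewrite mdM mdRe ger0_norm ?divr_ge0 1?ltW// mulrC divfK// gt_eqF.
exists (c * (rho / r)%:C); rewrite /om mdt -mulrA -[LHS]mulr1; congr (c * _).
rewrite -rmorphM /= -[1]/(1%:C); congr (_%:C).
rewrite mulf_div -exprS prednK// rk /x; have := c1; rewrite -/r => c1'.
have h1 : 1 - r != 0 by rewrite subr_eq0 gt_eqF.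
have h2 : r != 0 by rewrite gt_eqF.
by field; rewrite h2 h1 /= addrNK oner_neq0.
Qed.

Lemma continuous_om k : continuous (om k).
Proof.
apply: ctsM; first exact: cts_id.
apply: cts_toC; apply: ctsM; first by apply: ctsX; apply: cts_md; exact: cts_id.
apply: ctsV; first by apply: ctsD; [exact: cts_cst|apply: ctsX; apply: cts_md; exact: cts_id].
by move=> t; rewrite gt_eqF// om_den.
Qed.

Lemma om_pow k (z : C) : (0 < k)%N ->
  exists (u : C), [/\ md u = 1, om k z = (md (om k z))%:C * u & om 1 (z ^+ k) = (md (om k z))%:C * u ^+ k].
Proof.
move=> k0; have [->|z0] := eqVneq z 0.
  exists 1; rewrite md1 expr0n gtn_eqF// !om0 md0 !mul0r; split => //.
pose u := z / (md z)%:C.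
have m0 : md z != 0 by rewrite md_eq0.
have mC : (md z)%:C != 0 :> C by rewrite -md_gt0 mdRe normr_gt0.
have zu : z = (md z)%:C * u by rewrite /u mulrCA mulfV// mulr1.
exists u; split.
- by rewrite /u mdM mdV mdRe ger0_norm ?md_ge0// mulfV.
- rewrite md_om// {1}/om {1}zu mulrAC -rmorphM; congr (_%:C * _).
  by rewrite /= mulrA -exprS prednK.
- rewrite md_om// /om mdX expr1 expr0 {1}zu exprMn -rmorphXn mulrAC -rmorphM /=.
  by rewrite mul1r.
Qed.

End Om.

Section Charts.
Variables (R : realType) (g : nat).
Hypothesis g0 : (0 < g)%N.
Notation C := R[i].
Notation z4 := ((4 * g)%N%:Z).
Notation arc := (@arc R g).

Section OneSurface.
Variables (S : finType) (tau : int -> S -> S).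
Hypothesis tauK : forall j s, tau (iota4 j) (tau j s) = s.
Hypothesis tau_per : forall j m s, tau (j + z4 * m) s = tau j s.
Notation nxt := (@nxt R S tau).
Notation shift := (@shift R g S).
Variables (X : topologicalType) (q : S -> C -> X).
Hypothesis ps : polysurf g tau q.

(** Clamping to the closed upper half-plane makes [mob] continuous on the whole plane. *)
Definition upper (w : C) : C := (Re w)%:C + 'i%C * (Num.max 0 (Im w))%:C.

Lemma upper_id w : 0 <= Im w -> upper w = w.
Proof. by case: w => x y /= y0; rewrite /upper /= (max_idPr y0); apply/eqP; rewrite eq_complex /=; apply/andP; split; apply/eqP; ring. Qed.

Lemma Im_upper w : 0 <= Im (upper w).
Proof.
rewrite [Im _](_ : _ = Num.max 0 (Im w)) ?le_max ?lexx//.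
by case: w => x y; rewrite /upper /=; ring.
Qed.

(** The exponent [k] of the radial coordinate is free: 1 in the base and the branching index
    upstairs. The chart is given by choices of representatives, and it is continuous by
    [compact_lift] applied to the [n] closed sectors. *)
Lemma chart_ex (a : S * R) (n : nat) (m0 : int) (eps : R) (k : nat) :
  (0 < n)%N -> iter n nxt a = shift m0 a ->
  (forall i k m, iter i nxt a = shift m (iter k nxt a) -> i = k %[mod n]) ->
  0 < eps -> small g eps a.2 ->
  (forall i k, arc (iter i nxt a).2 != arc (iter k nxt a).2 ->
    4 * eps <= md (arc (iter i nxt a).2 - arc (iter k nxt a).2)) -> (0 < k)%N ->
  exists phi : C -> X, [/\ open_embedding phi,
    (forall t s z, Gamz g tau a n eps s z ((eps / 2)%:C * om k t) -> phi t = q s z) &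
    range phi = Nb g tau q a n eps (eps / 2)].
Proof.
move=> n0 hn h2 eps0 epsS epsD k0.
have e2 : 0 < eps / 2 by rewrite divr_gt0.
have e2e : eps / 2 < eps by rewrite ltr_pdivrMr// mulr_natr mulr2n ltrDr.
pose w t : C := (eps / 2)%:C * om k t.
have mw t : md (w t) = eps / 2 * md (om k t) by rewrite mdM mdRe gtr0_norm.
have we t : md (w t) < eps / 2 by rewrite mw -[ltRHS]mulr1 ltr_pM2l// md_om_lt1.
have wee t : md (w t) < eps by exact: lt_trans (we t) e2e.
have [|f fP] := @choice _ _ (fun t (sz : S * C) => Gamz g tau a n eps sz.1 sz.2 (w t)).
  move=> t; have [s [z G]] := Gamz_surj g tau a n0 (wee t).
  by exists (s, z).
pose phi t := q (f t).1 (f t).2.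
have phiE t s z : Gamz g tau a n eps s z (w t) -> phi t = q s z.
  by move=> G; exact: (Gamz_inj g0 tau_per ps n0 hn epsS (fP t) G).
have w_inj t t' : w t = w t' -> t = t'.
  by move/mulfI => /(_ _)/(om_inj k0); apply; rewrite -md_gt0 mdRe normr_gt0 gt_eqF.
have hX := ps_hausdorff g0 tauK tau_per ps.
have phi_inj : injective phi.
  move=> t t' E; apply: w_inj.
  have G' := Gamz_sat g0 tauK tau_per ps n0 hn eps0 epsS (Gamz_md (fP t)) (esym E) (fP t').
  exact: (Gamz_fun g0 n0 h2 epsD (fP t) G').
have phi_img r : 0 < r -> phi @` [set z | md z < r] = Nb g tau q a n eps (eps / 2 * (r ^+ k / (1 + r ^+ k))).
  move=> r0; apply/seteqP; split => y.
    move=> [t tr <-]; exists (f t).1, (f t).2, (w t); split => //.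
    by rewrite mw ltr_pM2l// md_om// ratio_lt ?exprn_ge0 ?md_ge0 ?(ltW r0)// ltr_pXn2r// ?nnegrE ?md_ge0 ?ltW.
  move=> [s [z [c [G cr ->]]]].
  have [t tE] : exists t, c = w t.
    have [|t tE] := @om_surj R k (c / (eps / 2)%:C) k0.
      rewrite mdM mdV mdRe gtr0_norm// ltr_pdivrMr// mul1r (lt_le_trans cr)//.
      rewrite -[leRHS]mulr1 ler_pM2l// ler_pdivrMr ?ltr_pwDl ?exprn_ge0 ?(ltW r0)//.
      by rewrite mul1r lerDr.
    exists t; rewrite /w -tE mulrCA mulfV ?mulr1// -md_gt0 mdRe normr_gt0 gt_eqF//.
  exists t; last by apply: phiE; rewrite -tE.
  move: cr; rewrite tE mw ltr_pM2l// md_om// ratio_lt ?exprn_ge0 ?md_ge0 ?(ltW r0)//.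
  by rewrite ltr_pXn2r// ?nnegrE ?md_ge0 ?ltW.
have cphi : continuous phi.
  pose K (i : 'I_n) : set (R * R) := `[0, eps / 2]%classic `*` `[0, pi]%classic.
  pose Phi (i : 'I_n) (u : R * R) : C := u.1%:C * cis (th n i u.2).
  pose G (i : 'I_n) (u : R * R) : X :=
    q (iter i nxt a).1 (mob (arc (iter i nxt a).2) (upper (hpol u.1 u.2))).
  have KG i u : K i u -> Gamz g tau a n eps (iter i nxt a).1
      (mob (arc (iter i nxt a).2) (upper (hpol u.1 u.2))) (Phi i u).
    move=> [] /=; rewrite !in_itv /= => /andP[u1 u1'] u2.
    exists i, u.1, u.2; split => //; first by rewrite u1 (le_lt_trans u1').
    by rewrite upper_id// Im_hpol.
  apply: (@compact_lift _ C X _ _ K Phi G w phi).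
  - exact: norm_hausdorff.
  - by move=> i; apply: compact_setX; exact: segment_compact.
  - move=> i; apply: ctsM; first by apply: cts_toC; exact: cts_fst.
    apply: cts_cis; apply: ctsM; first exact: cts_cst.
    by apply: ctsD; [exact: cts_snd|exact: cts_cst].
  - move=> i; apply: continuous_subspaceT.
    apply: (cts_comp (f := fun u : R * R => mob (arc (iter i nxt a).2) (upper (hpol u.1 u.2))) (ps_cont ps _)).
    have cu : continuous (fun u : R * R => upper (hpol u.1 u.2)).
      have ch : continuous (fun u : R * R => hpol u.1 u.2).
        have -> : (fun u : R * R => hpol u.1 u.2) =
            (fun u : R * R => (- (u.1 * cos u.2))%:C + 'i%C * (u.1 * sin u.2)%:C).
          by apply/funext => u; rewrite /hpol; apply/eqP; rewrite eq_complex /=; apply/andP; split; apply/eqP; ring.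
        apply: ctsD.
          apply: cts_toC; apply: ctsN; apply: ctsM; first exact: cts_fst.
          by apply: (cts_comp _ (@cts_snd _ _)); exact: continuous_cos.
        apply: ctsM; first exact: cts_cst.
        apply: cts_toC; apply: ctsM; first exact: cts_fst.
        by apply: (cts_comp _ (@cts_snd _ _)); exact: continuous_sin.
      apply: ctsD; first by apply: cts_toC; apply: cts_Re.
      apply: ctsM; first exact: cts_cst.
      by apply: cts_toC; apply: cts_max; [exact: cts_cst|exact: cts_Im].
    have ciu : continuous (fun u : R * R => 'i%C * upper (hpol u.1 u.2)).
      by apply: ctsM; [exact: cts_cst|exact: cu].
    apply: ctsM; first apply: ctsM.
    + exact: cts_cst.
    + by apply: ctsD; [exact: cts_cst|exact: ciu].
    + apply: ctsV; first by apply: ctsB; [exact: cts_cst|exact: ciu].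
      by move=> u; apply: mob_den; exact: Im_upper.
  - move=> i u i' u' /KG G1 /KG G2 E; rewrite -E in G2.
    exact: (Gamz_inj g0 tau_per ps n0 hn epsS G1 G2).
  - by apply: ctsM; [exact: cts_cst|exact: continuous_om].
  - move=> t; have [i [rho [psi [il /andP[r0 re] p0 sE [zE cE]]]]] := Gamz_mod g0 tau_per n0 hn (fP t).
    have rE : rho = md (w t) by rewrite cE mdM md_cis mulr1 mdRe ger0_norm.
    exists (Ordinal il), (rho, psi); split => //.
      by split => /=; rewrite in_itv /= ?r0// rE ltW.
    by rewrite /G /phi sE zE upper_id// Im_hpol.
exists phi; split => //.
  apply: open_embeddingP => // r r0; rewrite phi_img//.
  apply: (Nb_open g0 tauK tau_per ps n0 hn eps0 epsS).
    by rewrite mulr_gt0// divr_gt0 ?exprn_gt0// ltr_pwDl// exprn_ge0// ltW.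
  apply: ltW; apply: le_lt_trans e2e; rewrite -[leRHS]mulr1 ler_pM2l// ler_pdivrMr ?ltr_pwDl ?exprn_ge0 ?(ltW r0)//.
  by rewrite mul1r lerDr.
apply/seteqP; split => y.
  by move=> [t _ <-]; exists (f t).1, (f t).2, (w t); split.
move=> [s [z [c [G cr ->]]]].
have [|t tE] := @om_surj R k (c / (eps / 2)%:C) k0.
  by rewrite mdM mdV mdRe gtr0_norm// ltr_pdivrMr// mul1r.
exists t => //; apply: phiE; rewrite /w -tE mulrCA mulfV ?mulr1// -md_gt0 mdRe normr_gt0 gt_eqF//.
Qed.

Definition disc_chart (z0 : C) (t : C) : C := z0 + (1 - md z0)%:C * om 1 t.

Lemma disc_chart_lt z0 t : md z0 < 1 -> md (disc_chart z0 t) < 1.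
Proof.
move=> z1; have d0 : 0 < 1 - md z0 by rewrite subr_gt0.
rewrite /disc_chart (le_lt_trans (mdD _ _))// -ltrBrDl mdM mdRe gtr0_norm//.
by rewrite -[ltRHS]mulr1 ltr_pM2l// md_om_lt1.
Qed.

Lemma int_chart s z0 : md z0 < 1 -> open_embedding (fun t => q s (disc_chart z0 t)).
Proof.
move=> z1; have d0 : 0 < 1 - md z0 by rewrite subr_gt0.
have dC : (1 - md z0)%:C != 0 :> C by rewrite -md_gt0 mdRe normr_gt0 gt_eqF.
have lt1 t := disc_chart_lt t z1.
apply: open_embeddingP.
- exact: (ps_hausdorff g0 tauK tau_per ps).
- apply: (cts_comp (f := disc_chart z0) (ps_cont ps s)); apply: ctsD; first exact: cts_cst.
  by apply: ctsM; [exact: cts_cst|exact: continuous_om].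
- by move=> t t' /(int_eq ps (lt1 t) (ltW (lt1 t')))[_ /addrI/(mulfI dC)/(om_inj (ltnSn 0))].
- move=> r r0; apply: (ps_open ps) => s'; have [sE|ne] := eqVneq s' s.
    pose dl := (1 - md z0) * (r / (1 + r)).
    have -> : q s' @^-1` ((fun t => q s (disc_chart z0 t)) @` [set z | md z < r]) =
      [set z | md (ret z - z0) < dl].
      have key t : (md ((1 - md z0)%:C * om 1 t) < dl) = (md t < r).
        by rewrite mdM mdRe gtr0_norm// ltr_pM2l// md_om// expr1 ratio_lt ?md_ge0// ltW.
      apply/seteqP; split => z /=.
        move=> [t tr E]; have [_ <-] := int_eq ps (lt1 t) (md_ret z) (etrans E (ps_ret ps _ _)).
        by rewrite /disc_chart addrAC subrr add0r key.
      move=> zd; have [|t tE] := @om_surj R 1 ((ret z - z0) / (1 - md z0)%:C) isT.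
        rewrite mdM mdV mdRe gtr0_norm// ltr_pdivrMr// mul1r (lt_le_trans zd)//.
        rewrite /dl -[leRHS]mulr1 ler_pM2l// ler_pdivrMr ?ltr_pwDl ?(ltW r0)//.
        by rewrite mul1r lerDr.
      have zE : (1 - md z0)%:C * om 1 t = ret z - z0 by rewrite -tE mulrCA mulfV ?mulr1.
      exists t; first by rewrite -key zE.
      by rewrite /disc_chart zE addrC subrK -(ps_ret ps) sE.
    have cf : continuous (fun z => md (ret z - z0)).
      by apply: cts_md; apply: ctsB; [exact: continuous_ret|exact: cts_cst].
    apply: (open_comp (f := fun z => md (ret z - z0)) (D := [set x | x < dl])); last exact: open_lt.
    by move=> z _; exact: cf.
  rewrite (_ : _ @^-1` _ = set0); first exact: open0.
  apply/seteqP; split => // z [t tr E].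
  have [sE _] := int_eq ps (lt1 t) (md_ret z) (etrans E (ps_ret ps _ _)).
  by move: ne; rewrite sE eqxx.
Qed.

Lemma ps_closed_surface : closed_surface R X.
Proof.
split.
- by apply: (ps_compact ps); exact: finite_finset.
- exact: (ps_hausdorff g0 tauK tau_per ps).
move=> y; have [[s [z [z1 ->]]]|[s [x ->]]] := bd_or_int g0 ps y.
  exists (fun t => q s (disc_chart z t)); split; first exact: int_chart.
  by rewrite /disc_chart om0 mulr0 addr0.
have [n1 [m1 [n10 per dist]]] := base_period g0 x.
have [k [k0 kper kdist _]] := orbit_period tauK tau_per s n10 per dist.
have [e [e0 es ed]] := eps_ex g0 x.
have kn0 : (0 < k * n1)%N by rewrite muln_gt0 k0.
have [phi [ophi phiE _]] := chart_ex kn0 kper kdist e0 es (ed _ _ _) (ltn0Sn 0).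
exists phi; split => //; apply: phiE; rewrite om0 mulr0.
exists 0%N, 0, 0; split => //; rewrite ?lexx ?e0 ?pi_ge0//; last by rewrite mul0r.
by rewrite hpol0 oppr0 mob_real// beta0 addr0.
Qed.

Definition act (w : seq int) (s : S) : S := foldl (fun s j => tau j s) s w.

(** A clopen set contains a sheet as soon as it meets it, along radii, and then contains every sheet
    that shares a corner with it. *)
Lemma ps_connected (s0 : S) : (forall s, exists w, s = act w s0) -> connected_space X.
Proof.
move=> tr; split; first by exists (q s0 0).
move=> B [y0 By0] [U oU BU] [V ctsV BV]; rewrite setTI in BU; rewrite setTI in BV.
have const (f : R -> X) t : continuous f -> B (f 0) <-> B (f t).
  move=> cf; have cts_id : connected `[Num.min 0 t, Num.max 0 t] by exact: segment_connected.
  pose D := `[Num.min 0 t, Num.max 0 t]%classic `&` (f @^-1` B).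
  have D0 : (D !=set0) -> D = `[Num.min 0 t, Num.max 0 t]%classic.
    move=> ne; apply: cts_id => //.
      exists (f @^-1` B) => //; rewrite BU; apply: open_comp => // u _; exact: cf.
    by exists (f @^-1` B) => //; rewrite BV; apply: closed_comp => // u _; exact: cf.
  have i0 : `[Num.min 0 t, Num.max 0 t]%classic 0 by rewrite /= in_itv /= ge_min lexx le_max lexx.
  have it : `[Num.min 0 t, Num.max 0 t]%classic t by rewrite /= in_itv /= ge_min lexx le_max lexx !orbT.
  split=> h.
    have : D t by rewrite D0//; exists 0; split.
    by case.
  have : D 0 by rewrite D0//; exists t; split.
  by case.
have const1 s z : B (q s 0) <-> B (q s z).
  have := const (fun u => q s (u%:C * z)) 1; rewrite mul0r mul1r; apply.
  by apply: (cts_comp (f := fun u : R => u%:C * z) (ps_cont ps s)); apply: ctsM; [apply: cts_toC; exact: cts_id|exact: cts_cst].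
have step s j : B (q s 0) <-> B (q (tau j s) 0).
  have E : q s (arc j%:~R) = q (tau j s) (arc ((iota4 j + 1)%:~R)).
    apply: (ps_glue ps); have := bdrel_nxt g tau (s, j%:~R : R).
    rewrite /Gluing.nxt /= intrKfloor => /(bdrel_sym tau_per).
    by congr bdrel; congr pair; rewrite !intrD; ring.
  by rewrite (const1 s (arc j%:~R)) E -const1.
have allB s : B (q s0 0) <-> B (q s 0).
  have [w ->] := tr s; elim: w s0 {tr} => //= j w IH s1.
  by rewrite (step s1 j); exact: IH.
have [s [z [_ yE]]] := ps_surj ps y0.
apply/seteqP; split => // y _; have [s' [z' [_ ->]]] := ps_surj ps y.
by apply/const1/(allB s')/(allB s)/(const1 s z); rewrite -yE.
Qed.

End OneSurface.
End Charts.

Section Cover.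
Variables (R : realType) (g : nat).
Hypothesis g0 : (0 < g)%N.
Notation C := R[i].
Notation z4 := ((4 * g)%N%:Z).
Notation arc := (@arc R g).
Let tau1 (j : int) (u : unit) := u.
Variables (S : finType) (tau : int -> S -> S).
Hypothesis tauK : forall j s, tau (iota4 j) (tau j s) = s.
Hypothesis tau_per : forall j m s, tau (j + z4 * m) s = tau j s.
Notation nxt := (@nxt R S tau).
Notation shift := (@shift R g S).
Notation nxt1 := (@Gluing.nxt R unit tau1).
Variables (X Y : topologicalType) (q : S -> C -> X) (q1 : unit -> C -> Y).
Hypotheses (ps : polysurf g tau q) (ps1 : polysurf g tau1 q1).
Variable p : X -> Y.
Hypothesis pE : forall s z, p (q s z) = q1 tt z.
Variable s0 : S.

Let tK1 : forall j s, tau1 (iota4 j) (tau1 j s) = s. Proof. by []. Qed.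
Let tP1 : forall (j m : int) s, tau1 (j + z4 * m) s = tau1 j s. Proof. by []. Qed.

Lemma branched_interior (y : Y) z0 : md z0 < 1 -> y = q1 tt z0 ->
  branched_model R p y (fun i : 'I_#|S| => 1%N).
Proof.
move=> z1 yE; have lt1 t := disc_chart_lt t z1.
exists (fun t => q1 tt (disc_chart z0 t)), (fun i t => q (enum_val i) (disc_chart z0 t)); split.
- split; first exact: (int_chart g0 tK1 tP1 ps1).
  by rewrite /disc_chart om0 mulr0 addr0 yE.
- by move=> i; exact: (int_chart g0 tauK tau_per ps).
- move=> i j _ _ [y' [[t _ <-] [t' _ E]]]; apply: enum_val_inj.
  by have [] := int_eq ps (lt1 t') (ltW (lt1 t)) E.
- apply/seteqP; split => x.
    move=> [t _ E]; have [s ->] := fiberP tauK ps ps1 pE (ltW (lt1 t)) (esym E).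
    by exists (enum_rank s) => //; exists t; rewrite // enum_rankK.
  by move=> [i _ [t _ <-]]; exists t; rewrite // pE.
- by move=> i t; rewrite pE expr1.
Qed.

(** The sectors have angle [2 * pi / (k * n1)] upstairs and [2 * pi / n1] downstairs, so angles are
    multiplied by [k]. *)
Lemma Gamz_proj (x : R) (s : S) n1 k e s' z (rho : R) u : (0 < n1)%N -> (0 < k)%N ->
  md u = 1 -> 0 <= rho -> Gamz g tau (s, x) (k * n1) e s' z (rho%:C * u) ->
  Gamz g tau1 (tt, x) n1 e tt z (rho%:C * u ^+ k).
Proof.
move=> n10 k0 u1 r0 [i [r [psi [re p0 sE zE cE]]]].
have rE : r = rho.
  have := congr1 (@md R) cE; rewrite !mdM md_cis u1 !mulr1 !mdRe !ger0_norm//.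
  by case/andP: re.
exists i, rho, psi; split; rewrite -?rE//.
- by case: (iter _ _ _) => -[].
- by rewrite zE (iter_nxt_proj tau).
move: cE; rewrite -rE; have [->|rn] := eqVneq r 0; first by rewrite !mul0r.
have rC : r%:C != 0 :> C by rewrite -md_gt0 mdRe normr_gt0.
move=> /(mulfI rC) ->; congr (_ * _).
have cisX a : cis a ^+ k = cis (k%:R * a) :> C.
  elim: (k) => [|l IH]; first by rewrite mul0r cis0.
  by rewrite exprS IH -natr1 mulrDl mul1r addrC cisD.
rewrite cisX; congr cis; rewrite /th natrM.
by field; rewrite !pnatr_eq0 -!lt0n n10.
Qed.

Lemma Gamz_class (x : R) e s1 s2 n n' s z c c' :
  (forall i k, arc (iter i nxt1 (tt, x)).2 != arc (iter k nxt1 (tt, x)).2 ->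
    4 * e <= md (arc (iter i nxt1 (tt, x)).2 - arc (iter k nxt1 (tt, x)).2)) ->
  Gamz g tau (s1, x) n e s z c -> Gamz g tau (s2, x) n' e s z c' ->
  md c < e -> md c' < e -> q s1 (arc x) = q s2 (arc x).
Proof.
move=> eD G1 G2 ce ce'.
have [i [i1 [i2 _]]] := Gamz_near G1; have [l [l1 [l2 _]]] := Gamz_near G2.
pose a i := iter i nxt (s1, x); pose b i := iter i nxt (s2, x).
have E : arc (a i).2 = arc (b l).2.
  apply/eqP; apply: contraT; rewrite /a /b !(iter_nxt_proj tau) => /eD h.
  move: i2 l2; rewrite !(iter_nxt_proj tau) => i2 l2.
  move: h; have -> : arc (iter i nxt1 (tt, x)).2 - arc (iter l nxt1 (tt, x)).2 =
    (z - arc (iter l nxt1 (tt, x)).2) - (z - arc (iter i nxt1 (tt, x)).2) by ring.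
  move=> h; have := le_trans h (mdD _ _); rewrite mdN; lra.
have [m mE] := arc_inj g0 E.
have abl : a i = shift m (b l) by rewrite [LHS]surjective_pairing mE -i1 l1.
apply: (ps_glue ps); apply: (bdrel_trans tau_per (b := a i)).
  by apply: bdrel_sym => //; exact: (bd_h g tau (s1, x) i).
rewrite abl; apply: (bdrel_trans tau_per (b := b l)); first exact: bdrel_shift.
exact: (bd_h g tau (s2, x) l).
Qed.

Lemma bdrel_orbit (a b : S * R) n m0 : (0 < n)%N -> iter n nxt a = shift m0 a ->
  bdrel g tau a b -> exists i m, a = shift m (iter i nxt b).
Proof.
move=> n0 hn [i [k [m E]]].
have rep l : exists m', iter (l * n) nxt a = shift m' a.
  elim: l => [|l [m' IH]]; first by exists 0; rewrite mul0n shift0.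
  by exists (m' + m0); rewrite mulSn addnC iterD hn iter_nxt_shift// IH shiftD addrC.
have [m' mE] := rep i; exists (i * n - i + k)%N, (m - m').
have ii : (i <= i * n)%N by rewrite leq_pmulr.
have : iter (i * n - i + i) nxt a = shift m (iter (i * n - i + k) nxt b).
  by rewrite iterD E -iterD iter_nxt_shift.
rewrite subnK// mE => /(congr1 (shift (- m'))); rewrite !shiftD addNr shift0 => ->.
by rewrite addrC.
Qed.

(** A canonical sheet among those that present the same point over [arc x]; the discs over a
    boundary point are indexed by these representatives. *)
Definition crep (x : R) (s : S) : S :=
  odflt s [pick s' | `[< q s' (arc x) = q s (arc x) >]].

Lemma crepP x s : q (crep x s) (arc x) = q s (arc x).
Proof. by rewrite /crep; case: pickP => //= s' /asboolP. Qed.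

Lemma crep_eq x s s' : q s (arc x) = q s' (arc x) -> crep x s = crep x s'.
Proof.
move=> E; rewrite /crep.
have -> : [pick u | `[< q u (arc x) = q s (arc x) >]] = [pick u | `[< q u (arc x) = q s' (arc x) >]].
  by apply: eq_pick => u; rewrite E.
by case: pickP => //= /(_ s'); rewrite asboolT.
Qed.

Definition creps x : {set S} := [set s | crep x s == s]%SET.

Lemma crep_in x s : crep x s \in creps x.
Proof. by rewrite inE (crep_eq (crepP x s)). Qed.

(** The branching indices are the lengths of the cycles of the monodromy around the point. The last
    clause holds because a loop that closes up downstairs is a power of the generating one, so a
    sheet that it moves has a cycle of length at least 2. *)
Lemma branched_boundary (x : R) : exists n (k : 'I_n -> nat),
  [/\ (0 < n)%N, forall i, (0 < k i)%N, branched_model R p (q1 tt (arc x)) k &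
    (forall s, exists N m, iter N nxt1 (tt, x) = Gluing.shift g m (tt, x) /\ (iter N nxt (s, x)).1 != s) ->
    forall i, (1 < k i)%N].
Proof.
have [n1 [m1 [n10 per dist]]] := base_period g0 x.
have [e [e0 es ed]] := eps_ex g0 x.
have ed1 := ed _ tau1 tt.
have [kk kkP] := choice (fun s => orbit_period tauK tau_per s n10 per dist).
have kn0 s : (0 < kk s * n1)%N by have [k0 _ _ _] := kkP s; rewrite muln_gt0 k0.
have [psi [opsi psiE psir]] := chart_ex g0 tK1 tP1 ps1 n10 per dist e0 es (ed _ _ _) (ltnSn 0).
have [phi phiP] := choice (fun s => let: And4 k0 kper kdist _ := kkP s in
  chart_ex g0 tauK tau_per ps (kn0 s) kper kdist e0 es (ed _ _ _) k0).
pose D := creps x.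
have D0 : (0 < #|D|)%N by apply/card_gt0P; exists (crep x s0); exact: crep_in.
have e2e : e / 2 < e by rewrite ltr_pdivrMr// mulr_natr mulr2n ltrDr.
have e20 : 0 < e / 2 by rewrite divr_gt0.
exists #|D|, (fun i => kk (enum_val i)); split => //.
- by move=> i; have [] := kkP (enum_val i).
- have pphi s z : p (phi s z) = psi (z ^+ kk s).
    have [k0 kper kdist _] := kkP s; have [_ phiE _] := phiP s.
    have [|s' [z' G]] := Gamz_surj g tau (s, x) (kn0 s) (c := (e / 2)%:C * om (kk s) z) (eps := e).
      by rewrite mdM mdRe gtr0_norm// (lt_trans _ e2e)// -[ltRHS]mulr1 ltr_pM2l// md_om_lt1.
    rewrite (phiE _ _ _ G) pE; apply/esym/psiE.
    have [u [u1 zE zkE]] := om_pow z k0.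
    rewrite zE mulrA -rmorphM /= in G; rewrite zkE mulrA -rmorphM /=.
    by apply: Gamz_proj G => //; rewrite mulr_ge0 ?md_ge0// ltW.
  exists psi, (fun i => phi (enum_val i)); split.
  + split => //; apply: psiE; rewrite om0 mulr0.
    exists 0%N, 0, 0; split => //; rewrite ?lexx ?e0 ?pi_ge0//; last by rewrite mul0r.
    by rewrite hpol0 oppr0 mob_real// beta0 addr0.
  + by move=> i; have [] := phiP (enum_val i).
  + move=> i j _ _ [y [yi yj]]; apply: enum_val_inj.
    have [_ _ ri] := phiP (enum_val i); have [_ _ rj] := phiP (enum_val j).
    move: yi yj; rewrite ri rj => -[s [z [c [G ce yE]]]] [s' [z' [c' [G' ce' yE']]]].
    have [k0 kper kdist _] := kkP (enum_val j).
    have G2 := Gamz_sat g0 tauK tau_per ps (kn0 _) kper e0 es (Gamz_md G) (etrans (esym yE') yE) G'.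
    have := Gamz_class ed1 G G2 (lt_trans ce e2e) (lt_trans ce' e2e) => /crep_eq.
    by have := enum_valP i; have := enum_valP j; rewrite !inE => /eqP -> /eqP ->.
  + apply/seteqP; split => y; last first.
      by move=> [i _ [t _ <-]]; exists (t ^+ kk (enum_val i)); rewrite // pphi.
    rewrite psir => -[[] [z [c [G ce pyE]]]].
    have z1 := Gamz_md G; have [s sE] := fiberP tauK ps ps1 pE z1 pyE.
    (* Going [l] steps back from the sheet [s] gives a sheet whose centre lies over [arc x], from
       which [s] is reached as sector [l]; it is then replaced by its representative. *)
    case: G => l [rho [ps' [re p0 _ zE cE]]].
    pose c0 := iter l (prv tau) (s, (iter l nxt1 (tt, x)).2).
    pose s' := c0.1.
    have it : iter l nxt (s', x) = (s, (iter l nxt1 (tt, x)).2).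
      have cK' : iter l nxt c0 = (s, (iter l nxt1 (tt, x)).2).
        by rewrite /c0; elim: (l) (s, _) => //= u IH b; rewrite -iterS iterSr (prvK tauK) IH.
      have c02 : c0.2 = x.
        have inj : injective (iter l nxt1).
          have inj : injective (nxt1 : unit * R -> unit * R) by apply: can_inj (nxtKp (fun=> fun=> erefl)).
          by elim: (l) => [|u IH] a b //= /inj/IH.
        have : iter l nxt1 (tt, c0.2) = iter l nxt1 (tt, x).
          have := congr1 snd cK'; rewrite [c0 in iter _ _ c0]surjective_pairing !(iter_nxt_proj tau) /=.
          by case: (iter l nxt1 (tt, c0.2)) => -[] u; case: (iter l nxt1 (tt, x)) => -[] v /= ->.
        by move=> /inj[].
      by rewrite -cK' [c0 in RHS]surjective_pairing c02.
    pose r := crep x s'.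
    have [k0 kper kdist _] := kkP s'.
    have [i [m im]] : exists i m, (s', x) = shift m (iter i nxt (r, x)).
      have [||[s'E _]|[x1 [x2 [xE1 xE2 bd]]]] := ps_eq ps _ _ (esym (crepP x s')).
      - by rewrite md_arc.
      - by rewrite md_arc.
      - by exists 0%N, 0; rewrite shift0 /r -s'E.
      have [v1 v1E] := arc_inj g0 xE1; have [v2 v2E] := arc_inj g0 xE2.
      have bd' : bdrel g tau (s', x) (r, x).
        rewrite -/r in bd; apply: (bdrel_trans tau_per (b := (s', x1))).
          by rewrite v1E; exact: (bdrel_shift g tau v1 (s', x1)).
        apply: (bdrel_trans tau_per bd); apply: bdrel_sym => //.
        by rewrite v2E; exact: (bdrel_shift g tau v2 (r, x2)).
      exact: bdrel_orbit (kn0 s') kper bd'.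
    have rD : r \in D by exact: crep_in.
    exists (enum_rank_in rD r) => //; rewrite enum_rankK_in//.
    have [_ _ ->] := phiP r.
    exists s, z, (rho%:C * cis (th (kk r * n1) (l + i) ps')); split => //.
      have E : (s, (iter l nxt1 (tt, x)).2) = shift m (iter (l + i) nxt (r, x)).
        by rewrite -it im iter_nxt_shift// -iterD.
      exists (l + i)%N, rho, ps'; split => //.
        by have /= := congr1 fst E.
      by have /= := congr1 snd E; rewrite zE => ->; rewrite arc_per.
    by move: ce; rewrite cE !mdM !md_cis.
  + by move=> i z; rewrite pphi.
- move=> mv i; set s := enum_val i; have [k0 kper kdist _] := kkP s.
  rewrite ltn_neqAle k0 andbT; apply/eqP => k1.
  have [N [m [NE]]] := mv s; rewrite -k1 mul1n in kper.
  have := dist N 0%N m; rewrite NE /= mod0n => /(_ erefl)/eqP/dvdnP[d ->].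
  have -> : (iter (d * n1) nxt (s, x)).1 = s; last by rewrite eqxx.
  suff [m' ->] : exists m', iter (d * n1) nxt (s, x) = shift m' (s, x) by [].
  elim: d => [|d [m' IH]]; first by exists 0; rewrite mul0n shift0.
  by exists (m' + 1 * m1); rewrite mulSn addnC iterD kper iter_nxt_shift// IH shiftD addrC.
Qed.

Lemma ps_branched_cover : continuous p -> finite_branched_cover R p.
Proof.
move=> cp; split => // y.
have [[[] [z [z1 yE]]]|[[] [x yE]]] := bd_or_int g0 ps1 y.
  exists #|S|, (fun=> 1%N); split => //; last exact: branched_interior yE.
  by apply/card_gt0P; exists s0.
by have [n [k [h1 h2 h3 _]]] := branched_boundary x; exists n, k; split => //; rewrite yE.
Qed.

Lemma vertex_branch : (forall s, (iter (4 * g) nxt (s, 0)).1 != s) -> branch_point R p (q1 tt 1).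
Proof.
move=> mv; have [n [k [n0 h2 h3 h4]]] := branched_boundary 0.
exists n, k; split => //; first by rewrite -(arc0 R g).
exists (Ordinal n0); apply: h4 => s; exists (4 * g)%N, 1; split => //.
rewrite [LHS](iter_nxt_corner R tau1 tt 0) iter_cstep4 add0r /Gluing.shift /= add0r mulr1.
by case: (iter _ _ _).1.
Qed.

End Cover.

(** * The sheets *)

Section Unitriangular.
Variables (F : finFieldType) (k : nat).
Let m := (2 ^ k)%N.
Hypothesis cardF : #|F| = (2 ^ m)%N.
Hypothesis char2 : 2 \in [pchar F].

Lemma addff (x : F) : x + x = 0. Proof. exact: addrr_pchar2. Qed.

(** Unitriangular matrices whose first superdiagonal consists of the Frobenius conjugates of [w],
    with no condition above it. The parameter is additive under products, and the product of the
    superdiagonal is [w ^ (2 ^ m - 1)], the norm of [w] to the prime field. *)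
Definition uni (w : F) (M : 'M[F]_m.+1) := forall i j : 'I_m.+1,
  [/\ (j < i)%N -> M i j = 0, j = i -> M i j = 1 & j = i.+1 :> nat -> M i j = w ^+ (2 ^ i)].

Definition umx (w : F) : 'M[F]_m.+1 :=
  \matrix_(i, j) (if j == i then 1 else if j == i.+1 :> nat then w ^+ (2 ^ i) else 0).

Lemma uni_umx w : uni w (umx w).
Proof.
move=> i j; rewrite mxE; split.
- move=> ji; rewrite -val_eqE /= ltn_eqF// ltn_eqF//; exact: ltn_trans ji _.
- by move=> ->; rewrite eqxx.
- by move=> ji; rewrite -val_eqE /= ji gtn_eqF// eqxx.
Qed.

Lemma frobD2 (x y : F) i : (x + y) ^+ (2 ^ i) = x ^+ (2 ^ i) + y ^+ (2 ^ i).
Proof.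
elim: i => [|i IH]; first by rewrite !expr1.
by rewrite expnSr !exprM IH sqrrD -mulr_natr (pcharf0 char2) mulr0 addr0.
Qed.

Lemma uni1 : uni 0 1.
Proof.
move=> i j; rewrite mxE; split.
- by move=> ji; rewrite -val_eqE /= gtn_eqF.
- by move=> ->; rewrite eqxx.
- by move=> ji; rewrite -val_eqE /= ji ltn_eqF// expr0n expn_eq0.
Qed.

Lemma uniM w w' M M' : uni w M -> uni w' M' -> uni (w + w') (M *m M').
Proof.
move=> uM uM' i j; rewrite mxE; split=> [ji|->|ji].
- apply: big1 => l _; have [li|il] := ltnP l i.
    by have [-> //] := uM i l; rewrite mul0r.
  by have [-> //] := uM' l j; rewrite ?mulr0// (leq_trans ji).
- rewrite (bigD1 i)//= big1 ?addr0 => [|l li].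
    by have [_ -> //] := uM i i; have [_ -> //] := uM' i i; rewrite mulr1.
  case: (ltngtP l i) => h.
  + by have [-> //] := uM i l; rewrite mul0r.
  + by have [-> //] := uM' l i; rewrite mulr0.
  + by move: li; rewrite -val_eqE /= h eqxx.
- have ij : j != i by rewrite -val_eqE /= ji gtn_eqF.
  rewrite (bigD1 i)//= (bigD1 j)//= big1 ?addr0 => [|l /andP[li lj]].
    have [_ -> // _] := uM i i; have [_ _ -> //] := uM' i j.
    have [_ -> // _] := uM' j j; have [_ _ -> //] := uM i j.
    by rewrite mul1r mulr1 frobD2 addrC.
  case: (ltngtP l i) => h.
  + by have [-> //] := uM i l; rewrite mul0r.
  + have jl : (j < l)%N by rewrite ltn_neqAle -val_eqE eq_sym in lj *; rewrite lj ji.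
    by have [-> //] := uM' l j; rewrite mulr0.
  + by move: li; rewrite -val_eqE /= h eqxx.
Qed.

Lemma uniX w M n : uni w M -> uni (w *+ n) (M ^+ n).
Proof.
by move=> uM; elim: n => [|n IH]; [exact: uni1|rewrite exprS mulrS; exact: uniM].
Qed.

(** The [n]-th power of [M - 1] starts on the [n]-th superdiagonal, with products of [n] consecutive
    superdiagonal entries of [M]. *)
Lemma expN_entries w M n : uni w M -> forall i j : 'I_m.+1,
  ((j < i + n)%N -> ((M - 1) ^+ n) i j = 0) /\
  (j = (i + n)%N :> nat -> ((M - 1) ^+ n) i j = w ^+ (2 ^ i * (2 ^ n - 1))%N).
Proof.
move=> uM; have NE (i j : 'I_m.+1) : ((j <= i)%N -> (M - 1) i j = 0) /\ (j = i.+1 :> nat -> (M - 1) i j = w ^+ (2 ^ i)).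
  have [M1 M2 M3] := uM i j; rewrite !mxE; split.
    rewrite leq_eqVlt => /orP[/eqP ji|ji].
      have ji' : j = i by apply: val_inj.
      by rewrite M2// ji' eqxx subrr.
    by rewrite M1// -val_eqE /= gtn_eqF// subr0.
  by move=> ji; rewrite M3// -val_eqE /= ji ltn_eqF// subr0.
elim: n => [|n IH] i j; first rewrite expr0 addn0 mxE; first split.
- by move=> ji; rewrite -val_eqE /= gtn_eqF.
- by move=> ji; rewrite -val_eqE /= ji eqxx subnn muln0.
rewrite exprSr mxE addnS ltnS; split => ji.
  apply: big1 => l _; have [h1 _] := IH i l; have [h2 _] := NE l j.
  have [li|il] := ltnP l (i + n); first by rewrite h1// mul0r.
  by rewrite h2 ?mulr0// (leq_trans ji).
have lm : (i + n < m.+1)%N by rewrite -ltnS -ji ltnS ltnW// ltn_ord.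
rewrite (bigD1 (Ordinal lm))//= big1 ?addr0 => [|l ll].
  have [_ -> //] := IH i (Ordinal lm); have [_ -> //] := NE (Ordinal lm) j.
  rewrite -exprD /=; congr (_ ^+ _); rewrite !mulnBr -!expnD !muln1 addnS expnS.
  have := leq_pexp2l (m := 2) isT (leq_addr n i); lia.
have [h1 _] := IH i l; have [h2 _] := NE l j.
case: (ltngtP l (i + n)) => h.
- by rewrite h1// mul0r.
- by rewrite h2 ?mulr0// ji.
- by move: ll; rewrite -val_eqE /= h eqxx.
Qed.

Lemma mx_sqr1 (A : 'M[F]_m.+1) : (1 + A) ^+ 2 = 1 + A ^+ 2.
Proof.
have A2 : A *+ 2 = 0 by rewrite mulr2n; apply/matrixP => i j; rewrite !mxE addff.
by rewrite addrC sqrrD1 A2 addr0 addrC.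
Qed.

Lemma mx_frob (A : 'M[F]_m.+1) l : (1 + A) ^+ (2 ^ l) = 1 + A ^+ (2 ^ l).
Proof. by elim: l => [|l IH]; rewrite ?expr1// expnSr !exprM IH mx_sqr1. Qed.

(** As [m] is a power of 2, [M ^ m = 1 + (M - 1) ^ m], and only the corner of [(M - 1) ^ m]
    survives. It is the norm of [w], which is 1 whenever [w] is nonzero. *)
Lemma uni_pow w M : w != 0 -> uni w M -> M ^+ m = 1 + delta_mx ord0 ord_max.
Proof.
move=> w0 uM; rewrite -[M in LHS](subrK 1) addrC mx_frob; congr (_ + _).
apply/matrixP => i j; rewrite [RHS]mxE; have [h1 h2] := expN_entries m uM i j.
have [jm|jm] := ltnP j (i + m).
  rewrite h1//; case: eqP => //= i0; case: eqP => // j0.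
  by move: jm; rewrite i0 j0 /= ltnn.
have jm' := leq_trans jm (leq_ord j : (j <= m)%N).
have i0 : i = ord0 by apply: val_inj => /=; lia.
have jE : j = ord_max by apply: val_inj => /=; move: jm (leq_ord j); rewrite i0 /=; lia.
rewrite h2; last by rewrite i0 jE.
rewrite i0 jE !eqxx expn0 mul1n /=.
have := expf_card w; rewrite cardF -[X in w ^+ X](@prednK (2 ^ m)%N) ?expn_gt0// exprS subn1.
by rewrite -[RHS]mulr1 => /(mulfI w0).
Qed.

Lemma umxK w : umx w *m (umx w) ^+ (2 * m - 1) = 1.
Proof.
rewrite -[_ *m _]/(umx w * _) -exprS.
have -> : (2 * m - 1).+1 = (m * 2)%N by rewrite -[(_ - 1).+1]addn1 subnK ?muln_gt0 ?expn_gt0// mulnC.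
have [->|w0] := eqVneq w 0.
  have -> : umx 0 = 1.
    apply/matrixP => i j; rewrite !mxE eq_sym; case: eqP => // _.
    by case: ifP => // _; rewrite expr0n expn_eq0.
  by rewrite expr1n.
rewrite exprM (uni_pow w0 (uni_umx w)) mx_sqr1 expr2 -[delta_mx _ _ * _]/(_ *m _).
by rewrite mul_delta_mx_0 ?addr0// -val_eqE /= -lt0n expn_gt0.
Qed.

End Unitriangular.

(** Greedy choice: [n] vectors have at most [2 ^ n] partial sums, so a further vector outside them
    exists while [n < m]. *)
Lemma indep_family (F : finFieldType) (m n : nat) : 2 \in [pchar F] -> #|F| = (2 ^ m)%N -> (n <= m)%N ->
  exists v : nat -> F, forall c : nat -> bool, (exists2 i, (i < n)%N & c i) ->
    \sum_(0 <= i < n | c i) v i != 0.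
Proof.
move=> char2 cardF; elim: n => [|n IH] nm; first by exists (fun=> 0) => c [].
have [v vP] := IH (ltnW nm).
pose sums := [set \sum_(i < n | c i) v i | c : {ffun 'I_n -> bool}]%SET.
have [u us] : exists u, u \notin sums.
  apply/existsP; rewrite -negb_forall; apply: contraTN nm => /forallP all.
  rewrite -ltnNge ltnS -(leq_exp2l (m := 2))// -cardF.
  have : (#|F| <= #|sums|)%N by apply: subset_leq_card; apply/fintype.subsetP => x _; exact: all.
  move=> h; apply: leq_trans h (leq_trans (leq_imset_card _ _) _).
  by rewrite card_ffun card_bool card_ord.
exists (fun i => if i == n then u else v i) => c [i i1 ci].
have eqv : \sum_(0 <= i < n | c i) (if i == n then u else v i) = \sum_(0 <= i < n | c i) v i.
  by rewrite !big_mkord; apply: eq_bigr => l _; rewrite (ltn_eqF (ltn_ord l)).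
rewrite big_mkcond big_nat_recr//= eqxx -big_mkcond /= eqv; case: (boolP (c n)) => cn.
  apply: contraNneq us => /eqP; rewrite addr_eq0 => /eqP E.
  apply/imsetP; exists [ffun i : 'I_n => c i] => //.
  rewrite -[u]opprK -E oppr_pchar2// big_mkord.
  by apply: eq_bigl => l; rewrite ffunE.
rewrite addr0; apply: vP; exists i => //.
by move: i1; rewrite ltnS leq_eqVlt => /orP[/eqP E|//]; rewrite E (negPf cn) in ci.
Qed.

Lemma iter_double (T : Type) (f : T -> T) n b : iter (n * 2) f b = iter n (fun x => f (f x)) b.
Proof. by elim: n => //= n ->. Qed.

Section Sides.
Variable g : nat.
Hypothesis g0 : (0 < g)%N.
Notation z4 := ((4 * g)%N%:Z).

Definition pos (j : int) : bool := (j %% 4)%Z < 2.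

Lemma z4_gt0 : 0 < z4. Proof. by rewrite ltz_nat muln_gt0. Qed.

Definition side (j : int) : 'I_(4 * g) :=
  Ordinal (ltn_pmod `|(j %% z4)%Z| (z4_gt0 : (0 < 4 * g)%N)).

Lemma sideE j : (side j)%:Z = (j %% z4)%Z.
Proof.
have z0 := z4_gt0; have h0 : 0 <= (j %% z4)%Z by rewrite modz_ge0// gt_eqF.
by rewrite /= modn_small ?gez0_abs// -ltz_nat gez0_abs// ltz_pmod.
Qed.

Lemma side_eq j j' : side j = side j' -> exists m, j = j' + z4 * m.
Proof.
move=> /(congr1 (fun i : 'I_(4 * g) => (i : nat)%:Z)); rewrite !sideE => E.
exists ((j %/ z4)%Z - (j' %/ z4)%Z).
by rewrite {1}(divz_eq j z4) {1}(divz_eq j' z4) E; ring.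
Qed.

Lemma side_per j m : side (j + z4 * m) = side j.
Proof. by apply: val_inj; apply/eqP; rewrite -eqz_nat !sideE addrC mulrC modzMDl. Qed.

Definition edg (j : int) : 'I_(4 * g) := side (if pos j then j else iota4 j).

Lemma pos_iota j : pos (iota4 j) = ~~ pos j.
Proof.
clear g0.
rewrite /pos /iota4; have := divz_eq j 4; have := modz_ge0 j (isT : 4 != 0 :> int).
have := ltz_pmod j (isT : 0 < 4 :> int).
set r := (j %% 4)%Z; set d := (j %/ 4)%Z => h4 h0 jE.
have sm k : 0 <= r + k < 4 -> ((j + k) %% 4)%Z = r + k by move=> hk; rewrite jE -addrA modzMDl modz_small.
by case: (ltP r 2) => hr; rewrite sm; lia.
Qed.

Lemma edg_iota j : edg (iota4 j) = edg j.
Proof. by rewrite /edg pos_iota iota4K; case: (pos j). Qed.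

Lemma pos_per j m : pos (j + z4 * m) = pos j.
Proof. by rewrite /pos (_ : z4 * m = (g%:Z * m) * 4) ?[j + _]addrC ?modzMDl// PoszM; ring. Qed.

Lemma edg_per j m : edg (j + z4 * m) = edg j.
Proof. by rewrite /edg pos_per iota4_per; case: ifP => _; rewrite side_per. Qed.

Notation Q := 'rV['F_2]_(4 * g).

Definition dq (j : int) : Q := delta_mx 0 (edg j).

Lemma addqq (x : Q) : x + x = 0.
Proof. by apply/rowP => i; rewrite !mxE addrr_pchar2// pchar_Fp. Qed.

Lemma addqK (x y : Q) : x + y + y = x.
Proof. by rewrite -addrA addqq addr0. Qed.

(** Edges of the Cayley graph of [Q] are named by the endpoint from which the crossing is positive,
    so that both directions of crossing give the same name. *)
Definition qedge (u : Q) (j : int) : Q * 'I_(4 * g) := (if pos j then u else u + dq j, edg j).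

Fixpoint edges (u : Q) (W : seq int) : seq (Q * 'I_(4 * g)) :=
  if W is j :: W' then qedge u j :: edges (u + dq j) W' else [::].

Definition wd (W : seq int) : Q := \sum_(j <- W) dq j.

Lemma edges_cat u W W' : edges u (W ++ W') = edges u W ++ edges (u + wd W) W'.
Proof.
elim: W u => [|j W IH] u /=; first by rewrite /wd big_nil addr0.
by rewrite IH /wd big_cons addrA.
Qed.

Lemma wd_cat W W' : wd (W ++ W') = wd W + wd W'.
Proof. exact: big_cat. Qed.

Lemma edges_shift u h W : edges (u + h) W = [seq (x.1 + h, x.2) | x <- edges u W].
Proof.
elim: W u => //= j W IH u; rewrite addrAC IH /qedge; congr cons.
by case: (pos j); rewrite // addrAC.
Qed.

Lemma count_shift u h W x : count_mem x (edges (u + h) W) = count_mem (x.1 + h, x.2) (edges u W).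
Proof.
rewrite edges_shift count_map; apply: eq_count => -[y i] /=.
by rewrite -!pair_eqE /= /pair_eq /= -(inj_eq (addIr h)) addqK.
Qed.

Definition odd_word (W : seq int) := wd W != 0 \/ exists x, odd (count_mem x (edges 0 W)).

(** Translation by [d] pairs the vectors, and the two terms of a pair have the same parity. *)
Lemma sum_even (d : Q) (f : Q -> nat) : d != 0 -> (forall u, odd (f (u + d)) = odd (f u)) ->
  ~~ odd (\sum_u f u)%N.
Proof.
move=> d0 fd; have [h dh] : exists h, d 0 h != 0.
  apply/existsP; rewrite -negb_forall; apply: contraNN d0 => /forallP d0.
  by apply/eqP/rowP => h; rewrite mxE; apply/eqP; exact: d0.
have F2 (x : 'F_2) : x != 0 -> x = 1 by case: x => -[|[|x]] //= i _; exact: val_inj.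
rewrite (bigID (fun u : Q => u 0 h == 0)) /= [X in (_ + X)%N](reindex (fun u : Q => u + d)) /=; last first.
  by exists (fun u => u + d) => u _; rewrite addqK.
have -> : (\sum_(u : Q | (u + d)%R 0%R h != 0%R) f (u + d)%R = \sum_(u : Q | u 0%R h == 0%R) f (u + d)%R)%N.
  apply: eq_bigl => u; rewrite mxE (F2 _ dh); case: (eqVneq (u 0 h) 0) => [->|/F2 ->] //.
rewrite -big_split /=; elim/big_rec: _ => // u n _ on.
by rewrite oddD negb_add (negPf on) oddD fd addbb.
Qed.

(** If the word is not closed modulo 2, its square is. Were every edge crossed an even number of
    times by the square, the crossings of edges with label [h] by the word would have parities
    invariant under translation by [wd W]; then [h] would occur an even number of times in the word,
    although coordinate [h] of [wd W] is nonzero. *)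
Lemma odd_word2 W : odd_word W -> exists x, odd (count_mem x (edges 0 (W ++ W))) \/ 
  (wd W = 0 /\ odd (count_mem x (edges 0 W))).
Proof.
have [d0|d0] := eqVneq (wd W) 0.
  by move=> [|[x ox]]; [rewrite d0 eqxx|exists x; right].
move=> _; apply: contrapT => nx.
have ev x : ~~ odd (count_mem x (edges 0 (W ++ W))) by apply/negP => ox; apply: nx; exists x; left.
have [h dh] : exists h, wd W 0 h != 0.
  apply/existsP; rewrite -negb_forall; apply: contraNN d0 => /forallP d0.
  by apply/eqP/rowP => h; rewrite mxE; apply/eqP; exact: d0.
have tot u : (\sum_v count_mem (v, h) (edges u W) = count (fun j => edg j == h) W)%N.
  elim: W u {d0 nx ev dh} => [|j W IH] u /=; first by rewrite big1.
  rewrite big_split /= IH; congr (_ + _)%N.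
  rewrite (bigD1 (qedge u j).1)//= big1 ?addn0 => [|v vn].
    by rewrite /qedge xpair_eqE eqxx.
  by rewrite [qedge u j]surjective_pairing xpair_eqE eq_sym (negPf vn).
have wdh : wd W 0 h = (count (fun j => edg j == h) W)%:R.
  rewrite /wd summxE; elim: (W) => [|j V IH]; first by rewrite big_nil.
  by rewrite big_cons IH /= natrD !mxE eqxx /= eq_sym; case: (edg j == h).
have : odd (count (fun j => edg j == h) W).
  apply: contraNT dh => ev'; rewrite wdh -(odd_double_half (count _ W)) (negPf ev') add0n.
  by rewrite -mul2n natrM (_ : 2%:R = 0) ?mul0r//; exact: val_inj.
rewrite -(tot 0); apply/negP; apply: (sum_even d0) => v.
have := ev (v, h); rewrite edges_cat count_cat oddD count_shift /= negb_add => /eqP ->.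
by [].
Qed.

End Sides.

(* [v] is a family of vectors of the field, linearly independent over the prime
   field and indexed by the edges of the Cayley graph; crossing an edge [x]
   multiplies the row by [umx (v x)].  The norm [v ^ (2 ^ m - 1) = 1] makes the
   corner of the [m]-th power of a product insensitive to the value of [v]. *)
Section States.
Variables (g : nat) (F : finFieldType) (k : nat).
Hypothesis g0 : (0 < g)%N.
Let m := (2 ^ k)%N.
Hypothesis cardF : #|F| = (2 ^ m)%N.
Hypothesis char2 : 2 \in [pchar F].
Notation z4 := ((4 * g)%N%:Z).
Notation Q := 'rV['F_2]_(4 * g).
Notation E := (Q * 'I_(4 * g))%type.
Variable v : E -> F.
Hypothesis vP : forall c : pred E, (exists x, c x) -> \sum_(x | c x) v x != 0.
Notation dqg := (dq g0).
Notation edgesg := (edges g0).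
Notation qedgeg := (qedge g0).
Notation wdg := (wd g0).

Notation state := (Q * 'rV[F]_m.+1)%type.

(** A negative crossing uses the inverse matrix, written as a power by [umxK], since the order
    divides [2 * m]. *)
Definition emx (j : int) (u : Q) : 'M[F]_m.+1 :=
  if pos j then umx k (v (qedgeg u j)) else umx k (v (qedgeg u j)) ^+ (2 * m - 1).

Definition tau0 (j : int) (a : state) : state := (a.1 + dqg j, a.2 *m emx j a.1).

(** Right multiplication by [1 + delta_mx ord0 ord_max], which commutes with all unitriangular
    matrices and moves exactly the rows with nonzero first entry. *)
Definition zz (a : state) : state := (a.1, a.2 + a.2 0 ord0 *: delta_mx 0 ord_max).

Lemma dq_iota j : dqg (iota4 j) = dqg j. Proof. by rewrite /dq edg_iota. Qed.

Lemma qedge_iota u j : qedgeg (u + dqg j) (iota4 j) = qedgeg u j.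
Proof. by rewrite /qedge pos_iota edg_iota dq_iota; case: (pos j); rewrite /= ?addqK. Qed.

Lemma umxKC (w : F) : umx k w ^+ (2 * m - 1) *m umx k w = 1.
Proof. by rewrite -[_ *m _]/(_ * _) -exprSr exprS -(umxK cardF char2 w). Qed.

Lemma tau0K j a : tau0 (iota4 j) (tau0 j a) = a.
Proof.
case: a => u y; rewrite /tau0 /= dq_iota addqK; congr pair.
rewrite /emx pos_iota qedge_iota -mulmxA; case: (pos j) => /=.
  by rewrite (umxK cardF char2) mulmx1.
by rewrite umxKC mulmx1.
Qed.

Lemma tau0_per j n a : tau0 (j + z4 * n) a = tau0 j a.
Proof. by rewrite /tau0 /emx /qedge /dq pos_per edg_per. Qed.

(** In characteristic 2 an odd multiple of the parameter is the parameter, so the direction of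
    crossing leaves no trace on the superdiagonal. *)
Lemma uni_emx j u : uni (v (qedgeg u j)) (emx j u).
Proof.
rewrite /emx; case: ifP => _; first exact: uni_umx.
rewrite -[X in uni X _](_ : v (qedgeg u j) *+ (2 * m - 1) = _).
  by apply: uniX => //; exact: uni_umx.
have -> : (2 * m - 1 = (2 * m - 2).+1)%N by have := expn_gt0 2 k; rewrite -/m; lia.
have e2 : (2 * m - 2 = 2 * (m - 1))%N by rewrite mulnBr.
by rewrite mulrS e2 mulrnA mulr2n addff// mul0rn addr0.
Qed.

Definition act0 (W : seq int) (a : state) : state := foldl (fun a j => tau0 j a) a W.

Lemma act0E W u : exists M : 'M[F]_m.+1, uni (\sum_(x <- edgesg u W) v x) M /\
  forall y, act0 W (u, y) = (u + wdg W, y *m M).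
Proof.
elim: W u => [|j W IH] u.
  exists 1; split; first by rewrite big_nil; exact: uni1.
  by move=> y; rewrite /wd big_nil addr0 mulmx1.
have [M [uM aM]] := IH (u + dqg j); exists (emx j u *m M); split.
  rewrite big_cons; apply: uniM => //; exact: uni_emx.
by move=> y; rewrite /= -/(act0 _ _) /tau0 /= aM /wd big_cons addrA mulmxA.
Qed.

(** The parameter of a word thus depends only on the set of edges crossed an odd number of times,
    and by independence it vanishes only if this set is empty. *)
Lemma sum_odd (s : seq E) : \sum_(x <- s) v x = \sum_(x | odd (count_mem x s)) v x.
Proof.
elim: s => [|y s IH]; first by rewrite big_nil big1.
rewrite big_cons IH [LHS]addrC; case: (boolP (odd (count_mem y s))) => oy.
  rewrite (bigD1 y)//= addrAC addff// add0r; apply: eq_bigl => x.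
  rewrite /= oddD [y == x]eq_sym; case: (eqVneq x y) => [->|_]; first by rewrite oy.
  by rewrite andbT.
rewrite [RHS](bigD1 y) /=; last by rewrite /= eqxx oddD (negPf oy).
rewrite addrC; congr (_ + _); apply: eq_bigl => x.
by rewrite /= oddD [y == x]eq_sym; case: (eqVneq x y) => [->|_]; rewrite ?(negPf oy) ?andbT.
Qed.

Lemma act0_cat W W' a : act0 (W ++ W') a = act0 W' (act0 W a).
Proof. exact: foldl_cat. Qed.

Lemma tau0_z j a : tau0 j (zz a) = zz (tau0 j a).
Proof.
case: a => u y; rewrite /tau0 /zz /=; congr pair; rewrite mulmxDl; congr (_ + _).
have uM := uni_emx j u; rewrite -scalemxAl; congr (_ *: _).
  rewrite mxE (bigD1 ord0)//= big1 ?addr0 => [|l l0].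
    by have [_ -> //] := uM ord0 ord0; rewrite mulr1.
  by have [-> //] := uM l ord0; rewrite ?mulr0// lt0n -val_eqE in l0 *.
apply/rowP => i; rewrite mxE (bigD1 ord_max)//= big1 ?addr0 => [|l l0]; last first.
  by rewrite mxE (negPf l0) andbF mul0r.
rewrite !mxE !eqxx /= mul1r; case: (eqVneq i ord_max) => [->|ne].
  by have [_ -> //] := uM ord_max ord_max.
have [-> //] := uM ord_max i; rewrite ltn_neqAle -val_eqE in ne *.
by rewrite ne -ltnS /=.
Qed.

Lemma act0_pow W u : wdg W = 0 -> (exists x, odd (count_mem x (edgesg u W))) ->
  forall y, iter m (act0 W) (u, y) = zz (u, y).
Proof.
move=> W0 ex y; have [M [uM aM]] := act0E W u.
rewrite sum_odd in uM; have w0 := vP ex.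
have it n : iter n (act0 W) (u, y) = (u, y *m M ^+ n).
  elim: n => [|n IH]; first by rewrite expr0 mulmx1.
  by rewrite iterS IH aM W0 addr0 exprSr mulmxA.
rewrite it (uni_pow cardF char2 w0 uM) mulmxDr mulmx1 /zz /=; congr (_, _ + _).
apply/rowP => i; rewrite !mxE (bigD1 ord0)//= big1 ?addr0 => [|l l0]; last first.
  by rewrite mxE (negPf l0) mulr0.
by rewrite mxE eqxx.
Qed.

(** By [odd_word2] the word or its square is closed and has a nonzero parameter; the power needed is
    [m] or [m * 2]. *)
Lemma star0 W a : odd_word g0 W -> exists n, iter n (act0 W) a = zz a.
Proof.
case: a => u y ow; have base V : (exists x, odd (count_mem x (edgesg 0 V))) ->
    exists x, odd (count_mem x (edgesg u V)).
  move=> [x ox]; exists (x.1 + u, x.2).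
  by rewrite -[u]add0r count_shift /= add0r addqK -surjective_pairing.
have [x [ox|[w0 ox]]] := odd_word2 ow.
  exists (m * 2)%N; rewrite -(act0_pow (W := W ++ W)) ?wd_cat ?addqq//; last by apply: base; exists x.
  have it n b : iter (n * 2) (act0 W) b = iter n (act0 (W ++ W)) b.
    rewrite iter_double; elim: n => //= n IH; rewrite IH.
    by rewrite act0_cat.
  exact: it.
by exists m; apply: act0_pow => //; apply: base; exists x.
Qed.

Lemma zzK a : zz (zz a) = a.
Proof.
case: a => u y; rewrite /zz /=; congr pair; rewrite !mxE /= -addrA.
have -> : (ord0 == ord_max :> 'I_m.+1) = false.
  by rewrite -val_eqE /= ltn_eqF// expn_gt0.
by rewrite mulr0 addr0 -scalerDl addff// scale0r addr0.
Qed.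

(** A unitriangular matrix keeps the first entry of a row; it stays 1 on the orbit used for the
    cover, where [zz] therefore has no fixed point. *)
Lemma act0_first W a : (act0 W a).2 0 ord0 = a.2 0 ord0.
Proof.
case: a => u y; have [M [uM ->]] := act0E W u; rewrite mxE (bigD1 ord0)//= big1 ?addr0 => [|l l0].
  by have [_ -> //] := uM ord0 ord0; rewrite mulr1.
by have [-> //] := uM l ord0; rewrite ?mulr0// lt0n -val_eqE in l0 *.
Qed.

Lemma zz_neq (a : state) : a.2 0 ord0 = 1 -> zz a != a.
Proof.
case: a => u y /= y1; apply/eqP => -[] /rowP/(_ ord_max).
rewrite !mxE y1 !eqxx mulr1 -[RHS]addr0 => /addrI/eqP.
by rewrite oner_eq0.
Qed.

End States.

Section Sheets.
Variable g : nat.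
Hypothesis g0 : (0 < g)%N.
Notation z4 := ((4 * g)%N%:Z).

(** The sides crossed in turning once around the vertex, from corner 0. *)
Definition vword : seq int := mkseq (fun i => iter i cstep 0) (4 * g).

Lemma side_small (n : nat) : (n < 4 * g)%N -> side g0 n%:Z = n :> nat.
Proof. by move=> n4; apply/eqP; rewrite -eqz_nat sideE modz_small. Qed.

Lemma edg_corner l u : (l < g)%N -> (u < 4)%N ->
  edg g0 ((4 * l + u)%N%:Z) = (4 * l + u %% 2)%N :> nat.
Proof.
move=> lg u4; have pE : pos (4 * l + u)%N%:Z = (u < 2)%N.
  by rewrite /pos PoszD PoszM mulrC modzMDl -ltz_nat; case: u u4 => [|[|[|[|]]]].
rewrite /edg pE; case: ifP => u2.
  by rewrite side_small ?modn_small//; lia.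
have -> : iota4 (4 * l + u)%N%:Z = (4 * l + (u - 2))%N%:Z.
  rewrite /iota4 -/(pos _) pE u2; lia.
by rewrite side_small; [case: u u4 u2 pE => [|[|[|[|]]]]|lia].
Qed.

Lemma edg_corner0 u : (u < 4)%N -> edg g0 u%:Z = (u %% 2)%N :> nat.
Proof. by move=> u4; have := edg_corner g0 u4; rewrite muln0 !add0n. Qed.

Lemma vword_odd : odd_word g0 vword.
Proof.
right; exists (0, side g0 0).
have gE : (4 * g = 4 + 4 * (g - 1))%N by lia.
have it0 r l : iter (4 * l + r) cstep 0 = iter r cstep 0 + (4 * l)%N%:Z by rewrite iterD iter_cstep4.
have -> : vword = [:: 0; 3; 2; 1] ++ mkseq (fun i => iter (4 + i) cstep 0) (4 * (g - 1)).
  by rewrite /vword gE /mkseq (iotaD 0 4) map_cat add0n -{2}[4%N]addn0 iotaDl -map_comp.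
rewrite edges_cat count_cat.
have s0E : side g0 0 = 0%N :> nat by rewrite (@side_small 0)//; lia.
rewrite [X in (_ + X)%N](_ : _ = 0%N) ?addn0; last first.
  set u := 0 + _; have : all (fun j => edg g0 j != side g0 0) (mkseq (fun i => iter (4 + i) cstep 0) (4 * (g - 1))).
    rewrite /mkseq all_map; apply/allP => i; rewrite mem_iota add0n => /= i4.
    have -> : cstep (cstep (cstep (cstep (iter i cstep 0)))) =
        iter (i %% 4) cstep 0 + (4 * (i %/ 4).+1)%N%:Z.
      have e4 : (4 + i = 4 * (i %/ 4).+1 + i %% 4)%N by have := divn_eq i 4; lia.
      by rewrite -it0 -e4.
    have i4' := ltn_pmod i (isT : (0 < 4)%N); have d4 : (i %/ 4 < g - 1)%N by rewrite ltn_divLR// mulnC.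
    have [w w4 ->] : exists2 w, (w < 4)%N & iter (i %% 4) cstep 0 = w%:Z.
      by case: (i %% 4)%N i4' => [|[|[|[|]]]]// _; [exists 0%N|exists 3%N|exists 2%N|exists 1%N].
    rewrite addrC -PoszD; apply/eqP => /(congr1 (@nat_of_ord _)).
    rewrite edg_corner//; lia.
  elim: (mkseq _ _) u => //= j W IH u /andP[ne /IH ->].
  by rewrite /qedge xpair_eqE (negPf ne) andbF.
have e0 : edg g0 0 = side g0 0 by apply: ord_inj; exact: (etrans (@edg_corner0 0 isT) (esym s0E)).
have e2 : edg g0 2 = side g0 0 by apply: ord_inj; exact: (etrans (@edg_corner0 2 isT) (esym s0E)).
have e13 j : (j == 1) || (j == 3) -> edg g0 j != side g0 0.
  move=> /orP[]/eqP ->; apply/eqP => /(congr1 (@nat_of_ord _)); rewrite s0E.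
    by have -> : nat_of_ord (edg g0 1) = 1%N by exact: (@edg_corner0 1 isT).
  by have -> : nat_of_ord (edg g0 3) = 1%N by exact: (@edg_corner0 3 isT).
have d2 : dq g0 2 = dq g0 0 by rewrite /dq e2 e0.
have -> : edges g0 0 [:: 0; 3; 2; 1] = [:: (0, side g0 0); (dq g0 0 + dq g0 3, edg g0 3);
    (dq g0 3, side g0 0); (dq g0 3, edg g0 1)].
  rewrite /edges /qedge -[pos 0]/true -[pos 3]/false -[pos 2]/false -[pos 1]/true /= e0 e2 add0r d2.
  by rewrite [dq g0 0 + _]addrC addqK.
have n1 := negPf (e13 1 isT); have n3 := negPf (e13 3 isT).
move: n1 n3; set a1 := edg g0 1; set a3 := edg g0 3; move: a1 => a1 n1 n3.
rewrite /= !xpair_eqE n1 n3 !eqxx !andbF andbT /=.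
have -> : (dq g0 3 == 0) = false; last by [].
apply/eqP => /rowP/(_ (edg g0 3)); rewrite !mxE !eqxx /= => /eqP.
by rewrite oner_eq0.
Qed.

(** The field has dimension [2 ^ #|E|] over its prime field, which is both a power of 2 and at least
    the number of edges. *)
Lemma edge_vectors : exists (F : finFieldType) (k : nat) (v : 'rV['F_2]_(4 * g) * 'I_(4 * g) -> F),
  [/\ #|F| = (2 ^ (2 ^ k))%N, 2 \in [pchar F] &
      forall c : pred ('rV['F_2]_(4 * g) * 'I_(4 * g)), (exists x, c x) -> \sum_(x | c x) v x != 0].
Proof.
pose E : finType := ('rV['F_2]_(4 * g) * 'I_(4 * g))%type.
have [F char2 cardF] := PrimePowerField (isT : prime 2) (expn_gt0 2 #|E|).
have [v vP] := indep_family char2 cardF (ltnW (ltn_expl #|E| (ltnSn 1))).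
exists F, #|E|, (fun x => v (enum_rank (x : E))); split => // c [x0 cx0].
pose c' i := [exists x : E, (enum_rank x == i :> nat) && c x].
have c'E (x : E) : c' (enum_rank x) = c x.
  apply/existsP/idP => [[y /andP[/eqP/ord_inj/enum_rank_inj -> //]]|cx].
  by exists x; rewrite eqxx.
have := vP c' (ex_intro2 _ _ (enum_rank (x0 : E) : nat) (ltn_ord _) _).
rewrite c'E => /(_ cx0); rewrite big_mkord (reindex (@enum_rank E)) /=; last first.
  by exists enum_val => i _; [exact: enum_rankK|exact: enum_valK].
by under eq_bigl do rewrite c'E.
Qed.

(** The sheets are the states reachable from the zero vector with the first basis row. This set is
    stable under [z] because [z] is a power of the vertex word on each state. *)
Lemma sheets_ex : exists (S : finType) (tau : int -> S -> S) (z : S -> S) (s0 : S),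
  [/\ forall j s, tau (iota4 j) (tau j s) = s, forall j m s, tau (j + z4 * m) s = tau j s,
      forall j s, z (tau j s) = tau j (z s), forall s, z (z s) = s & forall s, z s != s] /\
  [/\ forall s, exists w, s = act tau w s0,
      forall W s, odd_word g0 W -> exists n, iter n (act tau W) s = z s &
      forall s, act tau vword s != s].
Proof.
have [F [k [v [cardF char2 vP]]]] := edge_vectors.
pose st : finType := ('rV['F_2]_(4 * g) * 'rV[F]_(2 ^ k).+1)%type.
pose a0 : st := (0, delta_mx 0 ord0).
pose t0 : int -> st -> st := tau0 g0 v.
pose A0 : seq int -> st -> st := act0 g0 v.
pose e (a b : st) := [exists j : 'I_(4 * g), b == t0 j%:Z a].
have eA a b : connect e a b -> exists W, b = A0 W a.
  move=> /connectP[p]; elim: p a => [|c p IH] a /=; first by move=> _ ->; exists [::].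
  move=> /andP[/existsP[j /eqP ac] /IH h] /h[W ->]; exists (j%:Z :: W); rewrite ac //.
have et j a : connect e a (t0 j a).
  apply: connect1; apply/existsP; exists (side g0 j); apply/eqP.
  have jE : j = (side g0 j)%:Z + z4 * (j %/ z4)%Z by rewrite sideE {1}(divz_eq j z4); ring.
  by rewrite [in LHS]jE /t0 tau0_per.
have eW W a : connect e a (A0 W a).
  elim: W a => [|j W IH] a; first exact: connect0.
  exact: connect_trans (et j a) (IH _).
have eWn n W a : connect e a (iter n (A0 W) a).
  elim: n => [|n IH]; first exact: connect0.
  exact: connect_trans IH (eW _ _).
have one a : connect e a0 a -> a.2 0 ord0 = 1.
  by move=> /eA[W ->]; rewrite (act0_first g0 cardF char2) mxE !eqxx.
pose P : pred st := fun a => connect e a0 a.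
pose S : finType := {a : st | P a}.
have tP j (s : S) : P (t0 j (val s)) by exact: connect_trans (valP s) (et _ _).
pose tau j (s : S) : S := Sub (t0 j (val s)) (tP j s).
have zP (s : S) : P (zz (val s)).
  have [n <-] := star0 cardF char2 vP (val s) vword_odd.
  exact: connect_trans (valP s) (eWn _ _ _).
pose z (s : S) : S := Sub (zz (val s)) (zP s).
have P0 : P a0 by exact: connect0.
have actE W (s : S) : val (act tau W s) = A0 W (val s).
  by elim: W s => //= j W IH s; rewrite IH.
have itE n W (s : S) : val (iter n (act tau W) s) = iter n (A0 W) (val s).
  by elim: n => // n IH; rewrite !iterS actE IH.
have star W (s : S) : odd_word g0 W -> exists n, iter n (act tau W) s = z s.
  move=> oW; have [n nE] := star0 cardF char2 vP (val s) oW; exists n.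
  by apply: val_inj; rewrite itE.
have zn (s : S) : z s != s.
  by rewrite -val_eqE /=; apply: zz_neq; exact: one (valP s).
exists S, tau, z, (Sub a0 P0); split; split.
- by move=> j s; apply: val_inj; exact: (tau0K g0 cardF char2).
- by move=> j m s; apply: val_inj; exact: tau0_per.
- by move=> j s; apply: val_inj; apply/esym; exact: tau0_z.
- by move=> s; apply: val_inj; exact: (zzK char2).
- exact: zn.
- by move=> s; have [W sE] := eA _ _ (valP s); exists W; apply: val_inj; rewrite actE.
- exact: star.
(* If the vertex word fixed a sheet, so would its powers, one of which is [z]. *)
- move=> s; apply: contra_not_neq (elimN eqP (zn s)) => sE; have [n <-] := star _ s vword_odd.
  by elim: n => //= n ->.
Qed.

End Sheets.

(* A word acts on integer cochains; [coh_trivial W] says that the closed lifts of a loop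
   with crossing word [W] are killed by every antisymmetric cochain [t]. *)
Section Words.
Variables (S : finType) (tau : int -> S -> S) (z : S -> S).
Hypothesis tauK : forall j s, tau (iota4 j) (tau j s) = s.
Hypothesis tauz : forall j s, z (tau j s) = tau j (z s).

Definition cochain (t : S -> int -> int) :=
  (forall s j, t (tau j s) (iota4 j) = - t s j) /\ (forall s j, t (z s) j = - t s j).

Fixpoint wsum (t : S -> int -> int) (W : seq int) (s : S) : int :=
  if W is j :: W' then t s j + wsum t W' (tau j s) else 0.

Lemma act_cat W W' s : act tau (W ++ W') s = act tau W' (act tau W s).
Proof. exact: foldl_cat. Qed.

Lemma wsum_cat t W W' s : wsum t (W ++ W') s = wsum t W s + wsum t W' (act tau W s).
Proof. by elim: W s => [|j W IH] s /=; rewrite ?add0r// IH addrA. Qed.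

Definition witer (W : seq int) (i : nat) : seq int := flatten (nseq i W).

Definition coh_trivial (W : seq int) := forall t, cochain t ->
  forall s i, iter i (act tau W) s = s -> wsum t (witer W i) s = 0.

Lemma act_z W s : act tau W (z s) = z (act tau W s).
Proof. by elim: W s => //= j W IH s; rewrite -tauz IH. Qed.

Lemma wsum_z t W s : cochain t -> wsum t W (z s) = - wsum t W s.
Proof.
move=> [_ tz]; elim: W s => [|j W IH] s /=; first by rewrite oppr0.
by rewrite tz -tauz IH opprD.
Qed.

Lemma wsum_witer t W i s : wsum t (witer W i) s = \sum_(k < i) wsum t W (iter k (act tau W) s).
Proof.
elim: i s => [|i IH] s; first by rewrite big_ord0.
rewrite /witer /= wsum_cat IH big_ord_recl /=; congr (_ + _).
by apply: eq_bigr => k _; rewrite -iterSr.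
Qed.

(** The sum along a closed orbit does not depend on its starting point, and starting at [z s]
    changes its sign; hence it equals its opposite. *)
Lemma coh_trivial_z W : (forall s, exists n, iter n (act tau W) s = z s) -> coh_trivial W.
Proof.
move=> h t ct s i si; rewrite wsum_witer; have [n nE] := h s.
pose f k := wsum t W (iter k (act tau W) s).
have per k : f (k + i)%N = f k by rewrite /f iterD si.
have sh u : \sum_(k < i) f (u + k)%N = \sum_(k < i) f k.
  elim: u => // u IH; rewrite -IH; case: i si per {IH} => [|i] si per; first by rewrite !big_ord0.
  rewrite [LHS]big_ord_recr [RHS]big_ord_recl /= addn0 addrC; congr (_ + _).
    by rewrite addSnnS per.
  by apply: eq_bigr => k _; rewrite /bump /= add1n addSnnS.
have : \sum_(k < i) f (n + k)%N = - \sum_(k < i) f k.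
  rewrite -sumrN; apply: eq_bigr => k _; rewrite /f addnC iterD nE.
  have -> : iter k (act tau W) (z s) = z (iter k (act tau W) s).
    by elim: (k : nat) => //= l ->; rewrite act_z.
  exact: wsum_z.
rewrite sh; set x := \sum_(_ < _) _; lia.
Qed.

Lemma coh_trivial_nil : coh_trivial [::].
Proof.
move=> t ct s i _; have -> : witer [::] i = [::] by elim: i.
by [].
Qed.

Lemma act_inj W : injective (act tau W).
Proof. by elim: W => //= j W IH s s' /IH/(can_inj (tauK j)). Qed.

Lemma coh_trivial_rot W W' : coh_trivial (W ++ W') -> coh_trivial (W' ++ W).
Proof.
move=> h t ct s i si.
have [s1 sE] : exists s1, s = act tau W s1.
  have [f _ fK] := injF_bij (@act_inj W).
  by exists (f s); rewrite fK.
have comm k u : iter k (act tau (W' ++ W)) (act tau W u) = act tau W (iter k (act tau (W ++ W')) u).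
  by elim: k => //= k ->; rewrite !act_cat.
have s1i : iter i (act tau (W ++ W')) s1 = s1 by apply: (@act_inj W); rewrite -comm -sE si.
have := h t ct s1 i s1i; rewrite !wsum_witer sE => H.
under eq_bigr do rewrite comm wsum_cat -act_cat.
have {}H : \sum_(k < i) (wsum t W (iter k (act tau (W ++ W')) s1) +
    wsum t W' (act tau W (iter k (act tau (W ++ W')) s1))) = 0.
  by rewrite -[RHS]H; apply: eq_bigr => k _; rewrite wsum_cat.
rewrite -[RHS]H.
rewrite !big_split /= addrC; congr (_ + _).
pose f k := wsum t W (iter k (act tau (W ++ W')) s1).
have -> : \sum_(k < i) wsum t W (act tau (W ++ W') (iter k (act tau (W ++ W')) s1)) = \sum_(k < i) f k.+1 by [].
case: i si s1i H => [|i] si s1i H; first by rewrite !big_ord0.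
rewrite big_ord_recr big_ord_recl addrC /=; congr (_ + _).
by rewrite /f s1i.
Qed.

Lemma coh_trivial_cancel W j : coh_trivial W -> coh_trivial (j :: iota4 j :: W).
Proof.
move=> h t ct s i; have aE u : act tau (j :: iota4 j :: W) u = act tau W u by rewrite /= tauK.
have itE k u : iter k (act tau (j :: iota4 j :: W)) u = iter k (act tau W) u.
  by elim: k => // k IH; rewrite !iterS IH aE.
rewrite itE => si; rewrite -[RHS](h t ct s i si) !wsum_witer; apply: eq_bigr => k _.
by rewrite itE /= tauK ct.1 addrA subrr add0r.
Qed.

End Words.

(** * Harmonic cochains *)

Lemma dim_solve (F : fieldType) (U E : finType) (f : E -> (U -> F) -> F) :
  (forall e a x y, f e (fun u => a * x u + y u) = a * f e x + f e y) ->
  (#|E| < #|U|)%N -> exists2 x : U -> F, exists u, x u != 0 & forall e, f e x = 0.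
Proof.
move=> fl EU; pose dl (v u : U) : F := (u == v)%:R.
have f0 e : f e (fun=> 0) = 0.
  have := fl e 1 (fun=> 0) (fun=> 0); rewrite mulr0 addr0 mul1r => h.
  by apply/eqP; rewrite -(inj_eq (addrI (f e (fun=> 0)))) -h addr0.
have fsum e (x : U -> F) (r : seq U) :
    f e (fun u => \sum_(v <- r) x v * dl v u) = \sum_(v <- r) x v * f e (dl v).
  elim: r => [|v r IH].
    by rewrite big_nil -[RHS](f0 e); congr (f e _); apply/funext => u; rewrite big_nil.
  rewrite big_cons -IH -fl; congr (f e _); apply/funext => u; by rewrite big_cons.
pose A : 'M[F]_(#|U|, #|E|) := \matrix_(i, j) f (enum_val j) (dl (enum_val i)).
have kA : kermx A != 0.
  rewrite -mxrank_eq0 mxrank_ker subn_eq0 -ltnNge.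
  by apply: leq_ltn_trans EU; exact: rank_leq_col.
have [i /eqP ri] : exists i, row i (kermx A) != 0.
  apply/existsP; rewrite -negb_forall; apply: contraNN kA => /forallP r0.
  by apply/eqP/row_matrixP => i; rewrite row0; exact/eqP.
have rA : row i (kermx A) *m A = 0 by rewrite -row_mul mulmx_ker row0.
set r := row i (kermx A) in ri rA; exists (fun u => r 0 (enum_rank u)).
  apply/existsP; rewrite -negb_forall; apply: contra_notN ri => /forallP r0.
  by apply/rowP => j; rewrite [RHS]mxE -[j]enum_valK; exact/eqP.
move=> e; have := congr1 (fun M : 'rV_#|E| => M 0 (enum_rank e)) rA; rewrite !mxE => E0.
rewrite -[RHS]E0 (reindex (@enum_rank U)) /=; last first.
  by exists enum_val => j _; [exact: enum_rankK|exact: enum_valK].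
have -> : (fun u => r 0 (enum_rank u)) = (fun u => \sum_v r 0 (enum_rank v) * dl v u).
  apply/funext => u; rewrite (bigD1 u)//= /dl eqxx mulr1 big1 ?addr0// => v vu.
  by rewrite eq_sym (negPf vu) mulr0.
rewrite fsum; apply: eq_bigr => v _; congr (_ * _).
by rewrite mxE !enum_rankK.
Qed.

Lemma clear_denominators (U : finType) (x : U -> rat) : exists (D : int) (y : U -> int),
  D != 0 /\ forall u, (y u)%:~R = D%:~R * x u.
Proof.
exists (\prod_u denq (x u)), (fun u => numq (x u) * \prod_(v | v != u) denq (x v)); split.
  by apply/prodf_neq0 => u _; exact: denq_neq0.
move=> u; rewrite [in RHS](bigD1 u)//= !intrM numqE; ring.
Qed.

Section Harmonic.
Variable g : nat.
Hypothesis g0 : (0 < g)%N.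
Notation z4 := ((4 * g)%N%:Z).
Variables (S : finType) (tau : int -> S -> S) (z : S -> S) (s0 : S).
Hypothesis tauK : forall j s, tau (iota4 j) (tau j s) = s.
Hypothesis tau_per : forall j m s, tau (j + z4 * m) s = tau j s.
Hypothesis tauz : forall j s, z (tau j s) = tau j (z s).
Hypothesis zK : forall s, z (z s) = s.
Hypothesis zn : forall s, z s != s.
Notation cor := (S * 'I_(4 * g))%type.

Definition corner (c : cor) : cor := (tau (c.2 : nat)%:Z c.1, side g0 (iota4 (c.2 : nat)%:Z + 1)).

Lemma side_id (i : 'I_(4 * g)) : side g0 (i : nat)%:Z = i.
Proof. by apply: ord_inj; rewrite side_small. Qed.

Lemma sideK j : exists m, j = (side g0 j : nat)%:Z + z4 * m.
Proof. by exists (j %/ z4)%Z; rewrite sideE {1}(divz_eq j z4); ring. Qed.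

Lemma tau_side j s : tau (side g0 j : nat)%:Z s = tau j s.
Proof. by have [m {2}->] := sideK j; rewrite tau_per. Qed.

Lemma side_cstep j : side g0 (iota4 (side g0 j : nat)%:Z + 1) = side g0 (cstep j).
Proof.
have [m {2}->] := sideK j; rewrite /cstep iota4_per addrAC.
by rewrite [RHS]side_per.
Qed.

Lemma corner_inj : injective corner.
Proof.
move=> [s i] [s' i'] E0; have /= sE := congr1 fst E0; have /side_eq[m] := congr1 snd E0.
rewrite -addrA [1 + _]addrC addrA => /addIr E; have {}E : (i : nat)%:Z = (i' : nat)%:Z + z4 * m.
  by rewrite -[LHS]iota4K E iota4_per iota4K.
have ii : i = i' by rewrite -(side_id i) E side_per side_id.
by move: sE; rewrite ii => /(can_inj (tauK _)) ->.
Qed.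

Lemma iter_corner n s j : iter n corner (s, side g0 j) =
  (act tau (mkseq (fun i => iter i cstep j) n) s, side g0 (iter n cstep j)).
Proof.
elim: n => // n IH; rewrite iterS IH mkseqS -cats1 act_cat /corner tau_side.
by rewrite side_cstep.
Qed.

Lemma corner_idxK j : corner_idx (corner_idx j) = j.
Proof.
rewrite (divz_eq j 4); move: (modz_ge0 j (isT : 4 != 0 :> int)) (ltz_pmod j (isT : 0 < 4 :> int)).
set d := divz j 4; case: (modz j 4) => // r _ r4.
have -> : d * 4 + r%:Z = r%:Z + 4 * d by ring.
rewrite !corner_idxD; congr (_ + _).
by case: r r4 => [|[|[|[|r]]]].
Qed.

Lemma corner_idx_iter n j : corner_idx (iter n cstep j) = corner_idx j + n%:Z.
Proof.
elim: n => [|n IH]; first by rewrite addr0.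
by rewrite iterS /cstep corner_idx_next IH -addrA -PoszD addn1.
Qed.

(** There are thus at most as many vertices as sheets, which bounds the number of vertex
    equations. *)
Lemma corner_to0 (c : cor) : exists s, fconnect corner c (s, side g0 0).
Proof.
case: c => s i; pose n := `|(- corner_idx (i : nat)%:Z %% z4)%Z|%N.
have z0 := z4_gt0 g0.
have nE : n%:Z = (- corner_idx (i : nat)%:Z %% z4)%Z by rewrite /n gez0_abs// modz_ge0// gt_eqF.
exists (act tau (mkseq (fun l => iter l cstep (i : nat)%:Z) n) s).
have := iter_corner n s (i : nat)%:Z; rewrite side_id => E.
have -> : side g0 0 = side g0 (iter n cstep (i : nat)%:Z).
  have : exists m, corner_idx (iter n cstep (i : nat)%:Z) = z4 * m.
    rewrite corner_idx_iter nE; exists (- (- corner_idx (i : nat)%:Z %/ z4)%Z).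
    by have := divz_eq (- corner_idx (i : nat)%:Z) z4; lia.
  move=> [m mE]; rewrite -[iter n _ _]corner_idxK mE PoszM -mulrA -[4 * _]add0r corner_idxD.
  by rewrite [4 * _]mulrA -PoszM side_per.
by rewrite -E; exact: fconnect_iter.
Qed.

Definition zc (c : cor) : cor := (z c.1, c.2).

Lemma corner_z c : corner (zc c) = zc (corner c).
Proof. by rewrite /corner /zc /= tauz. Qed.

Lemma fconnect_z c c' : fconnect corner (zc c) (zc c') = fconnect corner c c'.
Proof.
suff H a b : fconnect corner a b -> fconnect corner (zc a) (zc b).
  apply/idP/idP; last exact: H.
  by move=> /H; rewrite /zc /= !zK; case: c c' => ? ? [].
move=> /iter_findex <-; elim: (findex _ _ _) => [|n IH] /=; first exact: connect0.
by rewrite -corner_z; apply: connect_trans IH (fconnect1 _ _).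
Qed.

(** One sheet in each orbit of [z]; the unknowns and equations are indexed by these, and odd
    cochains are their odd extensions [xS]. *)
Definition half (s : S) : bool := (enum_rank s < enum_rank (z s))%N.

Lemma half_z s : half (z s) = ~~ half s.
Proof.
rewrite /half zK -leqNgt ltn_neqAle; case: eqVneq => //= E.
by have := zn s; rewrite -(inj_eq enum_rank_inj) -val_eqE /= E eqxx.
Qed.

Notation T := {s : S | half s}.
Notation U := (T * ('I_g * bool))%type.

Section Field.
Variable F : comNzRingType.

Definition xS (x : U -> F) (s : S) (e : 'I_g * bool) : F :=
  if insub s is Some t then x (t, e) else if insub (z s) is Some t then - x (t, e) else 0.

Lemma xS_half x (t : T) e : xS x (val t) e = x (t, e).
Proof. by rewrite /xS valK. Qed.

Lemma xS_z x s e : xS x (z s) e = - xS x s e.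
Proof.
have hz := half_z s; rewrite /xS zK; case: (boolP (half s)) hz => hs hz.
  by rewrite (insubN _ (negbT hz)) insubT.
by rewrite (insubT _ hz) (insubN _ hs) opprK.
Qed.

Fact sidx_lt (i : 'I_(4 * g)) : (i %/ 4 < g)%N.
Proof. by rewrite ltn_divLR//; have := ltn_ord i; lia. Qed.

Definition sidx (i : 'I_(4 * g)) : 'I_g * bool := (Ordinal (sidx_lt i), odd i).

Definition eidx (j : int) := sidx (side g0 (if pos j then j else iota4 j)).

Lemma eidx_iota j : eidx (iota4 j) = eidx j.
Proof. by rewrite /eidx pos_iota iota4K; case: (pos j). Qed.

Lemma eidx_per j m : eidx (j + z4 * m) = eidx j.
Proof.
by rewrite /eidx pos_per iota4_per; case: ifP => _; rewrite side_per.
Qed.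

Definition nS (x : U -> F) (s : S) (j : int) : F :=
  if pos j then xS x s (eidx j) else - xS x (tau j s) (eidx j).

Lemma nS_iota x s j : nS x (tau j s) (iota4 j) = - nS x s j.
Proof. by rewrite /nS pos_iota eidx_iota tauK; case: (pos j); rewrite //= opprK. Qed.

Lemma nS_per x s j m : nS x s (j + z4 * m) = nS x s j.
Proof. by rewrite /nS pos_per eidx_per tau_per. Qed.

Lemma nS_z x s j : nS x (z s) j = - nS x s j.
Proof. by rewrite /nS -tauz !xS_z; case: (pos j). Qed.

Definition eqs (e : T + T) (x : U -> F) : F :=
  match e with
  | inl t => \sum_(i < 4 * g) nS x (val t) (i : nat)%:Z
  | inr t => \sum_(c : cor | fconnect corner (val t, side g0 0) c) nS x c.1 (c.2 : nat)%:Z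
  end.

Lemma nS_linear a x y s j : nS (fun u => a * x u + y u) s j = a * nS x s j + nS y s j.
Proof.
have xL s' e : xS (fun u => a * x u + y u) s' e = a * xS x s' e + xS y s' e.
  by rewrite /xS; case: insub => [t|]; [ring|case: insub => [t|]; ring].
by rewrite /nS !xL; case: ifP => _; ring.
Qed.

Lemma eqs_linear e a x y : eqs e (fun u => a * x u + y u) = a * eqs e x + eqs e y.
Proof.
by case: e => t /=; rewrite mulr_sumr -big_split /=; apply: eq_bigr => i _; exact: nS_linear.
Qed.

End Field.

Lemma nS_int (y : U -> int) s j : (nS y s j)%:~R = nS (fun u => (y u)%:~R : rat) s j.
Proof.
have xE s' e : (xS y s' e)%:~R = xS (fun u => (y u)%:~R : rat) s' e.
  by rewrite /xS; case: insub => // ; case: insub => [t|//]; rewrite rmorphN.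
by rewrite /nS; case: ifP; rewrite ?rmorphN /= xE.
Qed.

Definition harmonic (N : S -> int -> int) := [/\ cochain tau z N,
  forall s j m, N s (j + z4 * m) = N s j, forall s, \sum_(i < 4 * g) N s (i : nat)%:Z = 0 &
  forall c : cor, \sum_(c' | fconnect corner c c') N c'.1 (c'.2 : nat)%:Z = 0].

(** With [T] the set of half sheets, there are [#|T| * 2 * g] unknowns, [#|T|] equations from the
    sheets and [#|T|] from the corners numbered 0, so a nonzero rational solution exists when
    [2 < 2 * g]. Clearing denominators makes it integral, and oddness extends the equations to all
    sheets and vertices. *)
Lemma harmonic_ex : (1 < g)%N -> exists2 N, harmonic N & exists (s : S) (i : 'I_(4 * g)), N s (i : nat)%:Z != 0.
Proof.
move=> g1; have T0 : (0 < #|{: T}|)%N.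
  apply/card_gt0P; case: (boolP (half s0)) => h; first by exists (Sub s0 h).
  by rewrite -half_z in h; exists (Sub (z s0) h).
have [|x [u xu] xP] := @dim_solve rat U (T + T)%type (@eqs rat) (@eqs_linear rat).
  rewrite card_sum !card_prod card_ord card_bool addnn -mul2n mulnC ltn_pmul2l//.
  by rewrite -[2%N]mul1n ltn_pmul2r.
have [D [y [D0 yE]]] := clear_denominators x.
have yx : (fun u => (y u)%:~R : rat) = (fun u => D%:~R * x u + 0).
  by apply/funext => v; rewrite addr0.
have nE s j : (nS y s j)%:~R = D%:~R * nS x s j.
  rewrite nS_int yx nS_linear [X in _ + X](_ : _ = 0) ?addr0//.
  have x0 s' e : xS (fun=> 0 : rat) s' e = 0.
    by rewrite /xS; case: insub => //; case: insub => // t; rewrite oppr0.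
  by rewrite /nS !x0 oppr0; case: ifP.
have sumE (I : finType) (P : pred I) (h : I -> S * int) :
    \sum_(i | P i) nS x (h i).1 (h i).2 = 0 -> \sum_(i | P i) nS y (h i).1 (h i).2 = 0.
  move=> E; apply/eqP; rewrite -(intr_eq0 rat) rmorph_sum /=.
  by under eq_bigr do rewrite nE; rewrite -mulr_sumr E mulr0.
have face s : \sum_(i < 4 * g) nS y s (i : nat)%:Z = 0.
  wlog hs : s / half s.
    move=> H; case: (boolP (half s)) => hs; first exact: H.
    rewrite -half_z in hs; have := H _ hs; under eq_bigr do rewrite nS_z.
    by rewrite sumrN => /eqP; rewrite oppr_eq0 => /eqP.
  exact: (sumE _ _ (fun i : 'I_(4 * g) => (s, (i : nat)%:Z)) (xP (inl (Sub s hs)))).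
exists (nS y); last first.
  case: u xu => t [k b] xu; have lt : (4 * k + b < 4 * g)%N.
    by have := ltn_ord k; case: (b) => /=; lia.
  exists (val t), (Ordinal lt); rewrite -(intr_eq0 rat) nE mulf_neq0 ?intr_eq0//.
  have pE : pos (4 * k + b)%N%:Z.
    by rewrite /pos PoszD PoszM mulrC modzMDl; case: (b).
  rewrite /nS /= pE xS_half; set e := eidx _; suff -> : e = (k, b) by [].
  rewrite /e /eidx pE /sidx; congr pair.
    by apply: val_inj; rewrite /= -[X in (X %/ 4)%N]/(nat_of_ord (side g0 _)) side_small// mulnC divnMDl// divn_small ?addn0//; case: (b).
  by rewrite side_small// oddD oddM /=; case: (b).
split.
- by split=> [s j|s j]; [exact: nS_iota|exact: nS_z].
- by move=> s j m; exact: nS_per.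
- exact: face.
- have base s : \sum_(c' | fconnect corner (s, side g0 0) c') nS y c'.1 (c'.2 : nat)%:Z = 0.
    wlog hs : s / half s.
      move=> H; case: (boolP (half s)) => hs; first exact: H.
      rewrite -half_z in hs; have := H _ hs.
      rewrite (reindex zc) /=; last by exists zc => -[c i] _; rewrite /zc /= zK.
      under eq_bigl do rewrite -[(z s, _)]/(zc (s, _)) fconnect_z.
      under eq_bigr do rewrite nS_z.
      by rewrite sumrN => /eqP; rewrite oppr_eq0 => /eqP.
    exact: (sumE _ _ (fun c : cor => (c.1, (c.2 : nat)%:Z)) (xP (inr (Sub s hs)))).
  move=> c; have [s cs] := corner_to0 c; rewrite -[RHS](base s); apply: eq_bigl => c'.
  by rewrite (same_connect (fconnect_sym corner_inj) cs).
Qed.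

End Harmonic.

(** * Chord diagrams *)

(* Points on the boundary of a polygon, in the order [rk] in which they occur.  [sd] is the side of
   a point, [m] matches points across an edge, [ch] joins the two ends of a chord, and [ql] is the
   sheet of the chord in the mod 2 homology cover.  If the closed curve made of the chords is
   null-homologous mod 2 in that cover, it bounds a region, black, away from the corners; the region
   retracts to a graph all of whose vertices have degree at least 2, and a mod 2 cycle [y] of this
   graph is crossed once by an arc between two points of the connected curve: a contradiction. *)
Section Diagram.
Variables (T I : finType) (Q : finZmodType) (K : nat).
Variables (rk : T -> nat) (sd : T -> I) (m ch : T -> T) (io : I -> I) (le : I -> nat).
Variables (ql : T -> Q) (d : I -> Q) (sp : pred I) (co : I -> Q -> 'F_2).
Hypothesis rk_inj : injective rk.
Hypothesis rk_lt : forall P, (rk P < #|T|)%N.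
Hypothesis le_inj : injective le.
Hypothesis sd_mono : forall P P', (rk P < rk P')%N -> (le (sd P) <= le (sd P'))%N.
Hypothesis mK : involutive m.
Hypothesis chK : involutive ch.
Hypothesis ioK : involutive io.
Hypothesis sp_io : forall j, sp (io j) = ~~ sp j.
Hypothesis sd_m : forall P, sd (m P) = io (sd P).
Hypothesis m_rev : forall P P', sd P = sd P' -> (rk P < rk P')%N -> (rk (m P') < rk (m P))%N.
Hypothesis unlinked : forall P P', (rk P < rk P')%N -> (rk P' < rk (ch P))%N -> (rk (ch P') < rk (ch P))%N.
Hypothesis noret : forall P, sd (ch P) != sd P.
Hypothesis ql_ch : forall P, ql (ch P) = ql P.
Hypothesis ql_m : forall P, ql (m P) = ql P + d (sd P).
Hypothesis Q2 : forall x : Q, x + x = 0.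
Hypothesis d_io : forall j, d (io j) = d j.
Hypothesis co_add : forall j x y, co j (x + y) = co j x + co j y.
Hypothesis co_d : forall j i, sp j -> sp i -> co j (d i) = (i == j)%:R.
Hypothesis even : forall x j, \sum_(P | (sd P == j) && (ql P == x)) 1 = 0 :> 'F_2.
Hypothesis conn : forall f : T -> 'F_2, (forall P, f (m P) = f P) -> (forall P, f (ch P) = f P) ->
  forall P P', f P = f P'.

Lemma F2D (x : 'F_2) : x + x = 0. Proof. by rewrite addrr_pchar2// pchar_Fp. Qed.

Lemma F2_odd n : (n%:R : 'F_2) = if odd n then 1 else 0.
Proof.
transitivity ((odd n)%:R : 'F_2); last by case: (odd n).
by rewrite -[in LHS](odd_double_half n) natrD -mul2n natrM (_ : 2%:R = 0) ?mul0r ?addr0//; exact: val_inj.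
Qed.

Lemma rk_surj k : (k < #|T|)%N -> exists P, rk P = k.
Proof.
move=> kT; pose f P : 'I_#|T| := Ordinal (rk_lt P).
have fi : injective f by move=> P P' /(congr1 val)/rk_inj.
have := inj_card_onto fi _ (Ordinal kT); rewrite card_ord leqnn => /(_ isT)/codomP[P /(congr1 val) /= ->].
by exists P.
Qed.

Lemma inv_sum0 (f : T -> T) (A : pred T) (h : T -> 'F_2) : involutive f -> (forall P, f P != P) ->
  (forall P, A P -> A (f P)) -> (forall P, h (f P) = h P) -> \sum_(P | A P) h P = 0.
Proof.
move=> fK fn Af hf; have Aff P : A (f P) = A P by apply/idP/idP => /Af; rewrite ?fK.
rewrite (bigID (fun P => (rk P < rk (f P))%N)) /= [X in _ + X](reindex_inj (inv_inj fK)) /=.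
rewrite [X in _ + X](eq_big (fun P => A P && (rk P < rk (f P))%N) h); first exact: F2D.
  move=> P; rewrite Aff fK -leqNgt leq_eqVlt orbC; case: ltnP => //= _.
  by rewrite (inj_eq rk_inj) eq_sym (negPf (fn P)).
by move=> P _; rewrite hf.
Qed.

(** Sum of [h] along the boundary from the starting corner up to [P], with [P] excluded. *)
Definition cum (h : T -> 'F_2) (P : T) := \sum_(P' | (rk P' < rk P)%N) h P'.
Definition side0 (h : T -> 'F_2) := forall j, \sum_(P | sd P == j) h P = 0.

Lemma side_sum h (C : pred I) : side0 h -> \sum_(P | C (sd P)) h P = 0.
Proof.
move=> h0; rewrite (partition_big sd C)//= big1// => j Cj; rewrite -[RHS](h0 j); apply: eq_bigl => P.
by case: eqP => [->|_]; rewrite ?andbF// Cj.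
Qed.

Lemma cum_side h P : side0 h -> cum h P = \sum_(P' | (sd P' == sd P) && (rk P' < rk P)%N) h P'.
Proof.
move=> h0; rewrite /cum (bigID (fun P' => sd P' == sd P)) /= [X in _ + X](_ : _ = 0) ?addr0.
  by apply: eq_bigl => P'; rewrite andbC.
rewrite -[RHS](side_sum (fun i => (le i < le (sd P))%N) h0); apply: eq_bigl => P'.
apply/andP/idP => [[lt ne]|lt].
  by rewrite ltn_neqAle sd_mono// andbT (inj_eq le_inj).
split; last by apply: contraTneq lt => ->; rewrite ltnn.
rewrite ltnNge leq_eqVlt; apply/negP => /orP[/eqP/rk_inj E|/sd_mono].
  by move: lt; rewrite E ltnn.
by rewrite leqNgt lt.
Qed.

(** Matching across an edge reverses the order, so what precedes [m P] on its side is what follows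
    [P] on the other; as each side has sum 0, this equals what precedes [P], together with [P]. *)
Lemma cum_cross h h' P : side0 h -> side0 h' -> (forall P', sd P' = sd P -> h' (m P') = h P') ->
  cum h' (m P) = cum h P + h P.
Proof.
move=> h0 h0' hm; rewrite !cum_side// (reindex_inj (inv_inj mK)) /=.
have -> : \sum_(P' | (sd (m P') == sd (m P)) && (rk (m P') < rk (m P))%N) h' (m P') =
    \sum_(P' | (sd P' == sd P) && (rk P < rk P')%N) h P'.
  apply: eq_big => [P'|P' /andP[/eqP sE _]]; last first.
    by apply: hm; move: sE; rewrite !sd_m => /(inv_inj ioK).
  rewrite !sd_m (inj_eq (inv_inj ioK)); case: eqP => //= sE.
  case: (ltngtP (rk P') (rk P)) => lt.
  - by have := m_rev sE lt; rewrite ltnNge => /negPf; rewrite leq_eqVlt => /norP[_ /negPf].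
  - by rewrite m_rev.
  - by rewrite (rk_inj lt) ltnn.
have := h0 (sd P); rewrite (bigD1 P)//= (bigID (fun P' => (rk P' < rk P)%N)) /=.
set a := \sum_(_ | _) _; set b := \sum_(_ | _) _ => E.
have -> : \sum_(P' | (sd P' == sd P) && (rk P < rk P')%N) h P' = b.
  apply: eq_bigl => P'; rewrite -andbA -leqNgt; congr (_ && _).
  by rewrite ltn_neqAle (inj_eq rk_inj) eq_sym.
have -> : \sum_(P' | (sd P' == sd P) && (rk P' < rk P)%N) h P' = a.
  apply: eq_bigl => P'; rewrite -andbA; congr (_ && _).
  by case: eqP => [->|//]; rewrite ltnn.
have E2 : b = - (h P + a) by apply/eqP; rewrite -addr_eq0 addrC -addrA E.
by rewrite E2 addrC; apply/eqP; rewrite -subr_eq0 -opprD F2D oppr0.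
Qed.

(** The points strictly between the ends of a chord are joined to each other by chords, so they
    cancel in pairs. *)
Lemma cum_chord h P : (forall P', h (ch P') = h P') -> (forall P', rk P < rk P' < rk (ch P) -> h P' = h P')%N ->
  (rk P < rk (ch P))%N -> cum h (ch P) = cum h P + h P.
Proof.
move=> hc _ lt; rewrite /cum (bigID (fun P' => (rk P' < rk P)%N)) /=; congr (_ + _).
  apply: eq_bigl => P'; case: (ltnP (rk P') (rk P)) => h'; rewrite ?andbF// andbT.
  exact: ltn_trans lt.
rewrite (bigD1 P) /=; last by rewrite lt ltnn.
rewrite (_ : \sum_(_ | _) _ = 0) ?addr0//.
have chn P' : ch P' != P' by apply: contraNneq (noret P') => ->.
rewrite (eq_bigl (fun P' => (rk P < rk P' < rk (ch P))%N)); last first.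
  move=> P'; rewrite -leqNgt -andbA andbC; congr (_ && _).
  by rewrite [RHS]ltn_neqAle (inj_eq rk_inj) eq_sym andbC.
apply: (inv_sum0 chK chn) => // P' /andP[l1 l2]; rewrite (unlinked l1 l2) andbT.
rewrite ltnNge leq_eqVlt; apply/negP => /orP[/eqP/rk_inj E|l3].
  by move: l2; rewrite -E chK ltnn.
have := unlinked l3; rewrite chK => /(_ l1); rewrite ltnNge => /negP; apply.
exact: ltnW.
Qed.

Definition hq (x : Q) (P : T) : 'F_2 := (ql P == x)%:R.

Lemma side0_hq x : side0 (hq x).
Proof.
by move=> j; rewrite -[RHS](even x j) [RHS]big_mkcondr; apply: eq_bigr => P _; rewrite /hq; case: ifP.
Qed.

Lemma sum_hq P : \sum_x hq x P = 1.
Proof. by rewrite (bigD1 (ql P))//= big1 ?addr0 /hq ?eqxx// => x; rewrite eq_sym => /negPf ->. Qed.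

Lemma side0_1 : side0 (fun=> 1).
Proof.
move=> j; under eq_bigr => P _ do rewrite -(sum_hq P).
by rewrite exchange_big /= big1// => x _; exact: side0_hq.
Qed.

Lemma cum1 P : cum (fun=> 1) P = (rk P)%:R.
Proof.
rewrite /cum sumr_const; congr (_ *+ _).
have rT := ltnW (rk_lt P); rewrite -[RHS](card_ord (rk P)).
have [f fE] := choice (fun i : 'I_(rk P) => rk_surj (leq_trans (ltn_ord i) rT)).
have fi : injective f by move=> i i' /(congr1 rk); rewrite !fE => /ord_inj.
rewrite -(card_codom fi); apply: eq_card => P'; apply/idP/codomP => [lt|[i ->]].
  by exists (Ordinal lt); apply: rk_inj; rewrite fE.
by have : (rk (f i) < rk P)%N by rewrite fE.
Qed.

Lemma odd_m P : odd (rk (m P)) = ~~ odd (rk P).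
Proof.
have := cum_cross (P := P) side0_1 side0_1 (fun _ _ => erefl); rewrite !cum1 !F2_odd.
by case: (odd _); case: (odd _) => // /eqP.
Qed.

Lemma odd_ch P : odd (rk (ch P)) = ~~ odd (rk P).
Proof.
wlog lt : P / (rk P < rk (ch P))%N.
  move=> H; case: (ltngtP (rk P) (rk (ch P))) => lt; first exact: H.
    by have := H (ch P); rewrite chK => /(_ lt) ->; rewrite negbK.
  by have := noret P; rewrite (rk_inj (esym lt)) eqxx.
have := cum_chord (h := fun=> 1) (fun=> erefl) (fun _ _ => erefl) lt; rewrite !cum1 !F2_odd.
by case: (odd _); case: (odd _) => // /eqP.
Qed.

Lemma odd_T : ~~ odd #|T|.
Proof.
have := side_sum predT side0_1; rewrite (eq_bigl predT)// sumr_const F2_odd.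
by case: (odd _) => // /eqP.
Qed.

Lemma bs_ex P : exists P', rk P' == (if odd (rk P) then (rk P).-1 else (rk P).+1).
Proof.
suff [P' <-] : exists P', rk P' = (if odd (rk P) then (rk P).-1 else (rk P).+1) by exists P'.
apply: rk_surj; have := rk_lt P; case: ifP => o lt; first exact: leq_ltn_trans (leq_pred _) lt.
rewrite ltn_neqAle lt andbT; apply: contraNneq odd_T => <- /=; by rewrite o.
Qed.

(** The other end of the black interval at [P]: the boundary is coloured alternately, and the points
    of ranks [2 i] and [2 i + 1] bound a black interval. *)
Definition bs P := xchoose (bs_ex P).

Lemma rk_bs P : rk (bs P) = (if odd (rk P) then (rk P).-1 else (rk P).+1).
Proof. exact: (eqP (xchooseP (bs_ex P))). Qed.

Lemma odd_bs P : odd (rk (bs P)) = ~~ odd (rk P).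
Proof.
rewrite rk_bs; case: ifP => //= o; last by rewrite o.
by move: o; case: (rk P) => //= k /negPf.
Qed.

Lemma bsK : involutive bs.
Proof.
move=> P; apply: rk_inj; rewrite rk_bs odd_bs rk_bs; case: (boolP (odd (rk P))) => //= o.
by case: (rk P) o.
Qed.

(** Each side carries an even number of points, so no black interval contains a corner. *)
Lemma bs_sd P : sd (bs P) = sd P.
Proof.
wlog op : P / ~~ odd (rk P).
  move=> H; case: (boolP (odd (rk P))) => o; last exact: H.
  by have := H (bs P); rewrite odd_bs o bsK => ->.
have rE : rk (bs P) = (rk P).+1 by rewrite rk_bs (negPf op).
apply/le_inj/eqP; rewrite eqn_leq [X in _ && X]sd_mono ?rE// andbT leqNgt; apply/negP => lt.
have := side_sum (fun i => (le i <= le (sd P))%N) side0_1.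
rewrite (eq_bigl (fun P' => (rk P' < rk (bs P))%N)).
  by rewrite -/(cum _ _) cum1 rE F2_odd /= op => /eqP.
move=> P'; rewrite rE ltnS; apply/idP/idP => h.
  rewrite leqNgt; apply/negP; have -> : (rk P < rk P')%N = (rk (bs P) <= rk P')%N by rewrite rE.
  rewrite leq_eqVlt => /orP[/eqP/rk_inj E|/sd_mono].
    by move: lt; rewrite E ltnNge h.
  by move=> /(leq_trans lt)/leq_trans/(_ h); rewrite ltnn.
by move: h; rewrite leq_eqVlt => /orP[/eqP/rk_inj ->|/sd_mono].
Qed.

(** The matching changes parity and reverses the order on a side. A point between [m (bs P)] and
    [m P] would be matched with a point strictly between [P] and [bs P], which have consecutive
    ranks. *)
Lemma bs_m P : m (bs P) = bs (m P).
Proof.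
wlog op : P / ~~ odd (rk P).
  move=> H; case: (boolP (odd (rk P))) => o; last exact: H.
  have := H (bs P); rewrite odd_bs o bsK => /(_ isT) ->.
  by rewrite bsK.
have rE : rk (bs P) = (rk P).+1 by rewrite rk_bs (negPf op).
have lt : (rk (m (bs P)) < rk (m P))%N by apply: m_rev; rewrite ?rE// bs_sd.
apply: rk_inj; rewrite rk_bs odd_m op; apply/eqP; rewrite eqn_leq -ltnS.
have m0 : (0 < rk (m P))%N by exact: leq_ltn_trans lt.
rewrite prednK// lt /= leqNgt; apply/negP => lt2.
have [|P' P'E] := @rk_surj (rk (m P)).-1; first by rewrite (leq_ltn_trans (leq_pred _) (rk_lt (m P))).
rewrite -P'E in lt2; have lt3 : (rk P' < rk (m P))%N by rewrite P'E prednK.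
have s1 := sd_mono lt2; have s2 := sd_mono lt3.
have sE : sd P' = sd (m P).
  by apply: le_inj; apply/eqP; rewrite eqn_leq s2 /= (leq_trans _ s1)// !sd_m bs_sd.
have a1 : (rk P < rk (m P'))%N by have := m_rev sE lt3; rewrite mK.
have a2 : (rk (m P') < rk (bs P))%N.
  by have := @m_rev (m (bs P)) P' _ lt2; rewrite mK; apply; rewrite sE !sd_m bs_sd.
by move: a2; rewrite rE ltnS leqNgt a1.
Qed.

(** For a fixed shift [h], the parity of the number of points before [P'] with label [ql P' + h] is
    preserved by [m] and [ch], hence the same for all [P'] by connectedness. It is 0 at the first
    point of the side that carries one of the two labels in question. *)
Lemma cum_label P x : x != ql P -> cum (hq x) P = 0.
Proof.
move=> xP; pose h := x - ql P; pose f P' := cum (hq (ql P' + h)) P'.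
have hn : h != 0 by rewrite subr_eq0.
have nq P' : hq (ql P' + h) P' = 0.
  by rewrite /hq -[X in X == _]addr0 (inj_eq (addrI _)) eq_sym (negPf hn).
have fm P' : f (m P') = f P'.
  rewrite /f; have := cum_cross (P := P') (side0_hq (ql P' + h)) (side0_hq (ql (m P') + h)).
  rewrite nq addr0; apply => P'' sE.
  by rewrite /hq !ql_m sE addrAC (inj_eq (addIr _)).
have fc P' : f (ch P') = f P'.
  wlog lt : P' / (rk P' < rk (ch P'))%N.
    move=> H; case: (ltngtP (rk P') (rk (ch P'))) => lt; first exact: H.
      by have := H (ch P'); rewrite chK => /(_ lt) ->.
    by rewrite (rk_inj (esym lt)).
  rewrite /f ql_ch; have := cum_chord (h := hq (ql P' + h)) (P := P'); rewrite nq addr0; apply => // P''.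
  by rewrite /hq ql_ch.
have fE : f P = cum (hq x) P by rewrite /f /h addrC subrK.
rewrite -fE; pose A P' := (sd P' == sd P) && ((ql P' == ql P) || (ql P' == ql P + h)).
have AP : A P by rewrite /A !eqxx.
pose P0 := [arg min_(P' < P | A P') rk P'].
have [A0 mn] : A P0 /\ forall P', A P' -> (rk P0 <= rk P')%N by rewrite /P0; case: arg_minnP.
rewrite (conn fm fc P P0) /f cum_side; last exact: side0_hq.
apply: big1 => P' /andP[/eqP sE lt]; rewrite /hq; case: eqP => // qE; exfalso.
have : A P'.
  move: A0; rewrite /A sE => /andP[-> /orP[/eqP q0|/eqP q0]] /=; rewrite qE q0 ?eqxx ?orbT//.
  by rewrite -addrA Q2 addr0 eqxx.
by move=> /mn; rewrite leqNgt lt.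
Qed.

(** Points before an even [P] are even in number, and so are those of each label other than [ql P],
    hence also those with label [ql P]. If the label changed at [bs P], the number with label [ql P]
    before [bs P] would be both even and odd. *)
Lemma ql_bs P : ql (bs P) = ql P.
Proof.
wlog op : P / ~~ odd (rk P).
  move=> H; case: (boolP (odd (rk P))) => o; last exact: H.
  by have := H (bs P); rewrite odd_bs o bsK => ->.
have rE : rk (bs P) = (rk P).+1 by rewrite rk_bs (negPf op).
apply/eqP; rewrite eq_sym; apply: contraT => ne.
have c1 : cum (hq (ql P)) (bs P) = 0 by exact: cum_label.
have c2 : cum (hq (ql P)) (bs P) = cum (hq (ql P)) P + 1.
  rewrite /cum (bigD1 P) /=; last by rewrite rE.
  rewrite addrC {2}/hq eqxx; congr (_ + _); apply: eq_bigl => P'.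
  by rewrite rE ltnS leq_eqVlt (inj_eq rk_inj); case: eqP => [->|]; rewrite ?ltnn ?andbT.
have c3 : cum (hq (ql P)) P = 0.
  have : \sum_x cum (hq x) P = 0.
    rewrite /cum exchange_big /=; under eq_bigr => P' _ do rewrite sum_hq.
    by rewrite -/(cum (fun=> 1) P) cum1 F2_odd (negPf op).
  by rewrite (bigD1 (ql P))//= big1 ?addr0// => x; exact: cum_label.
by move: c1; rewrite c2 c3 add0r => /eqP.
Qed.

(** Along a black interval and then along a chord: the orbits of even points bound the black pieces
    of the polygon. *)
Definition phi P := ch (bs P).

Lemma phi_inj : injective phi.
Proof. by move=> P P' /(inv_inj chK)/(inv_inj bsK). Qed.

Lemma odd_phi P : odd (rk (phi P)) = odd (rk P).
Proof. by rewrite odd_ch odd_bs negbK. Qed.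

Lemma phi_neq P : phi P != P.
Proof. by apply: contraNneq (noret (bs P)) => E; rewrite -/(phi P) E bs_sd. Qed.

Notation op P := (~~ odd (rk P)).

Lemma op_connect P P' : fconnect phi P P' -> op P = op P'.
Proof.
by move=> /iter_findex <-; elim: (findex _ _ _) => //= k ->; rewrite odd_phi.
Qed.

(** As the matching reverses order, this is the even end of the black interval across the edge. *)
Definition mb P := m (bs P).

Lemma mbK : involutive mb.
Proof. by move=> P; rewrite /mb bs_m mK bsK. Qed.

Lemma op_mb P : odd (rk (mb P)) = odd (rk P).
Proof. by rewrite odd_m odd_bs negbK. Qed.

Lemma sp_mb P : sp (sd (mb P)) = ~~ sp (sd P).
Proof. by rewrite sd_m bs_sd sp_io. Qed.

(** The black pieces are the vertices of a graph whose edges are the matched pairs of black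
    intervals. No chord returns to its side, so each piece has at least two intervals, and there are
    at least as many edges as vertices. One vertex equation follows from the others, which leaves a
    nonzero cycle modulo 2. *)
Lemma cycle_ex : (0 < #|T|)%N -> exists2 y : T -> 'F_2,
  [/\ forall P, y (bs P) = y P, forall P, y (m P) = y P & exists P, y P != 0] &
  forall r, \sum_(P | op P && (froot phi P == r)) y P = 0.
Proof.
move=> T0; have [P0 P0E] := rk_surj T0; have op0 : op P0 by rewrite P0E.
pose U := {P : T | op P && sp (sd P)}.
pose r0 := froot phi P0.
pose E := {r : T | [&& op r, froot phi r == r & r != r0]}.
pose c P := if sp (sd P) then (if odd (rk P) then bs P else P)
            else (if odd (rk (m P)) then bs (m P) else m P).
have cb P : c (bs P) = c P.
  rewrite /c bs_sd bs_m !odd_bs !bsK.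
  by case: (sp _); [case: (odd (rk P))|case: (odd (rk (m P)))].
have cm P : c (m P) = c P.
  by rewrite /c sd_m sp_io mK; case: (sp (sd P)).
pose ev (x : U -> 'F_2) P := if insub (c P) is Some u then x u else 0.
pose f (e : E) (x : U -> 'F_2) := \sum_(P | op P && (froot phi P == val e)) ev x P.
have evL a x y P : ev (fun u => a * x u + y u) P = a * ev x P + ev y P.
  by rewrite /ev; case: insub => [u|]; rewrite ?mulr0 ?addr0.
have card_op : #|[pred P | op P]| = (#|{: U}| * 2)%N.
  rewrite -sum1_card (bigID (fun P => sp (sd P))) /= [X in (_ + X)%N](reindex_inj (inv_inj mbK)) /=.
  rewrite [X in (_ + X)%N](eq_bigl (fun P => op P && sp (sd P))); last first.
    by move=> P; rewrite inE op_mb sp_mb negbK.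
  by rewrite addnn -muln2 sum1_card card_sig.
have card_E : (#|{: E}|.+1 * 2 <= #|[pred P | op P]|)%N.
  have -> : #|{: E}|.+1 = #|[pred r | op r && (froot phi r == r)]|.
    have rr : froot phi r0 == r0 by rewrite /r0 root_root//; exact: (fconnect_sym phi_inj).
    have or0 : op r0 by rewrite -(op_connect (connect_root _ P0)).
    rewrite (cardD1 r0) inE or0 rr card_sig add1n; congr _.+1; apply: eq_card => r.
    by rewrite !inE; case: (odd (rk r)); case: (r == r0); case: (_ == r).
  rewrite -sum1_card big_distrl /= -[leqRHS]sum1_card.
  rewrite [leqRHS](partition_big (froot phi) (fun r => op r && (froot phi r == r))) /=; last first.
    move=> P oP; rewrite -(op_connect (connect_root _ P)) inE in oP *; rewrite oP.
    by apply/eqP; rewrite root_root//; exact: (fconnect_sym phi_inj).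
  apply: leq_sum => r /andP[or /eqP rr]; rewrite (bigD1 r) ?inE ?or ?rr ?eqxx//=.
  rewrite (bigD1 (phi r)) ?inE ?odd_phi ?or ?phi_neq//=; last first.
    rewrite andbT; apply/eqP; rewrite -[RHS]rr; apply/esym/(fingraph.rootP (fconnect_sym phi_inj)).
    exact: fconnect1.
have [||x [u xu] xP] := @dim_solve 'F_2 U E f.
- move=> e a x y; rewrite /f mulr_sumr -big_split /=; apply: eq_bigr => P _; exact: evL.
- by rewrite -(ltn_pmul2r (isT : (0 < 2)%N)) -card_op (leq_trans _ card_E)// ltn_pmul2r.
exists (ev x).
  split; [by move=> P; rewrite /ev cb|by move=> P; rewrite /ev cm|].
  exists (val u); rewrite /ev /c; have /andP[ou su] := valP u.
  by rewrite su (negPf ou) valK.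
have tot : \sum_(P | op P) ev x P = 0.
  rewrite (bigID (fun P => sp (sd P))) /= [X in _ + X](reindex_inj (inv_inj mbK)) /=.
  rewrite [X in _ + X](eq_big (fun P => op P && sp (sd P)) (ev x)); first exact: F2D.
    by move=> P; rewrite op_mb sp_mb negbK.
  by move=> P _; rewrite /ev cm cb.
have nr r : r != r0 -> \sum_(P | op P && (froot phi P == r)) ev x P = 0.
  move=> rr; case: (boolP (op r && (froot phi r == r))) => [/andP[or rE]|nr].
    have h : [&& op r, froot phi r == r & r != r0] by rewrite or rE rr.
    exact: (xP (Sub r h)).
  apply: big1 => P /andP[oP /eqP rE]; exfalso; move/negP: nr; apply.
  rewrite -rE -(op_connect (connect_root _ P)) oP /=; apply/eqP.
  by rewrite root_root//; exact: (fconnect_sym phi_inj).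
move=> r; have [->|] := eqVneq r r0; last exact: nr.
move: tot; rewrite (partition_big (froot phi) predT)//= (bigD1 r0)//= [X in _ + X]big1 ?addr0//.
Qed.

Lemma diagram_absurd : (0 < #|T|)%N -> False.
Proof.
move=> /cycle_ex[y [yb ym [P0 yP0]] orb].
have stab (A : pred T) : (forall P, A P -> op P) -> (forall P, A P -> A (phi P)) -> \sum_(P | A P) y P = 0.
  move=> Ao Ap; rewrite (partition_big (froot phi) predT)//= big1// => r _.
  case: (pickP (fun P => A P && (froot phi P == r))) => [P1 /andP[A1 r1]|no]; last by apply: big_pred0.
  rewrite -[RHS](orb r); apply: eq_bigl => P; case: (eqVneq (froot phi P) r) => rE; rewrite ?andbF// !andbT.
  apply/idP/idP => [/Ao//|_].
  have /(fingraph.rootP (fconnect_sym phi_inj)) : froot phi P1 = froot phi P by rewrite rE (eqP r1).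
  move=> /iter_findex <-; elim: (findex _ _ _) => //= k; exact: Ap.
pose h P : 'F_2 := if odd (rk P) then 0 else y P.
pose h2 P : 'F_2 := if odd (rk P) then y P else 0.
have ql_orb P P' : fconnect phi P P' -> ql P = ql P'.
  move=> /iter_findex <-; elim: (findex _ _ _) => //= k ->; by rewrite /phi ql_ch ql_bs.
(* Labels are constant on black pieces, so the cycle weighted by a coordinate of the label still has
   sum 0. Adding the two ends of each black interval leaves only the change of label across the
   edge, that is, the total of [y] on side [j]. *)
have side_sp j : sp j -> \sum_(P | op P && (sd P == j)) y P = 0.
  move=> sj; have Z0 : \sum_(P | op P) y P * co j (ql P) = 0.
    rewrite (partition_big (froot phi) predT)//= big1// => r _.
    rewrite (eq_bigr (fun P => y P * co j (ql r))); first by rewrite -mulr_suml orb mul0r.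
    by move=> P /andP[_ /eqP <-]; rewrite -(ql_orb _ _ (connect_root _ P)).
  rewrite -[RHS]Z0 [RHS](bigID (fun P => sp (sd P))) /= [X in _ = _ + X](reindex_inj (inv_inj mbK)) /=.
  rewrite [X in _ = _ + X](eq_big (fun P => op P && sp (sd P)) (fun P => y P * co j (ql P) + y P * co j (d (sd P)))).
  - rewrite big_split /= addrA F2D add0r [LHS]big_mkcond [RHS]big_mkcond; apply: eq_bigr => P _.
    case: (odd (rk P)) => //=; case: (eqVneq (sd P) j) => [->|ne] /=; first by rewrite sj co_d// eqxx mulr1.
    by case: ifP => // sP; rewrite co_d// (negPf ne) mulr0.
  - by move=> P; rewrite op_mb sp_mb negbK.
  - by move=> P _; rewrite /mb ym yb ql_m ql_bs bs_sd co_add mulrDr.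
have h0 : side0 h.
  move=> j; have -> : \sum_(P | sd P == j) h P = \sum_(P | op P && (sd P == j)) y P.
    rewrite [LHS]big_mkcond [RHS]big_mkcond; apply: eq_bigr => P _; rewrite /h.
    by case: (odd _); case: (_ == _).
  case: (boolP (sp j)) => sj; first exact: side_sp.
  rewrite (reindex_inj (inv_inj mbK)) /=.
  rewrite -[RHS](side_sp (io j)) ?sp_io//; apply: eq_big => [P|P _]; last by rewrite /mb ym yb.
  by rewrite op_mb /mb sd_m bs_sd -(inj_eq (inv_inj ioK)) ioK.
have h20 : side0 h2.
  move=> j; rewrite -[RHS](h0 j) (reindex_inj (inv_inj bsK)) /=; apply: eq_big => [P|P _].
    by rewrite bs_sd.
  by rewrite /h2 /h odd_bs yb; case: (odd _).
have km P : cum h (m P) = cum h P.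
  rewrite (@cum_cross h2 h)//; last by move=> P' _; rewrite /h /h2 odd_m ym; case: (odd _).
  have -> : cum h2 P + h2 P = \sum_(P' | (rk P' <= rk P)%N) h2 P'.
    rewrite (bigD1 P)//= addrC; congr (_ + _); apply: eq_bigl => P'.
    by rewrite ltn_neqAle (inj_eq rk_inj) andbC.
  rewrite (reindex_inj (inv_inj bsK)) /= /cum [LHS]big_mkcond [RHS]big_mkcond; apply: eq_bigr => P' _.
  rewrite /h2 /h odd_bs yb rk_bs; case: (boolP (odd (rk P'))) => //= o.
  by case: ifP; case: ifP.
have kc P : cum h (ch P) = cum h P.
  wlog lt : P / (rk P < rk (ch P))%N.
    move=> H; case: (ltngtP (rk P) (rk (ch P))) => lt; first exact: H.
      by have := H (ch P); rewrite chK => /(_ lt) ->.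
    by rewrite (rk_inj (esym lt)).
  rewrite /cum (bigID (fun P' => (rk P' < rk P)%N)) /= [X in X + _](_ : _ = cum h P); last first.
    apply: eq_bigl => P'; case: (ltnP (rk P') (rk P)) => h'; rewrite ?andbF// andbT.
    exact: ltn_trans lt.
  rewrite -[RHS]addr0; congr (_ + _).
  (* By unlinkedness the even points from [P] up to [ch P] form a union of orbits of [phi], on which
     [y] sums to 0. *)
  rewrite -[RHS](stab (fun P' => [&& op P', (rk P <= rk P')%N & (rk P' < rk (ch P))%N])).
  - rewrite [LHS]big_mkcond [RHS]big_mkcond; apply: eq_bigr => P' _; rewrite /h -leqNgt.
    by case: (odd (rk P')); case: (rk P <= rk P')%N; case: (rk P' < rk (ch P))%N.
  - by move=> P' /and3P[].
  move=> P' /and3P[nodd l1 l2]; rewrite odd_phi nodd /=.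
  have rb : rk (bs P') = (rk P').+1 by rewrite rk_bs (negPf nodd).
  have : (rk (bs P') <= rk (ch P))%N by rewrite rb.
  rewrite leq_eqVlt => /orP[/eqP/rk_inj E|l3].
    by rewrite /phi E chK leqnn lt.
  have l4 : (rk P < rk (bs P'))%N by rewrite rb ltnS.
  rewrite /phi (unlinked l4 l3) andbT leqNgt; apply/negP => l5.
  have := unlinked l5; rewrite chK => /(_ l4); rewrite ltnNge => /negP; apply; exact: ltnW.
wlog o0 : P0 yP0 / op P0.
  move=> H; case: (boolP (odd (rk P0))) => o; last exact: (H P0).
  by apply: (H (bs P0)); rewrite ?yb// odd_bs o.
(* The prefix sum is constant on the connected diagram, but it increases by [y P0] across the black
   interval at [P0]. *)
have := conn km kc (bs P0) P0; rewrite /cum (bigD1 P0) /=; last by rewrite rk_bs (negPf o0).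
rewrite (eq_bigl (fun P => (rk P < rk P0)%N)); last first.
  move=> P; rewrite rk_bs (negPf o0) ltnS leq_eqVlt (inj_eq rk_inj).
  by case: eqP => [->|]; rewrite ?ltnn ?andbT.
rewrite -[RHS]add0r => /addIr; rewrite /h (negPf o0) => E.
by rewrite E eqxx in yP0.
Qed.

End Diagram.

(** * Reduction of the cyclic word of a chord diagram *)

Section Lists.
Variables (R : realDomainType) (g : nat).
Hypothesis g0 : (0 < g)%N.
Notation z4 := ((4 * g)%N%:Z).
Variables (S : finType) (tau : int -> S -> S) (z : S -> S).
Hypothesis tauK : forall j s, tau (iota4 j) (tau j s) = s.
Hypothesis tauz : forall j s, z (tau j s) = tau j (z s).
Hypothesis star : forall W s, odd_word g0 W -> exists n, iter n (act tau W) s = z s.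
Variables (X : finType) (outp inp : X -> R) (jl : X -> int).
Notation pt := (X * bool)%type.

Definition ppos (P : pt) : R := if P.2 then outp P.1 else inp P.1.
Definition psd (P : pt) : int := if P.2 then jl P.1 else iota4 (jl P.1).
Definition pm (P : pt) : pt := (P.1, ~~ P.2).
(** A crossing has an exit [(x, true)] on side [jl x] and an entry [(x, false)] on the glued side. A
    chord runs from the entry of a crossing to the exit of the next one in the cyclic list. *)
Definition pch (L : seq X) (P : pt) : pt := if P.2 then (prev L P.1, false) else (next L P.1, true).

Hypothesis jl_itv : forall x, 0 <= jl x < z4.
Hypothesis ppos_inj : injective ppos.
Hypothesis psd_mono : forall P P', ppos P <= ppos P' -> psd P <= psd P'.
Hypothesis pm_rev : forall P P', psd P = psd P' -> ppos P < ppos P' -> ppos (pm P') < ppos (pm P).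

Definition unlinkedL (L : seq X) := forall P P', P.1 \in L -> P'.1 \in L ->
  ppos P < ppos P' -> ppos P' < ppos (pch L P) -> ppos (pch L P') < ppos (pch L P).

Lemma pmK : involutive pm. Proof. by move=> [x b]; rewrite /pm /= negbK. Qed.

Lemma psd_itv P : 0 <= psd P < z4.
Proof.
case: P => x []; rewrite /psd /=; first exact: jl_itv.
have := jl_itv x; rewrite /iota4 PoszM; have := divz_eq (jl x) 4.
have := modz_ge0 (jl x) (isT : 4 != 0 :> int); have := ltz_pmod (jl x) (isT : 0 < 4 :> int).
set d := divz _ _; set r := modz _ _ => h1 h2 -> h3; case: ifP => h4; lia.
Qed.

Lemma psd_m P : psd (pm P) = iota4 (psd P).
Proof. by case: P => x []; rewrite /psd /= ?iota4K. Qed.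

Lemma pchK L : uniq L -> forall P, pch L (pch L P) = P.
Proof. by move=> uL [x []]; rewrite /pch /= ?next_prev ?prev_next. Qed.

Lemma pch_in L P : ((pch L P).1 \in L) = (P.1 \in L).
Proof. by case: P => x []; rewrite /pch /= ?mem_prev ?mem_next. Qed.

Lemma pos_lt P P' : P != P' -> ppos P' <= ppos P -> ppos P' < ppos P.
Proof. by move=> ne le; rewrite lt_def le andbT (inj_eq ppos_inj). Qed.

Lemma unlinked_low L : uniq L -> unlinkedL L -> forall P P', P.1 \in L -> P'.1 \in L ->
  ppos P < ppos P' -> ppos P' < ppos (pch L P) -> ppos P < ppos (pch L P').
Proof.
move=> uL un P P' PL PL' h1 h2; rewrite ltNge le_eqVlt; apply/negP => /orP[/eqP/ppos_inj E|h3].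
  by move: h2; rewrite -E (pchK uL) ltxx.
have := un (pch L P') P; rewrite pch_in (pchK uL) => /(_ PL' PL h3 h1).
by rewrite ltNge (ltW h2).
Qed.

Section NoReturn.
Variable L : seq X.
Hypothesis uL : uniq L.
Hypothesis un : unlinkedL L.
Hypothesis nr : forall P, P.1 \in L -> psd (pch L P) != psd P.
Hypothesis wd0 : wd g0 (map jl L) = 0.
Hypothesis ev : forall e, ~~ odd (count_mem e (edges g0 0 (map jl L))).

Notation sub := {x : X | x \in L}.
Notation T := (sub * bool)%type.
Notation Q := 'rV['F_2]_(4 * g).

Definition tval (P : T) : pt := (val P.1, P.2).

Lemma tval_inj : injective tval.
Proof.
move=> [x b] [y b'] E; congr pair; [apply: val_inj; exact: (congr1 fst E)|exact: (congr1 snd E)].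
Qed.

Lemma tval_in P : (tval P).1 \in L. Proof. exact: valP P.1. Qed.

Definition tmk (P : pt) (h : P.1 \in L) : T := (Sub P.1 h, P.2).

Lemma tmkK P h : tval (@tmk P h) = P. Proof. by case: P h. Qed.

Definition trk (P : T) : nat := #|[pred P' : T | ppos (tval P') < ppos (tval P)]|.

Lemma trk_lt P P' : (trk P < trk P')%N = (ppos (tval P) < ppos (tval P')).
Proof.
have H A B : ppos (tval A) < ppos (tval B) -> (trk A < trk B)%N.
  move=> lt; apply: proper_card; apply/fintype.properP; split.
    by apply/fintype.subsetP => C; rewrite !inE => /lt_trans; apply.
  by exists A; rewrite !inE ?lt// ltxx.
apply/idP/idP => [h|/H//]; rewrite ltNge le_eqVlt; apply/negP => /orP[/eqP/ppos_inj/tval_inj E|/H].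
  by move: h; rewrite E ltnn.
by rewrite ltnNge (ltnW h).
Qed.

Lemma trk_inj : injective trk.
Proof.
move=> P P' E; apply/tval_inj/ppos_inj/eqP; rewrite eq_le !leNgt -!trk_lt E.
by rewrite ltnn.
Qed.

Lemma trk_bd P : (trk P < #|{: T}|)%N.
Proof.
apply: proper_card; apply/fintype.properP; split; first by apply/fintype.subsetP => C; rewrite inE.
by exists P; rewrite ?inE ?ltxx.
Qed.

Definition tcross (P : T) : T := (P.1, ~~ P.2).

Lemma tval_m P : tval (tcross P) = pm (tval P). Proof. by []. Qed.

Lemma tch_in (P : T) : (pch L (tval P)).1 \in L. Proof. by rewrite pch_in tval_in. Qed.

Definition tch (P : T) : T := tmk (tch_in P).

Lemma tval_ch P : tval (tch P) = pch L (tval P). Proof. exact: tmkK. Qed.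

Definition tsd (P : T) : 'I_(4 * g) := side g0 (psd (tval P)).

Lemma tsdE P : tsd P = `|psd (tval P)|%N :> nat.
Proof.
have /andP[h0 h1] := psd_itv (tval P); apply/eqP; rewrite -eqz_nat sideE gez0_abs// modz_small//.
by rewrite h0.
Qed.

Lemma tsd_eq P P' : (tsd P == tsd P') = (psd (tval P) == psd (tval P')).
Proof.
apply/eqP/eqP => [E|E]; last by apply: ord_inj; rewrite !tsdE E.
have := congr1 (@nat_of_ord _) E; rewrite !tsdE => /(congr1 Posz).
by rewrite !gez0_abs//; have /andP[] := psd_itv (tval P); have /andP[] := psd_itv (tval P').
Qed.

(** The sheet of the mod 2 homology cover in which the curve runs when it reaches the crossing [x],
    starting from 0. *)
Definition qb (x : X) : Q := wd g0 (map jl (take (index x L) L)).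

Lemma wd_rcons W j : wd g0 (rcons W j) = wd g0 W + dq g0 j.
Proof. by rewrite -cats1 wd_cat /wd big_cons big_nil addr0. Qed.

Lemma qb_next x : x \in L -> qb (next L x) = qb x + dq g0 (jl x).
Proof.
move=> xL; pose i := index x L; have iL : (i < size L)%N by rewrite index_mem.
have xE : x = nth x L i by rewrite nth_index.
have tE : take i.+1 L = rcons (take i L) x by rewrite (take_nth x)// -xE.
have -> : qb x + dq g0 (jl x) = wd g0 (map jl (take i.+1 L)) by rewrite tE map_rcons wd_rcons.
case: (ltnP i.+1 (size L)) => h.
  have -> : next L x = nth x L i.+1.
    by rewrite next_nth xL -/i; case: (L) h => // y s h; rewrite /= (set_nth_default x).
  by rewrite /qb index_uniq.
have -> : take i.+1 L = L by rewrite take_oversize.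
rewrite wd0 /qb; suff -> : index (next L x) L = 0%N by rewrite take0 /= /wd big_nil.
rewrite next_nth xL -/i; case: (L) iL h => //= y s iL h.
by rewrite nth_default// eqxx.
Qed.

Definition tql (P : T) : Q := let x := val P.1 in if P.2 then qb x else qb x + dq g0 (jl x).

Lemma edges_qb : edges g0 0 (map jl L) = [seq qedge g0 (qb x) (jl x) | x <- L].
Proof.
suff H u L' : uniq L' -> edges g0 u (map jl L') =
    [seq qedge g0 (u + wd g0 (map jl (take (index x L') L'))) (jl x) | x <- L'].
  by rewrite H//; apply: eq_map => x; rewrite add0r.
elim: L' u => //= x L' IH u /andP[xL' uL']; rewrite eqxx /= IH//; congr cons; first by rewrite /wd big_nil addr0.
apply/eq_in_map => y yL'; rewrite (_ : (x == y) = false) /=; last first.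
  by apply: contraNF xL' => /eqP ->.
by rewrite /wd big_cons addrA.
Qed.

Lemma qedge_eq (q q' : Q) i j : 0 <= i < z4 -> 0 <= j < z4 -> (qedge g0 q i == qedge g0 q' j) =
  ((i == j) && (q == q')) || ((iota4 i == j) && (q + dq g0 i == q')).
Proof.
move=> iz jz; have side_inj a b : 0 <= a < z4 -> 0 <= b < z4 -> side g0 a = side g0 b -> a = b.
  by move=> az bz /(congr1 (fun u : 'I_(4 * g) => (u : nat)%:Z)); rewrite !sideE !modz_small.
have io a : 0 <= a < z4 -> 0 <= iota4 a < z4.
  rewrite /iota4 PoszM; have := divz_eq a 4.
  have := modz_ge0 a (isT : 4 != 0 :> int); have := ltz_pmod a (isT : 0 < 4 :> int).
  set d := divz _ _; set r := modz _ _ => h1 h2 -> h3; case: ifP => h4; lia.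
have edgE a b : 0 <= a < z4 -> 0 <= b < z4 -> edg g0 a = edg g0 b -> a = b \/ iota4 a = b.
  move=> az bz; rewrite /edg; case: ifP => _; case: ifP => _ /side_inj h.
  - by left; exact: h.
  - by right; rewrite h ?iota4K//; exact: io.
  - by right; rewrite h//; exact: io.
  - by left; apply: (inv_inj iota4K); apply: h; exact: io.
rewrite /qedge xpair_eqE; apply/andP/orP => [[q1 /eqP/(edgE _ _ iz jz)[E|E]]|].
- left; move: q1; rewrite E eqxx /=; case: ifP => // _ /eqP/addIr ->; exact: eqxx.
- right; move: q1; rewrite -E eqxx pos_iota /= dq_iota; case: (pos i) => /= /eqP ->.
    by rewrite addqK.
  by [].
- case=> /andP[/eqP <- /eqP <-] //; rewrite pos_iota edg_iota dq_iota; case: (pos i) => //=.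
  by rewrite addqK.
Qed.

(** The points on side [j] with label [x] correspond to the crossings of the edge [qedge x j] by the
    word, in either direction. *)
Lemma teven (x : Q) (j : 'I_(4 * g)) : \sum_(P | (tsd P == j) && (tql P == x)) 1 = 0 :> 'F_2.
Proof.
have jz : 0 <= (j : nat)%:Z < z4 by rewrite ltz_nat ltn_ord.
have tsdj P : (tsd P == j) = (psd (tval P) == (j : nat)%:Z).
  have /andP[h0 h1] := psd_itv (tval P).
  rewrite -(inj_eq (@ord_inj _)) tsdE; apply/eqP/eqP => [<-|->//]; by rewrite gez0_abs.
have -> : \sum_(P | (tsd P == j) && (tql P == x)) 1 = (count_mem (qedge g0 x j) (edges g0 0 (map jl L)))%:R :> 'F_2.
  rewrite edges_qb count_map.
  have -> : count (fun y => qedge g0 (qb y) (jl y) == qedge g0 x (j : nat)%:Z) L =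
      (\sum_(y : sub) (qedge g0 (qb (val y)) (jl (val y)) == qedge g0 x (j : nat)%:Z))%N.
    rewrite -sum1_count big_mkcond /= big_uniq//=.
    rewrite (reindex_omap (val : sub -> X) insub) /=; last by move=> y yL; rewrite insubT.
    by apply: eq_bigl => y; rewrite valK eqxx (valP y).
  rewrite natr_sum big_mkcond /= -(pair_bigA _ (fun y b => if (tsd (y, b) == j) && (tql (y, b) == x) then 1 else 0)) /=.
  apply: eq_bigr => y _; rewrite big_bool /= !tsdj /psd /tql /= qedge_eq ?jl_itv//.
  case: (eqVneq (jl (val y)) j) => [<-|_] /=.
    rewrite (negPf (iota4_neq _)) /= orbF addr0; by case: (_ == x).
  by rewrite add0r; case: (_ && _).
by rewrite F2_odd (negPf (ev _)).
Qed.

Lemma no_return_absurd : (0 < size L)%N -> False.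
Proof.
move=> L0; pose io (i : 'I_(4 * g)) := side g0 (iota4 (i : nat)%:Z).
have sI (i : 'I_(4 * g)) : side g0 (i : nat)%:Z = i by exact: side_id.
have sK j : exists m, j = (side g0 j : nat)%:Z + z4 * m by exact: sideK.
have ios j : io (side g0 j) = side g0 (iota4 j).
  by have [m {2}->] := sK j; rewrite /io iota4_per side_per.
have dqs j : dq g0 (side g0 j : nat)%:Z = dq g0 j.
  by have [m {2}->] := sK j; rewrite /dq edg_per.
have poss j : pos (side g0 j : nat)%:Z = pos j by have [m {2}->] := sK j; rewrite pos_per.
apply: (@diagram_absurd T 'I_(4 * g) Q trk tsd tcross tch io (@nat_of_ord _) tql (fun i => dq g0 (i : nat)%:Z)
   (fun i => pos (i : nat)%:Z) (fun i q => q 0 (edg g0 (i : nat)%:Z))).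
- exact: trk_inj.
- exact: trk_bd.
- exact: ord_inj.
- move=> P P'; rewrite trk_lt !tsdE => /ltW/psd_mono.
  by have /andP[] := psd_itv (tval P); have /andP[] := psd_itv (tval P'); lia.
- by move=> [x b]; rewrite /tcross /= negbK.
- by move=> P; apply: tval_inj; rewrite !tval_ch (pchK uL).
- move=> i; have -> : io i = side g0 (iota4 (i : nat)%:Z) by [].
  by rewrite ios iota4K sI.
- by move=> i; rewrite /io poss pos_iota.
- by move=> P; rewrite /tsd ios tval_m psd_m.
- move=> P P' /eqP; rewrite tsd_eq !trk_lt !tval_m => /eqP; exact: pm_rev.
- by move=> P P'; rewrite !trk_lt !tval_ch; apply: un; exact: tval_in.
- by move=> P; rewrite tsd_eq tval_ch; apply: nr; exact: tval_in.
- move=> [x b]; rewrite /tql /tch /tmk /pch /=; case: b => /=.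
    have pL : prev L (val x) \in L by rewrite mem_prev (valP x).
    by rewrite -qb_next// (next_prev uL).
  by rewrite qb_next// (valP x).
- move=> [x b]; rewrite /tql /tcross /tsd /= dqs /psd /=; case: b => //=.
  by rewrite dq_iota addqK.
- exact: addqq.
- by move=> i a b; rewrite mxE.
- move=> i j pi pj; rewrite /dq /edg pi pj !sI mxE eqxx /=.
  by rewrite eq_sym.
- exact: teven.
- move=> f fm fc.
  have x0 : exists x0, x0 \in L by case: (L) L0 => // y s _; exists y; rewrite inE eqxx.
  have [x0' x0L] := x0.
  have step x (xL : x \in L) (nL : next L x \in L) : f (Sub x xL, true) = f (Sub (next L x) nL, true).
    rewrite -(fm (Sub x xL, true)) /tcross /= -(fc (Sub x xL, false)); congr f.
    by apply: tval_inj; rewrite tval_ch.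
  pose h0 := nth x0' L 0.
  have h0L : h0 \in L by rewrite mem_nth.
  have all x (xL : x \in L) : f (Sub x xL, true) = f (Sub h0 h0L, true).
    have [i iL E] : exists2 i, (i < size L)%N & x = nth x0' L i.
      by exists (index x L); rewrite ?index_mem// nth_index.
    elim: i iL x xL E => [|i IH] iL x xL E.
      by congr f; apply: tval_inj; rewrite /tval /= E.
    have yL : nth x0' L i \in L by rewrite mem_nth// ltnW.
    have nE : next L (nth x0' L i) = x.
      by rewrite next_nth yL index_uniq ?(ltnW iL)// E; case: (L) iL => // a s iL; exact: set_nth_default.
    have nL : next L (nth x0' L i) \in L by rewrite nE.
    rewrite -(IH (ltnW iL) _ yL erefl) (step _ yL nL).
    by congr f; apply: tval_inj; rewrite /tval /= nE.
  have all' (P : T) : f P = f (Sub h0 h0L, true).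
    case: P => [[x xL] b]; case: b; first exact: all.
    by rewrite -(fm (_, false)) /tcross /=; exact: all.
  by move=> P P'; rewrite !all'.
apply/card_gt0P; case: (L) L0 => // y s _.
by have yL : y \in y :: s by [rewrite inE eqxx]; exists (Sub y yL, true).
Qed.

End NoReturn.

Definition between (L : seq X) (P P' : pt) : nat :=
  #|[pred A : pt | (A.1 \in L) && (ppos P < ppos A < ppos P')]|.

Lemma coh_trivial_catC W W' : coh_trivial tau z (W ++ W') -> coh_trivial tau z (W' ++ W).
Proof. exact: coh_trivial_rot. Qed.

(** Induction on the number of crossings. An odd word has [z] among the powers of its monodromy.
    Otherwise some chord returns to its side; for an innermost one the two adjacent letters are
    inverse to each other, and they cancel. *)
Lemma diag_trivial (L : seq X) : uniq L -> unlinkedL L -> coh_trivial tau z (map jl L).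
Proof.
have [n] := ubnP (size L); elim: n L => // n IH L; rewrite ltnS => Ln uL un.
case: (posnP (size L)) => [/size0nil ->|L0]; first exact: coh_trivial_nil.
case: (pselect (odd_word g0 (map jl L))) => [ow|no].
  by apply: (coh_trivial_z tauz) => s; exact: star.
have wd0 : wd g0 (map jl L) = 0.
  by apply/eqP; apply: contraT => ne; exfalso; apply: no; left.
have ev e : ~~ odd (count_mem e (edges g0 0 (map jl L))).
  by apply/negP => oe; apply: no; right; exists e.
have [P /and3P[PL /eqP rP lP]|no_ret] := pickP (fun P : pt =>
    [&& P.1 \in L, psd (pch L P) == psd P & ppos P < ppos (pch L P)]); last first.
  exfalso; apply: (no_return_absurd uL un _ wd0 ev L0) => P PL; apply/eqP => rP.
  have [lt|gt|/ppos_inj E] := ltgtP (ppos P) (ppos (pch L P)).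
  - by have := no_ret P; rewrite PL rP eqxx lt.
  - by have := no_ret (pch L P); rewrite pch_in PL (pchK uL) rP eqxx gt.
  - by case: P {PL rP} E => x [].
pose A P := [&& P.1 \in L, psd (pch L P) == psd P & ppos P < ppos (pch L P)].
have AP : A P by rewrite /A PL rP eqxx lP.
pose P0 := [arg min_(P' < P | A P') between L P' (pch L P')].
have [/and3P[P0L /eqP rP0 lP0] mn] : A P0 /\ forall P', A P' -> (between L P0 (pch L P0) <= between L P' (pch L P'))%N.
  by rewrite /P0; case: arg_minnP.
(* A point between the ends of the minimal returning chord would start a chord trapped there, on the
   same side, with fewer points in between. *)
have nobtw B : B.1 \in L -> ppos P0 < ppos B -> ppos B < ppos (pch L P0) -> False.
  move=> BL b1 b2; have c1 := unlinked_low uL un P0L BL b1 b2; have c2 := un _ _ P0L BL b1 b2.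
  wlog lt : B BL b1 b2 c1 c2 / ppos B < ppos (pch L B).
    move=> H; have [lt|gt|/ppos_inj E] := ltgtP (ppos B) (ppos (pch L B)).
    - exact: (H B).
    - by apply: (H (pch L B)); rewrite ?pch_in// (pchK uL).
    - by case: B {BL b1 b2 c1 c2} E => x [].
  have sB C : ppos P0 < ppos C -> ppos C < ppos (pch L P0) -> psd C = psd P0.
    by move=> /ltW/psd_mono s1 /ltW/psd_mono; rewrite rP0 => s2; apply/eqP; rewrite eq_le s2 s1.
  have AB : A B by rewrite /A BL lt !sB// eqxx.
  have := mn _ AB; rewrite leqNgt => /negP; apply; apply: proper_card; apply/fintype.properP; split.
    apply/fintype.subsetP => C; rewrite !inE => /andP[-> /andP[h1 h2]] /=.
    by rewrite (lt_trans b1 h1) (lt_trans h2 c2).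
  by exists B; rewrite !inE ?BL ?b1 ?b2 ?ltxx.
(* The innermost chord goes from the entry of [x] to the exit of the next crossing, whichever end
   has the lower position. *)
have [x [xL sxy nob]] : exists x, [/\ x \in L, psd (x, false) = psd (next L x, true) &
    forall B, B.1 \in L -> ~ (ppos (x, false) < ppos B < ppos (next L x, true)) /\
                          ~ (ppos (next L x, true) < ppos B < ppos (x, false))].
  move: P0L rP0 lP0 nobtw; case: P0 {mn} => x [] /= xL rx lx nob.
    exists (prev L x); rewrite mem_prev (next_prev uL); split => // B BL.
    by split=> /andP[h1 h2]; [move: (lt_trans h1 h2); rewrite ltNge (ltW lx)|exact: (nob B)].
  exists x; split => // B BL.
  by split=> /andP[h1 h2]; [exact: (nob B)|move: (lt_trans h1 h2); rewrite ltNge (ltW lx)].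
set y := next L x in sxy nob.
have sy : jl y = iota4 (jl x) by rewrite -[LHS]/(psd (y, true)) -sxy.
have xy : x != y.
  by apply/eqP => E; have := iota4_neq (jl x); rewrite -sy -E eqxx.
have yL : y \in L by rewrite mem_next.
have [i [L' rotE]] : exists i L', rot i L = x :: y :: L'.
  have [i L'' E] := rot_to xL; exists i.
  have := next_rot i uL x; rewrite E /= -/y; case: L'' E => [|y' L'] E /=; rewrite eqxx => yE.
    by move: xy; rewrite yE eqxx.
  by exists L'; rewrite yE.
have WE : map jl L = rotr i (map jl (x :: y :: L')) by rewrite -rotE map_rot rotK.
suff H : coh_trivial tau z (map jl (x :: y :: L')).
  by rewrite WE /rotr /rot; apply: coh_trivial_catC; rewrite cat_take_drop.
rewrite /= sy; apply: (coh_trivial_cancel tauK).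
have uR : uniq (x :: y :: L') by rewrite -rotE rot_uniq.
have inL B : (B \in L) = (B \in x :: y :: L') by rewrite -rotE mem_rot.
have pchR B : pch L B = pch (x :: y :: L') B.
  by rewrite -rotE; case: B => b []; rewrite /pch /= ?(prev_rot _ uL) ?(next_rot _ uL).
move: (uR) => /= /andP[xn /andP[yn uL']].
apply: IH => //.
  by move: Ln; rewrite -(size_rot i) rotE /= => /ltnW.
case: L' rotE WE uR inL pchR xn yn uL' => // w0 L' rotE WE uR inL pchR xn yn uL'.
set L1 := w0 :: L' in rotE WE uR inL pchR xn yn uL' *.
pose w := last w0 L'.
have wL1 : w \in L1 by exact: mem_last.
have sub1 B : B \in L1 -> B \in L by rewrite inL !inE => ->; rewrite !orbT.
have nx v : v \in L1 -> next L1 v = if v == w then w0 else next (x :: y :: L1) v.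
  move=> vL; have iv : (index v L1 < size L1)%N by rewrite index_mem.
  have xv : (x == v) = false by apply: contraNF xn => /eqP ->; rewrite inE vL orbT.
  have yv : (y == v) = false by apply: contraNF yn => /eqP ->.
  have vL2 : v \in x :: y :: L1 by rewrite in_cons (in_cons y L1) vL !orbT.
  rewrite !next_nth vL vL2.
  have -> : index v (x :: y :: L1) = (index v L1).+2 by rewrite /= xv yv.
  have vE : v = nth w0 L1 (index v L1) by rewrite nth_index.
  have wE : w = nth w0 L1 (size L') by rewrite /w (last_nth w0).
  case: eqVneq => [E|ne].
    by rewrite E wE index_uniq//= nth_default.
  have lt : (index v L1 < size L')%N.
    rewrite ltn_neqAle -ltnS iv andbT; apply: contraNneq ne => E.
    by rewrite vE E -wE.
  by rewrite /= (set_nth_default x).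
(* Removing [x] and its successor [y] replaces the chords from [w] to [x], from [x] to [y] and from
   [y] to [w0] by a single chord from [w] to [w0]. *)
have chE B : B.1 \in L1 -> pch L1 B = if B == (w, false) then (w0, true)
    else if B == (w0, true) then (w, false) else pch L B.
  move=> BL; rewrite pchR.
  have chf v : v \in L1 -> pch L1 (v, false) = if v == w then (w0, true) else pch (x :: y :: L1) (v, false).
    by move=> vL; rewrite -[LHS]/(next L1 v, true) nx//; case: eqP.
  case: B BL => v [] vL; rewrite xpair_eqE ?andbF ?andbT /=; last by rewrite chf//= xpair_eqE andbF.
  rewrite xpair_eqE andbT; have pv : prev L1 v \in L1 by rewrite mem_prev.
  have E : pch L1 (v, true) = (prev L1 v, false) by [].
  have E2 : pch L1 (prev L1 v, false) = (v, true) by rewrite -E (pchK uL').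
  rewrite chf// in E2; rewrite E; case: (eqVneq (prev L1 v) w) E2 => [pw [vE]|pw E2].
    by rewrite pw -vE eqxx.
  case: eqVneq => [vE|_].
    exfalso; move/eqP: pw; apply; rewrite vE; apply: (can_inj (prev_next uL')).
    by rewrite (next_prev uL') nx// eqxx.
  by rewrite -E2 (pchK uR).
have wx : pch L (w, false) = (x, true).
  rewrite pchR /pch /=; congr pair; apply: (can_inj (next_prev uR)).
  by rewrite (prev_next uR) prev_nth mem_head memNindex// -last_nth.
have zy : pch L (w0, true) = (y, false).
  rewrite pchR; rewrite -[LHS]/(prev (x :: y :: L1) w0, false); congr pair.
  apply: (can_inj (prev_next uR)).
  have yx : (y == x) = false by rewrite eq_sym; exact: negPf.
  by rewrite (next_prev uR) /= yx eqxx.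
have wxV : pch L (x, true) = (w, false) by rewrite -wx (pchK uL).
have zyV : pch L (y, false) = (w0, true) by rewrite -zy (pchK uL).
pose PA := (x, true); pose PB := (y, false).
have neL (B : pt) v b : B.1 \in L1 -> v \notin L1 -> B != (v, b).
  by move=> BL; apply: contraNneq => E; move: BL; rewrite E.
have xL1 : x \notin L1 by move: xn; rewrite inE negb_or => /andP[].
(* [PA] and [PB] face the two ends of the innermost chord across the edge. Nothing lies between
   those ends, so nothing lies between [PA] and [PB], and both compare alike with all other
   points. *)
have adj B : B.1 \in L -> B != PA -> B != PB -> (ppos B < ppos PA) = (ppos B < ppos PB).
  move=> BL BA BB; have [n1 n2] := nob (pm B) BL.
  have key C D : psd C = psd D -> B != C -> B != D -> (pm C == (x, false)) || (pm C == (y, true)) ->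
     (pm D == (x, false)) || (pm D == (y, true)) -> ppos B < ppos C -> ppos D < ppos B -> False.
    move=> sE BC BD hC hD bC Db; have lt := lt_trans Db bC.
    have sB : psd B = psd C.
      by apply/eqP; rewrite eq_le (psd_mono (ltW bC)) /= sE (psd_mono (ltW Db)).
    have r1 := pm_rev sB bC; have r2 := pm_rev (esym (etrans sB sE)) Db.
    move: hC hD; case/orP => /eqP hC; case/orP => /eqP hD; rewrite hC hD in r1 r2.
    - by have := lt_trans r1 r2; rewrite ltxx.
    - by apply: n1; rewrite r1.
    - by apply: n2; rewrite r1.
    - by have := lt_trans r1 r2; rewrite ltxx.
  have sAB : psd PA = psd PB by rewrite /psd /= sy iota4K.
  apply/idP/idP => h.
    rewrite ltNge; apply/negP => h2; apply: (key PA PB); rewrite ?eqxx ?orbT//.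
    by apply: pos_lt.
  rewrite ltNge; apply/negP => h2; apply: (key PB PA); rewrite ?eqxx ?orbT//.
  by apply: pos_lt.
have xL0 : PA.1 \in L by []. have yL0 : PB.1 \in L by [].
have low := unlinked_low uL un.
have pneq B B' : B != B' -> (ppos B < ppos B') = ~~ (ppos B' < ppos B).
  by move=> ne; rewrite -leNgt le_eqVlt (inj_eq ppos_inj) (negPf ne).
move=> B B' BL BL' b1; have [BL0 BL0'] := (sub1 _ BL, sub1 _ BL').
have aB C : C.1 \in L1 -> (ppos C < ppos PA) = (ppos C < ppos PB).
  by move=> CL; apply: adj; [exact: sub1|exact: neL|exact: neL].
have aB' C : C.1 \in L1 -> (ppos PA < ppos C) = (ppos PB < ppos C).
  by move=> CL; rewrite pneq 1?eq_sym 1?neL// aB// -pneq// eq_sym neL.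
rewrite !chE//; have wL : (w, false).1 \in L1 by []. have zL : (w0, true).1 \in L1 by rewrite inE eqxx.
have chL C : C.1 \in L1 -> C != (w, false) -> C != (w0, true) -> (pch L C).1 \in L1.
  move=> CL n1 n2; have : (pch L C).1 \in L by rewrite pch_in sub1.
  rewrite inL !in_cons -/L1 => /or3P[/eqP E|/eqP E|//].
  - have : pch L C = (x, true) \/ pch L C = (x, false) by case: (pch L C) E => v [] /= ->; [left|right].
    case=> E2; first by move: n1; rewrite -[C](pchK uL) E2 wxV eqxx.
    have := CL; rewrite -[C](pchK uL) E2 /pch /= -/y => h; by rewrite h in yn.
  - have : pch L C = (y, true) \/ pch L C = (y, false) by case: (pch L C) E => v [] /= ->; [left|right].
    case=> E2; last by move: n2; rewrite -[C](pchK uL) E2 zyV eqxx.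
    have := CL; rewrite -[C](pchK uL) E2 /pch /= /y (prev_next uL) => h; by rewrite h in xL1.
case: (eqVneq B (w, false)) => [Bw|Bw]; [|case: (eqVneq B (w0, true)) => [Bz|Bz]].
- rewrite -Bw => b2; have B'w : B' != (w, false) by rewrite -Bw; apply: contraTneq b1 => ->; rewrite ltxx.
  have B'z : B' != (w0, true) by apply: contraTneq b2 => ->; rewrite ltxx.
  rewrite Bw (negPf B'w) (negPf B'z); have cL := chL _ BL' B'w B'z.
  have cz : pch L B' != (w0, true).
    by apply/eqP => E; have := neL B' y false BL' yn; rewrite -zy -E (pchK uL) eqxx.
  rewrite pneq//; apply/negP => h.
  case: (boolP (ppos B' < ppos PA)) => hA; last first.
    rewrite -(pneq PA) 1?eq_sym ?neL// aB'// in hA.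
    by have := un PB B' yL0 BL0' hA; rewrite zyV => /(_ b2); rewrite ltNge (ltW h).
  have b1' : ppos (w, false) < ppos B' by rewrite -Bw.
  have := un (w, false) B' (sub1 _ wL) BL0' b1'; rewrite wx => /(_ hA) h3; rewrite aB// in h3.
  have := low (w0, true) (pch L B') (sub1 _ zL) (sub1 _ cL) h; rewrite zy => /(_ h3).
  by rewrite (pchK uL) ltNge (ltW b2).
- rewrite -Bz => b2; have B'z : B' != (w0, true) by rewrite -Bz; apply: contraTneq b1 => ->; rewrite ltxx.
  have B'w : B' != (w, false) by apply: contraTneq b2 => ->; rewrite ltxx.
  rewrite Bz (negPf B'w) (negPf B'z); have cL := chL _ BL' B'w B'z.
  have cw : pch L B' != (w, false).
    by apply/eqP => E; have := neL B' x true BL' xL1; rewrite -wx -E (pchK uL) eqxx.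
  rewrite pneq//; apply/negP => h.
  case: (boolP (ppos B' < ppos PB)) => hB; last first.
    rewrite -(pneq PB) 1?eq_sym ?neL// -aB'// in hB.
    by have := un PA B' xL0 BL0' hB; rewrite wxV => /(_ b2); rewrite ltNge (ltW h).
  have b1' : ppos (w0, true) < ppos B' by rewrite -Bz.
  have := un (w0, true) B' (sub1 _ zL) BL0' b1'; rewrite zy => /(_ hB) h3; rewrite -aB// in h3.
  have := low (w, false) (pch L B') (sub1 _ wL) (sub1 _ cL) h; rewrite wx => /(_ h3).
  by rewrite (pchK uL) ltNge (ltW b2).
- move=> b2; have cBL := chL _ BL Bw Bz.
  case: (eqVneq B' (w, false)) => [E|_]; [|case: (eqVneq B' (w0, true)) => [E|_]].
  + rewrite E in b1 b2; have h1 := un _ _ BL0 (sub1 _ wL) b1 b2; have h2 := low _ _ BL0 (sub1 _ wL) b1 b2.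
    rewrite wx -/PA in h1 h2.
    have h1' : ppos PB < ppos (pch L B) by rewrite -aB'.
    have h2' : ppos B < ppos PB by rewrite -aB.
    by have := un B PB BL0 yL0 h2' h1'; rewrite zyV.
  + rewrite E in b1 b2; have h1 := un _ _ BL0 (sub1 _ zL) b1 b2; have h2 := low _ _ BL0 (sub1 _ zL) b1 b2.
    rewrite zy -/PB in h1 h2.
    have h1' : ppos PA < ppos (pch L B) by rewrite aB'.
    have h2' : ppos B < ppos PA by rewrite aB.
    by have := un B PA BL0 xL0 h2' h1'; rewrite wxV.
  + exact: un.
Qed.

End Lists.

(** * Winding numbers *)

Section Winding.
Variable R : realType.
Notation C := R[i].

(** To reach another multiple of [2 * pi], the function would have to pass through [f 0 + pi] or
    [f 0 - pi]. *)
Lemma int_const (f : R -> R) : continuous f ->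
  (forall t, 0 <= t <= 1 -> exists m : int, f t = 2 * pi * m%:~R) -> f 0 = f 1.
Proof.
have pi0 := pi_gt0 R.
have le1 (h : R -> R) : continuous h -> (forall t, 0 <= t <= 1 -> exists m : int, h t = 2 * pi * m%:~R) ->
    h 1 <= h 0.
  move=> ch hm; have av t : 0 <= t <= 1 -> h t != h 0 + pi.
    move=> /hm[m ->]; have [|k ->] := hm 0; first by rewrite lexx ler01.
    apply/eqP => E; have : (2 * m - 2 * k)%:~R = 1 :> R.
      rewrite intrB !intrM.
      have p0 : pi != 0 :> R by rewrite gt_eqF.
      by apply: (mulfI p0); rewrite mulr1; lra.
    by move/eqP; rewrite -[1]/(1%:~R) eqr_int => /eqP; lia.
  have := ivt_avoid ch av; rewrite ltrDl pi0 => /(_ isT) lt.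
  have [|m E1] := hm 1; first by rewrite lexx ler01.
  have [|k E0] := hm 0; first by rewrite lexx ler01.
  move: lt; rewrite E1 E0 => lt; rewrite ler_pM2l ?mulr_gt0// ler_int.
  have p0 := pi_gt0 R; have : (2 * m < 2 * k + 1); last by lia.
  by rewrite -(ltr_int R) intrD !intrM -(ltr_pM2l p0) mulrDr mulr1; lra.
move=> cf fm; apply/eqP; rewrite eq_le le1// andbT.
have := le1 (fun t => - f t); rewrite lerN2; apply; first exact: ctsN.
by move=> t /fm[m ->]; exists (- m); rewrite intrN mulrN.
Qed.

Lemma lift_unique (h h' : R -> R) : continuous h -> continuous h' ->
  (forall t, 0 <= t <= 1 -> cis (h t) = cis (h' t)) -> h 1 - h 0 = h' 1 - h' 0.
Proof.
move=> ch ch' E; have := @int_const (fun t => h t - h' t); move=> /(_ _ _)/wrap[].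
- exact: ctsB.
- move=> t /E e; apply: cis_eq1; rewrite cisD cisN e mulfV//.
  by rewrite -md_eq0 md_cis oner_eq0.
by move=> e; lra.
Qed.

Lemma cts_row (T : topologicalType) n (f : 'I_n -> T -> R) : (forall j, continuous (f j)) ->
  continuous (fun t => \row_j f j t : 'rV[R]_n).
Proof.
move=> cf x A [P Px PA].
have : nbhs x [set y | forall a b, P a b ((\row_j f j y) a b)].
  apply: (@filter_forall _ _ _ (nbhs x)) => a.
  apply: (@filter_forall _ _ _ (nbhs x)) => b.
  have := Px a b; rewrite mxE => Pab.
  have := cf b x _ Pab; apply: (@filterS _ (nbhs x) (nbhs_filter x)) => y /=; by rewrite mxE.
by apply: (@filterS _ (nbhs x) (nbhs_filter x)) => y Py; exact: PA.
Qed.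

Section Simplex.
Variables (T : topologicalType) (n : nat) (f : 'I_n.+1 -> T -> R).
Hypothesis cf : forall j, continuous (f j).
Hypothesis f0 : forall j t, 0 <= f j t.
Hypothesis f1 : forall t, \sum_j f j t = 1.

Lemma spt_std t : (\row_j f j t) \in @std_simplex R n.
Proof.
by apply/mem_set; split=> [i|]; [rewrite mxE|rewrite -(f1 t); apply: eq_bigr => i _; rewrite mxE].
Qed.

Definition spt (t : T) : @std_simplex R n := SigSub (spt_std t).

Lemma cspt : continuous spt.
Proof. by apply: continuous_comp_initial; exact: cts_row. Qed.

Lemma sptE t j : set_val (spt t) ord0 j = f j t. Proof. by rewrite /= mxE. Qed.

End Simplex.

Lemma spt_eq n (x y : @std_simplex R n) : (forall j, set_val x ord0 j = set_val y ord0 j) -> x = y.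
Proof. by move=> E; apply: val_inj; apply/rowP => j; exact: E. Qed.

Definition edge_fun (j : 'I_2) (t : R) : R := if j == ord0 then 1 - clamp01 t else clamp01 t.

Lemma edge_fun_c j : continuous (edge_fun j).
Proof.
rewrite /edge_fun; case: (j == _); last exact: continuous_clamp01.
by apply: ctsB; [exact: cts_cst|exact: continuous_clamp01].
Qed.

Lemma edge_fun0 j t : 0 <= edge_fun j t.
Proof. by have := clamp01_itv t; rewrite /edge_fun; case: (j == _); lra. Qed.

Lemma edge_fun1 t : \sum_j edge_fun j t = 1.
Proof. by rewrite !big_ord_recl big_ord0 /edge_fun /=; lra. Qed.

Definition edge_pt : R -> @std_simplex R 1 := spt edge_fun0 edge_fun1.

(** The triangle as image of the square: the edge [p.1 = 0] collapses to vertex 0, and the faces 0,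
    1, 2 are the edges [p.1 = 1], [p.2 = 1], [p.2 = 0]. *)
Definition tri_fun (j : 'I_3) (p : R * R) : R := if j == ord0 then 1 - clamp01 p.1 else
  if j == ord_max then clamp01 p.1 * clamp01 p.2 else clamp01 p.1 * (1 - clamp01 p.2).

Lemma tri_fun_c j : continuous (tri_fun j).
Proof.
have c1 : continuous (fun p : R * R => clamp01 p.1) by apply: cts_comp; [exact: continuous_clamp01|exact: cts_fst].
have c2 : continuous (fun p : R * R => clamp01 p.2) by apply: cts_comp; [exact: continuous_clamp01|exact: cts_snd].
rewrite /tri_fun; case: (j == _); last case: (j == _).
- by apply: ctsB; [exact: cts_cst|].
- exact: ctsM.
- by apply: ctsM => //; apply: ctsB; [exact: cts_cst|].
Qed.

Lemma tri_fun0 j p : 0 <= tri_fun j p.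
Proof.
have := clamp01_itv p.1; have := clamp01_itv p.2; rewrite /tri_fun.
by case: (j == _); last case: (j == _); nra.
Qed.

Lemma tri_fun1 p : \sum_j tri_fun j p = 1.
Proof. by rewrite !big_ord_recl big_ord0 /tri_fun /=; ring. Qed.

Definition tri_pt : R * R -> @std_simplex R 2 := spt tri_fun0 tri_fun1.

Lemma face_pt (i : 'I_3) t : 0 <= t <= 1 -> face i (edge_pt t) =
  tri_pt (if i == ord0 then (1, t) else if i == ord_max then (t, 0) else (t, 1)).
Proof.
move=> t01; apply: spt_eq => j; rewrite sptE /= mxE.
have c0 : clamp01 0 = 0 :> R by apply: clamp01_id; rewrite lexx ler01.
have c1 : clamp01 1 = 1 :> R by apply: clamp01_id; rewrite lexx ler01.
have ct : clamp01 t = t by exact: clamp01_id.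
case: i j => -[|[|[|//]]] hi [] [|[|[|//]]] hj; case: unliftP => [k|] /(congr1 val) /=;
 rewrite /bump ?mxE /edge_fun /tri_fun /= ?c0 ?c1 ?ct;
 try (case: k => -[|[|//]] hk /= E; rewrite ?c0 ?c1 ?ct; try (by []); try ring);
 by move=> // E; rewrite ?c0 ?c1 ?ct; ring.
Qed.

Variables (X : topologicalType) (u : X -> C).
Hypotheses (cu : continuous u) (u1 : forall x, md (u x) = 1).

(** The reals as a rational vector space, the target of a linear form on rational chains. *)
Definition rat_line : Type := R.
HB.instance Definition _ := GRing.Zmodule.on rat_line.
Definition rat_scale (a : rat) (x : rat_line) : rat_line := (ratr a : R) * (x : R).

Fact rat_scaleA a b x : rat_scale a (rat_scale b x) = rat_scale (a * b) x.
Proof. by rewrite /rat_scale mulrA rmorphM. Qed.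
Fact rat_scale1 : left_id 1 rat_scale.
Proof. by move=> x; rewrite /rat_scale rmorph1 mul1r. Qed.
Fact rat_scaleDr : right_distributive rat_scale +%R.
Proof. by move=> a x y; exact: mulrDr. Qed.
Fact rat_scaleDl x : {morph rat_scale^~ x : a b / a + b}.
Proof. by move=> a b; rewrite /rat_scale rmorphD; exact: mulrDl. Qed.
HB.instance Definition _ := GRing.Zmodule_isLmodule.Build rat rat_line
  rat_scaleA rat_scale1 rat_scaleDr rat_scaleDl.

Lemma simplex_lift (s : singular_simplex R X 1) : exists h : R -> R, continuous h /\
  forall t, 0 <= t <= 1 -> u (s (edge_pt t)) = cis (h t).
Proof.
have [|t _|h ch hE] := @lift_line R (fun t => u (s (edge_pt t))); last by exists h.
  by apply: cts_comp cu _; apply: cts_comp; [exact: cts_fun|exact/cspt/edge_fun_c].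
by rewrite u1.
Qed.

Definition turn (s : singular_simplex R X 1) : rat_line :=
  let h := projT1 (cid (simplex_lift s)) in h 1 - h 0.

Lemma turnE (s : singular_simplex R X 1) (h : R -> R) : continuous h ->
  (forall t, 0 <= t <= 1 -> u (s (edge_pt t)) = cis (h t)) -> turn s = h 1 - h 0.
Proof.
move=> ch hE; rewrite /turn; case: cid => h' [ch' hE'] /=.
by apply: lift_unique => // t t01; rewrite -hE' // hE.
Qed.

Definition winding : chain R X 1 -> rat_line := fglift turn.

Lemma winding_is_linear : linear winding.
Proof.
move=> a c d; rewrite /winding; pose L := GRing.isZmodMorphism.Build _ _ _ (lift_is_additive turn).
pose w : {additive chain R X 1 -> rat_line} := HB.pack (fglift turn) L.
rewrite -[fglift turn]/(w : _ -> _) raddfD; congr (_ + _).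
have -> : a *: c = \sum_(s <- dom c) << a * coeff s c *g s >> by [].
rewrite raddf_sum -[in RHS](freeg_sumE c) raddf_sum scaler_sumr.
by apply: eq_bigr => s _; rewrite /w /= !liftU scalerA.
Qed.

HB.instance Definition _ :=
  GRing.isLinear.Build rat (chain R X 1) rat_line *:%R winding winding_is_linear.

(** An angle lifted over the square gives the turns of all three faces; their alternating sum is
    minus the increment along the collapsed edge, which is 0. *)
Lemma winding_boundary (b : chain R X 2) : winding (boundary b) = 0.
Proof.
suff H k (s : singular_simplex R X 2) : winding (boundary (<< k *g s >> : chain R X 2)) = 0.
  by rewrite -(freeg_sumE b) linear_sum linear_sum big1// => s _; exact: H.
have -> : boundary (<< k *g s >> : chain R X 2) =
  k *: (\sum_(i < 3) (-1) ^+ i *: << simplex_face s i >>) by rewrite /boundary liftU.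
rewrite linearZ linear_sum /=; rewrite !big_ord_recl big_ord0 addr0.
rewrite !linearZ /= /winding !liftU.
have [th E0] := @cis_surj R (u (s (tri_pt (0, 0)))) (u1 _).
have cH : continuous (fun p : R * R => u (s (tri_pt p))).
  by apply: cts_comp cu _; apply: cts_comp; [exact: cts_fun|exact/cspt/tri_fun_c].
have [|||h [ch _ hE]] := @lift_square' R (fun a c => u (s (tri_pt (a, c)))) th.
- by rewrite (_ : (fun p => _) = fun p : R * R => u (s (tri_pt p)))//; apply: funext => -[].
- by move=> a c _ _; rewrite -md_eq0 u1 oner_eq0.
- by rewrite u1 mul1r.
have z01 : 0 <= (0 : R) <= 1 by rewrite lexx ler01.
have o01 : 0 <= (1 : R) <= 1 by rewrite lexx ler01.
have E a c : 0 <= a <= 1 -> 0 <= c <= 1 -> u (s (tri_pt (a, c))) = cis (h a c).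
  by move=> a1 c1; rewrite hE// u1 mul1r.
have fE (i : 'I_3) t : simplex_face s i (edge_pt t) = s (face i (edge_pt t)) by [].
rewrite (@turnE _ (h 1)); last 2 first.
- exact: cslice1.
- by move=> t t01; rewrite fE face_pt// E.
rewrite (@turnE _ (h^~ 1)); last 2 first.
- exact: cslice2.
- by move=> t t01; rewrite fE face_pt// E.
rewrite (@turnE _ (h^~ 0)); last 2 first.
- exact: cslice2.
- by move=> t t01; rewrite fE face_pt// E.
have h00 : h 0 1 - h 0 0 = 0.
  rewrite (@lift_unique (h 0) (fun=> h 0 0)) ?subrr//.
  - exact: cslice1.
  - exact: cts_cst.
  move=> t t01; rewrite -!E//; congr (u (s _)); apply: spt_eq => j; rewrite !sptE /tri_fun /=.
  by rewrite clamp01_id// !mul0r.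
rewrite expr0 expr1 expr2 mulrNN mulr1 !scale1r scaleN1r.
rewrite [X in _ *: X](_ : _ = 0) ?scaler0//.
rewrite -[LHS]/((h 1 1 - h 1 0) + (- (h 1 1 - h 0 1) + (h 1 0 - h 0 0))).
by lra.
Qed.

Section Paths.
Variables (c : R -> X).
Hypothesis cc : continuous c.

Definition path_simplex : singular_simplex R X 1 := mkcts cc \o mkcts (@continuous_edge_coord R).

Lemma path_simplexE t : 0 <= t <= 1 -> path_simplex (edge_pt t) = c t.
Proof.
move=> t01; rewrite -[LHS]/(c (edge_coord (edge_pt t))); congr c.
by rewrite /edge_coord sptE /edge_fun /= clamp01_id.
Qed.

Lemma turn_path (h : R -> R) : continuous h -> (forall t, 0 <= t <= 1 -> u (c t) = cis (h t)) ->
  turn path_simplex = h 1 - h 0.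
Proof. by move=> ch hE; apply: turnE => // t t01; rewrite path_simplexE// hE. Qed.

Definition point_simplex (x : X) : singular_simplex R X 0 := mkcts (@cts_cst (@std_simplex R 0) X x).

Lemma boundary_path : boundary << path_simplex >> =
  << point_simplex (c 1) >> - << point_simplex (c 0) >>.
Proof.
rewrite /boundary liftU scale1r !big_ord_recl big_ord0 addr0.
rewrite expr0 expr1 scale1r scaleN1r.
have max1 : ord_max = fintype.lift ord0 ord0 :> 'I_2 by exact/val_inj.
have up1 : fintype.lift ord0 ord0 = ord_max :> 'I_2 by exact/val_inj.
have face_val i (x : @std_simplex R 0) : simplex_face path_simplex i x =
    c (face_row i (set_val x) ord0 ord_max) by [].
congr (<< _ >> - << _ >>); apply/continuousEP => x; have /set_mem[_] := valP x; rewrite big_ord1 => x1.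
  by rewrite face_val mxE {1}max1 liftK x1.
by rewrite face_val mxE up1 unlift_none.
Qed.

End Paths.
(** A linear form that kills boundaries and all generators of the span, but not the cycle [Z], shows
    that the class of [Z] is outside the span. *)
Lemma winding_proper (Y : topologicalType) (p : X -> Y) (Z : chain R X 1) :
  (forall c, closed_curve c -> component_of_scc_preimage p c -> exists h : R -> R,
    [/\ continuous h, forall t, 0 <= t <= 1 -> u (c t) = cis (h t) & h 1 = h 0]) ->
  boundary Z = 0 -> winding Z <> 0 -> H1_scc R p <> [set: H1 R X].
Proof.
move=> scc Z0 wZ E; have ZP : is_cycle1 Z by apply/eqP.
have : H1_scc R p (homology_class (Sub Z ZP : cycle1 R X)) by rewrite E.
case=> n [a [e [eP eE]]]; apply: wZ.
have /choice[k kP] : forall i, exists k : cycle1 R X, e i = homology_class k /\ winding (val k) = 0.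
  move=> i; have [c [cc [cs ->]]] := eP i; eexists; split; first by [].
  have [h [ch hE h10]] := scc c cc cs.
  rewrite /= /winding liftU scale1r.
  rewrite -[turn _]/(turn (path_simplex cc.1)) (@turn_path c cc.1 h ch hE) h10.
  exact: subrr.
have lin : homology_class (Sub Z ZP : cycle1 R X) = homology_class (\sum_(i < n) a i *: k i).
  rewrite eE (eq_bigr (fun i => a i *: homology_class (k i))); last by move=> i _; rewrite (kP i).1.
  have hD : forall x y : cycle1 R X, homology_class (x + y) = homology_class x + homology_class y.
    by move=> x y; exact: submod_piD.
  have hZ : forall b (x : cycle1 R X), homology_class (b *: x) = b *: homology_class x.
    by move=> b x; rewrite -[RHS]/(quot_scale b (submod_pi (@is_boundary1_closed R X) x)) quot_scale_pi.
  elim/big_rec2: _ => [|i x y _ ->]; last by rewrite hD hZ.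
  by rewrite -(scale0r (0 : cycle1 R X)) hZ scale0r.
move/eqP: lin; rewrite submod_pi_eq => /asboolP[b bE].
have vE : boundary b = Z - \sum_(i < n) a i *: (val (k i) : chain R X 1).
  by rewrite -bE raddfB raddf_sum /=; congr (_ - _); apply: eq_bigr => i _.
have := winding_boundary b; rewrite vE.
rewrite [LHS](linearB winding) => /eqP; rewrite subr_eq0 => /eqP ->.
rewrite [LHS](linear_sum winding) big1// => i _.
transitivity (a i *: winding (val (k i))); first exact: linearZ.
by rewrite (kP i).2 scaler0.
Qed.

End Winding.

(** * The circle-valued primitive and the cycle dual to it *)

Section Cone.
Variables (R : realType) (g : nat).
Hypothesis g0 : (0 < g)%N.
Notation C := R[i].
Notation z4 := ((4 * g)%N%:Z).
Notation n4 := ((4 * g)%:R : R).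
Notation arc := (@arc R g).
Variables (S : finType) (tau : int -> S -> S) (z : S -> S).
Hypothesis tauK : forall j s, tau (iota4 j) (tau j s) = s.
Hypothesis tau_per : forall j m s, tau (j + z4 * m) s = tau j s.
Hypothesis tauz : forall j s, z (tau j s) = tau j (z s).
Variable N : S -> int -> int.
Hypothesis Nh : harmonic g0 tau z N.

(** Piecewise linear on the boundary of the sheet, with slope [N s i] on side [i]; it closes up
    because the values on the sides of a sheet sum to 0. *)
Definition cone_bd (s : S) (x : R) : R := \sum_(i < 4 * g) (N s (i : nat)%:Z)%:~R * clamp01 (x - (i : nat)%:R).

Lemma continuous_cone_bd s : continuous (cone_bd s).
Proof.
apply: cts_sum => i _; apply: ctsM; first exact: cts_cst.
by apply: cts_comp; [exact: continuous_clamp01|apply: ctsB; [exact: cts_id|exact: cts_cst]].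
Qed.

Lemma cone_bd0 s : cone_bd s 0 = 0.
Proof.
rewrite /cone_bd big1// => i _; rewrite /clamp01 [X in Num.max 0 X]min_r ?sub0r; last first.
  by rewrite (@le_trans _ _ 0)// oppr_le0 ler0n.
by rewrite max_l ?mulr0// oppr_le0 ler0n.
Qed.

Definition psum (s : S) (j : int) : int := \sum_(i < 4 * g | (i < side g0 j)%N) N s (i : nat)%:Z.

Lemma cone_bd_nat s (n : nat) t : (n < 4 * g)%N -> 0 <= t <= 1 ->
  cone_bd s (n%:R + t) = (psum s n)%:~R + (N s n%:Z)%:~R * t.
Proof.
move=> nn t01; rewrite /cone_bd (bigID (fun i : 'I_(4 * g) => (i < n)%N)) /=; congr (_ + _).
  rewrite /psum rmorph_sum side_small//=; apply: eq_bigr => i ii; rewrite /clamp01 min_l ?max_r ?mulr1//.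
  have : (i.+1 <= n)%N by []. rewrite -(ler_nat R) -addn1 natrD; lra.
pose i0 := Ordinal nn; rewrite (bigD1 i0) /=; last by rewrite ltnn.
rewrite addrAC subrr add0r clamp01_id// big1 ?addr0// => i /andP[ii ne].
have : (n.+1 <= i)%N by rewrite ltn_neqAle eq_sym -(inj_eq (@ord_inj _)) in ne *; rewrite ne /= leqNgt.
rewrite -(ler_nat R) -addn1 natrD => h; rewrite /clamp01 min_r ?max_l ?mulr0//; lra.
Qed.

Lemma cone_bd1 s : cone_bd s n4 = 0.
Proof.
have n40 : (0 < 4 * g)%N by rewrite muln_gt0.
have -> : n4 = (4 * g).-1%:R + 1 by rewrite -[X in X%:R](prednK n40) -natr1.
have [_ _ N0 _] := Nh; rewrite cone_bd_nat ?prednK ?ler01 ?lexx//.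
rewrite mulr1 -intrD -[RHS]/(0%:~R); congr (_%:~R); rewrite -[RHS](N0 s) /psum.
rewrite side_small ?prednK//; have lt0 : ((4 * g).-1 < 4 * g)%N by rewrite ltn_predL.
pose i0 := Ordinal lt0.
rewrite [RHS](bigD1 i0) //= addrC; congr (_ + _); apply: eq_bigl => i.
rewrite -(inj_eq (@ord_inj _)) /= ltn_neqAle; have := ltn_ord i.
by rewrite -[X in (i < X)%N -> _](prednK n40) ltnS => ->; rewrite andbT.
Qed.

(** The radial extension of [cone_bd]. The representation [r * arc x] is ambiguous only at the
    centre and at the seam [x = 0], [x = 4 * g], where the values agree. *)
Lemma coneE s : exists u : C -> R, continuous u /\
  forall r x, 0 <= r <= 1 -> 0 <= x <= n4 -> u (r%:C * arc x) = r * cone_bd s x.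
Proof.
have n40 : 0 < n4 by rewrite ltr0n muln_gt0.
pose K (_ : unit) : set (R * R) := `[0, 1] `*` `[0, n4].
pose Phi (_ : unit) (p : R * R) : C := p.1%:C * arc p.2.
pose G (_ : unit) (p : R * R) : R := p.1 * cone_bd s p.2.
have wd r x r' x' : 0 <= r <= 1 -> 0 <= x <= n4 -> 0 <= r' <= 1 -> 0 <= x' <= n4 ->
    r%:C * arc x = r'%:C * arc x' -> r * cone_bd s x = r' * cone_bd s x'.
  move=> r1 x1 r1' x1' E.
  have rr : r = r'.
    have := congr1 (@md R) E; rewrite !mdM !mdRe !md_arc !mulr1 !ger0_norm//; lra.
  rewrite -rr in E *; case: (eqVneq r 0) => [->|rn]; first by rewrite !mul0r.
  congr (_ * _); have {}E : arc x = arc x'.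
    by apply: mulfI E; rewrite fmorph_eq0.
  have [m mE] := arc_inj g0 E.
  have mz : (z4 * m)%:~R = n4 * m%:~R :> R by rewrite intrM.
  rewrite mz in mE; have h1 : -1 <= m%:~R :> R.
    by rewrite -(ler_pM2l n40); lra.
  have h2 : m%:~R <= 1 :> R by rewrite -(ler_pM2l n40); lra.
  have : (m == 0) || (m == 1) || (m == -1).
    by move: h1 h2; rewrite -[-1]/((-1)%:~R) -[X in _ -> _ <= X -> _]/(1%:~R) !ler_int; lia.
  case/orP => [/orP[]|] /eqP me; rewrite me in mE; move: mE; rewrite ?mulr0 ?addr0 ?mulr1 ?mulrN1z => mE.
  - by rewrite mE.
  - have -> : x = n4 by lra.
    have -> : x' = 0 by lra.
    by rewrite cone_bd0 cone_bd1.
  - have -> : x = 0 by lra.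
    have -> : x' = n4 by lra.
    by rewrite cone_bd0 cone_bd1.
have surj w : exists p : R * R, K tt p /\ ret w = Phi tt p.
  have [a /andP[a0 a2] aE] := polar (ret w); have p0 := pi_gt0 R.
  exists (md (ret w), a * n4 / (2 * pi)); split.
    split; rewrite /= in_itv /=; first by rewrite md_ge0 md_ret.
    have pp : 0 < 2 * pi :> R by rewrite mulr_gt0.
    apply/andP; split; first by rewrite divr_ge0 ?mulr_ge0// ltW.
    by rewrite ler_pdivrMr// mulrC ler_pM2l.
  rewrite /Phi /= {1}aE /arc; congr (_ * cis _).
  have pp : 2 * pi != 0 :> R by rewrite gt_eqF// mulr_gt0.
  by rewrite [2 * pi * _]mulrC divfK// mulfK// gt_eqF.
have [P PP] := choice surj.
pose u w := G tt (P w).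
have ur r x : 0 <= r <= 1 -> 0 <= x <= n4 -> u (r%:C * arc x) = r * cone_bd s x.
  move=> r1 x1; have [[k1 k2] E] := PP (r%:C * arc x); rewrite /u /G.
  move: k1 k2; rewrite /= !in_itv /= => k1 k2; apply: wd => //; rewrite -[LHS]/(Phi tt _) -E ret_id//.
  by rewrite mdM mdRe md_arc mulr1 ger0_norm//; case/andP: r1.
exists u; split => //.
apply: (@compact_lift _ _ _ _ unit K Phi G (@ret R) u).
- exact: norm_hausdorff.
- by move=> i; apply: compact_setX; exact: segment_compact.
- by move=> i; apply: ctsM; [apply: cts_toC; exact: cts_fst|apply: cts_comp; [exact: continuous_arc|exact: cts_snd]].
- move=> i; apply: continuous_subspaceT; apply: ctsM; first exact: cts_fst.
  by apply: cts_comp; [exact: continuous_cone_bd|exact: cts_snd].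
- move=> [] p [] p' [k1 k2] [k1' k2'] E; move: k1 k2 k1' k2'; rewrite /= !in_itv /= => *.
  exact: wd.
- exact: continuous_ret.
- by move=> w; exists tt, (P w); have [] := PP w.
Qed.

Definition cone (s : S) : C -> R := projT1 (cid (coneE s)).

Lemma continuous_cone s : continuous (cone s).
Proof. by rewrite /cone; case: cid => u []. Qed.

Lemma cone_side s (j : int) t : 0 <= t <= 1 ->
  cone s (arc (j%:~R + t)) = (psum s j)%:~R + (N s j)%:~R * t.
Proof.
move=> t01; have [_ Nper _ _] := Nh.
have [m jE] := sideK g0 j.
have -> : arc (j%:~R + t) = arc ((side g0 j : nat)%:R + t).
  by rewrite {1}jE intrD addrAC arc_per.
have -> : psum s j = psum s (side g0 j : nat)%:Z by rewrite /psum side_id.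
have -> : N s j = N s (side g0 j : nat)%:Z by rewrite {1}jE Nper.
rewrite -cone_bd_nat ?ltn_ord// /cone; case: cid => u [_ /= uE].
rewrite -[arc _]mul1r -[1]/(1%:C) uE ?mul1r ?ler01 ?lexx//.
have : ((side g0 j).+1 <= 4 * g)%N by rewrite ltn_ord.
by rewrite -(ler_nat R) -natr1; have := ler0n R (side g0 j); lra.
Qed.

(** The two cones along a glued side have the same slope, so they differ by a constant, and this
    constant is an integer. It is the cocycle whose sums along words measure winding. *)
Definition jump (s : S) (j : int) : int := psum (tau j s) (iota4 j) - N s j - psum s j.

Lemma jump_cochain : cochain tau z jump.
Proof.
have [[N1 N2] _ _ _] := Nh; split=> s j; rewrite /jump.
  by rewrite tauK iota4K N1; ring.
have psz s' j' : psum (z s') j' = - psum s' j' by rewrite /psum -sumrN; apply: eq_bigr => i _; rewrite N2.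
by rewrite -tauz !psz N2; ring.
Qed.

Lemma cone_glue s x : cone (nxt tau (s, x)).1 (arc (nxt tau (s, x)).2) =
  cone s (arc x) + (jump s (Num.floor x))%:~R.
Proof.
rewrite /nxt /=; set j := Num.floor x; have /andP[h1 h2] := floor_itv x; rewrite -/j in h1 h2.
have [[N1 N2] _ _ _] := Nh.
have -> : x = j%:~R + (x - j%:~R) by rewrite addrC subrK.
set t := x - j%:~R; have t01 : 0 <= t <= 1 by rewrite /t; move: h2; rewrite intrD => h2; lra.
have -> : (j + iota4 j + 1)%:~R - (j%:~R + t) = (iota4 j)%:~R + (1 - t) by rewrite !intrD; ring.
rewrite !cone_side//; last by lra.
by rewrite /jump !intrB N1 intrN; ring.
Qed.

(** Monodromy of the infinite cyclic cover on which the circle-valued function becomes the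
    exponential of a real function, equal to [cone s - c] on the sheet [(s, c)]. *)
Definition htau (j : int) (a : S * int) : S * int := (tau j a.1, a.2 + jump a.1 j).

Lemma htauK j a : htau (iota4 j) (htau j a) = a.
Proof. by case: a => s c; rewrite /htau /= tauK (jump_cochain.1 s j) addrK. Qed.

Lemma jump_per s j m : jump s (j + z4 * m) = jump s j.
Proof.
have [_ Nper _ _] := Nh; rewrite /jump iota4_per tau_per Nper.
by rewrite /psum !side_per.
Qed.

Lemma htau_per j m a : htau (j + z4 * m) a = htau j a.
Proof. by rewrite /htau tau_per jump_per. Qed.

Variables (X : topologicalType) (q : S -> C -> X).
Hypothesis ps : polysurf g tau q.

Lemma cone_circle : exists u : X -> C, [/\ continuous u, forall x, md (u x) = 1 &
  forall s z, md z <= 1 -> u (q s z) = cis (2 * pi * cone s z)].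
Proof.
have [||u cu uE] := descend g0 ps (F := fun s z => cis (2 * pi * cone s z)).
- by move=> s; apply: cts_cis; apply: ctsM; [exact: cts_cst|exact: continuous_cone].
- by move=> s x; rewrite cone_glue mulrDr cisD cis2piz mulr1.
exists u; split => // x; have [s [w [w1 ->]]] := ps_surj ps x.
by rewrite uE// md_cis.
Qed.

Variables (Xh : topologicalType) (qh : S * int -> C -> Xh).
Hypothesis psh : polysurf g htau qh.

Lemma cone_line : exists2 v : Xh -> R, continuous v &
  forall s c z, md z <= 1 -> v (qh (s, c) z) = cone s z - c%:~R.
Proof.
have [||v cv vE] := descend g0 psh (F := fun a z => cone a.1 z - (a.2)%:~R).
- by move=> a; apply: ctsB; [exact: continuous_cone|exact: cts_cst].
- move=> [s c] x; rewrite /nxt /= -/(nxt tau (s, x)).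
  have := cone_glue s x; rewrite /nxt /= => ->.
  by rewrite intrD; ring.
by exists v => // s c w w1; rewrite vE.
Qed.

Hypothesis ne0 : exists s (i : 'I_(4 * g)), N s (i : nat)%:Z != 0.

(** The coefficients are at the same time the slopes of the angle, so the winding number is [2 * pi]
    times a sum of squares. Every edge is counted from both of its sides, which doubles the
    chain. *)
Lemma harmonic_cycle (u : X -> C) (cu : continuous u) (u1 : forall x, md (u x) = 1) :
  (forall s z, md z <= 1 -> u (q s z) = cis (2 * pi * cone s z)) ->
  exists2 Z : chain R X 1, boundary Z = 0 & winding cu u1 Z <> 0.
Proof.
move=> uE; pose ed (c : S * 'I_(4 * g)) (t : R) := q c.1 (arc ((c.2 : nat)%:R + t)).
have ced c : continuous (ed c).
  apply: cts_comp; first exact: ps_cont ps c.1.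
  by apply: cts_comp; [exact: continuous_arc|apply: ctsD; [exact: cts_cst|exact: cts_id]].
pose n (c : S * 'I_(4 * g)) := N c.1 (c.2 : nat)%:Z.
pose Z : chain R X 1 := \sum_c (n c)%:~R *: << path_simplex (ced c) >>.
have [[N1 N2] Nper _ Nv] := Nh.
exists Z; last first.
  have wE c : winding cu u1 (<< path_simplex (ced c) >> : chain R X 1) = 2 * pi * (n c)%:~R :> R.
    rewrite /winding liftU scale1r.
    rewrite (turn_path cu u1 (ced c) (h := fun t => 2 * pi * ((psum c.1 (c.2 : nat)%:Z)%:~R + (n c)%:~R * t))).
    - by rewrite mulr1 mulr0 addr0 mulrDr addrAC subrr add0r.
    - apply: ctsM; first exact: cts_cst.
      by apply: ctsD; [exact: cts_cst|apply: ctsM; [exact: cts_cst|exact: cts_id]].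
    - by move=> t t01; rewrite uE ?md_arc// -cone_side.
  have -> : winding cu u1 Z = \sum_c 2 * pi * (n c)%:~R ^+ 2 :> R.
    rewrite /Z linear_sum; apply: eq_bigr => c _.
    rewrite [LHS](_ : _ = (n c)%:~R *: winding cu u1 (<< path_simplex (ced c) >> : chain R X 1)); last first.
      exact: linearZ.
    by rewrite -[LHS]/(ratr (n c)%:~R * _) ratr_int wE expr2; ring.
  have [s [i si]] := ne0; apply/eqP; rewrite gt_eqF//.
  have p0 := pi_gt0 R; rewrite (bigD1 (s, i))//= ltr_wpDr//.
    by apply: sumr_ge0 => c _; rewrite mulr_ge0 ?sqr_ge0// mulr_ge0 ?ltW.
  by apply: mulr_gt0; [rewrite mulr_gt0|rewrite exprn_even_gt0//= intr_eq0].
pose P (c : S * 'I_(4 * g)) : chain R X 0 := << point_simplex R (ed c 0) >>.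
pose flip (c : S * 'I_(4 * g)) := (tau (c.2 : nat)%:Z c.1, side g0 (iota4 (c.2 : nat)%:Z)).
have flipK c : flip (flip c) = c.
  case: c => s i; rewrite /flip /=.
  have [m mE] := sideK g0 (iota4 (i : nat)%:Z).
  have -> : tau (side g0 (iota4 (i : nat)%:Z) : nat)%:Z = tau (iota4 (i : nat)%:Z).
    by apply: funext => s'; exact: tau_side.
  rewrite tauK; congr pair; have : iota4 (iota4 (i : nat)%:Z) = iota4 (side g0 (iota4 (i : nat)%:Z) : nat)%:Z + z4 * m.
    by rewrite {1}mE iota4_per.
  by rewrite iota4K => /(congr1 (side g0)); rewrite side_per side_id => <-.
have n_flip c : n (flip c) = - n c.
  case: c => s i; rewrite /n /flip /=.
  have [m mE] := sideK g0 (iota4 (i : nat)%:Z).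
  by rewrite -N1 [in RHS]mE Nper.
have arcs j : arc ((side g0 j : nat)%:R) = arc j%:~R.
  have [m {2}->] := sideK g0 j; by rewrite intrD arc_per.
have glue s (i : 'I_(4 * g)) x : (i : nat)%:R <= x <= (i : nat)%:R + 1 ->
    q s (arc x) = q (tau (i : nat)%:Z s) (arc (((i : nat)%:Z + iota4 (i : nat)%:Z + 1)%:~R - x)).
  move=> xi; apply: esym; apply: (ps_glue ps); exact: bdrel_side.
have ed1 c : ed c 1 = ed (flip c) 0.
  case: c => s i; rewrite /ed /flip /= (glue s i); last by rewrite lerDl ler01 lexx.
  rewrite addr0 arcs; congr (q _ (arc _)); by rewrite !intrD -pmulrn; ring.
have P_corner c : P (corner g0 tau c) = P c.
  case: c => s i; rewrite /P /ed /corner /= !addr0; congr << point_simplex R _ >>.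
  rewrite (glue s i); last by rewrite lerDl ler01 lexx.
  rewrite arcs; congr (q _ (arc _)); by rewrite !intrD -pmulrn; ring.
have bE : boundary Z = \sum_c (n c)%:~R *: P (flip c) - \sum_c (n c)%:~R *: P c.
  rewrite /Z linear_sum -sumrB; apply: eq_bigr => c _; rewrite linearZ /= boundary_path -scalerBr.
  by rewrite ed1.
(* The flip of an edge exchanges its ends and changes the sign of [N], so both end contributions
   agree; grouped by corner orbits they vanish by harmonicity at the vertices. *)
have -> : boundary Z = - (2%:R *: \sum_c (n c)%:~R *: P c).
  rewrite bE (reindex_inj (can_inj flipK)) /=; rewrite (eq_bigr (fun c => - ((n c)%:~R *: P c))).
    by rewrite sumrN scalerDl scale1r opprD.
  by move=> c _; rewrite flipK n_flip intrN scaleNr.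
rewrite (_ : \sum_c _ = 0) ?scaler0 ?oppr0//.
pose f := corner g0 tau.
have sym : connect_sym (frel f) by apply: fconnect_sym; exact: corner_inj.
have P_root c : P (froot f c) = P c.
  have := connect_root (frel f) c => /iter_findex <-.
  by elim: (findex _ _ _) => //= k <-; exact: P_corner.
rewrite (partition_big (froot f) predT)//= big1// => r _.
rewrite (eq_bigr (fun c => (n c)%:~R *: P r)); last by move=> c /eqP <-; rewrite P_root.
rewrite -scaler_suml -(rmorph_sum intr) /=.
case: (pickP (fun c => froot f c == r)) => [c0 /eqP rE|no]; last by rewrite big_pred0// scale0r.
rewrite (eq_bigl (fconnect f c0)); first by rewrite Nv scale0r.
by move=> c; rewrite -rE eq_sym; exact: root_connect.
Qed.

End Cone.

(** * Reading a curve in the polygon *)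

Section Collar.
Variables (R : realType) (g : nat).
Hypothesis g0 : (0 < g)%N.
Notation C := R[i].
Notation z4 := ((4 * g)%N%:Z).
Notation n4 := ((4 * g)%:R : R).
Notation arc := (@arc R g).

Lemma n4_ge4 : 4 <= n4.
Proof. by rewrite ler_nat -{1}[4%N]muln1 leq_mul2l. Qed.

Definition sec (j : int) (z : C) := 0 < md z /\
  exists2 x, j%:~R < x < j%:~R + 1 & z = (md z)%:C * arc x.

(** A holomorphic map that equals the gluing of side [j] on the unit circle and exchanges its inside
    and outside: a point just beyond side [j] is continued as a point inside the neighbouring
    sheet. *)
Definition mirror (j : int) (z : C) : C := arc (j + iota4 j + 1)%:~R / z.

Lemma int_between (x : R) (j k : int) : j%:~R < x < j%:~R + 1 -> k%:~R < x < k%:~R + 1 -> j = k.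
Proof.
move=> /andP[j1 j2] /andP[k1 k2]; have := lt_trans j1 k2; have := lt_trans k1 j2.
rewrite -!intrD1 !ltr_int; lia.
Qed.

Lemma not_int_between (x : R) (j k : int) : j%:~R < x < j%:~R + 1 -> x != k%:~R.
Proof.
move=> /andP[j1 j2]; apply/eqP => E; move: j1 j2; rewrite E -intrD1 !ltr_int; lia.
Qed.

Lemma sec_per j m z : sec j z -> sec (j + z4 * m) z.
Proof.
move=> [z0 [x xj zE]]; split => //; exists (x + (z4 * m)%:~R); last by rewrite arc_per.
by rewrite intrD; lra.
Qed.

Lemma sec_mod j k z : sec j z -> sec k z -> exists m, j = k + z4 * m.
Proof.
move=> [z0 [x xj zE]] [_ [y yk zE']]; have E : arc x = arc y.
  by apply: (@mulfI _ (md z)%:C); rewrite ?fmorph_eq0 ?gt_eqF// -zE.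
have [m xE] := arc_inj g0 E; exists m; apply: int_between xj _.
by rewrite xE intrD; lra.
Qed.

Lemma sec_uniq j k z : 0 <= j < z4 -> 0 <= k < z4 -> sec j z -> sec k z -> j = k.
Proof.
move=> jz kz sj sk; have [m E] := sec_mod sj sk.
have z40 : 0 < z4 by rewrite ltz_nat muln_gt0.
have [m0|[m1|m1]] : m = 0 \/ (m <= -1 \/ 1 <= m) by lia.
- by rewrite E m0 mulr0 addr0.
- by move: jz kz (ler_pM2l z40 m (-1)); rewrite m1 mulrN1 E => ? ? h; lia.
- by move: jz kz (ler_pM2l z40 1 m); rewrite m1 mulr1 E => ? ? h; lia.
Qed.

Lemma iota4_sum j : iota4 j + iota4 (iota4 j) + 1 = j + iota4 j + 1.
Proof. by rewrite iota4K [iota4 j + j]addrC. Qed.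

Lemma mirror_per j m z : mirror (j + z4 * m) z = mirror j z.
Proof.
rewrite /mirror iota4_per; congr (_ / _).
rewrite -[RHS](arc_per g0 _ (2 * m)); congr arc; rewrite -intrD; congr (_%:~R); ring.
Qed.

Lemma md_mirror j z : md (mirror j z) = (md z)^-1.
Proof. by rewrite mdM md_arc mul1r mdV. Qed.

Lemma mirrorK j z : 0 < md z -> mirror (iota4 j) (mirror j z) = z.
Proof.
rewrite md_gt0 => z0; rewrite /mirror iota4_sum invf_div mulrCA divff ?mulr1//.
by rewrite -md_eq0 md_arc oner_eq0.
Qed.

Lemma mirror_arc j (rho x : R) : mirror j (rho%:C * arc x) = (rho^-1)%:C * arc ((j + iota4 j + 1)%:~R - x).
Proof. by rewrite /mirror invfM arcB fmorphV mulrCA. Qed.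

Lemma sec_mirror j z : sec j z -> sec (iota4 j) (mirror j z).
Proof.
move=> [z0 [x xj zE]]; split; first by rewrite md_mirror invr_gt0.
exists ((j + iota4 j + 1)%:~R - x); last by rewrite md_mirror {1}zE mirror_arc.
by rewrite !intrD; lra.
Qed.

Lemma sec_iota j z : sec j z -> sec (iota4 j) z -> False.
Proof.
move=> s1 s2; have [m E] := sec_mod s1 s2.
have := iota4_neq j; have : z4 * m = 4 * (g%:Z * m) by rewrite PoszM mulrA.
by move: E; rewrite /iota4; case: ifP => _ E; set k := g%:Z * m => kE; lia.
Qed.

(** The sector as an open condition on the point rotated to its axis: its half-angle [pi / n4] is
    less than [pi / 2], where the sine is increasing. *)
Lemma secP j z : sec j z <-> let w := z / arc (j%:~R + 1 / 2) in
  0 < Re w /\ `|Im w| < md w * sin (pi / n4).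
Proof.
have p0 := pi_gt0 R; have n0 := (n4_gt0 R g0); have n44 := n4_ge4.
have pn0 : 0 < pi / n4 by rewrite divr_gt0.
have pn2 : pi / n4 < pi / 2 by rewrite ltr_pM2l// ltf_pV2 ?posrE//; lra.
set a := arc _; have a1 : md a = 1 by rewrite md_arc.
have an : a != 0 by rewrite -md_eq0 a1 oner_eq0.
have mdw : md (z / a) = md z by rewrite mdM mdV a1 invr1 mulr1.
have ReM (rho t : R) : Re (rho%:C * cis t) = rho * cos t by rewrite /= mul0r subr0.
have ImM (rho t : R) : Im (rho%:C * cis t) = rho * sin t by rewrite /= mul0r addr0.
have i1 (x : R) : `|x| < pi / n4 -> x \in `[- (pi / 2), (pi / 2)].
  by rewrite ltr_norml in_itv /= => /andP[h1 h2]; apply/andP; split; lra.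
split=> [[z0 [x xj zE]]|] /=.
  pose th := 2 * pi * (x - (j%:~R + 1 / 2)) / n4.
  have wE : z / a = (md z)%:C * cis th by rewrite {1}zE -mulrA -arcB.
  have thn : `|th| < pi / n4.
    have -> : th = (2 * (x - (j%:~R + 1 / 2))) * (pi / n4) by rewrite /th; ring.
    rewrite -[X in _ < X]mul1r.
    by rewrite normrM (gtr0_norm pn0) ltr_pM2r// ltr_norml; lra.
  rewrite wE ReM ImM; split.
    rewrite mulr_gt0// cos_gt0_pihalf//; move: thn; rewrite ltr_norml => /andP[h1 h2]; apply/andP; split; lra.
  rewrite -wE mdw normrM gtr0_norm// ltr_pM2l// ltr_norml -sinN.
  have m1 : th \in `[- (pi / 2), (pi / 2)] by exact: i1.
  have m2 : pi / n4 \in `[- (pi / 2), (pi / 2)] by rewrite in_itv /=; apply/andP; split; lra.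
  have m3 : - (pi / n4) \in `[- (pi / 2), (pi / 2)] by rewrite in_itv /=; apply/andP; split; lra.
  by rewrite !ltr_sin//; move: thn; rewrite ltr_norml.
move=> [re im]; have := argrP re; set th := argr _ => wE.
have w0 : 0 < md (z / a) by apply: lt_le_trans re _; exact: le_trans (ler_norm _) (Re_le_md _).
have thb : - (pi / 2) < th < pi / 2 by rewrite /th /argr atan_gtNpi2 atan_ltpi2.
move: im; rewrite {1}wE ImM normrM gtr0_norm// ltr_pM2l// ltr_norml -sinN.
rewrite !ltr_sin; last 4 first.
- by rewrite in_itv /=; apply/andP; split; lra.
- by rewrite in_itv /=; apply/andP; split; lra.
- by rewrite in_itv /=; apply/andP; split; lra.
- by rewrite in_itv /=; apply/andP; split; lra.
move=> /andP[t1 t2]; split; first by rewrite -mdw.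
exists (j%:~R + 1 / 2 + th * n4 / (2 * pi)).
  have e1 : th * n4 / (2 * pi) = th / (pi / n4) / 2.
    have pn : pi != 0 :> R by rewrite gt_eqF.
    by rewrite invf_div invfM; ring.
  have h1 : -1 < th / (pi / n4) by rewrite ltr_pdivlMr//; lra.
  have h2 : th / (pi / n4) < 1 by rewrite ltr_pdivrMr//; lra.
  by rewrite e1; apply/andP; split; lra.
rewrite arcD -/a mulrA -mdw mulrAC; have -> : arc (th * n4 / (2 * pi)) = cis th.
  rewrite /arc; congr cis; have pp : 2 * pi != 0 :> R by rewrite gt_eqF// mulr_gt0.
  by rewrite [2 * pi * _]mulrC divfK// mulfK// gt_eqF.
by rewrite -wE divfK.
Qed.

Lemma near_gt (f : C -> R) (z : C) (c : R) : continuous f -> c < f z -> \forall w \near z, c < f w.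
Proof. by move=> cf h; have := cf z; move/cvgr_gt; apply. Qed.

Lemma near_lt (f : C -> R) (z : C) (c : R) : continuous f -> f z < c -> \forall w \near z, f w < c.
Proof. by move=> cf h; have := cf z; move/cvgr_lt; apply. Qed.

Lemma sec_near j z : sec j z -> \forall w \near z, sec j w.
Proof.
move=> /secP[]; set a := arc _ => re im.
have cw : continuous (fun w : C => w / a) by apply: ctsM; [exact: cts_id|exact: cts_cst].
have n1 : \forall w \near z, 0 < Re (w / a).
  by apply: (near_gt (f := fun w => Re (w / a))) re; exact: (cts_Re cw).
have c2 : continuous (fun w : C => md (w / a) * sin (pi / n4) - `|Im (w / a)|).
  apply: ctsB; first by apply: ctsM; [exact: cts_md|exact: cts_cst].
  by apply: cts_comp; [exact: norm_continuous|exact: cts_Im].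
have n2 : \forall w \near z, 0 < md (w / a) * sin (pi / n4) - `|Im (w / a)|.
  by apply: (near_gt (f := fun w => md (w / a) * sin (pi / n4) - `|Im (w / a)|)) c2 _; rewrite subr_gt0.
near=> w; apply/secP; split; first by near: w.
by rewrite -subr_gt0; near: w.
Unshelve. all: by end_near. Qed.

(** A continuous argument of the path, in units of sides, is never an integer, so it stays between
    two consecutive integers. *)
Lemma sec_const (E : R -> C) (a b : R) (j : int) : continuous E -> a <= b ->
  (forall t, a <= t <= b -> exists k, sec k (E t)) -> sec j (E a) -> sec j (E b).
Proof.
move=> cE ab hE sa; pose f t := E (aff a b (clamp01 t)).
have cf : continuous f.
  apply: cts_comp cE _; apply: cts_comp; [exact: caff|exact: continuous_clamp01].
have fs t : exists k, sec k (f t) by apply: hE; apply: aff_itv => //; exact: clamp01_itv.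
have f0 t : 0 < md (f t) by have [k []] := fs t.
have [||h ch hf] := @lift_line R (fun t => f t / (md (f t))%:C).
- apply: (ctsM cf); apply: ctsV; first by apply: cts_toC; exact: cts_md.
  by move=> t; rewrite fmorph_eq0 gt_eqF.
- by move=> t _; rewrite mdM mdV mdRe ger0_norm ?md_ge0// divff// gt_eqF.
have p0 := pi_gt0 R; have n0 := (n4_gt0 R g0).
pose x t := h t * n4 / (2 * pi).
have cx : continuous x by apply: ctsM; [apply: ctsM => //; exact: cts_cst|exact: cts_cst].
have xE t : 0 <= t <= 1 -> f t = (md (f t))%:C * arc (x t).
  move=> /hf; have -> : cis (h t) = arc (x t).
    rewrite /arc /x; congr cis; have pp : 2 * pi != 0 :> R by rewrite gt_eqF// mulr_gt0.
    by rewrite [2 * pi * _]mulrC divfK// mulfK// gt_eqF.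
  by move=> <-; rewrite mulrCA divff ?mulr1// fmorph_eq0 gt_eqF.
have xs t k : 0 <= t <= 1 -> sec k (f t) -> exists m, (k + z4 * m)%:~R < x t < (k + z4 * m)%:~R + 1.
  move=> /xE fE [_ [y yk fE']]; have E1 : arc (x t) = arc y.
    by apply: (@mulfI _ (md (f t))%:C); rewrite ?fmorph_eq0 ?gt_eqF// -fE.
  by have [m ->] := arc_inj g0 E1; exists m; rewrite intrD; lra.
have xn t (k : int) : 0 <= t <= 1 -> x t != k%:~R.
  by move=> t1; have [l sl] := fs t; have [m] := xs _ _ t1 sl; exact: not_int_between.
have t0 : 0 <= (0 : R) <= 1 by rewrite lexx ler01.
have t1 : 0 <= (1 : R) <= 1 by rewrite lexx ler01.
have fa : f 0 = E a by rewrite /f clamp01_id// /aff mul0r addr0.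
have fb : f 1 = E b by rewrite /f clamp01_id// /aff mul1r addrC subrK.
have [m hm] := xs 0 j t0 ltac:(by rewrite fa).
have := ivt_stay cx (fun t => xn t (j + z4 * m)) _ hm; rewrite -intrD1.
move=> /(_ (fun t => xn t _)) hm1; rewrite -fb.
have : sec (j + z4 * m) (f 1).
  by split => //; exists (x 1); [rewrite -intrD1|exact: xE].
by move=> /(sec_per (- m)); rewrite mulrN addrK.
Qed.

(** The domain on which extended sheets are well behaved: outside the open disc the rays through the
    corners are removed. *)
Definition good (z : C) := md z < 1 \/ exists j, sec j z.

Section Ext.
Variables (S : choiceType) (tau : int -> S -> S).
Hypothesis tauK : forall j s, tau (iota4 j) (tau j s) = s.
Hypothesis tau_per : forall j m s, tau (j + z4 * m) s = tau j s.
Variables (X : topologicalType) (q : S -> C -> X).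
Hypothesis ps : polysurf g tau q.

Definition sector (z : C) : int := xget 0 [set j | sec j z].

(* The sheet s extended over a collar: a point of modulus > 1 in the sector of side j denotes its
   reflection in the sheet across j. *)
Definition qx (s : S) (z : C) : X :=
  if md z <= 1 then q s z else q (tau (sector z) s) (mirror (sector z) z).

Lemma qx_in s z : md z <= 1 -> qx s z = q s z. Proof. by rewrite /qx => ->. Qed.

Lemma qx_out s j z : sec j z -> 1 <= md z -> qx s z = q (tau j s) (mirror j z).
Proof.
move=> sj z1; rewrite /qx; case: ifP => [z1'|_].
  have [z0 [x /andP[x1 x2] zE]] := sj.
  have E : md z = 1 by apply/eqP; rewrite eq_le z1 z1'.
  rewrite zE mirror_arc E invr1 !mul1r; apply/esym/(ps_glue ps)/bdrel_side => //.
  by rewrite !ltW.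
have /sec_mod : sec (sector z) z by exact: (@xgetPex _ 0 [set j | sec j z] (ex_intro _ j sj)).
by move=> /(_ _ sj)[m ->]; rewrite tau_per mirror_per.
Qed.

Lemma qx_mirror s j z : sec j z -> qx s z = qx (tau j s) (mirror j z).
Proof.
move=> sj; have [z0 _] := sj; case: (leP 1 (md z)) => z1.
  by rewrite (qx_out _ sj)// qx_in// md_mirror invf_le1.
rewrite qx_in ?ltW// (qx_out _ (sec_mirror sj)); last by rewrite md_mirror invf_ge1 ?ltW.
by rewrite tauK mirrorK.
Qed.

Lemma qx_cont s z : good z -> {for z, continuous (qx s)}.
Proof.
have cq s' := ps_cont ps s'.
case: (ltP (md z) 1) => z1 gz U.
  rewrite /= {1}/qx (ltW z1) => /(cq s z) h.
  have n1 : \forall w \near z, md w < 1 by apply: near_lt z1; exact: continuous_md.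
  apply: filterS2 n1 h => w w1 /=; by rewrite /qx (ltW w1).
case: gz => [|[j sj]]; first by rewrite ltNge z1.
have [z0 _] := sj.
have cm : {for z, continuous (fun w => q (tau j s) (mirror j w))}.
  apply: (@continuous_comp _ _ _ (mirror j) (q (tau j s))); last exact: cq.
  apply: continuousM; first exact: cst_continuous.
  by apply: inv_continuous; rewrite -md_gt0.
rewrite /= => qU; suff : \forall w \near z, U (qx s w) by [].
have sn := sec_near sj.
have h2 : \forall w \near z, U (q (tau j s) (mirror j w)) by apply: cm; rewrite -(qx_out _ sj).
move: z1; rewrite le_eqVlt => /orP[/eqP z1|z1].
  have h1 : \forall w \near z, U (q s w) by apply: (cq s z); rewrite -qx_in// -z1.
  near=> w; rewrite /=; case: (leP (md w) 1) => w1; first by rewrite qx_in//; near: w.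
  by rewrite (@qx_out s j w) ?ltW//; near: w.
have n1 : \forall w \near z, 1 < md w by apply: near_gt z1; exact: continuous_md.
by near=> w; rewrite /= (@qx_out s j w); [near: w|near: w|apply: ltW; near: w].
Unshelve. all: by end_near. Qed.

(** On an open side the only other presentation of a point is on the glued side, which is a
    different side of the polygon; at the same place of the disc the sheet is therefore
    determined. *)
Lemma sheet_inj s s' z : md z <= 1 -> good z -> q s z = q s' z -> s = s'.
Proof.
move=> z1 gz /(ps_eq ps)-/(_ z1 z1)[[]//|[x [x' [E1 E2 bd]]]].
case: gz => [|[j sj]]; first by rewrite E1 md_arc ltxx.
have [z0 [y yj zE]] := sj.
have arcE u : z = arc u -> exists m : int, u = y + (z4 * m)%:~R.
  move=> E; apply: arc_inj => //; rewrite -E {1}zE E md_arc mul1r; congr arc.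
have [m xE] := arcE _ E1; have [m' xE'] := arcE _ E2.
have xj : (j + z4 * m)%:~R < x < (j + z4 * m)%:~R + 1 by rewrite xE intrD; lra.
have xj' : (j + z4 * m')%:~R < x' < (j + z4 * m')%:~R + 1 by rewrite xE' intrD; lra.
have xn : x \isn't a Num.int.
  by apply/negP => /intrP[k kE]; have := not_int_between k xj; rewrite kE eqxx.
have [k [[]//|[_]]] := bdrel_edge tauK tau_per (a := (s, x)) xn bd.
rewrite /nxt /=; have -> : Num.floor x' = j + z4 * m'.
  by apply: floor_def; rewrite intrD1; case/andP: xj' => /ltW -> ->.
rewrite iota4_per => E.
have : (iota4 j + z4 * (m' + k))%:~R < x < (iota4 j + z4 * (m' + k))%:~R + 1.
  by move: xj'; rewrite E mulrDr !intrD; lra.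
move=> /(int_between xj) E2'; exfalso; apply: (@sec_iota j z) => //.
have -> : iota4 j = j + z4 * (m - (m' + k)) by rewrite mulrBr addrA E2' addrK.
exact: sec_per.
Qed.

End Ext.

Section Base.
Let tau1 (j : int) (u : unit) := u.
Variables (Y : topologicalType) (q1 : unit -> C -> Y).
Hypothesis ps1 : polysurf g tau1 q1.
Let tK1 : forall j s, tau1 (iota4 j) (tau1 j s) = s. Proof. by []. Qed.
Let tP1 : forall (j m : int) s, tau1 (j + z4 * m) s = tau1 j s. Proof. by []. Qed.
Notation qy := (qx tau1 q1 tt).

Lemma qy_out j z : sec j z -> 1 <= md z -> qy z = q1 tt (mirror j z).
Proof. exact: qx_out. Qed.

Lemma qy_mirror j z : sec j z -> qy (mirror j z) = qy z.
Proof. by move=> sj; rewrite -(qx_mirror tK1 tP1 ps1 tt sj). Qed.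

Lemma q1_inj z w : md z <= 1 -> md w <= 1 -> good z -> good w -> q1 tt z = q1 tt w ->
  z = w \/ exists2 j, sec j z & w = mirror j z.
Proof.
move=> z1 w1 gz gw /(ps_eq ps1)-/(_ z1 w1)[[_ ->]|[x [x' [E1 E2 bd]]]]; first by left.
have sx u y : good u -> u = arc y -> exists2 j : int, j%:~R < y < j%:~R + 1 & sec j u.
  case=> [lt|[j sj]] E; first by move: lt; rewrite E md_arc ltxx.
  have [_ [t tj uE]] := sj; rewrite E md_arc mul1r in uE.
  have [m yE] := arc_inj g0 uE; have h : (j + z4 * m)%:~R < y < (j + z4 * m)%:~R + 1 by rewrite yE intrD; lra.
  by exists (j + z4 * m) => //; exact: sec_per.
have [j xj sj] := sx _ _ gz E1; have [k xk sk] := sx _ _ gw E2.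
have xn : x \isn't a Num.int.
  by apply/negP => /intrP[l lE]; have := not_int_between l xj; rewrite lE eqxx.
have marc l y : mirror l (arc y) = arc ((l + iota4 l + 1)%:~R - y) by rewrite /mirror arcB.
have [m [[E]|[E]]] := bdrel_edge tK1 tP1 (a := (tt, x)) xn bd.
  by left; rewrite E1 E2 E arc_per.
have zw : z = mirror k w.
  rewrite E1 E2 E arc_per// marc (_ : Num.floor x' = k)//.
  by apply: floor_def; rewrite intrD1; case/andP: xk => /ltW -> ->.
right; exists (iota4 k); first by rewrite zw; exact: sec_mirror.
by rewrite zw mirrorK//; case: sk.
Qed.

Lemma qy_rep z : good z -> exists w, [/\ md w <= 1, good w, qy z = q1 tt w &
  z = w \/ exists2 j, sec j z & w = mirror j z].
Proof.
move=> gz; case: (leP (md z) 1) => z1; first by exists z; rewrite qx_in//; split => //; left.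
case: gz => [|[j sj]]; first by rewrite ltNge ltW.
have w1 : md (mirror j z) < 1 by rewrite md_mirror invf_lt1// (lt_trans _ z1).
exists (mirror j z); split; [exact: ltW|by left| |by right; exists j].
by rewrite (qy_out sj)// ltW.
Qed.

(** Both points are brought into the closed disc, where [q1_inj] applies; two reflections across the
    same edge cancel. *)
Lemma qy_inj z w : good z -> good w -> qy z = qy w -> z = w \/ exists2 j, sec j z & w = mirror j z.
Proof.
move=> gz gw; have [z' [z1 gz' -> hz]] := qy_rep gz; have [w' [w1 gw' -> hw]] := qy_rep gw.
have sK j u : sec j u -> mirror (iota4 j) (mirror j u) = u by move=> [u0 _]; exact: mirrorK.
have mm j k u : sec j u -> sec k u -> mirror j u = mirror k u.
  by move=> sj sk; have [m ->] := sec_mod sj sk; rewrite mirror_per.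
move=> /q1_inj-/(_ z1 w1 gz' gw') h; case: hz => [->|[j sj zE]]; case: hw => [wE|[k sk wE]].
- by rewrite wE.
- case: h => [h|[l sl h]].
    by right; exists (iota4 k); rewrite h wE; [exact: sec_mirror|rewrite sK].
  left; have sk' := sec_mirror sk; rewrite -wE in sk'.
  by rewrite -(sK _ _ sk) -(sK _ _ sl) -wE -h; apply: mm; rewrite // h; exact: sec_mirror.
- case: h => [h|[l sl h]]; first by right; exists j => //; rewrite wE -h.
  left; rewrite wE h zE; apply: esym; rewrite -[RHS](sK _ _ sj); apply: mm; rewrite -?zE//.
  by rewrite zE; exact: sec_mirror.
- case: h => [h|[l sl h]].
    left; rewrite -(sK _ _ sj) -(sK _ _ sk) -zE -wE h; apply: mm; rewrite ?wE; last exact: sec_mirror.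
    by rewrite -wE -h zE; exact: sec_mirror.
  right; exists j => //; rewrite -zE -(sK _ _ sk) -wE h -(sK _ _ sl).
  have e : mirror (iota4 l) (mirror l z') = z' by exact: sK.
  rewrite e -[RHS]e; apply: mm; last exact: sec_mirror.
  by rewrite -h wE; exact: sec_mirror.
Qed.

Lemma radius_ex : exists2 r : Y -> R, continuous r &
  (forall z, md z <= 1 -> r (q1 tt z) = md z) /\
  (forall z, good z -> r (qy z) = if md z <= 1 then md z else (md z)^-1).
Proof.
have [||r cr rE] := descend g0 ps1 (F := fun _ z => md z).
- by move=> _; exact: continuous_md.
- by move=> s x; rewrite !md_arc.
exists r => //; split=> [z|z gz]; first exact: rE.
case: ifP => z1; first by rewrite qx_in// rE.
case: gz => [/ltW|[j sj]]; first by rewrite z1.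
have z1' : 1 <= md z by rewrite ltW// ltNge z1.
by rewrite (qy_out sj)// rE ?md_mirror// invf_le1// (lt_le_trans _ z1').
Qed.

(** Gluing turns [z ^ (4 g)] on the circle into its inverse, which is at the same distance from 1.
    On the closed disc the function vanishes exactly at the corners, so it measures the distance to
    the vertex. *)
Lemma vertex_dist : exists2 V : Y -> R, continuous V &
  forall z, md z <= 1 -> V (q1 tt z) = md (z ^+ (4 * g) - 1).
Proof.
have [||V ctsV VE] := descend g0 ps1 (F := fun _ z => md (z ^+ (4 * g) - 1)).
- by move=> _; apply: cts_md; apply: ctsB; [apply: ctsX; exact: cts_id|exact: cts_cst].
- move=> s x; have arcX y : arc y ^+ (4 * g) = cis (2 * pi * y).
    have cisX a n : cis a ^+ n = cis (n%:R * a) :> C.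
      by elim: n => [|n IH]; rewrite ?mul0r ?cis0// exprS IH -cisD -natr1 mulrDl mul1r addrC.
    by rewrite /arc cisX mulrC divfK// gt_eqF// (n4_gt0 R g0).
  rewrite !arcX; have -> : (nxt tau1 (s, x)).2 = (Num.floor x + iota4 (Num.floor x) + 1)%:~R - x by [].
  rewrite mulrBr cisD cis2piz mul1r cisN.
  set c := cis _; have c1 : md c = 1 by rewrite md_cis.
  have c0 : c != 0 by rewrite -md_eq0 c1 oner_eq0.
  have -> : c^-1 - 1 = - (c - 1) / c by rewrite opprB mulrBl divff// mul1r.
  by rewrite mdM mdV c1 invr1 mulr1 -[X in md X]mulN1r mdM -[-1]/(-1) -cis_pi md_cis mul1r.
by exists V => // z z1; rewrite VE.
Qed.

Lemma vertex_eq (j : int) : q1 tt (arc j%:~R) = q1 tt 1.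
Proof.
have step k : q1 tt (arc (cstep k)%:~R) = q1 tt (arc k%:~R).
  apply: (ps_glue ps1); have := @bdrel_side R g unit tau1 tK1 tP1 tt k%:~R k.
  rewrite lexx lerDl ler01 => /(_ isT).
  rewrite (_ : (k + iota4 k + 1)%:~R - k%:~R = (cstep k)%:~R)//.
  by rewrite /cstep !intrD; ring.
have iters n : q1 tt (arc (iter n cstep 0)%:~R) = q1 tt 1.
  by elim: n => [|n IH]; [rewrite /arc mulr0 mul0r cis0|rewrite iterS step].
pose m := absz (corner_idx j); pose n := absz (corner_idx j + z4 * m%:Z).
have nE : n%:Z = corner_idx j + 4 * (g * m)%N%:Z.
  rewrite /n gez0_abs; first by rewrite !PoszM mulrA.
  have : m%:Z <= z4 * m%:Z by rewrite -PoszM lez_nat leq_pmull// muln_gt0.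
  by rewrite /m; lia.
rewrite -(iters n); have -> : iter n cstep 0 = j + z4 * m%:Z.
  rewrite -[LHS]corner_idxK corner_idx_iter nE add0r corner_idxD corner_idxK.
  by rewrite !PoszM mulrA.
by rewrite intrD arc_per.
Qed.

End Base.
End Collar.

Section Hits.
Variable R : realType.

Lemma unif_per (f : R -> R) (e : R) : continuous f -> (forall t, f (t + 1) = f t) -> 0 < e ->
  exists2 d : R, 0 < d & forall t t', `|t - t'| <= d -> `|f t - f t'| < e.
Proof.
move=> cf fper e0; have := segment_compact (a := 0 : R) (b := 1) => /compact_near_coveringP cK0.
pose P (d : R) t := forall t', `|t - t'| < d -> `|f t - f t'| < e.
have : \forall d \near (0 : R)^'+, `[(0 : R), 1]%classic `<=` P d.
  apply: cK0 => x Kx; have e20 : 0 < e / 2 by rewrite divr_gt0.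
  have /cvgrPdist_lt/(_ _ e20)/nbhs_ballP[d /= d0 dB] := cf x.
  have d20 : 0 < d / 2 by rewrite divr_gt0.
  exists (ball x (d / 2), [set e | e < d / 2]); first split => /=.
  - exact: nbhsx_ballx.
  - near=> u; near: u; exact: nbhs_right_lt.
  move=> [p u] /= [xp ud] t' pt'.
  have h1 : `|f x - f p| < e / 2 by apply: dB; apply: le_ball xp; lra.
  have h2 : `|f x - f t'| < e / 2.
    apply: dB; rewrite /ball /= -(subrKA p) (le_lt_trans (ler_normD _ _))//.
    by have := xp; rewrite /ball /= => xp'; rewrite [d]splitr ltrD// (lt_trans pt').
  rewrite -(subrKA (f x)) (le_lt_trans (ler_normD _ _))// [e]splitr ltrD//.
  by rewrite distrC.
move=> H; have : \forall d \near (0 : R)^'+, 0 < d /\ `[(0 : R), 1]%classic `<=` P d.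
  by near=> d; split; near: d => //; exact: nbhs_right_gt.
move=> /filter_ex[d [d0 dP]]; exists (d / 2); first by rewrite divr_gt0.
have perz (m : nat) t : f (t + m%:R) = f t.
  by elim: m t => [|m IH] t; rewrite ?addr0// -natr1 addrA fper IH.
have fperz (m : int) t : f (t + m%:~R) = f t.
  case: m => m; first exact: perz.
  by rewrite -(perz m.+1 (t + (Negz m)%:~R)) NegzE mulrNz subrK.
move=> t t' tt'; rewrite -(fperz (- Num.floor t) t) -(fperz (- Num.floor t) t').
have /andP[h1 h2] := floor_itv t; apply: (dP (t + (- Num.floor t)%:~R)).
  by rewrite /= in_itv /= intrN; move: h2; rewrite intrD1 => h2; apply/andP; split; lra.
rewrite opprD addrACA subrr addr0; lra.
Unshelve. all: by end_near. Qed.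

Lemma first_hit (f : R -> R) (c u v : R) : continuous f -> u <= v -> f u < c -> c <= f v ->
  exists b, [/\ u < b, b <= v, f b = c & forall t, u <= t < b -> f t < c].
Proof.
move=> cf uv fu fv; pose A := `[u, v]%classic `&` f @^-1` [set y | c <= y].
have cA : compact A.
  apply: compact_closedI; first exact: segment_compact.
  by apply: closed_comp; [move=> x _; exact: cf|exact: closed_ge].
have [||b bA bm] := @compact_EVT_min R R idfun A _ cA.
- by exists v; split; rewrite /= ?in_itv /= ?uv ?lexx.
- by apply: continuous_subspaceT; exact: cts_id.
move: bA => /set_mem[/=]; rewrite in_itv /= => /andP[ub bv] fb.
have lt t : u <= t < b -> f t < c.
  move=> /andP[ut tb]; rewrite ltNge; apply/negP => ft.
  have : t \in A by apply/mem_set; split => //=; rewrite in_itv /= ut (le_trans (ltW tb)).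
  by move=> /bm /=; rewrite leNgt tb.
have ub' : u < b by rewrite lt_def ub andbT; apply: contraTneq fu => <-; rewrite -leNgt.
exists b; split => //; apply/eqP; rewrite eq_le fb andbT leNgt; apply/negP => fb'.
have [|||t] := @IVT R f u b c.
- exact: ltW.
- exact: continuous_subspaceT.
- by rewrite ge_min (ltW fu)/= le_max fb orbT.
rewrite in_itv /= => /andP[ut tb] ft; have tb' : t < b.
  by rewrite lt_def tb andbT; apply: contraTneq fb' => ->; rewrite ft ltxx.
by have := lt t; rewrite ut tb' ft ltxx => /(_ isT).
Qed.

Lemma last_hit (f : R -> R) (c u v : R) : continuous f -> u <= v -> f u <= c -> c < f v ->
  exists a, [/\ u <= a, a < v, f a = c & forall t, a < t <= v -> c < f t].
Proof.
move=> cf uv fu fv; have [||||b [b1 b2 fb lt]] := @first_hit (fun t => - f (- t)) (- c) (- v) (- u).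
- by apply: ctsN; apply: cts_comp cf _; apply: ctsN; exact: cts_id.
- by rewrite lerN2.
- by rewrite opprK ltrN2.
- by rewrite opprK lerN2.
exists (- b); split; first by rewrite lerNr.
- by rewrite ltrNl.
- by rewrite -[LHS]opprK fb opprK.
- move=> t /andP[t1 t2]; have := lt (- t); rewrite opprK ltrN2; apply.
  by rewrite lerN2 t2 ltrNl.
Qed.

End Hits.

(** * Following a curve through extended sheets *)

Section Path.
Variables (R : realType) (g : nat).
Hypothesis g0 : (0 < g)%N.
Notation C := R[i].
Notation z4 := ((4 * g)%N%:Z).
Notation n4 := ((4 * g)%:R : R).
Notation arc := (@arc R g).
Notation sec := (@sec R g).
Notation mirror := (@mirror R g).
Notation good := (@good R g).
Let tau1 (j : int) (u : unit) := u.
Variables (Y : topologicalType) (q1 : unit -> C -> Y).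
Hypothesis ps1 : polysurf g tau1 q1.
Hypothesis hY : hausdorff_space Y.
Let tK1 : forall j s, tau1 (iota4 j) (tau1 j s) = s. Proof. by []. Qed.
Let tP1 : forall (j m : int) s, tau1 (j + z4 * m) s = tau1 j s. Proof. by []. Qed.
Notation qy := (qx g tau1 q1 tt).
Variable r : Y -> R.
Hypothesis cr : continuous r.
Hypothesis rE : forall z, md z <= 1 -> r (q1 tt z) = md z.
Hypothesis rE' : forall z, good z -> r (qy z) = if md z <= 1 then md z else (md z)^-1.
Variable gam : R -> Y.
Hypothesis cg : continuous gam.
Variables (ka eta del : R).
Hypothesis ka1 : ka < 1.
Hypothesis ka3 : 1 < 3 * ka.
Hypothesis eta0 : 0 < eta.
Hypothesis del0 : 0 < del.
(** A curve of radius at least [ka] stays above this radius for a time [del]; it is positive because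
    [1 < 3 * ka]. *)
Definition ka' : R := ka - (1 - ka) / 2.
Hypothesis Hdel : forall t t', `|t - t'| <= del -> `|r (gam t) - r (gam t')| < (1 - ka) / 2.
Hypothesis Hcol : forall t z, md z <= 1 -> gam t = q1 tt z -> ka' <= md z ->
  exists2 x, z = (md z)%:C * arc x & eta <= md (cis (2 * pi * x) - 1).

Lemma ka0 : 0 < ka. Proof. by move: ka1 ka3; lra. Qed.
Lemma ka'0 : 0 < ka'. Proof. by rewrite /ka'; move: ka1 ka3; lra. Qed.
Lemma kaV1 : 1 < ka^-1. Proof. by rewrite invf_gt1// ka0. Qed.

Lemma eta_sec z x : 0 < md z -> z = (md z)%:C * arc x -> eta <= md (cis (2 * pi * x) - 1) ->
  exists j : 'I_(4 * g), exists2 x', (j : nat)%:Z%:~R < x' < (j : nat)%:Z%:~R + 1 &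
    z = (md z)%:C * arc x' /\ eta <= md (cis (2 * pi * x') - 1).
Proof.
move=> z0 zE ex; have [m jE] := sideK g0 (Num.floor x); exists (side g0 (Num.floor x)).
have /andP[h1 h2] := floor_itv x; rewrite intrD1 in h2.
have ne : x != (Num.floor x)%:~R.
  apply: contraTneq ex => ->; rewrite cis2piz subrr md0 -ltNge//.
have h1' : (Num.floor x)%:~R < x by rewrite lt_def ne h1.
exists (x - (z4 * m)%:~R); first by move: h1' h2; rewrite {1 2}jE intrD; lra.
have e : x - (z4 * m)%:~R = x + (z4 * - m)%:~R by rewrite mulrN intrN.
rewrite e arc_per//; split => //.
have -> : 2 * pi * (x + (z4 * - m)%:~R) = 2 * pi * x + 2 * pi * (z4 * - m)%:~R by ring.
by rewrite cisD cis2piz mulr1.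
Qed.

Lemma col_sec t z : good z -> qy z = gam t -> ka' <= md z -> exists j, sec j z.
Proof.
move=> gz zE kz; case: gz => [lt|//].
have z0 : 0 < md z by apply: lt_le_trans kz; exact: ka'0.
have [|x zx ex] := Hcol (t := t) (ltW lt) _ kz; first by rewrite -zE qx_in ?ltW.
have [j [x' xj [zx' _]]] := eta_sec z0 zx ex; exists (j : nat)%:Z; split => //; by exists x'.
Qed.

Definition valid (A : R -> C) (u v : R) := forall t, u <= t <= v -> good (A t) /\ qy (A t) = gam t.

(** During a time [del] the radius changes by less than [(1 - ka) / 2], so the curve stays in a
    compact disc inside the open polygon, where [q1] is injective. *)
Lemma local_core u z0 : good z0 -> md z0 <= 1 -> qy z0 = gam u -> md z0 < ka ->
  exists B, [/\ continuous B, B u = z0 & valid B u (u + del)].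
Proof.
move=> gz0 z01 zE rk; pose cl t := Num.max u (Num.min (u + del) t).
have ccl : continuous cl by apply: cts_max; [exact: cts_cst|apply: cts_min; [exact: cts_cst|exact: cts_id]].
have clid t : u <= t <= u + del -> cl t = t by move=> /andP[h1 h2]; rewrite /cl min_r// max_r.
have clitv t : `|cl t - u| <= del.
  rewrite ger0_norm ?subr_ge0 ?le_max ?lexx// lerBlDl /cl ge_max lerDl (ltW del0) /=.
  by rewrite ge_min lexx.
pose rho := (1 + ka) / 2.
have rlt t : r (gam (cl t)) < rho.
  have := Hdel (clitv t); rewrite -zE qx_in// rE// ltr_norml /rho => /andP[_]; lra.
have ex t : exists w, md w <= rho /\ gam (cl t) = q1 tt w.
  have [[] [w [w1 wE]]] := ps_surj ps1 (gam (cl t)); exists w; split => //.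
  by rewrite -(rE w1) -wE ltW.
have [E EP] := choice ex.
have lt1 w : md w <= rho -> md w < 1 by rewrite /rho; move: ka1; lra.
have cE : continuous E.
  apply: (@compact_lift R Y C C unit (fun _ => [set z | md z <= rho]) (fun _ => q1 tt) (fun _ => idfun)
    (fun t => gam (cl t)) E hY).
  - by move=> i; exact: compact_disc.
  - by move=> i; exact: ps_cont ps1 tt.
  - by move=> i; apply: continuous_subspaceT; exact: cts_id.
  - move=> [] k [] k' h h' e; have [_ //] := int_eq ps1 (lt1 _ h) (ltW (lt1 _ h')) e.
  - exact: cts_comp cg ccl.
  - by move=> t; exists tt, (E t); have [] := EP t.
have val t : u <= t <= u + del -> good (E t) /\ qy (E t) = gam t.
  by move=> tu; have [h e] := EP t; split; [left; exact: lt1|rewrite qx_in ?(ltW (lt1 _ h))// -e clid].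
exists E; split => //.
have [] : good (E u) /\ qy (E u) = gam u by apply: val; rewrite lexx lerDl ltW.
have [h _] := EP u; rewrite -zE !qx_in ?(ltW (lt1 _ h))// => _ e.
by have [_ //] := int_eq ps1 (lt1 _ h) z01 e.
Qed.

(** Near an edge a point has two coordinates, exchanged by [mirror]. Taking always the one in the
    sector of the positive side gives a continuous path by [compact_lift]; if it starts at the
    mirror image of [z0], the whole path is reflected. *)
Lemma local_collar u z0 : good z0 -> qy z0 = gam u -> ka <= r (gam u) ->
  exists B, [/\ continuous B, B u = z0 & valid B u (u + del)].
Proof.
move=> gz0 zE rk; pose cl t := Num.max u (Num.min (u + del) t).
have ccl : continuous cl by apply: cts_max; [exact: cts_cst|apply: cts_min; [exact: cts_cst|exact: cts_id]].
have clid t : u <= t <= u + del -> cl t = t by move=> /andP[h1 h2]; rewrite /cl min_r// max_r.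
have clitv t : `|cl t - u| <= del.
  rewrite ger0_norm ?subr_ge0 ?le_max ?lexx// lerBlDl /cl ge_max lerDl (ltW del0) /=.
  by rewrite ge_min lexx.
have rlt t : ka' <= r (gam (cl t)).
  have := Hdel (clitv t); rewrite ltr_norml /ka' => /andP[h _]; lra.
have k0 := ka'0.
pose K (j : 'I_(4 * g)) : set (R * R) := (`[ka', 1]%classic `*` `[(j : nat)%:Z%:~R, (j : nat)%:Z%:~R + 1]%classic) `&`
  (fun p : R * R => md (cis (2 * pi * p.2) - 1)) @^-1` [set y | eta <= y].
pose zz (p : R * R) := p.1%:C * arc p.2.
(* The coordinate in the positive sector. The maximum with [ka'] makes the inverse continuous
   everywhere and is inert on [K]. *)
pose G (j : 'I_(4 * g)) (p : R * R) : C := if pos (j : nat)%:Z then zz p else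
  ((Num.max ka' p.1)^-1)%:C * arc (((j : nat)%:Z + iota4 (j : nat)%:Z + 1)%:~R - p.2).
have czz : continuous zz.
  by apply: ctsM; [apply: cts_toC; exact: cts_fst|apply: cts_comp; [exact: continuous_arc|exact: cts_snd]].
have cG j : continuous (G j).
  rewrite /G; case: (pos _); first exact: czz.
  apply: ctsM.
    apply: cts_toC; apply: ctsV; first by apply: cts_max; [exact: cts_cst|exact: cts_fst].
    by move=> p; rewrite gt_eqF// lt_max k0.
  by apply: cts_comp; [exact: continuous_arc|apply: ctsB; [exact: cts_cst|exact: cts_snd]].
have Ksec j p : K j p -> [/\ md (zz p) = p.1, ka' <= p.1, p.1 <= 1 & sec (j : nat)%:Z (zz p)].
  case=> [[h1 h2] ex']; have ex : eta <= md (cis (2 * pi * p.2) - 1) := ex'.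
  have /andP[p1 p2] : ka' <= p.1 <= 1 by move: h1; rewrite /= in_itv.
  have /andP[x1 x2] : (j : nat)%:Z%:~R <= p.2 <= (j : nat)%:Z%:~R + 1 by move: h2; rewrite /= in_itv.
  have mz : md (zz p) = p.1 by rewrite mdM mdRe md_arc mulr1 gtr0_norm//; exact: lt_le_trans p1.
  have ne (k : int) : p.2 != k%:~R by apply: contraTneq ex => ->; rewrite cis2piz subrr md0 -ltNge.
  split => //; split; first by rewrite mz (lt_le_trans k0).
  exists p.2; last by rewrite mz.
  by rewrite !lt_neqAle x1 x2 eq_sym ne -intrD1 ne.
have GE j p : K j p -> G j p = if pos (j : nat)%:Z then zz p else mirror (j : nat)%:Z (zz p).
  by move=> /Ksec[_ p1 _ _]; rewrite /G; case: ifP => // _; rewrite mirror_arc max_r.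
have jz (j : 'I_(4 * g)) : 0 <= (j : nat)%:Z < z4 by rewrite ltz_nat ltn_ord.
have sgood k w : sec k w -> good w by move=> sk; right; exists k.
have compat j p j' p' : K j p -> K j' p' -> q1 tt (zz p) = q1 tt (zz p') -> G j p = G j' p'.
  move=> Kp Kp'; rewrite !GE//; have [mz _ m1 sj] := Ksec _ _ Kp; have [mz' _ m1' sj'] := Ksec _ _ Kp'.
  rewrite -mz in m1; rewrite -mz' in m1'.
  move=> /(q1_inj g0 ps1 m1 m1' (sgood _ _ sj) (sgood _ _ sj'))[e|[l sl e]].
    by rewrite -e in sj' *; rewrite (sec_uniq g0 (jz j) (jz j') sj sj').
  have [m lE] := sec_mod g0 sl sj; rewrite lE mirror_per// in e.
  have si := sec_mirror sj; rewrite -e in si.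
  have [m' jE'] := sec_mod g0 sj' si.
  have pj : pos (j' : nat)%:Z = ~~ pos (j : nat)%:Z by rewrite jE' pos_per pos_iota.
  rewrite pj; case: (pos _) => /=; last by rewrite e.
  by rewrite jE' mirror_per// e mirrorK//; case: sj.
have ex t : exists jp : 'I_(4 * g) * (R * R), K jp.1 jp.2 /\ gam (cl t) = q1 tt (zz jp.2).
  have [[] [w [w1 wE]]] := ps_surj ps1 (gam (cl t)).
  have kw : ka' <= md w by rewrite -rE// -wE.
  have w0 : 0 < md w by exact: lt_le_trans kw.
  have [x wx ex] := Hcol w1 wE kw.
  have [j [x' /andP[x1 x2] [wx' ex']]] := eta_sec w0 wx ex.
  exists (j, (md w, x')); split => /=; last by rewrite /zz /= -wx'.
  by split => //; split; rewrite /= in_itv /= ?kw ?w1// !ltW.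
have [JP JPP] := choice ex; pose E t := G (JP t).1 (JP t).2.
have cE : continuous E.
  apply: (@compact_lift R Y C (R * R)%type 'I_(4 * g) K (fun _ p => q1 tt (zz p)) G (fun t => gam (cl t)) E hY).
  - move=> j; apply: compact_closedI; first by apply: compact_setX; exact: segment_compact.
    apply: closed_comp; last exact: closed_ge.
    move=> p _; apply: cts_md; apply: ctsB; last exact: cts_cst.
    by apply: cts_cis; apply: ctsM; [exact: cts_cst|exact: cts_snd].
  - by move=> j; apply: cts_comp czz; exact: ps_cont ps1 tt.
  - by move=> j; apply: continuous_subspaceT; exact: cG.
  - exact: compat.
  - exact: cts_comp cg ccl.
  - by move=> t; exists (JP t).1, (JP t).2; have [] := JPP t.
have Eq t : (exists j, sec j (E t)) /\ qy (E t) = gam (cl t).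
  have [Kt ct] := JPP t; rewrite /E GE// ct; have [mz _ m1 sj] := Ksec _ _ Kt.
  case: ifP => _; last rewrite qy_mirror//.
    by split; [exists ((JP t).1 : nat)%:Z|rewrite qx_in// mz].
  by split; [exists (iota4 ((JP t).1 : nat)%:Z); exact: sec_mirror|rewrite qx_in// mz].
have uu : u <= u <= u + del by rewrite lexx lerDl ltW.
have Egood t : good (E t) by right; exact: (Eq t).1.
have [e|[l sl e]] := qy_inj g0 ps1 (Egood u) gz0 (etrans (Eq u).2 (etrans (congr1 gam (clid u uu)) (esym zE))).
  by exists E; split => // t tu; split => //; rewrite (Eq t).2 clid.
have cB : continuous (fun t => mirror l (E t)).
  apply: ctsM; first exact: cts_cst.
  by apply: (ctsV cE) => t; rewrite -md_gt0; have [[k []]] := Eq t.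
exists (fun t => mirror l (E t)); split; [exact: cB|exact: esym e|].
move=> t tu; have slt : sec l (E t).
  apply: (@sec_const R g g0 E u t l cE) => //; first by case/andP: tu.
  by move=> t' _; exact: (Eq t').1.
split; first by right; exists (iota4 l); exact: sec_mirror.
by rewrite qy_mirror// (Eq t).2 clid.
Qed.

Lemma local_lift u z0 : good z0 -> md z0 <= ka^-1 -> qy z0 = gam u ->
  exists B, [/\ continuous B, B u = z0 & valid B u (u + del)].
Proof.
move=> gz zk zE; case: (leP ka (r (gam u))) => rk; first exact: local_collar.
move: rk; rewrite -zE rE'//; case: ifP => z1 h; first exact: local_core.
have zp : 0 < md z0 by rewrite (lt_trans ltr01)// ltNge z1.
by move: h; rewrite ltNge -[ka]invrK lef_pV2 ?posrE ?invr_gt0 ?ka0// zk.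
Qed.

Lemma run (n : nat) u z0 : good z0 -> qy z0 = gam u -> md z0 < ka^-1 ->
  exists A, [/\ continuous A, A u = z0 &
    (valid A u (u + n%:R * del) /\ forall t, u <= t <= u + n%:R * del -> md (A t) < ka^-1) \/
    exists b, [/\ u < b, b <= u + n%:R * del, valid A u b, forall t, u <= t < b -> md (A t) < ka^-1 & md (A b) = ka^-1]].
Proof.
move=> gz zE zk; elim: n => [|n [A [cA Au [[vA lA]|[b [ub bn vA lA Ab]]]]]].
- exists (fun=> z0); split => //; first exact: cts_cst.
  left; split; last by move=> t _.
  by move=> t; rewrite mul0r addr0 -eq_le => /eqP <-.
- pose v := u + n%:R * del; have uv : u <= v by rewrite lerDl mulr_ge0 ?ler0n// ltW.
  have vv : u <= v <= v by rewrite uv lexx.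
  have [gv qv] := vA _ vv; have [B [cB Bv vB]] := local_lift gv (ltW (lA _ vv)) qv.
  have vS : u + n.+1%:R * del = v + del by rewrite -natr1 mulrDl mul1r addrA.
  pose A' t := if t - v <= 0 then A t else B t.
  have cA' : continuous A'.
    apply: (cts_paste (phi := fun t => t - v) _ cA cB).
      by apply: ctsB; [exact: cts_id|exact: cts_cst].
    by move=> t /subr0_eq ->; rewrite Bv.
  have A'u : A' u = z0 by rewrite /A' subr_le0 uv.
  have vA' : valid A' u (v + del).
    move=> t /andP[ut tv]; rewrite /A' subr_le0; case: leP => h; first by apply: vA; rewrite ut h.
    by apply: vB; rewrite ltW.
  exists A'; split => //; rewrite vS.
  have [all|[t [tu kt]]] : (forall t, u <= t <= v + del -> md (A' t) < ka^-1) \/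
      exists t, u <= t <= v + del /\ ka^-1 <= md (A' t).
  + case: (pselect (exists t, u <= t <= v + del /\ ka^-1 <= md (A' t))) => [h|no]; first by right.
    by left => t tu; rewrite ltNge; apply/negP => kt; apply: no; exists t.
  + by left.
  right; have /andP[ut tv] := tu.
  have [|b [b1 b2 b3 b4]] := first_hit (cts_md cA') ut _ kt; first by rewrite A'u.
  exists b; split => //; first exact: le_trans tv.
  by move=> t' /andP[h1 h2]; apply: vA'; rewrite h1 (le_trans h2)// (le_trans b2).
- exists A; split => //; right; exists b; split => //; rewrite (le_trans bn)// lerD2l ler_wpM2r ?(ltW del0)//.
  by rewrite ler_nat.
Qed.

Lemma run_to u v z0 : good z0 -> qy z0 = gam u -> md z0 < ka^-1 -> u <= v ->
  exists A, [/\ continuous A, A u = z0 &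
    (valid A u v /\ forall t, u <= t <= v -> md (A t) < ka^-1) \/
    exists b, [/\ u < b, b <= v, valid A u b, forall t, u <= t < b -> md (A t) < ka^-1 & md (A b) = ka^-1]].
Proof.
move=> gz zE zk uv; pose n := (Num.truncn ((v - u) / del)).+1.
have nv : v <= u + n%:R * del.
  by rewrite -lerBlDl -ler_pdivrMr// ltW// truncnS_gt.
have [A [cA Au [[vA lA]|[b [ub bn vA lA Ab]]]]] := run n gz zE zk; exists A; split => //.
  by left; split=> t /andP[h1 h2]; [apply: vA|apply: lA]; rewrite h1 (le_trans h2).
case: (leP b v) => bv; first by right; exists b.
left; split=> t /andP[h1 h2]; [apply: vA|apply: lA]; rewrite h1 ?(le_lt_trans h2)//.
by rewrite ltW// (le_lt_trans h2).
Qed.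

(** One crossing: the sheet entered at time [u] is left at the first time [b] of modulus [1 / ka];
    [a] is the last time before [b] of modulus [ka], and the path is then read in the next sheet,
    again at modulus [ka]. *)
Definition sheet_step (A A' : R -> C) (u a b : R) (j : int) :=
  [/\ u <= a /\ a < b, valid A u b /\ (forall t, u <= t < b -> md (A t) < ka^-1),
     [/\ md (A b) = ka^-1, md (A a) = ka & forall t, a < t <= b -> ka < md (A t)],
     0 <= j < z4 /\ (forall t, a <= t <= b -> sec j (A t)) & A' b = mirror j (A b)].

Definition reading (N : nat) (A : nat -> R -> C) (a b : nat -> R) (j : nat -> int) :=
  [/\ forall i, continuous (A i),
     forall i, (i < N)%N -> b i.+1 <= 1 /\ sheet_step (A i) (A i.+1) (b i) (a i) (b i.+1) (j i),
     b N <= 1, valid (A N) (b N) 1 & forall t, b N <= t <= 1 -> md (A N t) < ka^-1].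

Lemma exit_step u b A z0 : continuous A -> A u = z0 -> md z0 <= ka -> u < b -> valid A u b ->
  md (A b) = ka^-1 -> u + del < b /\
  exists a, exists2 j, 0 <= j < z4 & [/\ u <= a, a < b, md (A a) = ka,
    forall t, a < t <= b -> ka < md (A t) & forall t, u <= t <= b -> ka <= md (A t) -> a <= t -> sec j (A t)].
Proof.
move=> cA Au zk ub vA Ab; have k1 := kaV1; have k0 := ka0.
have uu : u <= u <= b by rewrite lexx ltW.
split.
  have [||c [uc cb Ac _]] := first_hit (c := 1) (cts_md cA) (ltW ub).
  - by rewrite Au (le_lt_trans zk).
  - by rewrite Ab ltW.
  rewrite (lt_le_trans _ cb)// ltNge; apply/negP => cd.
  have [gu qu] := vA _ uu; have [gc qc] : good (A c) /\ qy (A c) = gam c by apply: vA; rewrite ltW.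
  have : `|c - u| <= del by rewrite gtr0_norm ?subr_gt0// lerBlDl.
  move=> /Hdel; rewrite -qu -qc !rE'// Au Ac lexx (le_trans zk (ltW ka1)) ltr_norml => /andP[_].
  by move: ka1 zk; lra.
have [||a [ua ab Aa la]] := last_hit (c := ka) (cts_md cA) (ltW ub).
- by rewrite Au.
- by rewrite Ab; move: ka1; lra.
have aS t : a <= t <= b -> exists k, sec k (A t).
  move=> /andP[h1 h2]; have [gt qt] : good (A t) /\ qy (A t) = gam t by apply: vA; rewrite h2 (le_trans ua).
  apply: (col_sec gt qt); have k2 : ka' <= ka by rewrite /ka'; move: ka1; lra.
  rewrite (le_trans k2)//; move: h1; rewrite le_eqVlt => /orP[/eqP <-|h1]; first by rewrite Aa.
  by rewrite ltW// la// h1.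
have [k0' sk] : exists k, sec k (A a) by apply: aS; rewrite lexx ltW.
exists a, (side g0 k0' : nat)%:Z; first by rewrite ltz_nat ltn_ord.
split => // t /andP[ut tb] _ at'; have [m kE] := sideK g0 k0'.
apply: (@sec_const R g g0 A a t _ cA at').
  by move=> t' /andP[h1 h2]; apply: aS; rewrite h1 (le_trans h2).
by have := sec_per g0 (- m) sk; rewrite {1}kE mulrN addrK.
Qed.

Lemma reading_ex (n : nat) u z0 : good z0 -> qy z0 = gam u -> md z0 <= ka -> u <= 1 -> 1 - u <= n%:R * del ->
  exists N A a b j, [/\ reading N A a b j, b 0%N = u & A 0%N u = z0].
Proof.
have k1 := kaV1; have k0 := ka0; have kk : ka < ka^-1 by move: ka1 k1; lra.
elim: n u z0 => [|n IH] u z0 gz zE zk u1 un.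
all: have [A [cA Au [[vA lA]|[b [ub b1 vA lA Ab]]]]] := run_to gz zE (le_lt_trans zk kk) u1.
1,3: exists 0%N, (fun=> A), (fun=> u), (fun=> u), (fun=> 0); split => //; split => //.
all: have [ud [a [j jz [ua ab Aa la sj]]]] := exit_step cA Au zk ub vA Ab.
  by exfalso; move: un ud b1 del0; rewrite mul0r; lra.
have sjt t : a <= t <= b -> sec j (A t).
  move=> /andP[h1 h2]; apply: sj => //; first by rewrite h2 (le_trans ua).
  by move: h1; rewrite le_eqVlt => /orP[/eqP <-|h1]; [rewrite Aa|rewrite ltW// la// h1].
have sb : sec j (A b) by apply: sjt; rewrite lexx ltW.
have [|gb qb] := vA b; first by rewrite lexx ltW.
have [|||||N [A' [a' [b' [j' [[r1 r2 r3 r4 r5] r6 r7]]]]]] := IH b (mirror j (A b)).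
- by right; exists (iota4 j); exact: sec_mirror.
- by rewrite qy_mirror.
- by rewrite md_mirror Ab invrK.
- exact: b1.
- by move: un; rewrite -natr1 mulrDl mul1r; lra.
exists N.+1, (fun i => if i is i'.+1 then A' i' else A), (fun i => if i is i'.+1 then a' i' else a),
  (fun i => if i is i'.+1 then b' i' else u), (fun i => if i is i'.+1 then j' i' else j).
split; [|by []|exact: Au].
split; [by case| |exact: r3|exact: r4|exact: r5].
case=> [_|i iN]; last exact: r2.
rewrite r6; split; first exact: b1.
split; [by split|by split|by split|split; [exact: jz|exact: sjt]|exact: r7].
Qed.

End Path.

Section Generic.
Variable R : realType.

(* The values at local minima are countably many: each is the minimum over a rational interval. *)
Lemma generic_level (f : R -> R) (c d : R) : c < d -> exists2 v, c < v < d &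
  forall t e, 0 < e -> f t = v -> exists2 t', `|t' - t| < e & t' != t /\ f t' <= v.
Proof.
move=> cd; pose isv (pq : rat * rat) := [set v | exists t, [/\ ratr pq.1 < t < ratr pq.2, f t = v &
  forall t', ratr pq.1 < t' < ratr pq.2 -> v <= f t']].
pose L := range (fun pq : rat * rat => xget 0 (isv pq)).
have cL : countable L by apply: sub_countable (card_image_le _ _) _.
have [v [/= vcd nL]] : exists v, (`]c, d[%classic : set R) v /\ ~ L v.
  apply: contrapT => no; have sub : `]c, d[%classic `<=` L.
    by move=> v vcd; apply: contrapT => nL; apply: no; exists v.
  have : countable (`]c, d[%classic : set R) by apply: sub_countable cL; exact: subset_card_le.
  move/countable_lebesgue_measure0; rewrite lebesgue_measure_itv /= lte_fin cd -EFinB => -[/eqP].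
  by rewrite subr_eq0 gt_eqF.
move: vcd; rewrite in_itv /= => vcd; exists v => // t e e0 ft.
apply: contrapT => no; apply: nL.
have [p] := @rat_in_itvoo R (t - e) t ltac:(by rewrite ltrBlDr ltrDl).
have [q] := @rat_in_itvoo R t (t + e) ltac:(by rewrite ltrDl).
rewrite !in_itv /= => /andP[q1 q2] /andP[p1 p2]; exists (p, q) => //.
have vv : isv (p, q) v.
  exists t; split => /= [|//|t' /andP[t1 t2]]; first by rewrite p2 q1.
  rewrite leNgt; apply/negP => lt; apply: no; exists t'; first by rewrite ltr_distl; apply/andP; split; lra.
  by split; [apply: contraTneq lt => ->; rewrite ft ltxx|exact: ltW].
have := @xgetPex _ 0 (isv (p, q)) (ex_intro _ v vv); set w := xget _ _.
case=> t1 [h1 h2 h3]; case: vv => t2 [k1 k2 k3].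
by apply/eqP; rewrite eq_le -{1}k2 h3//= -h2 k3.
Qed.

Lemma expr_bernoulli (x : R) n : 0 <= x <= 1 -> 1 - x ^+ n <= n%:R * (1 - x).
Proof.
move=> /andP[x0 x1]; elim: n => [|n IH]; first by rewrite expr0 subrr mul0r.
have h : 0 <= x ^+ n <= 1 by rewrite exprn_ge0// exprn_ile1.
by rewrite exprS -natr1; nra.
Qed.

End Generic.

Section Reading.
Variables (R : realType) (g : nat).
Hypothesis g0 : (0 < g)%N.
Notation C := R[i].
Notation z4 := ((4 * g)%N%:Z).
Notation n4 := ((4 * g)%:R : R).
Notation arc := (@arc R g).
Notation sec := (@sec R g).
Notation mirror := (@mirror R g).
Notation good := (@good R g).
Let tau1 (j : int) (u : unit) := u.
Variables (Y : topologicalType) (q1 : unit -> C -> Y).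
Hypothesis ps1 : polysurf g tau1 q1.
Hypothesis hY : hausdorff_space Y.
Notation qy := (qx g tau1 q1 tt).

(** If the curve enters the open polygon, the parametrisation is moved to start there, and [ka] is
    taken above the radius of that point and generic. Otherwise the curve has constant radius 1; it
    never leaves the first extended sheet, and there are no crossings. *)
Lemma reading_main (gam0 : R -> Y) : simple_closed_curve gam0 -> (forall t, gam0 t <> q1 tt 1) ->
  exists t0 (gam : R -> Y) ka N A a b j, [/\ gam = (fun t => gam0 (t + t0)),
    0 < ka < 1, reading g q1 gam ka N A a b j, b 0%N = 0 & A N 1 = A 0%N 0] /\
    ((0 < N)%N -> md (A 0%N 0) < ka /\ forall i, (i.+1 < N)%N -> b i.+1 != a i.+1).
Proof.
move=> [[cg0 gper0] ginj0] nv0.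
have [r cr [rE rE']] := radius_ex g0 ps1; have [V ctsV VE] := vertex_dist g0 ps1.
have n40 := n4_gt0 R g0.
have rep y : exists w, md w <= 1 /\ y = q1 tt w by have [[] [w h]] := ps_surj ps1 y; exists w.
have [et et0 etP] : exists2 et, 0 < et & forall t, et <= V (gam0 t).
  have [||c c01 cts_pair] := @EVT_min R (fun t => V (gam0 t)) 0 1.
  - exact: ler01.
  - by apply: continuous_subspaceT; exact: cts_comp ctsV cg0.
  exists (V (gam0 c)).
    have [w [w1 wE]] := rep (gam0 c); rewrite wE VE// md_gt0 subr_eq0; apply/eqP => w4.
    have [x xE] : exists x, w = arc x.
      apply: (arc_surj g0); apply/eqP; rewrite -(@pexpr_eq1 _ _ (4 * g)) ?md_ge0 ?muln_gt0// -mdX w4.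
      by rewrite md1.
    have cisX al n : cis al ^+ n = cis (n%:R * al) :> C.
      by elim: n => [|n IH]; rewrite ?mul0r ?cis0// exprS IH -cisD -natr1 mulrDl mul1r addrC.
    move: w4; rewrite xE /arc cisX mulrC divfK ?gt_eqF// => /cis_eq1[m mE].
    apply: (nv0 c); rewrite wE xE; have -> : x = m%:~R.
      by apply: (@mulfI _ (2 * pi)) => //; rewrite gt_eqF// mulr_gt0// pi_gt0.
    exact: vertex_eq.
  have per (m : nat) t : gam0 (t + m%:R) = gam0 t.
    by elim: m t => [|m IH] t; rewrite ?addr0// -natr1 addrA gper0 IH.
  have perz (m : int) t : gam0 (t + m%:~R) = gam0 t.
    case: m => m; first exact: per.
    by rewrite -(per m.+1 (t + _)) NegzE mulrNz subrK.
  move=> t; rewrite -(perz (- Num.floor t) t); apply: cts_pair; rewrite in_itv /= intrN.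
  by have /andP[h1 h2] := floor_itv t; rewrite intrD1 in h2; apply/andP; split; lra.
(* The first bound gives [1 < 3 * ka]. With the second, [1 - md z ^ (4 g)] is below half of the
   distance [et] to the vertex throughout the collar, so angles stay away from the corners. *)
pose k0 := Num.max (1 / 3) (1 - et / (3 * n4)).
have k01 : k0 < 1.
  rewrite gt_max; apply/andP; split; first lra.
  by rewrite ltrBlDr ltrDl divr_gt0// mulr_gt0.
have Hcol ka t0 : k0 < ka -> ka < 1 -> forall t z, md z <= 1 -> gam0 (t + t0) = q1 tt z -> ka' ka <= md z ->
    exists2 x, z = (md z)%:C * arc x & et / 2 <= md (cis (2 * pi * x) - 1).
  rewrite gt_max => /andP[k1 k2] k3 t z z1 zE kz; have z0 : 0 < md z.
    by apply: lt_le_trans kz; rewrite /ka'; lra.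
  have [x xE] : exists x, z / (md z)%:C = arc x.
    by apply: (arc_surj g0); rewrite mdM mdV mdRe gtr0_norm// divff// gt_eqF.
  have zx : z = (md z)%:C * arc x by rewrite -xE mulrC divfK// fmorph_eq0 gt_eqF.
  exists x => //; have := etP (t + t0); rewrite zE VE// zx exprMn.
  have cisX al n : cis al ^+ n = cis (n%:R * al) :> C.
    by elim: n => [|n IH]; rewrite ?mul0r ?cis0// exprS IH -cisD -natr1 mulrDl mul1r addrC.
  have -> : arc x ^+ (4 * g) = cis (2 * pi * x) by rewrite /arc cisX mulrC divfK ?gt_eqF.
  set c := cis _; rewrite mulrC.
  have -> : c * (md z)%:C ^+ (4 * g) - 1 = c * ((md z)%:C ^+ (4 * g) - 1) + (c - 1) by ring.
  move=> /le_trans/(_ (mdD _ _)); rewrite mdM md_cis mul1r.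
  have -> : (md z)%:C ^+ (4 * g) - 1 = (md z ^+ (4 * g) - 1)%:C :> C by rewrite rmorphB rmorphXn rmorph1.
  rewrite mdRe.
  have z01 : 0 <= md z <= 1 by rewrite md_ge0.
  have h := expr_bernoulli (4 * g) z01.
  have p1 : md z ^+ (4 * g) <= 1 by rewrite exprn_ile1// md_ge0.
  rewrite ler0_norm ?subr_le0// opprB => h2.
  have h3 : 1 - md z <= 3 * (1 - ka) / 2 by move: kz; rewrite /ka'; lra.
  have h4 : n4 * (1 - md z) <= n4 * (3 * (1 - ka) / 2) by rewrite ler_pM2l.
  have h5 : 1 - ka < et / (3 * n4) by move: k2; lra.
  have h6 : 3 * n4 * (1 - ka) < et by rewrite mulrC -ltr_pdivlMr// mulr_gt0.
  by lra.
have et20 : 0 < et / 2 by rewrite divr_gt0.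
have rle1 y : r y <= 1 by have [w [w1 ->]] := rep y; rewrite rE.
have setup t0 ka : k0 < ka -> ka < 1 -> let gam t := gam0 (t + t0) in [/\ continuous gam,
    forall t, gam (t + 1) = gam t, 1 < 3 * ka & exists2 del, 0 < del &
    forall t t', `|t - t'| <= del -> `|r (gam t) - r (gam t')| < (1 - ka) / 2].
  move=> kl k1 gam; have cg : continuous gam.
    by apply: cts_comp cg0 _; apply: ctsD; [exact: cts_id|exact: cts_cst].
  have gp t : gam (t + 1) = gam t by rewrite /gam addrAC gper0.
  split => //; first by move: kl; rewrite gt_max => /andP[]; lra.
  apply: unif_per; [exact: cts_comp cr cg|by move=> t; rewrite gp|lra].
case: (pselect (exists t, r (gam0 t) < 1)) => [[t0 rt0]|nodeep].
- have [ka /andP[kl k1] kgen] := @generic_level R (fun t => r (gam0 (t + t0))) (Num.max k0 (r (gam0 t0))) 1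
    ltac:(by rewrite gt_max k01).
  move: kl; rewrite gt_max => /andP[kl kr].
  have [cg gp k3 [del del0 delP]] := setup t0 ka kl k1.
  pose gam t := gam0 (t + t0).
  have [z0 [z01 zE]] := rep (gam 0); have gz : gam 0 = gam0 t0 by rewrite /gam add0r.
  have zk : md z0 < ka by rewrite -rE// -zE gz.
  have z01' : md z0 < 1 by exact: lt_trans k1.
  pose n := (Num.truncn (1 / del)).+1.
  have [|||||N [A [a [b [j [rd b0 A0]]]]]] := @reading_ex R g g0 Y q1 ps1 hY r rE rE' gam cg ka (et / 2) del
     k1 k3 et20 del0 delP (Hcol ka t0 kl k1) n 0 z0.
  + by left.
  + by rewrite qx_in.
  + exact: ltW.
  + exact: ler01.
  + by rewrite subr0 -ler_pdivrMr// ltW// truncnS_gt.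
  exists t0, gam, ka, N, A, a, b, j; split; last first.
    (* If the next strand started at the very time of entry, the radius would exceed [ka] shortly
       before and after, and the time would be a strict local minimum at the level [ka], which was
       chosen not to have any. *)
    move=> N0; rewrite A0; split => // i iN; apply/eqP => ba.
    have [_ st _ _ _] := rd; have [b1 [[s1 s2] [s3 s4] [s5 s6 s7] _ _]] := st i (ltnW iN).
    have [b2 [[u1 u2] [u3 u4] [u5 u6 u7] _ _]] := st _ iN.
    have k0' : 0 < ka by lra.
    have big A' u v t : valid g q1 gam A' u v -> u <= t <= v -> ka < md (A' t) -> md (A' t) < ka^-1 -> ka < r (gam t).
      move=> vA tu l1 l2; have [gt <-] := vA t tu; rewrite rE'//; case: ifP => // _.
      by rewrite -[ka]invrK ltf_pV2 ?posrE ?invr_gt0// (lt_trans k0').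
    have bb : b i <= b i.+1 <= b i.+1 by rewrite lexx (le_trans s1)// ltW.
    have rb : r (gam (b i.+1)) = ka.
      have [gt <-] := s3 _ bb; rewrite rE'// s5 invrK ifF//.
      by apply/negbTE; rewrite -ltNge invf_gt1.
    pose e := Num.min (b i.+1 - a i) (b i.+2 - b i.+1).
    have e0 : 0 < e by rewrite lt_min !subr_gt0 s2 ba u2.
    have [t te [tne tle]] := kgen (b i.+1) e e0 rb.
    move: te; rewrite lt_min => /andP[te1 te2].
    have : ka < r (gam t); last by rewrite ltNge tle.
    move: te1 te2; rewrite !ltr_distl => /andP[l1 l2] /andP[l3 l4].
    have ta : a i < t by move: l1; rewrite subKr.
    have tb2 : t < b i.+2 by move: l4; rewrite addrC subrK.
    case: (ltgtP t (b i.+1)) tne => // tb _.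
      apply: (big (A i) (b i) (b i.+1)) => //; first by rewrite (ltW tb) (le_trans s1 (ltW ta)).
        by apply: s7; rewrite (ltW tb) ta.
      by apply: s4; rewrite tb (le_trans s1 (ltW ta)).
    apply: (big (A i.+1) (b i.+1) (b i.+2)) => //; first by rewrite (ltW tb) (ltW tb2).
      by apply: u7; rewrite -ba tb (ltW tb2).
    by apply: u4; rewrite (ltW tb) tb2.
  have ka01 : 0 < ka < 1 by rewrite k1 andbT; lra.
  split; [by []|exact: ka01|exact: rd|exact: b0|].
  rewrite A0; have [_ _ bN v5 l5] := rd.
  have h1 : (b N <= (1 : R)) && ((1 : R) <= 1) by rewrite bN /=; exact: lexx.
  have [gA qA] := v5 _ h1; have g0' : good z0 by left.
  have E : qy (A N 1) = qy z0 by rewrite qA qx_in// -zE; have := gp 0; rewrite add0r.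
  (* The end could otherwise only be the mirror image of the start. As the start has modulus less
     than [ka], that image has modulus above [1 / ka], where the sheet would already have been
     left. *)
  have [//|[l sl lE]] := qy_inj g0 ps1 gA g0' E.
  have [sl0 _] := sl; exfalso; have := l5 _ h1; rewrite ltNge => /negP; apply.
  have k0' : 0 < ka by lra.
  by rewrite -[md (A N 1)]invrK -(md_mirror g l) -lE lef_pV2 ?posrE ?ltW// lE md_mirror invr_gt0.
- have r1 t : r (gam0 t) = 1.
    by apply/eqP; rewrite eq_le rle1 leNgt; apply/negP => lt; apply: nodeep; exists t.
  pose ka := (k0 + 1) / 2; have kl : k0 < ka by rewrite /ka; lra.
  have k1 : ka < 1 by rewrite /ka; lra.
  have [cg gp k3 [del del0 delP]] := setup 0 ka kl k1.
  pose gam t := gam0 (t + 0); have [z0 [z01 zE]] := rep (gam 0).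
  have k0' : 0 < ka by lra.
  have kV : 1 < ka^-1 by rewrite invf_gt1.
  have mz0 : md z0 = 1 by rewrite -rE// -zE r1.
  have [x zx ex] := Hcol ka 0 kl k1 0 z0 z01 zE ltac:(by rewrite mz0 /ka'; lra).
  have [j [x' xj [zx' _]]] := @eta_sec R g g0 (et / 2) et20 z0 x ltac:(by rewrite mz0) zx ex.
  have sz : sec (j : nat)%:Z z0 by split; [rewrite mz0|exists x'].
  have gz : good z0 by right; exists (j : nat)%:Z.
  have [||||A [cA A0 alt]] := @run_to R g g0 Y q1 ps1 hY r rE rE' gam cg ka (et / 2) del
     k1 k3 et20 del0 delP (Hcol ka 0 kl k1) 0 1 z0.
  + exact: gz.
  + by rewrite qx_in.
  + by rewrite mz0.
  + exact: ler01.
  have md1' t v : valid g q1 gam A 0 v -> 0 <= t <= v -> md (A t) = 1.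
    move=> vA tv; have [gt qt] := vA t tv; have := rE' _ gt; rewrite qt r1; case: ifP => // _ /esym.
    by move=> h; rewrite -[md _]invrK h invr1.
  case: alt => [[vA lA]|[b [b0 b1 vA _ Ab]]]; last first.
    by exfalso; move: kV; rewrite -Ab (md1' b b) ?ltxx// lexx ltW.
  exists 0, gam, ka, 0%N, (fun=> A), (fun=> 0), (fun=> 0), (fun=> 0); split; last by [].
  have ka01 : 0 < ka < 1 by rewrite k0' k1.
  split; [by []|exact: ka01|split; [by []|by []|exact: ler01|exact: vA|exact: lA]|by []|].
  have z11 : 0 <= (1 : R) <= 1 by rewrite lexx ler01.
  have [gA qA] := vA _ z11.
  have s1 : sec (j : nat)%:Z (A 1).
    apply: (@sec_const R g g0 A 0 1) => //; rewrite ?ler01// ?A0// => t t01.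
    have [gt qt] := vA t t01; case: gt => // lt; by move: lt; rewrite (md1' t 1)// ltxx.
  have E : qy (A 1) = qy z0 by rewrite qA qx_in// -zE; have := gp 0; rewrite add0r.
  rewrite A0; have [//|[l sl lE]] := qy_inj g0 ps1 gA gz E.
  exfalso; have [m lm] := sec_mod g0 sl s1; apply: (@sec_iota R g g0 (j : nat)%:Z z0) => //.
  by rewrite lE lm mirror_per//; exact: sec_mirror.
Qed.

End Reading.

(** The analogue of [act] for sheets of any type, so that the infinite cyclic cover is included. *)
Definition walk (S : Type) (tau : int -> S -> S) (w : seq int) (s : S) : S := foldl (fun s j => tau j s) s w.

Lemma walk_rcons (S : Type) (tau : int -> S -> S) w j s : walk tau (rcons w j) s = tau j (walk tau w s).
Proof. by rewrite /walk foldl_rcons. Qed.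

(** * Lifts to covers of a curve that has been read *)

Section Lifts.
Variables (R : realType) (g : nat).
Hypothesis g0 : (0 < g)%N.
Notation C := R[i].
Notation z4 := ((4 * g)%N%:Z).
Notation sec := (@sec R g).
Notation mirror := (@mirror R g).
Notation good := (@good R g).
Let tau1 (j : int) (u : unit) := u.
Variables (Y : topologicalType) (q1 : unit -> C -> Y).
Hypothesis ps1 : polysurf g tau1 q1.
Notation qy := (qx g tau1 q1 tt).
Variables (gam : R -> Y) (ka : R) (N : nat) (A : nat -> R -> C) (a b : nat -> R) (j : nat -> int).
Hypothesis rd : reading g q1 gam ka N A a b j.
Hypothesis b0 : b 0%N = 0.
Hypothesis A1 : A N 1 = A 0%N 0.

Lemma step_lt i : (i < N)%N -> b i < b i.+1.
Proof. by have [_ st _ _ _] := rd => /st[_ [[s1 s2] _ _ _ _]]; exact: le_lt_trans s2. Qed.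

Lemma step_le i k : (i <= k)%N -> (k <= N)%N -> b i <= b k.
Proof.
move=> /subnK <-; elim: (k - i)%N => // n IH nN; apply: le_trans (IH (ltnW nN)) _.
by rewrite addSn ltW// step_lt.
Qed.

Lemma step_ltn i k : (i < k)%N -> (k <= N)%N -> b i < b k.
Proof. by move=> ik kN; apply: lt_le_trans (step_le ik kN); apply: step_lt; exact: leq_trans kN. Qed.

Definition sheet_end (i : nat) : R := if (i < N)%N then b i.+1 else 1.

Lemma sheet_at t : 0 <= t <= 1 -> exists i : 'I_N.+1, b i <= t <= sheet_end i.
Proof.
move=> /andP[t0 t1]; have H m : (m <= N)%N -> (exists i : 'I_N.+1, b i <= t <= sheet_end i) \/ b m <= t.
  elim: m => [|m IH] mN; first by right; rewrite b0.
  case: (IH (ltnW mN)) => [|h]; first by left.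
  case: (leP (b m.+1) t) => h2; first by right.
  have mN' : (m < N.+1)%N by rewrite ltnS ltnW.
  by left; exists (Ordinal mN'); rewrite /= h /sheet_end mN ltW.
case: (H N (leqnn N)) => // h; exists ord_max; by rewrite /= h /sheet_end ltnn.
Qed.

Lemma sheet_valid i t : (i <= N)%N -> b i <= t <= sheet_end i -> good (A i t) /\ qy (A i t) = gam t.
Proof.
have [_ st _ vN _] := rd; rewrite leq_eqVlt /sheet_end => /orP[/eqP ->|iN]; first by rewrite ltnn; exact: vN.
by rewrite iN; have [_ [_ [vA _] _ _ _]] := st i iN; exact: vA.
Qed.

Lemma clamp_sheet t : exists i : 'I_N.+1, b i <= clamp01 t <= sheet_end i.
Proof. by apply: sheet_at; exact: clamp01_itv. Qed.

Definition ix (t : R) : 'I_N.+1 := projT1 (cid (clamp_sheet t)).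

Lemma ixP t : b (ix t) <= clamp01 t <= sheet_end (ix t). Proof. by rewrite /ix; case: cid. Qed.

Definition raw (t : R) : C := A (ix t) (clamp01 t).
(** The crossings made up to time [t], together with the side just crossed if the path is in the
    collar outside its sheet. With this word the point [disc_at t] of the closed disc is the same
    for all covers. *)
Definition word_at (t : R) : seq int :=
  if md (raw t) <= 1 then mkseq j (ix t) else rcons (mkseq j (ix t)) (sector g (raw t)).
Definition disc_at (t : R) : C := if md (raw t) <= 1 then raw t else mirror (sector g (raw t)) (raw t).

Lemma raw_valid t : good (raw t) /\ qy (raw t) = gam (clamp01 t).
Proof. by apply: sheet_valid; [rewrite -ltnS|exact: ixP]. Qed.

Lemma disc_at_md t : md (disc_at t) <= 1.
Proof.
by rewrite /disc_at; case: (leP (md (raw t)) 1) => // h; rewrite md_mirror invf_le1 ?ltW// (lt_trans _ h).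
Qed.

Lemma disc_at_good t : good (disc_at t).
Proof.
have [gr _] := raw_valid t; rewrite /disc_at; case: (leP (md (raw t)) 1) => // h; left.
by rewrite md_mirror invf_lt1//; exact: lt_trans h.
Qed.

Section Lift.
Variables (S : choiceType) (tau : int -> S -> S).
Hypothesis tauK : forall j s, tau (iota4 j) (tau j s) = s.
Hypothesis tau_per : forall j m s, tau (j + z4 * m) s = tau j s.
Variables (X : topologicalType) (q : S -> C -> X).
Hypothesis ps : polysurf g tau q.

Definition lift (s : S) (t : R) : X := q (walk tau (word_at t) s) (disc_at t).

Definition lift_piece (s : S) (i : nat) (t : R) : X := qx g tau q (walk tau (mkseq j i) s) (A i t).

Lemma liftE s t : lift s t = lift_piece s (ix t) (clamp01 t).
Proof.
rewrite /lift /lift_piece /word_at /disc_at -/(raw t) /qx; case: ifP => // _.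
by rewrite walk_rcons.
Qed.

(** The time intervals of two readings meet only if they are consecutive, and there the two
    coordinates are exchanged by [mirror]. *)
Lemma lift_compat s i k t : (i <= N)%N -> (k <= N)%N -> b i <= t <= sheet_end i -> b k <= t <= sheet_end k ->
  lift_piece s i t = lift_piece s k t.
Proof.
wlog ik : i k / (i < k)%N.
  by move=> H iN kN ti tk; case: (ltngtP i k) => [ik|ki|-> //]; [exact: H|apply/esym; exact: H].
move=> iN kN /andP[i1 i2] /andP[k1 k2]; have iN' : (i < N)%N by exact: leq_trans kN.
rewrite /sheet_end iN' in i2; have tb : t = b i.+1.
  by apply/eqP; rewrite eq_le i2 (le_trans (step_le ik kN)).
have -> : k = i.+1.
  apply/eqP; rewrite eqn_leq ik andbT leqNgt; apply/negP => h.
  by have := step_ltn h kN; rewrite ltNge -tb k1.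
have [_ st _ _ _] := rd; have [_ [[s1 s2] _ _ [_ sj] Ab]] := st i iN'.
rewrite /lift_piece tb Ab mkseqS walk_rcons -(qx_mirror g0 tauK tau_per ps)//.
by apply: sj; rewrite lexx ltW.
Qed.

Lemma continuous_lift s : continuous (lift s).
Proof.
rewrite (_ : lift s = fun t => lift_piece s (ix t) (clamp01 t)); last by apply: funext => t; exact: liftE.
apply: (@compact_lift R R X R 'I_N.+1 (fun i => `[b i, sheet_end i]%classic) (fun _ => idfun)
  (fun i => lift_piece s i) (@clamp01 R)).
- exact: norm_hausdorff.
- by move=> i; exact: segment_compact.
- by move=> i; exact: cts_id.
- move=> i; apply: continuous_in_subspaceT => t /set_mem; rewrite /= in_itv /= => ti.
  have [cA _ _ _ _] := rd; have [gt _] := sheet_valid (ltn_ord i : (i <= N)%N) ti.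
  apply: (@continuous_comp _ _ _ (A i) (qx g tau q _)); first exact: cA.
  exact: (qx_cont g0 tauK tau_per ps).
- move=> i t i' t'; rewrite /= !in_itv /= => h h' e'; rewrite -e' in h' *.
  exact: (lift_compat s (ltn_ord i : (i <= N)%N) (ltn_ord i' : (i' <= N)%N) h h').
- exact: continuous_clamp01.
- by move=> t; exists (ix t), (clamp01 t); split => //; rewrite /= in_itv /= ixP.
Qed.

(** As the reading returns to its first coordinate, the end of one lift is the start of the lift
    from the sheet reached by the whole word. *)
Lemma lift1 s : lift s 1 = lift (walk tau (mkseq j N) s) 0.
Proof.
have z01 : 0 <= (0 : R) <= 1 by rewrite lexx ler01.
have o01 : 0 <= (1 : R) <= 1 by rewrite lexx ler01.
have [_ _ bN _ _] := rd.
rewrite !liftE; have := ixP 1; have := ixP 0; rewrite !clamp01_id// => i0 i1.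
rewrite (lift_compat s (ltn_ord (ix 1) : (ix 1 <= N)%N) (leqnn N) i1); last by rewrite bN /sheet_end ltnn lexx.
rewrite (lift_compat _ (ltn_ord (ix 0) : (ix 0 <= N)%N) (leq0n N) i0); last first.
  have be0 : 0 <= sheet_end 0 by rewrite /sheet_end; case: ltnP => // N0; have := step_lt N0; rewrite b0 => /ltW.
  by rewrite b0 lexx be0.
by rewrite /lift_piece A1.
Qed.

End Lift.

Lemma lift_base t : q1 tt (disc_at t) = gam (clamp01 t).
Proof.
have := @liftE unit tau1 Y q1 tt t; rewrite /lift; case: (walk _ _ _) => ->.
by rewrite /lift_piece; case: (walk _ _ _); exact: (raw_valid t).2.
Qed.

End Lifts.

Section Strip.
Variables (R : realType) (g : nat).
Hypothesis g0 : (0 < g)%N.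
Notation C := R[i].
Notation n4 := ((4 * g)%:R : R).
Notation arc := (@arc R g).
Notation sec := (@sec R g).

(** Coordinates on an open sector in which circles about 0 become vertical lines and the angle
    increases upwards, as [strands_meet] requires. *)
Definition strip (s : int) (z : C) : C := Complex (md z) (Im (z / arc (s%:~R + 1 / 2))).

Lemma continuous_strip s (T : topologicalType) (f : T -> C) : continuous f -> continuous (fun t => strip s (f t)).
Proof.
move=> cf; have -> : (fun t => strip s (f t)) =
    fun t => (md (f t))%:C + 'i%C * (Im (f t / arc (s%:~R + 1 / 2)))%:C.
  by apply: funext => t; apply/eqP; rewrite eq_complex /=; apply/andP; split; apply/eqP; ring.
apply: ctsD; first by apply: cts_toC; exact: cts_md.
apply: ctsM; first exact: cts_cst.
by apply: cts_toC; apply: cts_Im; apply: (ctsM cf); exact: cts_cst.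
Qed.

Lemma strip_inj s z w : sec s z -> sec s w -> strip s z = strip s w -> z = w.
Proof.
move=> /(secP g0)[rz _] /(secP g0)[rw _]; rewrite /strip; set c := arc _ in rz rw *.
have c1 : md c = 1 by rewrite md_arc.
have c0 : c != 0 by rewrite -md_eq0 c1 oner_eq0.
case=> em ei; have mE u : md (u / c) = md u by rewrite mdM mdV c1 invr1 mulr1.
have : Re (z / c) ^+ 2 = Re (w / c) ^+ 2.
  by apply: (@addIr _ (Im (z / c) ^+ 2)); rewrite -md_sqr ei -md_sqr !mE em.
move/eqP; rewrite eqrXn2 ?ltW// => /eqP er.
apply: (mulIf (invr_neq0 c0)); apply/eqP; rewrite eq_complex er ei; apply/andP; by split; apply/eqP.
Qed.

Lemma strip_lt s (rho x y : R) : 0 < rho -> s%:~R < x < s%:~R + 1 -> s%:~R < y < s%:~R + 1 -> x < y ->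
  Im (strip s (rho%:C * arc x)) < Im (strip s (rho%:C * arc y)).
Proof.
move=> r0 xs ys xy; have p0 := pi_gt0 R; have n0 := n4_gt0 R g0; have n44 := n4_ge4 R g0.
pose th u := 2 * pi * (u - (s%:~R + 1 / 2)) / n4.
have E u : Im (strip s (rho%:C * arc u)) = rho * sin (th u).
  have wE : rho%:C * arc u / arc (s%:~R + 1 / 2) = rho%:C * cis (th u) by rewrite -mulrA -arcB.
  by rewrite -[LHS]/(Im (rho%:C * arc u / arc (s%:~R + 1 / 2))) wE /= mul0r addr0.
have thE u : th u = (2 * (u - (s%:~R + 1 / 2))) * (pi / n4) by rewrite /th; ring.
have pn0 : 0 < pi / n4 by rewrite divr_gt0.
have pn2 : pi / n4 < pi / 2 by rewrite ltr_pM2l// ltf_pV2 ?posrE//; lra.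
have thI u : s%:~R < u < s%:~R + 1 -> th u \in `[- (pi / 2), (pi / 2)].
  move=> us; have : `|th u| < pi / n4.
    rewrite thE -[X in _ < X]mul1r normrM (gtr0_norm pn0) ltr_pM2r// ltr_norml; lra.
  by rewrite ltr_norml in_itv /= => /andP[h1 h2]; apply/andP; split; lra.
by rewrite !E ltr_pM2l// ltr_sin ?thI// !thE ltr_pM2r// ltr_pM2l//; lra.
Qed.

End Strip.

(** * The chord diagram of a simple closed curve *)

Section Diagram.
Variables (R : realType) (g : nat).
Hypothesis g0 : (0 < g)%N.
Notation C := R[i].
Notation z4 := ((4 * g)%N%:Z).
Notation n4 := ((4 * g)%:R : R).
Notation arc := (@arc R g).
Notation sec := (@sec R g).
Notation mirror := (@mirror R g).
Notation good := (@good R g).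
Let tau1 (j : int) (u : unit) := u.
Variables (Y : topologicalType) (q1 : unit -> C -> Y).
Hypothesis ps1 : polysurf g tau1 q1.
Notation qy := (qx g tau1 q1 tt).
Variables (gam : R -> Y) (ka : R) (N : nat) (A : nat -> R -> C) (a b : nat -> R) (j : nat -> int).
Hypothesis rd : reading g q1 gam ka N A a b j.
Hypothesis b0 : b 0%N = 0.
Hypothesis A1 : A N 1 = A 0%N 0.
Hypothesis gam_per : forall t, gam (t + 1) = gam t.
Hypothesis gam_inj : forall s t, gam s = gam t -> s - t \is a Num.int.
Hypothesis ka01 : 0 < ka < 1.
Hypothesis N0 : (0 < N)%N.
Hypothesis deep : md (A 0%N 0) < ka.
Hypothesis gen : forall i, (i.+1 < N)%N -> b i.+1 != a i.+1.

Lemma kaP : 0 < ka. Proof. by case/andP: ka01. Qed.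
Lemma kaV : 1 < ka^-1. Proof. by rewrite invf_gt1 ?kaP//; case/andP: ka01. Qed.

Lemma stepP i : (i < N)%N -> sheet_step g q1 gam ka (A i) (A i.+1) (b i) (a i) (b i.+1) (j i).
Proof. by have [_ st _ _ _] := rd => /st[]. Qed.

Lemma a_lt i : (i < N)%N -> a i < b i.+1.
Proof. by move=> /stepP[[]]. Qed.

(** The first sheet starts below the level [ka], and the generic level excludes equality later;
    hence the time intervals of distinct crossings are disjoint. *)
Lemma b_lt_a i : (i < N)%N -> b i < a i.
Proof.
move=> iN; have [[s1 _] _ [_ Aa _] _ _] := stepP iN; rewrite lt_def s1 andbT eq_sym.
case: i iN s1 Aa => [|i] iN s1 Aa; last exact: gen.
by apply/eqP => E; move: deep; rewrite -b0 E Aa ltxx.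
Qed.

Lemma a_gt0 i : (i < N)%N -> 0 < a i.
Proof.
move=> iN; apply: le_lt_trans (b_lt_a iN); rewrite -b0; exact: (step_le rd) (leq0n i) (ltnW iN).
Qed.

Lemma bN_lt1 : b N < 1.
Proof.
have [_ _ bN _ _] := rd; rewrite lt_def bN andbT eq_sym; apply/eqP => E.
case: N N0 E A1 rd => // n _ E A1' rd'; have [_ st _ _ _] := rd'.
have [_ [_ _ [Ab _ _] _ Am]] := st n (ltnSn n).
by move: deep; rewrite -A1' -E Am md_mirror Ab invrK ltxx.
Qed.

Lemma b_lt1 i : (i < N)%N -> b i.+1 < 1.
Proof. by move=> iN; apply: le_lt_trans bN_lt1; exact: (step_le rd). Qed.

Lemma b_a i k : (i < k)%N -> (k < N)%N -> b i.+1 < a k.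
Proof. by move=> ik kN; apply: le_lt_trans (b_lt_a kN); apply: (step_le rd) => //; exact: ltnW. Qed.

Notation X := 'I_N.
Notation pt := (X * bool)%type.
Notation jl := (fun i : X => j i).
Notation psd := (psd jl).
Notation pm := (@pm X).

(** Both kinds of end lie on the circle of radius [1 / ka]: an exit directly, and an entry as the
    strand's point of modulus [ka] reflected into the next sheet. *)
Definition pnt (P : pt) : C := if P.2 then A P.1 (b P.1.+1) else mirror (j P.1) (A P.1 (a P.1)).
Definition tm (P : pt) : R := if P.2 then b P.1.+1 else a P.1.

Lemma sheet_sec i t : (i < N)%N -> a i <= t <= b i.+1 -> sec (j i) (A i t).
Proof. by move=> /stepP[_ _ _ [_ sj] _]; exact: sj. Qed.

Lemma sheet_val i t : (i < N)%N -> b i <= t <= b i.+1 -> good (A i t) /\ qy (A i t) = gam t.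
Proof. by move=> /stepP[_ [vA _] _ _ _]; exact: vA. Qed.

Lemma sheet_val' i t : (i < N)%N -> a i <= t <= b i.+1 -> qy (A i t) = gam t.
Proof.
move=> iN /andP[t1 t2]; have [//|_ ->//] := @sheet_val i t iN.
by rewrite t2 (le_trans (ltW (b_lt_a iN))).
Qed.

Lemma a_itv i : (i < N)%N -> a i <= a i <= b i.+1. Proof. by move=> iN; rewrite lexx ltW ?a_lt. Qed.
Lemma b_itv i : (i < N)%N -> a i <= b i.+1 <= b i.+1. Proof. by move=> iN; rewrite lexx ltW ?a_lt. Qed.

Lemma pnt_md P : md (pnt P) = ka^-1.
Proof.
case: P => i c; have [_ _ [Ab Aa _] _ _] := stepP (ltn_ord i); rewrite /pnt.
by case: c => //=; rewrite md_mirror Aa.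
Qed.

Lemma pnt_sec P : sec (psd P) (pnt P).
Proof.
case: P => i []; rewrite /pnt /psd /=; first by apply: sheet_sec (ltn_ord i) _; exact: b_itv.
by apply: sec_mirror; apply: sheet_sec (ltn_ord i) _; exact: a_itv.
Qed.

Lemma pnt_gam P : qy (pnt P) = gam (tm P).
Proof.
case: P => i []; rewrite /pnt /tm /=; first by apply: sheet_val' (ltn_ord i) _; exact: b_itv.
have si := sheet_sec (ltn_ord i) (a_itv (ltn_ord i)).
rewrite (qy_mirror g0 ps1 si); apply: sheet_val' (ltn_ord i) _; exact: a_itv.
Qed.

Lemma pos_ex P : exists x, (psd P)%:~R < x < (psd P)%:~R + 1 /\ pnt P = (ka^-1)%:C * arc x.
Proof. by have [_ [x xs E]] := pnt_sec P; exists x; split => //; rewrite -(pnt_md P). Qed.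

Definition pp (P : pt) : R := projT1 (cid (pos_ex P)).
Lemma ppP P : (psd P)%:~R < pp P < (psd P)%:~R + 1 /\ pnt P = (ka^-1)%:C * arc (pp P).
Proof. by rewrite /pp; case: cid. Qed.

Notation outp := (fun i : X => pp (i, true)).
Notation inp := (fun i : X => pp (i, false)).

Lemma pposE P : ppos outp inp P = pp P. Proof. by case: P => i []. Qed.

Lemma int_small (x : R) : x \is a Num.int -> -1 < x < 1 -> x = 0.
Proof.
move=> /intrP[m ->] /andP[h1 h2].
have h3 : -1 < m by rewrite -(ltr_int R) mulrN1z.
have h4 : m < 1 by rewrite -(ltr_int R).
by have -> : m = 0 by lia.
Qed.

Lemma tm01 P : 0 < tm P < 1.
Proof.
case: P => i c; have h1 := a_gt0 (ltn_ord i); have h2 := a_lt (ltn_ord i); have h3 := b_lt1 (ltn_ord i).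
by rewrite /tm; case: c => /=; rewrite ?h1 ?h3 ?(lt_trans h1 h2) ?(lt_trans h2 h3).
Qed.

Lemma times_eq s t : 0 < s < 1 -> 0 < t < 1 -> gam s = gam t -> s = t.
Proof.
move=> s01 t01 /gam_inj/int_small h; apply/eqP; rewrite -subr_eq0; apply/eqP/h; lra.
Qed.

Lemma tm_sep i k t t' : (i < k)%N -> (k < N)%N -> t <= b i.+1 -> a k <= t' -> t < t'.
Proof. by move=> ik kN h1 h2; apply: le_lt_trans h1 _; apply: lt_le_trans h2; exact: b_a. Qed.

Lemma sheet_time i k t t' : (i < N)%N -> (k < N)%N -> a i <= t <= b i.+1 -> a k <= t' <= b k.+1 ->
  gam t = gam t' -> i = k.
Proof.
have H l s : (l < N)%N -> a l <= s <= b l.+1 -> 0 < s < 1.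
  move=> lN /andP[s1 s2]; rewrite (lt_le_trans (a_gt0 lN) s1) (le_lt_trans s2)//; exact: b_lt1.
move=> iN kN ti tk /times_eq E; have {}E := E (H _ _ iN ti) (H _ _ kN tk).
move: ti tk => /andP[t1 t2] /andP[t3 t4].
case: (ltngtP i k) => // h; [have := tm_sep h kN t2 t3|have := tm_sep h iN t4 t1]; by rewrite E ltxx.
Qed.

Lemma tm_inj P P' : gam (tm P) = gam (tm P') -> P = P'.
Proof.
have H (Q : pt) : a Q.1 <= tm Q <= b Q.1.+1.
  by case: Q => i []; rewrite /tm /=; [exact: b_itv|exact: a_itv].
move=> E; have E1 : P.1 = P'.1 by apply: ord_inj; apply: sheet_time E; rewrite ?ltn_ord.
have := times_eq (tm01 P) (tm01 P') E; case: P P' E1 {E} => i c [k c'] /= <-; rewrite /tm /=.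
have h := a_lt (ltn_ord i); case: c; case: c' => //= E; move: h; rewrite E ltxx//.
Qed.

Lemma pp_inj : injective pp.
Proof.
move=> P P' E; apply: tm_inj; rewrite -!pnt_gam; congr qy.
by have [_ ->] := ppP P; have [_ ->] := ppP P'; rewrite E.
Qed.

Lemma jl_itv (i : X) : 0 <= j i < z4.
Proof. by have [_ _ _ [h _] _] := stepP (ltn_ord i). Qed.

Lemma pp_mono P P' : pp P <= pp P' -> psd P <= psd P'.
Proof.
move=> le; have [/andP[h1 _] _] := ppP P; have [/andP[_ h2] _] := ppP P'.
have := lt_trans (lt_le_trans h1 le) h2; rewrite -intrD1 ltr_int; lia.
Qed.

(** Clamping the time keeps the path in its sector, away from 0, so that its mirror image is
    continuous for all times. *)
Definition track (i : nat) (t : R) : C := A i (Num.max (a i) (Num.min t (b i.+1))).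

Lemma track_id i t : a i <= t <= b i.+1 -> track i t = A i t.
Proof. by move=> /andP[h1 h2]; rewrite /track min_l// max_r. Qed.

Lemma ctrack i : continuous (track i).
Proof.
have [cA _ _ _ _] := rd; apply: cts_comp (cA i) _; apply: cts_max; first exact: cts_cst.
by apply: cts_min; [exact: cts_id|exact: cts_cst].
Qed.

Lemma track_neq0 i t : (i < N)%N -> track i t != 0.
Proof.
move=> iN; rewrite -md_gt0; have [] // : sec (j i) (track i t).
apply: sheet_sec => //; rewrite le_max lexx /= ge_max (ltW (a_lt iN)) ge_min lexx orbT//.
Qed.

Lemma cmirror_track i (f : R -> R) : (i < N)%N -> continuous f ->
  continuous (fun t => mirror (j i) (track i (f t))).
Proof.
move=> iN cf; apply: ctsM; first exact: cts_cst.
by apply: (ctsV (cts_comp (@ctrack i) cf)) => t; exact: track_neq0.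
Qed.

(** The crossing as a path in a sector from modulus [ka] to [1 / ka]; seen from the entry side it is
    reflected and run backwards. *)
Lemma strand P : exists (T : R -> C) u v, [/\ continuous T, u <= v, T v = pnt P, T u = mirror (psd (pm P)) (pnt (pm P)) &
  [/\ forall t, u <= t <= v -> sec (psd P) (T t) /\ exists2 t', a P.1 <= t' <= b P.1.+1 & qy (T t) = gam t',
      forall t, u < t <= v -> ka < md (T t) & forall t, u <= t < v -> md (T t) < ka^-1]].
Proof.
case: P => i c; have iN := ltn_ord i; have ab := a_lt iN; have k0 := kaP.
have [[s1 s2] [vA lA] [Ab Aa la] [jz sj] Am] := stepP iN.
have [cA _ _ _ _] := rd; have sa := sheet_sec iN (a_itv iN); have sb := sheet_sec iN (b_itv iN).
case: c; rewrite /psd /pm /pnt /=.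
  exists (A i), (a i), (b i.+1); split => //; first exact: ltW.
    by rewrite mirrorK//; case: sa.
  split=> [t tab|t|t /andP[t1 t2]]; [|exact: la|by apply: lA; rewrite t2 (le_trans s1)].
  by split; [exact: sj|exists t => //; exact: sheet_val'].
have ki t : - b i.+1 <= t <= - a i -> a i <= - t <= b i.+1.
  by move=> /andP[t1 t2]; rewrite lerNr t2 lerNl t1.
exists (fun t => mirror (j i) (track i (- t))), (- b i.+1), (- a i); split.
- by apply: (cmirror_track iN); apply: ctsN; exact: cts_id.
- by rewrite lerN2 ltW.
- by rewrite opprK track_id// a_itv.
- by rewrite opprK track_id ?b_itv.
split=> t tab.
- have h := ki t tab; rewrite track_id//; have st := sj _ h; split; first exact: sec_mirror.
  by exists (- t) => //; rewrite (qy_mirror g0 ps1 st); exact: sheet_val'.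
- move: tab => /andP[t1 t2]; rewrite track_id; last by apply: ki; rewrite t2 ltW.
  rewrite md_mirror -[X in X < _]invrK ltf_pV2 ?posrE ?invr_gt0//.
    have ht : a i <= - t by rewrite lerNr.
    by apply: lA; apply/andP; split; [exact: le_trans s1 ht|rewrite ltrNl].
  by have [] := sj (- t) (ki t ltac:(by rewrite t2 ltW)).
- move: tab => /andP[t1 t2]; rewrite track_id; last by apply: ki; rewrite t1 ltW.
  rewrite md_mirror ltf_pV2 ?posrE//; last by have [] := sj (- t) (ki t ltac:(by rewrite t1 ltW)).
  by apply: la; rewrite lerNl t1 ltrNr t2.
Qed.

(** Otherwise the two strands of the sector would exchange their order between the circles of radii
    [ka] and [1 / ka], hence meet, against simplicity of the curve. *)
Lemma pp_rev P P' : psd P = psd P' -> pp P < pp P' -> pp (pm P') < pp (pm P).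
Proof.
move=> sP lt; have k0 := kaP; have kV := kaV.
have neP : P != P' by apply: contraTneq lt => ->; rewrite ltxx.
rewrite ltNge le_eqVlt; apply/negP => /orP[/eqP/pp_inj E|lt2].
  by move/eqP: neP; apply; rewrite -[P](pmK) E pmK.
have [T [u [v [cT uv Tv Tu [Ts Tl Tg]]]]] := strand P.
have [T' [u' [v' [cT' uv' Tv' Tu' [Ts' Tl' Tg']]]]] := strand P'.
have psdm Q : psd (pm Q) = iota4 (psd Q) by exact: psd_m.
have kend Q : exists2 x, (psd Q)%:~R < x < (psd Q)%:~R + 1 & mirror (psd (pm Q)) (pnt (pm Q)) = ka%:C * arc x /\
    x = (psd Q + iota4 (psd Q) + 1)%:~R - pp (pm Q).
  have [h ->] := ppP (pm Q); rewrite mirror_arc invrK psdm iota4K [iota4 _ + _]addrC.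
  exists ((psd Q + iota4 (psd Q) + 1)%:~R - pp (pm Q)) => //.
  by move: h; rewrite psdm !intrD; lra.
have [x xs [xE xE']] := kend P; have [x' xs' [xE2 xE2']] := kend P'.
rewrite -sP in xs' Ts' xE2'.
have [hP pE] := ppP P; have [hP' pE'] := ppP P'; rewrite -sP in hP'.
pose s := psd P; have mk (rho y : R) : 0 < rho -> Re (strip g s (rho%:C * arc y)) = rho.
  by move=> r0; rewrite -[LHS]/(md (rho%:C * arc y)) mdM mdRe md_arc mulr1 gtr0_norm.
have kV0 : 0 < ka^-1 by rewrite invr_gt0.
have [||||||||||||t' [t [tu' tu E]]] := @strands_meet R (fun t => strip g s (T' t)) (fun t => strip g s (T t))
   u' v' u v ka ka^-1 uv' uv.
- by apply: (continuous_strip (f := T')); exact: cT'.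
- by apply: (continuous_strip (f := T)); exact: cT.
- by rewrite Tu' xE2 mk.
- by rewrite Tu xE mk.
- by rewrite Tv' pE' mk.
- by rewrite Tv pE mk.
- exact: Tl'.
- exact: Tg'.
- exact: Tl.
- exact: Tg.
- rewrite Tu' Tu xE2 xE; apply: strip_lt => //; rewrite xE' xE2'; lra.
- by rewrite Tv' Tv pE' pE; apply: strip_lt.
have [st' [w' w1' wE']] := Ts' _ tu'; have [st [w w1 wE]] := Ts _ tu.
have E2 := strip_inj g0 st' st E.
have E3 : P.1 = P'.1.
  by apply: ord_inj; apply: (sheet_time _ _ w1 w1'); rewrite ?ltn_ord// -wE -E2 wE'.
have : P' = pm P.
  case: P P' E3 neP {sP lt lt2 T cT Tv Tu Ts Tl Tg T' cT' Tv' Tu' Ts' Tl' Tg' xs xE xE' xs' xE2 xE2' hP pE hP' pE' s mk st st' w1 wE w1' wE' E E2} => i c [k c'] /= ->.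
  by rewrite /pm /=; case: c; case: c'; rewrite ?eqxx.
by move=> E4; move: sP; rewrite E4 psdm => /esym/eqP; rewrite (negPf (iota4_neq _)).
Qed.

Definition tail (i : nat) (t : R) : C :=
  if (i.+1 < N)%N then A i.+1 t else if t - 1 <= 0 then A N t else A 0%N (t - 1).
(** The passage of the curve through one sheet, extended by the collar at both ends: it starts with
    the mirror image of the preceding strand. After the last crossing it continues past time 1 with
    the first piece, in [tail]. *)
Definition chord (i : nat) (t : R) : C :=
  if t - b i.+1 <= 0 then mirror (j i) (track i t) else tail i t.
Definition cend (i : nat) : R := if (i.+1 < N)%N then b i.+2 else 1 + b 1%N.

Lemma ctail i : continuous (tail i).
Proof.
have [cA _ _ _ _] := rd; case E : (i.+1 < N)%N.
  by rewrite (_ : tail i = A i.+1)//; apply: funext => t; rewrite /tail E.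
rewrite (_ : tail i = fun t => if t - 1 <= 0 then A N t else A 0%N (t - 1)); last first.
  by apply: funext => t; rewrite /tail E.
have c1 : continuous (fun t : R => t - 1) by apply: ctsB; [exact: cts_id|exact: cts_cst].
apply: (@cts_paste R R C (fun t => t - 1) (A N) (fun t => A 0%N (t - 1)) c1 (cA N) (cts_comp (cA 0%N) c1)).
by move=> t /subr0_eq ->; rewrite subrr A1.
Qed.

Lemma tail_start i : (i < N)%N -> tail i (b i.+1) = mirror (j i) (A i (b i.+1)).
Proof.
move=> iN; have [_ _ _ _ <-] := stepP iN; rewrite /tail; case: ltnP => // h.
have -> : i.+1 = N by apply/eqP; rewrite eqn_leq iN h.
by rewrite subr_le0 ltW// bN_lt1.
Qed.

Lemma cchord i : (i < N)%N -> continuous (chord i).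
Proof.
move=> iN; have h : continuous (fun t => mirror (j i) (track i t)) by exact: (cmirror_track iN (@cts_id R)).
apply: (@cts_paste R R C (fun t => t - b i.+1) (fun t => mirror (j i) (track i t)) (tail i) _ h (@ctail i)).
  by apply: ctsB; [exact: cts_id|exact: cts_cst].
by move=> t /subr0_eq ->; rewrite tail_start// track_id// b_itv.
Qed.

Lemma chord_head i t : (i < N)%N -> a i <= t <= b i.+1 -> chord i t = mirror (j i) (A i t).
Proof. by move=> iN h; rewrite /chord subr_le0 track_id//; case/andP: h => _ ->. Qed.

Lemma chord_tail i t : (i < N)%N -> b i.+1 <= t -> chord i t = tail i t.
Proof.
move=> iN h; case: (eqVneq t (b i.+1)) => [->|ne].
  by rewrite tail_start// chord_head// b_itv.
by rewrite /chord subr_le0 leNgt lt_def ne h.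
Qed.

Lemma cend_gt i : (i < N)%N -> b i.+1 < cend i.
Proof.
move=> iN; rewrite /cend; case: ifP => [iN'|_]; first exact: (step_lt rd).
by apply: lt_trans (b_lt1 iN) _; rewrite ltrDl -b0; exact: (step_lt rd).
Qed.

Lemma chord_valid i t : (i < N)%N -> a i <= t <= cend i ->
  [/\ good (chord i t), qy (chord i t) = gam t & md (chord i t) <= ka^-1].
Proof.
move=> iN /andP[t1 t2]; have k0 := kaP; have kV := kaV; case: (leP t (b i.+1)) => h.
  have tb : a i <= t <= b i.+1 by rewrite t1.
  have st := sheet_sec iN tb; rewrite chord_head//; split.
  - by right; exists (iota4 (j i)); exact: sec_mirror.
  - by rewrite (qy_mirror g0 ps1 st) sheet_val'.
  - have [_ _ [_ Aa la] _ _] := stepP iN; have [st0 _] := st.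
    rewrite md_mirror lef_pV2 ?posrE//; move: t1; rewrite le_eqVlt => /orP[/eqP <-|t1]; first by rewrite Aa.
    by rewrite ltW// la// t1.
rewrite (chord_tail iN (ltW h)) /tail.
have bd k s : (k < N)%N -> b k <= s <= b k.+1 -> [/\ good (A k s), qy (A k s) = gam s & md (A k s) <= ka^-1].
  move=> kN sk; have [g1 q1'] := sheet_val kN sk; split => //.
  have [_ [_ lA] [Ab _ _] _ _] := stepP kN; move: sk => /andP[s1 s2].
  move: s2; rewrite le_eqVlt => /orP[/eqP ->|s2]; first by rewrite Ab.
  by rewrite ltW// lA// s1.
move: t2; rewrite /cend; case: ifP => iN' t2; first by apply: bd => //; rewrite (ltW h).
have iE : i.+1 = N by apply/eqP; rewrite eqn_leq iN leqNgt iN'.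
rewrite subr_le0; case: leP => t3.
  have [_ _ _ vN lN] := rd; have tN : b N <= t <= 1 by rewrite -iE (ltW h).
  by have [g1 q1'] := vN t tN; split => //; rewrite ltW// lN.
have gp : gam (t - 1) = gam t by rewrite -(gam_per (t - 1)) subrK.
have [|h1 h2 h3] := bd 0%N (t - 1) N0; last by split; rewrite // h2.
by rewrite b0 subr_ge0 (ltW t3) lerBlDl.
Qed.

(** The point [1 / ka] lies on the ray through corner 0, outside [good]; it is the pole of the
    Cayley transform in [disc_meet]. *)
Lemma chord_neq i t : (i < N)%N -> a i <= t <= cend i -> chord i t != (ka^-1)%:C.
Proof.
move=> iN ti; have [gt _ _] := chord_valid iN ti; have k0 := kaP; have kV := kaV; apply/eqP => E.
have mE : md ((ka^-1)%:C : C) = ka^-1 by rewrite mdRe gtr0_norm// invr_gt0.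
rewrite E in gt; case: gt => [|[l [m0 [x xl xE]]]]; first by rewrite mE ltNge (ltW kV).
have : arc x = arc 0.
  apply: (@mulfI _ (ka^-1)%:C); first by rewrite fmorph_eq0 gt_eqF// invr_gt0.
  by rewrite -{1}mE -xE /Gluing.arc mulr0 mul0r cis0 mulr1.
move=> /(arc_inj g0)[m]; rewrite add0r => xm; have := not_int_between g0 (z4 * m) xl.
by rewrite xm eqxx.
Qed.

(** Equal points have equal times, up to a full period at the last chord. Two chords overlap in time
    only along a strand between consecutive sheets, and there one shows the mirror image of the
    other, in a different sector. *)
Lemma chord_disj i k s t : (i < k)%N -> (k < N)%N -> a i <= s <= cend i -> a k <= t <= cend k ->
  chord i s <> chord k t.
Proof.
move=> ik kN si tk E; have iN := ltn_trans ik kN; have iN' : (i.+1 < N)%N by exact: leq_ltn_trans kN.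
have [_ qs _] := chord_valid iN si; have [_ qt _] := chord_valid kN tk.
have G : gam s = gam t by rewrite -qs E qt.
have nomir l w : sec (j l) w -> w <> mirror (j l) w.
  by move=> sl wE; have := sec_mirror sl; rewrite -wE; exact: sec_iota.
move: si tk => /andP[s1 s2] /andP[t1 t2]; rewrite /cend iN' in s2.
have s01 : 0 < s < 1.
  rewrite (lt_le_trans (a_gt0 iN) s1) (le_lt_trans s2)//; exact: b_lt1.
have t0 : 0 < t by exact: lt_le_trans (a_gt0 kN) t1.
have b11 : b 1%N < 1 by exact: b_lt1.
case: (ltP t 1) => t3.
  have ts : s = t by apply: times_eq; rewrite // t0.
  have kE : k = i.+1.
    apply/eqP; rewrite eqn_leq ik andbT leqNgt; apply/negP => h.
    by have := b_a h kN; rewrite ltNge (le_trans t1)// -ts.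
  have tb : a k <= t <= b k.+1 by rewrite t1 kE -ts.
  move: E; rewrite (chord_head kN tb) chord_tail//; last first.
    by rewrite ts (le_trans _ t1)// ltW// b_a// kE.
  by rewrite /tail iN' -kE ts; apply: nomir; exact: sheet_sec.
have kN' : (k.+1 < N)%N = false.
  by apply/negbTE/negP => h; move: t2; rewrite /cend h leNgt (lt_le_trans (b_lt1 h)).
rewrite /cend kN' in t2; have st : t - 1 = s.
  have E1 : t - 1 - s \is a Num.int.
    by rewrite addrAC; apply: rpredB; [exact: gam_inj (esym G)|exact: rpred1].
  have b10 : 0 < b 1%N by rewrite -b0; exact: (step_lt rd).
  apply/eqP; rewrite -subr_eq0; apply/eqP; apply: int_small => //; move: t2 t3 s01; lra.
have i0 : i = 0%N.
  case: i ik iN iN' s1 s2 E {qs} => // i ik iN iN' s1 s2 E; exfalso.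
  have := b_a (ltn0Sn i) iN; rewrite ltNge => /negP; apply; apply: le_trans s1 _.
  by rewrite -st lerBlDl.
have t4 : 1 < t by rewrite -subr_gt0 st; case/andP: s01.
have bk : b k.+1 <= t by rewrite ltW// (lt_trans _ t4)// b_lt1.
have sb : a i <= s <= b i.+1 by rewrite s1 i0 -st lerBlDl.
move: E; rewrite (chord_head iN sb) (chord_tail kN bk) /tail kN' subr_le0 leNgt t4 /= st i0.
by move/esym; apply: nomir; rewrite -i0; exact: sheet_sec.
Qed.

Lemma next_ord (i : X) : next (enum X) i = (if (i.+1 < N)%N then i.+1 else 0%N) :> nat.
Proof.
have iin : i \in enum X by rewrite mem_enum.
rewrite next_nth iin.
have key (s : seq X) : index i s = i -> (forall k d, (k < N)%N -> nth d s k = k :> nat) -> size s = N ->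
    (if s is y :: p then nth y p (index i s) else i) = (if (i.+1 < N)%N then i.+1 else 0%N) :> nat.
  case: s => [|y p] iE nE sz; first by exfalso; have := N0; rewrite -sz.
  rewrite iE; have y0 : y = 0%N :> nat by exact: (nE 0%N y N0).
  case: ifP => h; first exact: (nE i.+1 y h).
  rewrite nth_default// -ltnS -[(size p).+1]/(size (y :: p)) sz.
  by rewrite leqNgt h.
have := key (enum X) (index_enum_ord i) (fun k d => @nth_enum_ord N d k) (size_enum_ord N).
by move=> <-; case: (enum X).
Qed.

Notation L := (enum X).
Notation pch := (pch L).

Definition cidx (P : pt) : X := if P.2 then prev L P.1 else P.1.

Lemma chord_ends (i : X) : chord i (a i) = pnt (i, false) /\ chord i (cend i) = pnt (next L i, true).
Proof.
have iN := ltn_ord i; split; first by rewrite chord_head ?a_itv.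
rewrite chord_tail//; last exact/ltW/cend_gt.
rewrite /pnt /= next_ord /tail /cend; case h : (i.+1 < N)%N; first by [].
have b10 : 0 < b 1%N by rewrite -b0; exact: (step_lt rd).
by rewrite subr_le0 leNgt ltrDl b10 /= addrAC subrr add0r.
Qed.

Lemma chord_path P : exists (D : R -> C) u v, [/\ continuous D, u <= v, D u = pnt P, D v = pnt (pch P) &
  forall t, u <= t <= v -> exists2 t', a (cidx P) <= t' <= cend (cidx P) & D t = chord (cidx P) t'].
Proof.
case: P => i c; have uL : uniq L by exact: enum_uniq.
have ac (k : X) : a k <= cend k by rewrite (le_trans (ltW (a_lt (ltn_ord k))))// ltW// cend_gt.
case: c; rewrite /cidx /pch /=; last first.
  have [e1 e2] := chord_ends i; exists (chord i), (a i), (cend i); split => //; first exact: cchord.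
  by move=> t ti; exists t.
set k := prev L i; have [e1 e2] := chord_ends k; have nk : next L k = i by exact: next_prev.
exists (fun t => chord k (- t)), (- cend k), (- a k); split.
- by apply: cts_comp (cchord (ltn_ord k)) _; apply: ctsN; exact: cts_id.
- by rewrite lerN2.
- by rewrite opprK e2 nk.
- by rewrite opprK e1.
by move=> t /andP[t1 t2]; exists (- t) => //; rewrite lerNr t2 lerNl t1.
Qed.

(** Linked ends would force the two chords to meet in the disc of radius [1 / ka] by [disc_meet]. *)
Lemma diagram_unlinked : unlinkedL outp inp L.
Proof.
move=> P P' _ _; rewrite !pposE => h1 h2; have uL : uniq L by exact: enum_uniq.
have pK := pchK uL.
rewrite ltNge le_eqVlt; apply/negP => /orP[/eqP/pp_inj E|h3].
  by move: h1; rewrite -[P]pK E pK ltxx.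
have [D [u [v [cD uv Du Dv Dc]]]] := chord_path P; have [D' [u' [v' [cD' uv' Du' Dv' Dc']]]] := chord_path P'.
have kV := kaV; have n40 := n4_gt0 R g0; have p0 := pi_gt0 R.
have sc x y : x < y -> 2 * pi * x / n4 < 2 * pi * y / n4.
  by move=> xy; rewrite ltr_pM2r ?invr_gt0// ltr_pM2l// mulr_gt0.
have ok Q (E : R -> C) w1 w2 : (forall t, w1 <= t <= w2 -> exists2 t', a (cidx Q) <= t' <= cend (cidx Q) & E t = chord (cidx Q) t') ->
    forall t, w1 <= t <= w2 -> md (E t) <= ka^-1 /\ E t != (ka^-1)%:C.
  move=> H t /H[t' ht ->]; have [_ _ h] := chord_valid (ltn_ord _) ht; split => //.
  by apply: chord_neq; rewrite ?ltn_ord.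
have pz Q : 0 < pp Q < n4.
  have [/andP[q1' q2'] _] := ppP Q; have /andP[z1 z2] := psd_itv g0 jl_itv Q.
  apply/andP; split; first by apply: le_lt_trans q1'; rewrite ler0z.
  apply: (lt_le_trans q2'); have -> : n4 = z4%:~R by [].
  by rewrite -intrD1 ler_int; move: z2; clear; lia.
have [s [t [su tv E]]] := @disc_meet R ka^-1 D D' u v u' v' _ _ _ _ (lt_trans ltr01 kV) uv uv' cD cD'
   (ok P D u v Dc) (ok P' D' u' v' Dc') (etrans Du (ppP P).2) (etrans Dv (ppP (pch P)).2)
   (etrans Du' (ppP P').2) (etrans Dv' (ppP (pch P')).2)
   ltac:(by have /andP[h _] := pz P; rewrite divr_gt0// mulr_gt0// mulr_gt0) (sc _ _ h1) (sc _ _ h2) (sc _ _ h3)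
   ltac:(by have /andP[_ h] := pz (pch P'); rewrite ltr_pdivrMr// ltr_pM2l// mulr_gt0).
have [s' hs sE] := Dc s su; have [t' ht tE] := Dc' t tv; rewrite sE tE in E.
have ne : cidx P != cidx P'.
  apply/eqP => ce; have : P' = P \/ P' = pch P.
    move: ce; case: P P' {h1 h2 h3 D cD Du Dv Dc D' cD' Du' Dv' Dc' E s su hs sE t tv ht tE} => i c [k c'].
    rewrite /cidx /pch; case: c; case: c' => /= ce.
    - by left; have := congr1 (next L) ce; rewrite !(next_prev uL) => ->.
    - by right; rewrite ce.
    - by right; rewrite ce (next_prev uL).
    - by left; rewrite ce.
  by case=> pE; [move: h1; rewrite pE ltxx|move: h2; rewrite pE ltxx].
case: (ltngtP (cidx P) (cidx P')) => h.
- exact: (chord_disj h (ltn_ord _) hs ht E).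
- exact: (chord_disj h (ltn_ord _) ht hs (esym E)).
- by move/eqP: ne; apply; exact: ord_inj.
Qed.

Variables (S : finType) (tau : int -> S -> S) (z : S -> S).
Hypothesis tauK : forall j s, tau (iota4 j) (tau j s) = s.
Hypothesis tauz : forall j s, z (tau j s) = tau j (z s).
Hypothesis star : forall W s, odd_word g0 W -> exists n, iter n (act tau W) s = z s.

Lemma reading_trivial : coh_trivial tau z (mkseq j N).
Proof.
have -> : mkseq j N = [seq jl i | i <- enum X].
  by rewrite /mkseq -val_enum_ord -map_comp.
apply: (diag_trivial tauK tauz star (outp := outp) (inp := inp)).
- exact: jl_itv.
- by move=> P P'; rewrite !pposE; exact: pp_inj.
- by move=> P P'; rewrite !pposE; exact: pp_mono.
- by move=> P P' sP; rewrite !pposE; exact: pp_rev.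
- exact: enum_uniq.
- exact: diagram_unlinked.
Qed.

End Diagram.

(** * The theorem *)

Section Coboundary.
Variables (S : finType) (f : S -> S) (w : S -> int).
Hypothesis f_inj : injective f.
Hypothesis w0 : forall s i, iter i f s = s -> \sum_(k < i) w (iter k f s) = 0.

(** Sum of [w] along the orbit from its root; the condition on closed orbits makes it independent of
    the number of turns. *)
Lemma coboundary_ex : exists k : S -> int, forall s, k (f s) = k s + w s.
Proof.
pose sm n r := \sum_(k < n) w (iter k f r).
have smD n m r : sm (n + m)%N r = sm n r + sm m (iter n f r).
  rewrite /sm big_split_ord /=; congr (_ + _); apply: eq_bigr => k _.
  by rewrite addnC iterD.
have H n m r : iter n f r = iter m f r -> sm n r = sm m r.
  wlog nm : n m / (n <= m)%N.
    by move=> H E; case: (leqP n m) => h; [exact: H|apply/esym/H => //; exact: ltnW].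
  move=> E; rewrite -(subnKC nm) smD [sm (m - n)%N _]w0 ?addr0//.
  by rewrite -iterD subnK// -E.
have sym : connect_sym (frel f) by exact: fconnect_sym.
exists (fun s => sm (findex f (froot f s) s) (froot f s)) => s.
have rE : froot f (f s) = froot f s.
  by apply/eqP; rewrite (root_connect sym) sym; exact: fconnect1.
have c1 : fconnect f (froot f s) s by rewrite sym; exact: connect_root.
have c2 : fconnect f (froot f s) (f s) by rewrite -rE sym; exact: connect_root.
rewrite rE (H _ (findex f (froot f s) s).+1); last by rewrite iterS !iter_findex.
by rewrite /sm big_ord_recr /= iter_findex.
Qed.

End Coboundary.

Lemma iter_nxt0 (R : realType) (S : choiceType) (tau : int -> S -> S) (s : S) n :
  iter n (nxt tau) (s, 0 : R) = (walk tau (mkseq (fun i => iter i cstep 0) n) s, (iter n cstep 0)%:~R).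
Proof.
elim: n => [|n IH]; first by [].
rewrite iterS IH mkseqS walk_rcons /nxt intrKfloor; congr pair.
by rewrite /cstep !intrD; ring.
Qed.

Section Preimages.
Variables (R : realType) (g : nat).
Hypothesis g0 : (0 < g)%N.
Notation C := R[i].
Notation z4 := ((4 * g)%N%:Z).
Let tau1 (j : int) (u : unit) := u.
Variables (S : finType) (tau : int -> S -> S) (z : S -> S) (N : S -> int -> int).
Hypothesis tauK : forall j s, tau (iota4 j) (tau j s) = s.
Hypothesis tau_per : forall j m s, tau (j + z4 * m) s = tau j s.
Hypothesis tauz : forall j s, z (tau j s) = tau j (z s).
Hypothesis star : forall W s, odd_word g0 W -> exists n, iter n (act tau W) s = z s.
Hypothesis Nh : harmonic g0 tau z N.
Variables (X Xh Y : topologicalType) (q : S -> C -> X) (qh : S * int -> C -> Xh) (q1 : unit -> C -> Y).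
Hypotheses (ps : polysurf g tau q) (psh : polysurf g (htau g0 tau N) qh) (ps1 : polysurf g tau1 q1).
Variables (p : X -> Y) (u : X -> C).
Hypothesis pE : forall s w, p (q s w) = q1 tt w.
Hypothesis uE : forall s w, md w <= 1 -> u (q s w) = cis (2 * pi * cone Nh s w).

Lemma walk_htau w s n : walk (htau g0 tau N) w (s, n) = (walk tau w s, n + wsum tau (jump g0 tau N) w s).
Proof.
elim: w s n => [|j w IH] s n; first by rewrite /= addr0.
by rewrite -[LHS]/(walk (htau g0 tau N) w (tau j s, n + jump g0 tau N s j)) IH -addrA.
Qed.

(** The lifts of the simple curve cover its preimage. A height function on sheets, whose coboundary
    is the sum of jumps along the word, lets all these lifts be raised to the infinite cyclic cover
    with the same identifications. So the closed curve [c] has a closed lift there, and the real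
    primitive returns to its value. *)
Lemma scc_trivial (c : R -> X) (gam0 : R -> Y) : closed_curve c -> simple_closed_curve gam0 ->
  (forall t, gam0 t <> q1 tt 1) -> (forall t, exists t', p (c t) = gam0 t') ->
  exists h : R -> R, [/\ continuous h, forall t, 0 <= t <= 1 -> u (c t) = cis (h t) & h 1 = h 0].
Proof.
move=> [cc cper] sg nv pc; have [[cg gper0] ginj0] := sg.
have hX : hausdorff_space X := ps_hausdorff g0 tauK tau_per ps.
have hY : hausdorff_space Y.
  by apply: (@ps_hausdorff R g g0 unit tau1 _ _ Y q1 ps1).
have [t0 [gam [ka [M [A [a [b [j [[gamE ka01 rd b0 A1] deep]]]]]]]]] := reading_main g0 ps1 hY sg nv.
have gper t : gam (t + 1) = gam t by rewrite gamE /= addrAC gper0.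
have ginj s t : gam s = gam t -> s - t \is a Num.int.
  by rewrite gamE => /ginj0; rewrite opprD addrACA subrr addr0.
pose W := mkseq j M.
have coh : coh_trivial tau z W.
  case: (posnP M) => [M0|M0]; first by rewrite /W M0; exact: coh_trivial_nil.
  have [dp gen] := deep M0.
  exact: (reading_trivial ps1 rd b0 A1 gper ginj ka01 M0 dp gen tauK tauz star).
have cj := jump_cochain tauK tauz Nh.
have [k kP] : exists k : S -> int, forall s, k (walk tau W s) = k s + wsum tau (jump g0 tau N) W s.
  apply: (@coboundary_ex S (act tau W) (wsum tau (jump g0 tau N) W)); first exact: act_inj tauK _.
  by move=> s i si; rewrite -wsum_witer; apply: coh.
have htK := htauK tauK tauz Nh; have htP := htauK tauK tauz Nh.
have htP' := htau_per tau_per Nh.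
pose L s t := lift g M A j b0 tau q s t; pose Lh s t := lift g M A j b0 (htau g0 tau N) qh (s, k s) t.
have cL s : continuous (L s) by move=> t; exact: (continuous_lift g0 rd tauK tau_per ps).
have cLh s : continuous (Lh s) by move=> t; exact: (continuous_lift g0 rd htK htP' psh).
have perz (m : int) t : gam0 (t + m%:~R) = gam0 t.
  have per (n : nat) t' : gam0 (t' + n%:R) = gam0 t'.
    by elim: n t' => [|n IH] t'; rewrite ?addr0// -natr1 addrA gper0 IH.
  case: m => m; first exact: per.
  by rewrite -(per m.+1 (t + _)) NegzE mulrNz subrK.
have cover x t' : p x = gam0 t' -> exists st : S * R, 0 <= st.2 <= 1 /\ x = L st.1 st.2.
  move=> px; pose y := t' - t0; pose t := y - (Num.floor y)%:~R.
  have /andP[h1 h2] := floor_itv y; rewrite intrD1 in h2.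
  have t01 : 0 <= t <= 1 by rewrite /t; apply/andP; split; lra.
  have gt : gam t = p x.
    rewrite px gamE /= (_ : t + t0 = t' + (- Num.floor y)%:~R) ?perz//.
    by rewrite /t /y intrN; ring.
  have dE : q1 tt (disc_at g M A b0 t) = gam t by rewrite (lift_base rd)// clamp01_id.
  have [s xE] := fiberP tauK ps ps1 pE (disc_at_md g M A b0 t) (etrans (esym gt) (esym dE)).
  have [f fK fK'] := injF_bij (act_inj tauK (W := word_at g M A j b0 t)).
  exists (f s, t); split => //=; rewrite xE /L /lift; congr (q _ _); exact: (esym (fK' s)).
have pL s t : 0 <= t <= 1 -> p (L s t) = gam t.
  by move=> t01; rewrite pE (lift_base rd)// clamp01_id.
have sheet s s' t : L s t = L s' t -> s = s'.
  move=> /(sheet_inj g0 tauK tau_per ps (disc_at_md g M A b0 t) (disc_at_good rd b0 t)).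
  exact: (act_inj tauK).
have Lh1 s : Lh s 1 = Lh (walk tau W s) 0.
  by rewrite /Lh (lift1 g0 rd b0 A1 htK htP' psh) walk_htau kP.
(* Equal points have times that agree or are 1 and 0. In the first case the sheets agree; in the
   second they differ by the monodromy of the word, which [Lh1] follows upstairs. *)
have compat s t s' t' : 0 <= t <= 1 -> 0 <= t' <= 1 -> L s t = L s' t' -> Lh s t = Lh s' t'.
  have L1 r : L r 1 = L (walk tau W r) 0 by exact: (lift1 g0 rd b0 A1 tauK tau_per ps).
  wlog tt' : s t s' t' / t' <= t.
    by move=> H h1 h2 E; case: (leP t' t) => h; [exact: H|apply/esym/H => //; exact: ltW].
  move=> t1 t1' E; have := congr1 p E; rewrite !pL// => /ginj/intrP[m mE].
  have : m = 0 \/ m = 1.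
    have m0 : 0 <= m by rewrite -(ler0z R) -mE; lra.
    have m1 : m <= 1 by rewrite -(ler_int R) -mE; lra.
    by lia.
  case=> me; rewrite me in mE.
    have e : t = t' by lra.
    by move: E; rewrite e => /sheet ->.
  have mE' : t - t' = 1 by rewrite mE.
  have e1 : t = 1 by lra.
  have e0 : t' = 0 by lra.
  by move: E; rewrite e1 e0 L1 Lh1 => /sheet ->.
have ex t : exists st : S * R, 0 <= st.2 <= 1 /\ c t = L st.1 st.2.
  by have [t' /cover] := pc t.
have [f fP] := choice ex; pose ch t := Lh (f t).1 (f t).2.
have cch : continuous ch.
  apply: (@compact_lift R X Xh R S (fun _ => `[0, 1]%classic) L Lh c ch hX).
  - by move=> i; exact: segment_compact.
  - exact: cL.
  - by move=> i; apply: continuous_subspaceT; exact: cLh.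
  - by move=> s t s' t'; rewrite /= !in_itv /=; exact: compat.
  - exact: cc.
  - by move=> t; exists (f t).1, (f t).2; have [h1 h2] := fP t; split => //; rewrite /= in_itv.
have [v cv vE] := cone_line Nh psh.
(* The real primitive differs from the cone by an integer, so it is an angle for [u] along [c]. *)
exists (fun t => 2 * pi * v (ch t)); split.
- by apply: ctsM; [exact: cts_cst|exact: cts_comp cv cch].
- move=> t _; have [_ ->] := fP t; rewrite /ch /L /Lh /lift walk_htau.
  have md1 := disc_at_md g M A b0 (f t).2.
  by rewrite uE// vE// mulrBr cisD cisN cis2piz invr1 mulr1.
congr (_ * v _); have [h1 e1] := fP 1; have [h0 e0] := fP 0.
by apply: compat => //; rewrite -e1 -e0 -[1]add0r cper.
Qed.

End Preimages.

Theorem theorem2 (R : realType) (g : nat) (hg : (2 <= g)%N) :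
  exists (X : topologicalType) (p : X -> genus_surface R g),
    [/\ closed_surface R X,
        connected_space X,
        finite_branched_cover R p
      & H1_scc R p <> [set: H1 R X]%classic].
Proof.
have g0 : (0 < g)%N by exact: ltnW.
have [S [tau [z [s0 [[tauK tau_per tauz zK zn] [trans star vw]]]]]] := sheets_ex g0.
have [N Nh Nn] := harmonic_ex g0 s0 tauK tau_per tauz zK zn hg.
have ps := psurfP R g0 tau_per; have ps1 := genus_surfaceP R g0.
have psh := psurfP R g0 (htau_per tau_per Nh).
have [p cp pE] := sheet_map g0 ps ps1 (f := fun _ : S => tt) (fun _ _ => erefl).
have [u [cu u1 uE]] := cone_circle Nh ps.
have [Zc Z0 wZ] := harmonic_cycle tauK tau_per (Nh := Nh) ps Nn cu u1 uE.
exists (psurf R g tau), p; split.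
- exact: (ps_closed_surface g0 tauK tau_per ps).
- exact: (ps_connected tau_per ps trans).
- exact: (ps_branched_cover g0 tauK tau_per ps ps1 pE s0 cp).
apply: (winding_proper (cu := cu) (u1 := u1) _ Z0 wZ) => c cc [sc [gam [sg nb [x [_ rc]]]]].
apply: (scc_trivial tauK tau_per tauz star ps psh ps1 pE uE cc sg).
  move=> t E; apply: (nb t); rewrite E.
  apply: (vertex_branch g0 tauK tau_per ps ps1 pE s0) => s.
  by rewrite iter_nxt0; exact: vw.
move=> t; have : connected_component (p @^-1` range gam) x (c t) by rewrite -rc; exists t.
by move=> /connected_component_sub[t' _ tE]; exists t'.
Qed.
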